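(* Assume the setting of the context, with constant background coefficients $\epsilon_0>0$, $\mu_0>0$, $\sigma_0\ge 0$, two linearly independent unit vectors $\boldsymbol a_1,\boldsymbol a_2$, and indicator function $\boldsymbol I(\tau)=I_1(\tau)+I_2(\tau)$. Assume that $\partial D$ is $C^2$ and that $f$ satisfies: there exists $\gamma\in\mathbb R$ with $\liminf_{\tau\to\infty}\tau^\gamma|\tilde f(\tau)|>0$. Then $$\lim_{\tau\to\infty}e^{\tau T}\boldsymbol I(\tau)=\begin{cases}0,&\text{if }T<2\sqrt{\mu_0\epsilon_0}\,\mathrm{dist}(D,B),\\-\infty,&\text{if }T>2\sqrt{\mu_0\epsilon_0}\,\mathrm{dist}(D,B)\text{ and (A.I) is satisfied},\\ \infty,&\text{if }T>2\sqrt{\mu_0\epsilon_0}\,\mathrm{dist}(D,B)\text{ and (A.II) is satisfied}.\end{cases}$$ Moreover, if one of (A.I) or (A.II) is satisfied, then for all $T>2\sqrt{\mu_0\epsilon_0}\,\mathrm{dist}(D,B)$, $$\lim_{\tau\to\infty}\frac1\tau\log|\boldsymbol I(\tau)|=-2\sqrt{\mu_0\epsilon_0}\,\mathrm{dist}(D,B).$$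
   Context: Coefficients: $\epsilon_0>0$, $\mu_0>0$, $\sigma_0\ge0$ are constants. $\epsilon,\mu,\sigma$ are real-valued essentially bounded functions on $\mathbb R^3$ such that $\epsilon,\mu$ have strictly positive essential infimum and $\sigma\ge 0$ a.e. $D\subset\mathbb R^3$ is a nonempty bounded open set with $\mathbb R^3\setminus\overline D$ connected, and $\epsilon=\epsilon_0$, $\mu=\mu_0$, $\sigma=\sigma_0$ a.e. on $\mathbb R^3\setminus D$. Put $\epsilon_r=\epsilon/\epsilon_0$, $\mu_r=\mu/\mu_0$. Source: $B$ is the open ball with center $p$ and radius $\eta>0$, with $\overline B\cap\overline D=\emptyset$; $0<T<\infty$; $f\in H^1(0,T)$ is real-valued with $f(0)=0$; $\tilde f(\tau)=\int_0^Te^{-\tau t}f(t)\,dt$. $\mathrm{dist}(D,B)=\inf_{x\in D,y\in B}|x-y|$. $\chi_B$ is the characteristic function of $B$. Indicator function for a direction: for a constant unit vector $\boldsymbol a$ let $\boldsymbol J(x,t)=f(t)\chi_B(x)\boldsymbol a$; let $(\boldsymbol E,\boldsymbol H)$ be the solution on $\mathbb R^3\times\,]0,T[$ of $$\epsilon\,\partial_t\boldsymbol E-\nabla\times\boldsymbol H=-\sigma\boldsymbol E+\boldsymbol J,\quad \mu\,\partial_t\boldsymbol H+\nabla\times\boldsymbol E=\boldsymbol 0,\quad \boldsymbol E|_{t=0}=\boldsymbol H|_{t=0}=\boldsymbol 0,$$ and $(\boldsymbol E_0,\boldsymbol H_0)$ the solution of the same system with $(\epsilon,\mu,\sigma)$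 replaced by $(\epsilon_0,\mu_0,\sigma_0)$ (same $\boldsymbol J$). Solutions are understood in the class $C^1([0,T];L^2(\mathbb R^3)^3)\cap C([0,T];H(\mathrm{curl};\mathbb R^3))$ for each of the two fields. For $\tau>0$ put $\boldsymbol W_e=\int_0^Te^{-\tau t}\boldsymbol E(\cdot,t)\,dt$, $\boldsymbol V_e=\int_0^Te^{-\tau t}\boldsymbol E_0(\cdot,t)\,dt$, $\boldsymbol f(x,\tau)=\tilde f(\tau)\chi_B(x)\boldsymbol a$ and $I(\tau)=\int_{\mathbb R^3}\boldsymbol f\cdot(\boldsymbol W_e-\boldsymbol V_e)\,dx$. For $j=1,2$, $I_j(\tau)$ denotes $I(\tau)$ for the choice $\boldsymbol a=\boldsymbol a_j$. Jump conditions: (A.I) there is a constant $C_1>0$ with $\left(1-\frac1{\epsilon_r(x)}\right)+(1-\mu_r(x))\ge C_1$ for a.e. $x\in D$. (A.II) there is a constant $C_2>0$ with $(1-\epsilon_r(x))+\left(1-\frac1{\mu_r(x)}\right)\ge C_2$ for a.e. $x\in D$. *)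

(* Defs.v *)
From HB Require Import structures.
From mathcomp Require Import all_boot all_order all_algebra.
From mathcomp Require Import all_classical all_reals all_analysis.

Set Implicit Arguments.
Unset Strict Implicit.
Unset Printing Implicit Defensive.
Import Order.TTheory GRing.Theory Num.Theory.
Import numFieldNormedType.Exports.

Local Open Scope classical_set_scope.
Local Open Scope ring_scope.

(* Points of R^3 are triples in R * R * R, the type on which the library
   provides a product measure; values of vector fields are row vectors. *)
Section Euclidean.
Context {R : realType}.

Definition vec (x : R * R * R) : 'rV[R]_3 :=
  \row_(i < 3) nth 0 [:: x.1.1; x.1.2; x.2] i.

Definition unit_vec (i : 'I_3) : R * R * R :=
  ((i == 0 :> nat)%:R, (i == 1 :> nat)%:R, (i == 2 :> nat)%:R).

Definition dot (u v : 'rV[R]_3) : R := \sum_(i < 3) u ord0 i * v ord0 i.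

Definition enorm (u : 'rV[R]_3) : R := Num.sqrt (dot u u).

(* The norm of the library on R * R * R is the maximum norm. *)
Definition edist (x y : R * R * R) : R := enorm (vec x - vec y).

Definition eball (p : R * R * R) (r : R) : set (R * R * R) :=
  [set x | edist x p < r].

Definition set_dist (A B : set (R * R * R)) : R :=
  inf [set edist x y | x in A & y in B].

Definition leb3 : {measure set (measurableTypeR R * measurableTypeR R *
                                measurableTypeR R)%type -> \bar R} :=
  ((lebesgue_measure \x lebesgue_measure) \x lebesgue_measure)%E.

End Euclidean.

Section Smoothness.
Context {R : realType}.

(* On a finite-dimensional V this is the class C^k: all directional (in
   particular all partial) derivatives of order at most k exist and are
   continuous. *)
Fixpoint is_Ck (V : normedModType R) (k : nat) (f : V -> R) : Prop :=
  continuous f /\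
  if k is k'.+1 then
    forall v : V, (forall x, derivable f x v) /\ is_Ck k' (fun x => 'D_v f x)
  else True.

Definition test_function (V : normedModType R) (U : set V) (phi : V -> R) :=
  (forall k, is_Ck k phi) /\
  exists K : set V, [/\ compact K, K `<=` U & forall x, ~ K x -> phi x = 0].

(* Near each boundary point, D is the set of points above the graph of a C^2
   function in some orthonormal system of coordinates. *)
Definition C2_boundary (D : set (R * R * R)) : Prop :=
  forall x0, (closure D `\` D°) x0 ->
  exists r (Q : 'M[R]_3) (g : R * R -> R),
    [/\ 0 < r, Q *m Q^T = 1%:M, is_Ck 2 g &
        forall x, edist x x0 < r ->
          let y := vec x *m Q in
          D x <-> g (y ord0 (inord 0), y ord0 (inord 1)) < y ord0 (inord 2)].

End Smoothness.

Section FunctionSpaces.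
Context {R : realType}.
Local Notation field := (R * R * R -> 'rV[R]_3).

Definition L2 (u : field) : Prop :=
  forall i, (fun x => u x ord0 i) \in Lfun leb3 2%:E.

Definition L2norm (u : field) : \bar R :=
  Lnorm leb3 2%:E (fun x => (enorm (u x))%:E).

(* Indices of 'I_3 are added modulo 3. *)
Definition curl (phi : field) : field := fun x =>
  \row_(i < 3) ('D_(unit_vec (i + 1)) (fun y => phi y ord0 (i + 2)) x
              - 'D_(unit_vec (i + 2)) (fun y => phi y ord0 (i + 1)) x).

Definition weak_curl (u c : field) : Prop :=
  [/\ L2 u, L2 c &
      forall phi : field,
        (forall i, test_function setT (fun x => phi x ord0 i)) ->
        (\int[leb3]_x dot (u x) (curl phi x) =
         \int[leb3]_x dot (c x) (phi x))%R].

Definition L2_continuous (T : R) (u : R -> field) : Prop :=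
  (forall t, 0 <= t <= T -> L2 (u t)) /\
  (forall t, 0 <= t <= T ->
     L2norm (fun x => u s x - u t x)
       @[s --> within `[0, T] (nbhs t)] --> 0%E).

(* u belongs to C^1([0,T]; L^2) and has time derivative du *)
Definition L2_C1 (T : R) (u du : R -> field) : Prop :=
  [/\ L2_continuous T u, L2_continuous T du &
      forall t, 0 <= t <= T ->
        L2norm (fun x => (s - t)^-1 *: (u s x - u t x) - du t x)
          @[s --> within `[0, T] (t^')] --> 0%E].

(* u belongs to C([0,T]; H(curl)) and has curl cu *)
Definition Hcurl_continuous (T : R) (u cu : R -> field) : Prop :=
  [/\ L2_continuous T u, L2_continuous T cu &
      forall t, 0 <= t <= T -> weak_curl (u t) (cu t)].

(* W is the integral over [0,T] of the L^2-valued function u, as the limit in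
   L^2 of Riemann sums over tagged partitions. *)
Definition L2_integral (T : R) (u : R -> field) (W : field) : Prop :=
  L2 W /\
  forall e : R, 0 < e -> exists2 d : R, 0 < d &
    forall (n : nat) (t xi : nat -> R), t 0%N = 0 -> t n = T ->
      (forall i, (i < n)%N ->
         (t i <= xi i <= t i.+1) && (t i.+1 - t i < d)) ->
      (L2norm (fun x =>
         \sum_(i < n) (t i.+1 - t i) *: u (xi i) x - W x)%R < e%:E)%E.

(* f belongs to H^1(0,T), with a weak derivative g *)
Definition sobolev_H1 (T : R) (f : R -> R) : Prop :=
  f \_ `]0, T[ \in Lfun lebesgue_measure 2%:E /\
  exists2 g : R -> R, g \_ `]0, T[ \in Lfun lebesgue_measure 2%:E &
    forall phi : R -> R, test_function `]0, T[ phi ->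
      (\int[lebesgue_measure]_(t in `]0, T[) (f t * derive1 phi t) =
       - \int[lebesgue_measure]_(t in `]0, T[) (g t * phi t))%R.

End FunctionSpaces.

Section Maxwell.
Context {R : realType}.
Local Notation point := (R * R * R)%type.
Local Notation field := (point -> 'rV[R]_3).

Definition maxwell_solution (eps mu sigma : point -> R) (T : R)
    (J E H : R -> field) : Prop :=
  exists dE dH cE cH : R -> field,
  [/\ L2_C1 T E dE /\ Hcurl_continuous T E cE,
      L2_C1 T H dH /\ Hcurl_continuous T H cH,
      forall t, 0 < t < T ->
        {ae leb3, forall x,
          eps x *: dE t x - cH t x = - (sigma x *: E t x) + J t x},
      forall t, 0 < t < T ->
        {ae leb3, forall x, mu x *: dH t x + cE t x = 0} &
      {ae leb3, forall x, E 0 x = 0} /\ {ae leb3, forall x, H 0 x = 0}].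

Definition laplace (T : R) (f : R -> R) (tau : R) : R :=
  (\int[lebesgue_measure]_(t in `[0, T]) (expR (- (tau * t)) * f t))%R.

(* I is the indicator function for the direction a; its values at
   nonpositive arguments are not constrained. *)
Definition indicator_function (eps0 mu0 sigma0 : R) (eps mu sigma : point -> R)
    (T : R) (f : R -> R) (B : set point) (a : 'rV[R]_3) (I : R -> R) : Prop :=
  exists E H E0 H0 W V : R -> field,
  let J := fun t x => (f t * \1_B x) *: a in
  [/\ maxwell_solution eps mu sigma T J E H,
      maxwell_solution (cst eps0) (cst mu0) (cst sigma0) T J E0 H0 &
      forall tau, 0 < tau ->
      [/\ L2_integral T (fun t x => expR (- (tau * t)) *: E t x) (W tau),
          L2_integral T (fun t x => expR (- (tau * t)) *: E0 t x) (V tau) &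
          I tau = (\int[leb3]_x
            dot ((laplace T f tau * \1_B x) *: a) (W tau x - V tau x))%R]].

Definition jump_AI (eps0 mu0 : R) (eps mu : point -> R) (D : set point) :=
  exists2 C : R, 0 < C & {ae leb3, forall x, D x ->
    C <= (1 - 1 / (eps x / eps0)) + (1 - mu x / mu0)}.

Definition jump_AII (eps0 mu0 : R) (eps mu : point -> R) (D : set point) :=
  exists2 C : R, 0 < C & {ae leb3, forall x, D x ->
    C <= (1 - eps x / eps0) + (1 - 1 / (mu x / mu0))}.

End Maxwell.

(* Main.v *)
(* For each tau the transform of the background field is explicit: with
   k^2 = (tau eps0 + sigma0) tau mu0 and Phi the convolution of 1_B with the
   Yukawa kernel of rate k, it is built from k^2 Phi a - grad div (Phi a) and
   curl (Phi a). The difference between the transforms of the two solutions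
   satisfies the stationary system with coefficients tau eps + sigma and tau mu
   up to residuals of size e^(-tau T), so Green's formula and completion of
   squares in two ways bound I(tau) from both sides, up to e^(-tau T) / tau, by
   integrals over D of the explicit electric and magnetic energy densities,
   weighted by the jumps of the coefficients. Both densities are comparable to
   e^(-2 k (|x - p| - eta)) times the squared component of a orthogonal to
   x - p, and the sum of these components for a_1 and a_2 is at least
   1 - |a_1 . a_2| > 0. Hence the sign of I(tau) is that of the jump, and
   |I(tau)| decays like e^(-2 tau sqrt(mu0 eps0) dist(D, B)) up to factors that
   are subexponential in tau. *)
Require Import Defs.
From HB Require Import structures.
From mathcomp Require Import all_boot all_order all_algebra.
From mathcomp Require Import all_classical all_reals all_analysis.
From mathcomp Require Import ess_sup_inf.
From mathcomp Require Import measurable_realfun ring lra.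
Set Implicit Arguments.
Unset Strict Implicit.
Unset Printing Implicit Defensive.
Import Order.TTheory GRing.Theory Num.Theory.
Import numFieldNormedType.Exports.
Local Open Scope classical_set_scope.
Local Open Scope ring_scope.

(** The obstacle is regularity. [L2_integral] describes a transformed field only as a limit in mean
    square, so its weak curl is not at hand, whereas a finite Riemann sum inherits one term by term.
    All estimates are therefore made on Riemann sums, at fixed [tau], and their tolerance [d] is
    sent to 0 only in the resulting inequality. Green's formula is then needed for two fields that
    are both only weakly differentiable, while weak curls are tested against smooth compactly
    supported fields. It is obtained by smoothing the pairing of the two fields with one even
    kernel, which requires smoothed pairings to converge for all square-integrable functions. The
    explicit background field spares any regularity theory near the boundary of [D]: its size is
    known at each point, so a small cube inside [D] near a closest point already yields the lower
    bound. Two directions enter because, to leading order, a single source radiates nothing to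
    points [x] with [x - p] parallel to [a]. The conductivity shifts [k] by a bounded amount only
    and the jump weights by a multiple of [1 / tau]. *)

Lemma measurable_invr (R : realType) : measurable_fun setT (fun x : R => x^-1).
Proof.
(* The real power with exponent -1 is the inverse on nonnegative reals, whence the square; at 0 both
   sides vanish because [0^-1 = 0]. *)
have -> : (fun x : R => x^-1) = (fun x => x * (x ^+ 2) `^ (- 1)).
  apply/funext => x; rewrite powR_inv1 ?sqr_ge0//.
  have [->|x0] := eqVneq x 0; first by rewrite invr0 mul0r.
  by field.
apply: measurable_funM => //.
by apply: (measurableT_comp (measurable_powR _)); exact: measurable_funX.
Qed.

(** * Real-valued integrals and square-integrable fields *)

Section RealIntegral.
Context {d} {T : measurableType d} {R : realType}.
Variable m : {measure set T -> \bar R}.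
Implicit Types f g : T -> R.

Lemma aeS (P Q : T -> Prop) : (forall x, P x -> Q x) ->
  {ae m, forall x, P x} -> {ae m, forall x, Q x}.
Proof. by move=> h; apply: filterS. Qed.

Lemma aeI (P Q : T -> Prop) : {ae m, forall x, P x} -> {ae m, forall x, Q x} ->
  {ae m, forall x, P x /\ Q x}.
Proof. by move=> h1 h2; apply: filterS2 h1 h2. Qed.

Definition intg (f : T -> R) := m.-integrable setT (EFin \o f).
Definition Int (f : T -> R) : R := (\int[m]_x f x)%R.

Lemma intg_meas f : intg f -> measurable_fun setT f.
Proof. by move=> /measurable_int mf; exact/measurable_EFinP. Qed.

Lemma intg_ext f g : f =1 g -> intg f -> intg g.
Proof. by move=> fg; have -> : f = g by apply/funext. Qed.

Lemma Int_ext f g : f =1 g -> Int f = Int g.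
Proof. by move=> fg; congr Int; apply/funext. Qed.

Lemma intg0 : intg (fun=> 0).
Proof. exact: integrable0. Qed.

Lemma intgD f g : intg f -> intg g -> intg (fun x => f x + g x).
Proof. by move=> hf hg; have := integrableD measurableT hf hg. Qed.

Lemma intgZ (c : R) f : intg f -> intg (fun x => c * f x).
Proof. by move=> hf; have := integrableZl measurableT c hf. Qed.

Lemma intgN f : intg f -> intg (fun x => - f x).
Proof. by move=> hf; have := integrableN hf. Qed.

Lemma intgB f g : intg f -> intg g -> intg (fun x => f x - g x).
Proof. by move=> hf hg; exact: intgD hf (intgN hg). Qed.

Lemma intg_sum (I : Type) (s : seq I) (h : I -> T -> R) :
  (forall i, intg (h i)) -> intg (fun x => \sum_(i <- s) h i x).
Proof.
move=> hh; elim: s => [|i s IH].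
  by apply: intg_ext intg0 => x; rewrite big_nil.
by apply: (intg_ext (f := fun x => h i x + \sum_(j <- s) h j x)) => [x|];
  [rewrite big_cons|exact: intgD].
Qed.

Lemma intg_norm f : intg f -> intg (fun x => `|f x|).
Proof. by move=> hf; have := integrable_abse hf. Qed.

Lemma intg_dom f g : measurable_fun setT f -> intg g ->
  (forall x, `|f x| <= g x) -> intg f.
Proof.
move=> mf hg fg; apply: (le_integrable measurableT _ _ hg).
  exact/measurable_EFinP.
by move=> x _ /=; rewrite lee_fin (le_trans (fg x))// ler_norm.
Qed.

Lemma intg_ae f g : measurable_fun setT f -> measurable_fun setT g ->
  {ae m, forall x, f x = g x} -> intg g -> intg f.
Proof.
move=> mf mg fg /integrableP[_ ig].
have mf' : measurable_fun setT (EFin \o f) by exact/measurable_EFinP.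
have mg' : measurable_fun setT (EFin \o g) by exact/measurable_EFinP.
apply/integrableP; split => //.
rewrite (ge0_ae_eq_integral measurableT (g := fun x => `|(EFin \o g) x|%E))//.
- exact: measurableT_comp.
- exact: measurableT_comp.
- by apply: filterS fg => x /= -> _.
Qed.

Lemma intg_dom_ae f g : measurable_fun setT f -> intg g ->
  {ae m, forall x, `|f x| <= g x} -> intg f.
Proof.
move=> mf hg fg; have mg := intg_meas hg.
(* [h] truncates [f] to the interval between [-|g|] and [|g|]: it is dominated everywhere and
   differs from [f] only on a null set. *)
pose h x := Num.max (- `|g x|) (Num.min (f x) `|g x|).
have mng : measurable_fun setT (fun x => `|g x|) by exact: measurableT_comp.
have mh : measurable_fun setT h.
  apply: measurable_maxr; last exact: measurable_minr.
  exact: measurable_funN.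
apply: (intg_ae (g := h)) => //; last first.
  apply: intg_dom mh (intg_norm hg) _ => x; rewrite /h.
  by rewrite ler_norml le_max lexx/= ge_max ge_min lexx orbT andbT ge0_cp.
apply: filterS fg => x fgx; rewrite /h.
have h1 := le_trans fgx (ler_norm _).
by move: h1; rewrite ler_norml => /andP[h1 h2]; rewrite min_l// max_r.
Qed.

Lemma IntD f g : intg f -> intg g -> Int (fun x => f x + g x) = Int f + Int g.
Proof. by move=> hf hg; rewrite /Int RintegralD. Qed.

Lemma IntZ (c : R) f : intg f -> Int (fun x => c * f x) = c * Int f.
Proof. by move=> hf; rewrite /Int RintegralZl. Qed.

Lemma IntN f : intg f -> Int (fun x => - f x) = - Int f.
Proof.
by move=> hf; rewrite -mulN1r -IntZ//; apply: Int_ext => x; rewrite mulN1r.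
Qed.

Lemma IntB f g : intg f -> intg g -> Int (fun x => f x - g x) = Int f - Int g.
Proof. by move=> hf hg; rewrite /Int RintegralB. Qed.

Lemma Int0 : Int (fun=> 0) = 0.
Proof. by rewrite /Int /Rintegral integral0. Qed.

Lemma Int_sum (I : Type) (s : seq I) (h : I -> T -> R) :
  (forall i, intg (h i)) ->
  Int (fun x => \sum_(i <- s) h i x) = \sum_(i <- s) Int (h i).
Proof.
move=> hh; elim: s => [|i s IH].
  by rewrite big_nil -[RHS]Int0; apply: Int_ext => x; rewrite big_nil.
rewrite big_cons -IH -IntD//; last exact: intg_sum.
by apply: Int_ext => x; rewrite big_cons.
Qed.

Lemma Int_ae f g : measurable_fun setT f -> measurable_fun setT g ->
  {ae m, forall x, f x = g x} -> Int f = Int g.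
Proof.
move=> mf mg fg; rewrite /Int /Rintegral; congr fine.
apply: ae_eq_integral => //; try exact/measurable_EFinP.
by apply: filterS fg => x /= -> _.
Qed.

Lemma Int_ge0 f : (forall x, 0 <= f x) -> 0 <= Int f.
Proof. by move=> f0; apply: Rintegral_ge0 => x _. Qed.

Lemma Int_ge0_ae f : measurable_fun setT f ->
  {ae m, forall x, 0 <= f x} -> 0 <= Int f.
Proof.
move=> mf f0; rewrite (Int_ae (g := fun x => Num.max 0 (f x)))//.
- by apply: Int_ge0 => x; rewrite le_max lexx.
- exact: measurable_maxr.
- by apply: filterS f0 => x f0; rewrite max_r.
Qed.

Lemma Int_le_ae f g : intg f -> intg g -> {ae m, forall x, f x <= g x} ->
  Int f <= Int g.
Proof.
move=> hf hg fg; rewrite -subr_ge0 -IntB//; apply: Int_ge0_ae.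
  by apply: measurable_funB; exact: intg_meas.
by apply: filterS fg => x; rewrite subr_ge0.
Qed.

Lemma Int_le f g : intg f -> intg g -> (forall x, f x <= g x) -> Int f <= Int g.
Proof. by move=> hf hg fg; apply: Int_le_ae => //; exact: aeW. Qed.

Lemma ler_Int_norm f : intg f -> `|Int f| <= Int (fun x => `|f x|).
Proof. by move=> hf; exact: le_normr_Rintegral. Qed.

Lemma Int_fin f : intg f -> (\int[m]_x (f x)%:E)%E = (Int f)%:E.
Proof. by move=> hf; rewrite /Int /Rintegral fineK// integrable_fin_num. Qed.

Lemma intg_indic (A : set T) : measurable A -> (m A < +oo)%E ->
  intg (fun x => \1_A x : R).
Proof. move=> mA fA; apply/integrableP; split.
  by apply/measurable_EFinP; exact: measurable_indic.
under eq_integral do rewrite gee0_abs ?lee_fin ?indic_ge0//.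
by rewrite integral_indic// setIT.
Qed.

Lemma Int_indic (A : set T) : measurable A -> Int (fun x => \1_A x : R) = fine (m A).
Proof. by move=> mA; rewrite /Int /Rintegral integral_indic// setIT. Qed.

Definition sq (f : T -> R) := f \in Lfun m 2%:E.

Lemma sqP f : sq f <-> measurable_fun setT f /\ intg (fun x => f x ^+ 2).
Proof.
split=> [hf|[mf hf]].
  split; last exact: Lfun2_integrable_sqr.
  by move: hf; rewrite /sq inE => /andP[]; rewrite inE.
rewrite /sq inE; apply/andP; split; rewrite inE//=.
rewrite /finite_norm unlock; apply: poweR_lty.
have /integrableP[_ h] := hf.
rewrite (le_lt_trans _ h)// le_eqVlt; apply/orP; left; apply/eqP.
apply: eq_integral => x _.
by rewrite /= powR_mulrn// normrX.
Qed.

Lemma sq_ext f g : f =1 g -> sq f -> sq g.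
Proof. by move=> fg; have -> : f = g by apply/funext. Qed.

Lemma sq_meas f : sq f -> measurable_fun setT f.
Proof. by move=> /sqP[]. Qed.

Lemma sqM f g : sq f -> sq g -> intg (fun x => f x * g x).
Proof. by move=> hf hg; apply/Lfun1_integrable; exact: Lfun2_mul_Lfun1. Qed.

Lemma sq_dom_ae f g : measurable_fun setT f -> sq g ->
  {ae m, forall x, `|f x| <= `|g x|} -> sq f.
Proof.
move=> mf /sqP[mg hg] fg; apply/sqP; split => //.
apply: intg_dom_ae hg _; first exact: measurable_funX.
apply: filterS fg => x fg.
by rewrite normrX -(real_normK (num_real (g x))) lerXn2r ?nnegrE.
Qed.

Lemma sqD f g : sq f -> sq g -> sq (fun x => f x + g x).
Proof.
move=> hf hg; have [mf f2] := (sqP _).1 hf; have [mg g2] := (sqP _).1 hg.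
apply/sqP; split; first exact: measurable_funD.
apply: (intg_ext (f := fun x => f x ^+ 2 + (2 * (f x * g x) + g x ^+ 2))).
  by move=> x; ring.
by apply: intgD => //; apply: intgD => //; apply: intgZ; exact: sqM.
Qed.

Lemma sqZ (c : R) f : sq f -> sq (fun x => c * f x).
Proof.
move=> /sqP[mf f2]; apply/sqP; split; first exact: measurable_funM.
apply: (intg_ext (f := fun x => c ^+ 2 * f x ^+ 2)); last exact: intgZ.
by move=> x; ring.
Qed.

Lemma sq0 : sq (fun=> 0).
Proof.
apply/sqP; split => //; apply: (intg_ext (f := fun=> 0)); last exact: intg0.
by move=> x; rewrite expr0n.
Qed.

(** Essentially bounded multipliers. The bound is existential, so sums, products and inverses
    bounded away from 0 stay in the class without any bookkeeping of essential suprema. *)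
Definition bmul (c : T -> R) :=
  measurable_fun setT c /\ exists M, {ae m, forall x, `|c x| <= M}.

Lemma sq_mul (c : T -> R) f : bmul c -> sq f -> sq (fun x => c x * f x).
Proof.
move=> [mc [M cM]] hf; apply: (@sq_dom_ae _ (fun x => M * f x)).
- exact: measurable_funM mc (sq_meas hf).
- exact: sqZ.
- apply: filterS cM => x cM; rewrite !normrM ler_wpM2r//.
  exact: le_trans cM (ler_norm _).
Qed.

Lemma bmul_cst (c : R) : bmul (fun=> c).
Proof. by split => //; exists `|c|; exact: aeW. Qed.

Lemma bmulD c c' : bmul c -> bmul c' -> bmul (fun x => c x + c' x).
Proof.
move=> [mc [M cM]] [mc' [M' cM']]; split; first exact: measurable_funD.
exists (M + M'); apply: filterS2 cM cM' => x h h'.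
by rewrite (le_trans (ler_normD _ _))// lerD.
Qed.

Lemma bmulM c c' : bmul c -> bmul c' -> bmul (fun x => c x * c' x).
Proof.
move=> [mc [M cM]] [mc' [M' cM']]; split; first exact: measurable_funM.
by exists (M * M'); apply: filterS2 cM cM' => x h h'; rewrite normrM ler_pM.
Qed.

Lemma bmulN c : bmul c -> bmul (fun x => - c x).
Proof.
move=> [mc [M cM]]; split; first exact: measurable_funN.
by exists M; apply: filterS cM => x; rewrite normrN.
Qed.

Lemma bmulB c c' : bmul c -> bmul c' -> bmul (fun x => c x - c' x).
Proof. by move=> hc hc'; exact: bmulD hc (bmulN hc'). Qed.

Lemma bmulV c (e : R) : measurable_fun setT c -> 0 < e ->
  {ae m, forall x, e <= c x} -> bmul (fun x => (c x)^-1).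
Proof.
move=> mc e0 ec; split.
  by apply: (measurableT_comp _ mc); exact: measurable_invr.
exists e^-1; apply: filterS ec => x ec.
have c0 : 0 < c x := lt_le_trans e0 ec.
by rewrite ger0_norm ?invr_ge0 ?(ltW c0)// lef_pV2 ?posrE.
Qed.

Lemma Lfunoo_bmul c : c \in Lfun m +oo%E -> bmul c.
Proof.
rewrite inE => /andP[]; rewrite inE => mc; rewrite inE /= /finite_norm unlock => h.
split => //; move: h; case: ifPn => [m0 h|m0 _].
  have := ess_sup_ge m (abse \o (EFin \o c)).
  move: h; case: (ess_sup m _) => [r||] //= _.
    by move=> h; exists r; apply: filterS h => x /=; rewrite lee_fin.
  by move=> h; exists 0; apply: filterS h => x /=; rewrite leeNy_eq.
(* On a space of measure zero every bound holds almost everywhere. *)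
exists 0.
have m00 : m setT = 0%E by apply/eqP; rewrite -leNgt in m0; rewrite eq_le m0 measure_ge0.
exact: measure0_ae.
Qed.

End RealIntegral.

(** * Inner product and norm of square-integrable vector fields *)

Section Fields.
Context {R : realType}.
Local Notation point := (R * R * R)%type.
Local Notation field := (point -> 'rV[R]_3).
Implicit Types u v w : field.

Lemma dotC (a b : 'rV[R]_3) : dot a b = dot b a.
Proof. by apply: eq_bigr => i _; rewrite mulrC. Qed.
Lemma dotDl (a b c : 'rV[R]_3) : dot (a + b) c = dot a c + dot b c.
Proof. by rewrite /dot -big_split; apply: eq_bigr => i _; rewrite mxE mulrDl. Qed.
Lemma dotDr (a b c : 'rV[R]_3) : dot c (a + b) = dot c a + dot c b.
Proof. by rewrite dotC dotDl !(dotC c). Qed.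
Lemma dotZl k (a b : 'rV[R]_3) : dot (k *: a) b = k * dot a b.
Proof. by rewrite /dot mulr_sumr; apply: eq_bigr => i _; rewrite mxE mulrA. Qed.
Lemma dotZr k (a b : 'rV[R]_3) : dot a (k *: b) = k * dot a b.
Proof. by rewrite dotC dotZl dotC. Qed.
Lemma dotNl (a b : 'rV[R]_3) : dot (- a) b = - dot a b.
Proof. by rewrite -scaleN1r dotZl mulN1r. Qed.
Lemma dotNr (a b : 'rV[R]_3) : dot a (- b) = - dot a b.
Proof. by rewrite dotC dotNl dotC. Qed.
Lemma dotBl (a b c : 'rV[R]_3) : dot (a - b) c = dot a c - dot b c.
Proof. by rewrite dotDl dotNl. Qed.
Lemma dotBr (a b c : 'rV[R]_3) : dot c (a - b) = dot c a - dot c b.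
Proof. by rewrite dotDr dotNr. Qed.
Lemma dot0l (a : 'rV[R]_3) : dot 0 a = 0.
Proof. by rewrite /dot big1// => i _; rewrite mxE mul0r. Qed.
Lemma dot_ge0 (a : 'rV[R]_3) : 0 <= dot a a.
Proof. by apply: sumr_ge0 => i _; rewrite -expr2 sqr_ge0. Qed.
Lemma dot_suml (I : Type) (s : seq I) (h : I -> 'rV[R]_3) (a : 'rV[R]_3) :
  dot (\sum_(i <- s) h i) a = \sum_(i <- s) dot (h i) a.
Proof.
elim: s => [|i s IH]; first by rewrite !big_nil dot0l.
by rewrite !big_cons dotDl IH.
Qed.

Lemma L2D u v : L2 u -> L2 v -> L2 (fun x => u x + v x).
Proof.
move=> hu hv i; have := sqD (hu i) (hv i).
by apply: sq_ext => x; rewrite mxE.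
Qed.

Lemma L2mul c u : bmul leb3 c -> L2 u -> L2 (fun x => c x *: u x).
Proof.
move=> hc hu i; have := sq_mul hc (hu i).
by apply: sq_ext => x; rewrite mxE.
Qed.

Lemma L2Z c u : L2 u -> L2 (fun x => c *: u x).
Proof. by apply: L2mul; exact: bmul_cst. Qed.

Lemma L2N u : L2 u -> L2 (fun x => - u x).
Proof.
by move=> /(L2Z (-1)); congr L2; apply/funext => x; rewrite scaleN1r.
Qed.

Lemma L2B u v : L2 u -> L2 v -> L2 (fun x => u x - v x).
Proof. by move=> hu hv; exact: L2D hu (L2N hv). Qed.

Lemma L2_0 : L2 (fun=> 0 : 'rV[R]_3).
Proof.
move=> i; have := @sq0 _ _ R (@leb3 R).
by apply: sq_ext => x; rewrite mxE.
Qed.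

Lemma L2_sum (I : Type) (s : seq I) (h : I -> field) :
  (forall i, L2 (h i)) -> L2 (fun x => \sum_(i <- s) h i x).
Proof.
move=> hh; elim: s => [|i s IH].
  by have := L2_0; congr L2; apply/funext => x; rewrite big_nil.
by have := L2D (hh i) IH; congr L2; apply/funext => x; rewrite big_cons.
Qed.

Lemma intg_dot u v : L2 u -> L2 v -> intg leb3 (fun x => dot (u x) (v x)).
Proof. by move=> hu hv; apply: intg_sum => i; exact: sqM (hu i) (hv i). Qed.

Definition ip u v : R := Int leb3 (fun x => dot (u x) (v x)).
Definition nrm u : R := Num.sqrt (ip u u).

Lemma ipC u v : ip u v = ip v u.
Proof. by apply: Int_ext => x; rewrite dotC. Qed.
Lemma ipDl u v w : L2 u -> L2 v -> L2 w ->
  ip (fun x => u x + v x) w = ip u w + ip v w.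
Proof.
move=> hu hv hw; rewrite /ip -IntD; try exact: intg_dot.
by apply: Int_ext => x; rewrite dotDl.
Qed.
Lemma ipZl c u v : L2 u -> L2 v -> ip (fun x => c *: u x) v = c * ip u v.
Proof.
move=> hu hv; rewrite /ip -IntZ; last exact: intg_dot.
by apply: Int_ext => x; rewrite dotZl.
Qed.
Lemma ipBl u v w : L2 u -> L2 v -> L2 w ->
  ip (fun x => u x - v x) w = ip u w - ip v w.
Proof.
move=> hu hv hw; rewrite /ip -IntB; try exact: intg_dot.
by apply: Int_ext => x; rewrite dotBl.
Qed.
Lemma ip_suml (I : Type) (s : seq I) (h : I -> field) v :
  (forall i, L2 (h i)) -> L2 v ->
  ip (fun x => \sum_(i <- s) h i x) v = \sum_(i <- s) ip (h i) v.
Proof.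
move=> hh hv; rewrite /ip -Int_sum; last by move=> i; exact: intg_dot.
by apply: Int_ext => x; rewrite dot_suml.
Qed.
Lemma ip_ge0 u : 0 <= ip u u.
Proof. by apply: Int_ge0 => x; exact: dot_ge0. Qed.

Lemma ip_cs u v : L2 u -> L2 v -> ip u v ^+ 2 <= ip u u * ip v v.
Proof.
move=> hu hv.
have key t : 0 <= t ^+ 2 * ip u u - 2 * t * ip u v + ip v v.
  have -> : t ^+ 2 * ip u u - 2 * t * ip u v + ip v v
      = ip (fun x => (- t) *: u x + v x) (fun x => (- t) *: u x + v x).
    have h := L2Z (- t) hu; have h' := L2D h hv.
    rewrite ipDl// ipZl// ![ip _ (fun x => _ + _)]ipC !ipDl// !ipZl//.
    by rewrite (ipC v u); ring.
  exact: ip_ge0.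
have [u0|u0] := eqVneq (ip u u) 0.
  rewrite u0 mul0r; have [->|ne] := eqVneq (ip u v) 0; first by rewrite expr0n.
  (* With [ip u u = 0] the quadratic is affine in [t], and this [t] makes it equal to -1. *)
  have := key ((ip v v + 1) / (2 * ip u v)); rewrite u0 => h.
  suff : 0 <= (-1 : R) by rewrite lerNr oppr0 ler10.
  apply: le_trans h _; rewrite mulr0 add0r.
  by rewrite le_eqVlt; apply/orP; left; apply/eqP; field.
have up : 0 < ip u u by rewrite lt_def u0 ip_ge0.
have := key (ip u v / ip u u).
have -> : (ip u v / ip u u) ^+ 2 * ip u u - 2 * (ip u v / ip u u) * ip u v + ip v v
   = (ip u u * ip v v - ip u v ^+ 2) / ip u u by field.
by rewrite pmulr_lge0 ?invr_gt0// subr_ge0.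
Qed.

Lemma nrm_ge0 u : 0 <= nrm u. Proof. exact: sqrtr_ge0. Qed.

Lemma nrm2 u : nrm u ^+ 2 = ip u u.
Proof. by rewrite sqr_sqrtr// ip_ge0. Qed.

Lemma ip_le_nrm u v : L2 u -> L2 v -> `|ip u v| <= nrm u * nrm v.
Proof.
move=> hu hv; rewrite -(@ler_pXn2r _ 2)// ?nnegrE ?normr_ge0 ?mulr_ge0 ?nrm_ge0//.
by rewrite exprMn !nrm2 real_normK ?num_real// ip_cs.
Qed.

Lemma nrmD u v : L2 u -> L2 v -> nrm (fun x => u x + v x) <= nrm u + nrm v.
Proof.
move=> hu hv; have h := L2D hu hv.
rewrite -(@ler_pXn2r _ 2)// ?nnegrE ?addr_ge0 ?nrm_ge0//.
rewrite nrm2 ipDl// ![ip _ (fun x => _ + _)]ipC !ipDl// sqrrD !nrm2.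
have := le_trans (ler_norm _) (ip_le_nrm hu hv); rewrite (ipC v u) => ?.
by rewrite mulr2n; lra.
Qed.

Lemma nrmZ c u : L2 u -> nrm (fun x => c *: u x) = `|c| * nrm u.
Proof.
move=> hu; have h := L2Z c hu.
by rewrite /nrm ipZl// ipC ipZl// mulrA -expr2 sqrtrM ?sqr_ge0// sqrtr_sqr.
Qed.

Lemma nrm_ext u v : u =1 v -> nrm u = nrm v.
Proof. by move=> h; congr nrm; apply/funext. Qed.

Lemma ip_ae u v w : L2 u -> L2 v -> L2 w -> {ae leb3, forall x, u x = v x} ->
  ip u w = ip v w.
Proof.
move=> hu hv hw uv; apply: Int_ae; try exact: intg_meas (intg_dot _ _).
by apply: aeS uv => x ->.
Qed.

Lemma nrm_ae u v : L2 u -> L2 v -> {ae leb3, forall x, u x = v x} -> nrm u = nrm v.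
Proof.
move=> hu hv uv; congr Num.sqrt.
by rewrite (ip_ae hu hv hu uv) ipC (ip_ae hu hv hv uv).
Qed.

(** Passes from the extended-real norm of the definitions to the real-valued [nrm], on which all
    estimates are made. *)
Lemma L2normE u : L2 u -> L2norm u = (nrm u)%:E.
Proof.
move=> hu; rewrite /L2norm unlock.
have -> : (\int[leb3]_x (`|(enorm (u x))%:E| `^ 2))%E = (ip u u)%:E.
  rewrite /ip -Int_fin; last exact: intg_dot.
  apply: eq_integral => x _ /=.
  rewrite powR_mulrn ?normr_ge0// real_normK ?num_real// /enorm sqr_sqrtr//.
  exact: dot_ge0.
by rewrite poweR_EFin powR12_sqrt// ip_ge0.
Qed.

End Fields.

(** * Smooth bump functions *)

Section Smooth.
Context {R : realType}.

Lemma is_Ck_cont (V : normedModType R) k (f : V -> R) : is_Ck k f -> continuous f.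
Proof. by case: k => [|k] []. Qed.

Lemma is_CkW (V : normedModType R) k (f : V -> R) : is_Ck k.+1 f -> is_Ck k f.
Proof.
elim: k f => [|k IH] f /= [cf h]; first by split.
by split=> // v; have [df h'] := h v; split => //; exact: IH.
Qed.

Lemma is_CkD (V : normedModType R) k (f g : V -> R) :
  is_Ck k f -> is_Ck k g -> is_Ck k (fun x => f x + g x).
Proof.
elim: k f g => [|k IH] f g /= [cf hf] [cg hg].
  by split => // x; apply: cvgD; [exact: cf|exact: cg].
split=> [x|v]; first by apply: cvgD; [exact: cf|exact: cg].
have [df hf'] := hf v; have [dg hg'] := hg v; split.
  by move=> x; exact: derivableD.
by have := IH _ _ hf' hg'; congr is_Ck; apply/funext => x; rewrite -deriveD.
Qed.

Lemma is_CkM (V : normedModType R) k (f g : V -> R) :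
  is_Ck k f -> is_Ck k g -> is_Ck k (fun x => f x * g x).
Proof.
elim: k f g => [|k IH] f g hf hg.
  move: hf hg => /= [cf hf] [cg hg].
  by split => // x; apply: cvgM; [exact: cf|exact: cg].
have f' := is_CkW hf; have g' := is_CkW hg.
move: hf hg => /= [cf hf] [cg hg].
split=> [x|v]; first by apply: cvgM; [exact: cf|exact: cg].
have [df hf'] := hf v; have [dg hg'] := hg v; split.
  by move=> x; exact: derivableM.
have := is_CkD (IH _ _ f' hg') (IH _ _ g' hf').
by congr is_Ck; apply/funext => x; rewrite -deriveM.
Qed.

Lemma is_Ck_cst (V : normedModType R) k (c : R) : is_Ck k (fun _ : V => c).
Proof.
elim: k c => [|k IH] c /=; first by split => //; exact: cst_continuous.
split=> [|v]; first exact: cst_continuous.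
split=> [x|]; first exact: derivable_cst.
by have := IH 0; congr is_Ck; apply/funext => x; rewrite derive_cst.
Qed.

(* difference quotients of [f \o l] in the direction [v] are those of [f] in
   the direction [L v] *)
Lemma derive_affine (V : normedModType R) (f : R -> R) (l : V -> R) (L : V -> R) :
  (forall h x v, l (h *: v + x) = h * L v + l x) ->
  forall x v, (derivable f (l x) (L v) -> derivable (f \o l) x v) /\
              'D_v (f \o l) x = 'D_(L v) f (l x).
Proof.
move=> hl x v; rewrite /derivable /derive.
have -> : (fun h : R => h^-1 *: (((f \o l) \o shift x) (h *: v) - (f \o l) x)) =
          (fun h : R => h^-1 *: ((f \o shift (l x)) (h *: L v) - f (l x))).
  by apply/funext => h; rewrite /= hl.
by [].
Qed.

Lemma is_Ck_affine (V : normedModType R) (l : V -> R) (L : V -> R) :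
  continuous l -> (forall h x v, l (h *: v + x) = h * L v + l x) ->
  forall k (f : R -> R), is_Ck k f -> is_Ck k (f \o l).
Proof.
move=> cl hl; elim=> [|k IH] f /= [cf hf].
  by split => // x; apply: continuous_comp; [exact: cl|exact: cf].
split=> [x|v]; first by apply: continuous_comp; [exact: cl|exact: cf].
have [df hf'] := hf (L v); split.
  by move=> x; apply: (derive_affine f hl x v).1.
have := IH _ hf'; congr is_Ck; apply/funext => x.
by rewrite (derive_affine f hl x v).2.
Qed.

Lemma derive_dir (f : R -> R) (x v df : R) : is_derive x 1 f df ->
  derivable f x v /\ 'D_v f x = v * df.
Proof.
move=> [h1 h2]; have h := (derivable1_diffP _ _).1 h1.
split; first exact: diff_derivable.
rewrite deriveE// -[X in 'd f x X]mulr1 -[v * 1]/(v *: (1 : R)) linearZ /=.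
by rewrite -deriveE// h2.
Qed.

(** [flat 0] is the classical function [exp(-1/t)], smooth and flat at 0. The powers of [t^-1] make
    the family closed under differentiation up to linear combinations, so a single induction on the
    order proves smoothness. *)
Definition flat (n : nat) (t : R) : R := if 0 < t then t^-1 ^+ n * expR (- t^-1) else 0.

(** The exponential at [t^-1] dominates the term of order [n.+1] of its series; one factor [t] is
    left over, which gives continuity at 0. *)
Lemma flat_le n t : `|flat n t| <= n.+1`!%:R * `|t|.
Proof.
rewrite /flat; case: ifPn => [t0|_]; last by rewrite normr0 mulr_ge0.
rewrite ger0_norm ?mulr_ge0 ?exprn_ge0 ?invr_ge0 ?expR_ge0 ?(ltW t0)//.
rewrite (gtr0_norm t0) expRN ler_pdivrMr ?expR_gt0//.
have h : (t^-1) ^+ n.+1 / n.+1`!%:R <= expR t^-1.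
  apply: le_trans (expR_ge1Dxn n _); first by rewrite lerDr.
  by rewrite invr_ge0 ltW.
have f0 : (0 : R) < n.+1`!%:R by rewrite ltr0n fact_gt0.
apply: le_trans (ler_wpM2l _ h); last by rewrite mulr_ge0// ltW.
rewrite le_eqVlt; apply/orP; left; apply/eqP.
by rewrite exprS; field; rewrite !gt_eqF.
Qed.

Lemma flat_cont0 n : {for 0, continuous (flat n)}.
Proof.
have h : flat n @ (0 : R) --> (0 : R).
  have f0 : (0 : R) < n.+1`!%:R by rewrite ltr0n fact_gt0.
  apply/cvgrPdist_le => /= e e0; near=> t; rewrite sub0r normrN.
  apply: le_trans (flat_le n t) _; rewrite mulrC -ler_pdivlMr//.
  near: t; exists (e / n.+1`!%:R); rewrite /= ?divr_gt0// => y /=.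
  by rewrite sub0r normrN => /ltW.
by rewrite /prop_for /continuous_at {2}/flat ltxx.
Unshelve. all: by end_near. Qed.

Lemma flat_derive n (t : R) : is_derive t (1 : R) (flat n) (flat n.+2 t - n%:R * flat n.+1 t).
Proof.
have [t0|t0|->] := ltgtP t 0.
- apply: (near_eq_is_derive (f := cst (0 : R))).
    near=> s; rewrite /flat ltNge ltW//; near: s; exact: lt_nbhsl.
  rewrite /flat !ltNge !ltW//= mulr0 subr0; exact: is_derive_cst.
- have tn : t != 0 by rewrite gt_eqF.
  apply: (near_eq_is_derive (f := fun s : R => s^-1 ^+ n * expR (- s^-1))).
    by near=> s; rewrite /flat ifT//; near: s; exact: lt_nbhsr.
  have hv : is_derive t 1 (fun s : R => s^-1) (- (t ^- 2) *: 1).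
    exact: (is_deriveV (f := id) tn).
  have hx := is_deriveX n hv.
  have he : is_derive t 1 (expR \o (fun s : R => - s^-1)) (expR (- t^-1) * (t ^- 2)).
    have hg : is_derive t 1 (fun s : R => - s^-1) (t ^- 2).
      by apply: (is_derive_eq (is_deriveN hv)); rewrite [_ *: _]mulr1 opprK.
    have := is_derive1_comp (f := expR) (is_derive_expR _) hg.
    by move=> h; apply: (is_derive_eq h); rewrite mulrC.
  have hm := is_deriveM hx he.
  have -> : (fun s : R => s^-1 ^+ n * expR (- s^-1)) =
      (fun s : R => s^-1) ^+ n * (expR \o (fun s : R => - s^-1)).
    by apply/funext => s; rewrite fctE exprfctE.
  apply: (is_derive_eq hm).
  rewrite /flat t0 exprfctE /= /GRing.scale /= {hm hx}.
  by case: n => [|n] /=; rewrite ?expr0 ?exprS; field.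
(* At 0 the difference quotient of [flat n] is [flat n.+1] itself, which is continuous there with
   value 0. *)
- have hq : (fun h : R => h^-1 *: ((flat n \o shift 0) (h *: (1:R)) - flat n 0)) @ 0^' --> (0:R).
    apply: (cvg_trans (G := flat n.+1 @ 0^')); last first.
      have /continuous_withinNx := @flat_cont0 n.+1.
      by rewrite [X in _ --> X]/flat ltxx.
    apply: near_eq_cvg; near=> h.
    rewrite /= addr0 [_ *: 1]mulr1 /flat ltxx subr0; case: ifPn => h0; last by rewrite scaler0.
    by rewrite exprS -mulrA.
  have -> : flat n.+2 (0 : R) - n%:R * flat n.+1 0 = 0.
    by rewrite /flat ltxx mulr0 subr0.
  apply: DeriveDef; first by apply/cvg_ex; exists 0.
  by apply: cvg_lim; [exact: norm_hausdorff|exact: hq].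
Unshelve. all: by end_near. Qed.

Lemma flat_Ck n k : is_Ck k (flat n).
Proof.
have cf n' : continuous (flat n').
  move=> t; apply: differentiable_continuous; apply/derivable1_diffP.
  by have [] := flat_derive n' t.
elim: k n => [|k IH] n; first by split.
split=> [|v]; first exact: cf.
split=> [t|]; first exact: (derive_dir v (flat_derive n t)).1.
have -> : (fun t => 'D_v (flat n) t) = (fun t => v * (flat n.+2 t + - n%:R * flat n.+1 t)).
  by apply/funext => t; rewrite (derive_dir v (flat_derive n t)).2 mulNr.
by apply: is_CkM (is_Ck_cst _ _ _) _; apply: is_CkD => //; apply: is_CkM (is_Ck_cst _ _ _) _.
Qed.

Lemma flat_ge0 n t : 0 <= flat n t.
Proof.
by rewrite /flat; case: ifPn => // t0; rewrite mulr_ge0 ?expR_ge0// exprn_ge0// invr_ge0 ltW.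
Qed.

End Smooth.

(** * Borel measurability of continuous functions on R^3 *)

Section Measurability3.
Context {R : realType}.
Local Notation point := (R * R * R)%type.
Local Notation mpoint := (measurableTypeR R * measurableTypeR R * measurableTypeR R)%type.

(** These are the open balls of the maximum norm, hence a basis of the topology on triples, and also
    products of intervals, hence measurable with a volume given by iterated integrals. *)
Definition cube (c : point) (r : R) : set mpoint :=
  [set x | [/\ `|c.1.1 - x.1.1| < r, `|c.1.2 - x.1.2| < r & `|c.2 - x.2| < r]].

Lemma measurable_c1 : measurable_fun setT (fun x : mpoint => x.1.1).
Proof. exact: measurableT_comp. Qed.
Lemma measurable_c2 : measurable_fun setT (fun x : mpoint => x.1.2).
Proof. exact: measurableT_comp. Qed.
Lemma measurable_c3 : measurable_fun setT (fun x : mpoint => x.2).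
Proof. exact: measurable_snd. Qed.

Lemma cube_prod (c : point) r : cube c r =
  [set x | `|c.1.1 - x| < r] `*` [set x | `|c.1.2 - x| < r] `*` [set x | `|c.2 - x| < r].
Proof. by apply/seteqP; split => [x []|x [[]]]. Qed.

Lemma measurable_ball1 (c r : R) : measurable ([set x | `|c - x| < r] : set (measurableTypeR R)).
Proof. exact: (measurable_ball c r). Qed.

Lemma measurable_cube c r : measurable (cube c r).
Proof.
by rewrite cube_prod; apply: measurableX; [apply: measurableX|]; exact: measurable_ball1.
Qed.

Lemma rat_approx (x e : R) : 0 < e -> exists q : rat, `|ratr q - x| < e.
Proof.
move=> e0; have /rat_in_itvoo[q] : x < x + e by rewrite ltrDl.
rewrite in_itv /= => /andP[h1 h2]; exists q.
by rewrite ger0_norm ?subr_ge0 ?(ltW h1)// ltrBlDl.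
Qed.

(** An open set is the union of the cubes with rational centre and radius that it contains; these
    are enumerated by [unpickle]. The sigma-algebra is the product one. *)
Lemma open_measurable3 (U : set mpoint) : open (U : set point) -> measurable U.
Proof.
move=> oU.
pose rc (q : rat * rat * rat * rat) : set mpoint :=
  cube (ratr q.1.1.1, ratr q.1.1.2, ratr q.1.2) (ratr q.2).
pose F n : set mpoint := if unpickle n is Some q then
  (if `[< rc q `<=` U >] then rc q else set0) else set0.
have -> : U = \bigcup_n F n.
  apply/seteqP; split=> [x Ux|x [n _]]; last first.
    rewrite /F; case: unpickle => [q|//].
    by case: asboolP => // h /h.
  have := oU; rewrite openE => /(_ _ Ux)/nbhs_ballP[e /= e0 eU].
  (* The radius [q] lies strictly between 0 and [e / 2], so a cube of radius [q] whose centre is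
     within [q] of [x] stays within [e] of [x]. *)
  have [q] : exists q : rat, `|ratr q - e / 4| < e / 4 by apply: rat_approx; lra.
  rewrite ltr_norml => /andP[q1 q2].
  have q0 : 0 < (ratr q : R) by lra.
  have [a1 h1] := rat_approx x.1.1 q0.
  have [a2 h2] := rat_approx x.1.2 q0.
  have [a3 h3] := rat_approx x.2 q0.
  exists (pickle (a1, a2, a3, q)); [exact: I|]; rewrite /F pickleK.
  case: asboolP => [_|h]; first by split.
  exfalso; apply: h => y [/= k1 k2 k3]; apply: eU.
  have tri (a b c : R) : `|c - a| < ratr q -> `|c - b| < ratr q -> `|a - b| < e.
    by rewrite !ltr_norml => /andP[? ?] /andP[? ?]; apply/andP; split; lra.
  split; [split|]; apply: tri; eassumption.
apply: bigcupT_measurable => n; rewrite /F; case: unpickle => [q|//].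
by case: asboolP => _ //; exact: measurable_cube.
Qed.

Lemma continuous_measurable3 (f : point -> R) : continuous f ->
  measurable_fun setT (f : mpoint -> R).
Proof.
move=> cf; apply: (measurability _ (RGenOInfty.measurableE R)).
move=> _ [_ [a ->] <-]; rewrite setTI; apply: open_measurable3.
by apply: open_comp => [x _|]; [exact: cf|exact: rray_open].
Qed.

End Measurability3.

(** * Iterated integrals on R^3 *)

Section RealFubini.
Context d1 d2 (T1 : measurableType d1) (T2 : measurableType d2) (R : realType).
Variable m1 : {sigma_finite_measure set T1 -> \bar R}.
Variable m2 : {sigma_finite_measure set T2 -> \bar R}.
Local Notation m12 := (m1 \x m2)%E.

Lemma product_sigma_finite : sigma_finite setT m12.
Proof.
have /sigma_finiteP[F [TF ndF fF]] := sigma_finiteT m1.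
have /sigma_finiteP[G [TG ndG fG]] := sigma_finiteT m2.
exists (fun n => F n `*` G n) => [|n]; last first.
  have [mFn Fn] := fF n; have [mGn Gn] := fG n; split; first exact: measurableX.
  by rewrite product_measure1E// lte_mul_pinfty// ge0_fin_numE.
apply/seteqP; split=> // -[x y] _.
have [i _ Fi] : (\bigcup_n F n) x by rewrite -TF.
have [j _ Gj] : (\bigcup_n G n) y by rewrite -TG.
exists (maxn i j) => //; split => /=.
  by move: x Fi; apply/subsetPset/ndF; exact: leq_maxl.
by move: y Gj; apply/subsetPset/ndG; exact: leq_maxr.
Qed.

(** The product measure packed again as a sigma-finite one, so that products can be iterated and
    Fubini applies on R^3 and on pairs of points of R^3. *)
Definition prodsf : {sigma_finite_measure set (T1 * T2)%type -> \bar R} :=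
  HB.pack m12 (Measure_isSigmaFinite.Build _ _ _ m12 product_sigma_finite).

(** Inner integrals are extended reals, finite only almost everywhere; taking [fine] changes neither
    integrability nor the integral. *)
Lemma intg_fine d (T : measurableType d) (m : {measure set T -> \bar R}) (F : T -> \bar R) :
  m.-integrable setT F -> intg m (fun x => fine (F x)) /\
  (Int m (fun x => fine (F x)))%:E = (\int[m]_x F x)%E.
Proof.
move=> iF; have mF := measurable_int _ iF.
have h : intg m (fun x => fine (F x)).
  apply: (le_integrable measurableT _ _ iF).
    by apply/measurable_EFinP; exact: measurableT_comp.
  move=> x _ /=; case: (F x) => [r||] //=; rewrite ?normr0 ?leey//.
split => //; rewrite -Int_fin//; apply: ae_eq_integral => //.
  by apply: measurable_int h.
have := integrable_ae measurableT iF; apply: filterS => x /= /(_ I) fx _.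
by rewrite fineK.
Qed.

Lemma fubini12 (f : T1 * T2 -> R) : intg m12 f ->
  intg m1 (fun x => Int m2 (fun y => f (x, y))) /\
  Int m1 (fun x => Int m2 (fun y => f (x, y))) = Int m12 f.
Proof.
move=> hf; have [h1 h2] := intg_fine (integrable_fubini_F hf).
split; first exact: h1.
have := integral12_prod_meas1 hf; rewrite (Int_fin hf) -h2 => -[<-].
by [].
Qed.

Lemma fubini21 (f : T1 * T2 -> R) : intg m12 f ->
  intg m2 (fun y => Int m1 (fun x => f (x, y))) /\
  Int m2 (fun y => Int m1 (fun x => f (x, y))) = Int m12 f.
Proof.
move=> hf.
have iG : m2.-integrable setT (fubini_G m1 (EFin \o f)).
  have mf := measurable_int _ hf.
  apply/integrableP; split; first exact: (measurable_fubini_G hf).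
  have h := (integrable21ltyP m1 m2 mf).1 hf; apply: le_lt_trans h.
  apply: ge0_le_integral => //.
  - by apply: measurableT_comp => //; exact: (measurable_fubini_G hf).
  - by apply: (measurable_fun_fubini_tonelli_G (abse \o (EFin \o f))) => //=; exact: measurableT_comp.
  - by move=> y _; apply: le_abse_integral => //; apply: measurableT_comp mf _; exact: measurable_pair2.
have [h1 h2] := intg_fine iG.
split; first exact: h1.
have := integral21_prod_meas1 hf; rewrite (Int_fin hf) -h2 => -[<-].
by [].
Qed.

Lemma intg_tonelli12 (f : T1 * T2 -> R) (G : T1 -> R) : measurable_fun setT f ->
  (forall x, intg m2 (fun y => f (x, y))) ->
  (forall x, Int m2 (fun y => `|f (x, y)|) <= G x) -> intg m1 G -> intg m12 f.
Proof.
move=> mf hf hG iG; apply/integrable12ltyP; first exact/measurable_EFinP.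
have mn : measurable_fun setT (fun x => (\int[m2]_y `|(f (x, y))%:E|)%E).
  apply: (measurable_fun_fubini_tonelli_F (fun z => `|(f z)%:E|%E)) => //=.
  by apply/measurable_EFinP; exact: measurableT_comp.
have /integrableP[mG] := iG.
apply: le_lt_trans; apply: ge0_le_integral => //.
- by move=> x _; exact: integral_ge0.
- exact: measurableT_comp.
move=> x _ /=; have := Int_fin (intg_norm (hf x)); rewrite /= => ->.
by rewrite lee_fin (le_trans (hG x))// ler_norm.
Qed.

Lemma intg_tonelli21 (f : T1 * T2 -> R) (G : T2 -> R) : measurable_fun setT f ->
  (forall y, intg m1 (fun x => f (x, y))) ->
  (forall y, Int m1 (fun x => `|f (x, y)|) <= G y) -> intg m2 G -> intg m12 f.
Proof.
move=> mf hf hG iG; apply/integrable21ltyP; first exact/measurable_EFinP.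
have mn : measurable_fun setT (fun y => (\int[m1]_x `|(f (x, y))%:E|)%E).
  apply: (measurable_fun_fubini_tonelli_G (fun z => `|(f z)%:E|%E)) => //=.
  by apply/measurable_EFinP; exact: measurableT_comp.
have /integrableP[mG] := iG.
apply: le_lt_trans; apply: ge0_le_integral => //.
- by move=> x _; exact: integral_ge0.
- exact: measurableT_comp.
move=> y _ /=; have := Int_fin (intg_norm (hf y)); rewrite /= => ->.
by rewrite lee_fin (le_trans (hG y))// ler_norm.
Qed.

Lemma intg_prod (f : T1 -> R) (g : T2 -> R) : intg m1 f -> intg m2 g ->
  intg m12 (fun z => f z.1 * g z.2).
Proof.
move=> hf hg; apply: (@intg_tonelli12 _ (fun x => Int m2 (fun y => `|g y|) * `|f x|)).
- apply: measurable_funM.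
    exact: measurableT_comp (intg_meas hf) measurable_fst.
  exact: measurableT_comp (intg_meas hg) measurable_snd.
- by move=> x; exact: (intgZ (f x) hg).
- move=> x; rewrite mulrC -IntZ ?intg_norm//.
  by rewrite le_eqVlt; apply/orP; left; apply/eqP; apply: Int_ext => y; rewrite normrM.
- by apply: intgZ; exact: intg_norm.
Qed.

Lemma Int_prod (f : T1 -> R) (g : T2 -> R) : intg m1 f -> intg m2 g ->
  Int m12 (fun z => f z.1 * g z.2) = Int m1 f * Int m2 g.
Proof.
move=> hf hg; rewrite -(fubini12 (intg_prod hf hg)).2 mulrC -IntZ//.
by apply: Int_ext => x /=; rewrite IntZ// mulrC.
Qed.

End RealFubini.

Section Leb3.
Context {R : realType}.
Local Notation point := (R * R * R)%type.
Local Notation mpoint := (measurableTypeR R * measurableTypeR R * measurableTypeR R)%type.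
Local Notation leb := (@lebesgue_measure R).

Definition leb1s : {sigma_finite_measure set (measurableTypeR R) -> \bar R} := lebesgue_measure.
Definition leb2s : {sigma_finite_measure set (measurableTypeR R * measurableTypeR R)%type -> \bar R} :=
  prodsf leb1s leb1s.
Definition leb3s : {sigma_finite_measure set mpoint -> \bar R} := prodsf leb2s leb1s.

Lemma leb3E : (leb3s : {measure set mpoint -> \bar R}) = leb3.
Proof. by []. Qed.

Lemma intg_prod3 (f g h : R -> R) : intg leb f -> intg leb g -> intg leb h ->
  intg leb3s (fun x : mpoint => f x.1.1 * g x.1.2 * h x.2) /\
  Int leb3s (fun x : mpoint => f x.1.1 * g x.1.2 * h x.2) = Int leb f * Int leb g * Int leb h.
Proof.
move=> hf hg hh; have h2 := @intg_prod _ _ _ _ R leb1s leb1s f g hf hg.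
split; first exact: (@intg_prod _ _ _ _ R leb2s leb1s (fun z => f z.1 * g z.2) h h2 hh).
have e2 := @Int_prod _ _ _ _ R leb1s leb1s f g hf hg.
have e3 := @Int_prod _ _ _ _ R leb2s leb1s (fun z => f z.1 * g z.2) h h2 hh.
by rewrite -[LHS]/(Int (leb2s \x leb1s)%E _) e3 -[Int leb2s _]/(Int (leb1s \x leb1s)%E _) e2.
Qed.

(** The translated measure agrees with Lebesgue measure on half-open intervals, hence everywhere by
    uniqueness. *)
Lemma lebesgue_shift (a : R) (A : set R) : measurable A ->
  lebesgue_measure ((fun t => a + t) @^-1` A) = lebesgue_measure A.
Proof.
move=> mA.
have ms : measurable_fun setT (fun t : measurableTypeR R => (a + t) : measurableTypeR R).
  exact: measurable_funD.
pose phi : {mfun measurableTypeR R >-> measurableTypeR R} :=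
  HB.pack (fun t : measurableTypeR R => (a + t) : measurableTypeR R)
    (isMeasurableFun.Build _ _ _ _ _ ms).
suff : forall A, measurable A -> lebesgue_measure A = pushforward lebesgue_measure phi A.
  by move=> h; rewrite [RHS]h.
apply: lebesgue_measure_unique => _ [[b c]] _ <-.
rewrite /pushforward.
rewrite [RHS](_ : _ = lebesgue_measure `]b - a, c - a]%classic); last first.
  congr (lebesgue_measure _).
  by apply/seteqP; split => t /=; rewrite !in_itv /= ltrBlDl lerBrDl.
by rewrite !lebesgue_measure_itv /= !lte_fin ltrD2r -!EFinB; case: ifP => // _; congr EFin; ring.
Qed.

Lemma Int_shift (a : R) (f : R -> R) : measurable_fun setT f -> (forall t, 0 <= f t) ->
  Int leb (fun t => f (a + t)) = Int leb f.
Proof.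
move=> mf f0; rewrite /Int /Rintegral; congr fine.
have ms : measurable_fun setT (fun t : measurableTypeR R => (a + t) : measurableTypeR R).
  exact: measurable_funD.
have := @ge0_integral_pushforward _ _ _ _ _ _ ms leb setT (EFin \o f) measurableT.
rewrite preimage_setT => /(_ _ _)/= <- //.
- by apply: eq_measure_integral => A mA _; rewrite /pushforward; exact: lebesgue_shift.
- exact/measurable_EFinP.
- by move=> y _; rewrite lee_fin.
Qed.

Lemma intg_ball1 (a r : R) : intg leb (fun t => \1_[set t | `|a - t| < r] t : R).
Proof.
apply: intg_indic; first exact: measurable_ball1.
have -> : [set t | `|a - t| < r] = `]a - r, a + r[%classic.
  apply/seteqP; split => t /=; rewrite in_itv /= ltr_norml => /andP[? ?];
    apply/andP; split; lra.
by rewrite /= lebesgue_measure_itv /=; case: ifP => _; rewrite ?ltry// ltey.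
Qed.

Lemma Int_ball1 (a r : R) : 0 <= r -> Int leb (fun t => \1_[set t | `|a - t| < r] t : R) = 2 * r.
Proof.
move=> r0; rewrite Int_indic; last exact: measurable_ball1.
have -> : [set t | `|a - t| < r] = `]a - r, a + r[%classic.
  apply/seteqP; split => t /=; rewrite in_itv /= ltr_norml => /andP[? ?];
    apply/andP; split; lra.
rewrite /= lebesgue_measure_itv /= lte_fin; case: ifPn => [_|]; first by rewrite /=; lra.
by rewrite -leNgt => ?; have -> : r = 0 by [lra|]; rewrite mulr0.
Qed.

Lemma indic_cube (c : point) r (x : mpoint) : \1_(cube c r) x =
  \1_[set t | `|c.1.1 - t| < r] x.1.1 * \1_[set t | `|c.1.2 - t| < r] x.1.2 *
  \1_[set t | `|c.2 - t| < r] x.2 :> R.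
Proof.
have mb (P : bool) (T : Type) (A : set T) (y : T) : (A y <-> P) -> \1_A y = P%:R :> R.
  move=> h; rewrite indicE; congr (_%:R); congr nat_of_bool.
  by apply/idP/idP; [rewrite inE => /h|move=> /h; rewrite inE].
rewrite (mb _ _ [set t | `|c.1.1 - t| < r] x.1.1 (iff_refl _)).
rewrite (mb _ _ [set t | `|c.1.2 - t| < r] x.1.2 (iff_refl _)).
rewrite (mb _ _ [set t | `|c.2 - t| < r] x.2 (iff_refl _)).
rewrite (mb [&& `|c.1.1 - x.1.1| < r, `|c.1.2 - x.1.2| < r & `|c.2 - x.2| < r]).
  by do 3 case: (_ < r); rewrite /= ?mulr1 ?mulr0 ?mul0r.
by split => [[-> -> ->]|/and3P[]].
Qed.

Lemma intg_cube (c : point) r : intg leb3s (fun x : mpoint => \1_(cube c r) x : R).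
Proof.
have [h _] := intg_prod3 (intg_ball1 c.1.1 r) (intg_ball1 c.1.2 r) (intg_ball1 c.2 r).
by apply: intg_ext h => x; rewrite indic_cube.
Qed.

Lemma Int_cube (c : point) r : 0 <= r ->
  Int leb3s (fun x : mpoint => \1_(cube c r) x : R) = (2 * r) ^+ 3.
Proof.
move=> r0.
have [_ h] := intg_prod3 (intg_ball1 c.1.1 r) (intg_ball1 c.1.2 r) (intg_ball1 c.2 r).
rewrite (@Int_ext _ _ _ _ _ (fun x : mpoint => \1_[set t | `|c.1.1 - t| < r] x.1.1 *
  \1_[set t | `|c.1.2 - t| < r] x.1.2 * \1_[set t | `|c.2 - t| < r] x.2)).
  by rewrite h !Int_ball1//; ring.
by move=> x; rewrite indic_cube.
Qed.

End Leb3.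

(** * Smoothing kernels and the curl identity *)

Section Kernel.
Context {R : realType}.
Local Notation point := (R * R * R)%type.
Local Notation mpoint := (measurableTypeR R * measurableTypeR R * measurableTypeR R)%type.
Local Notation field := (point -> 'rV[R]_3).
Local Notation m33 := (leb3s \x leb3s)%E.

Lemma measurable_fun_pair3 d (T : measurableType d) (f1 f2 f3 : T -> R) :
  measurable_fun setT f1 -> measurable_fun setT f2 -> measurable_fun setT f3 ->
  measurable_fun setT (fun x => (f1 x, f2 x, f3 x) : mpoint).
Proof.
move=> h1 h2 h3; apply: measurable_fun_pair => //; exact: measurable_fun_pair.
Qed.

Lemma measurable_sub3 :
  measurable_fun setT (fun z : mpoint * mpoint => ((z.1 : point) - (z.2 : point)) : mpoint).
Proof.
have -> : (fun z : mpoint * mpoint => ((z.1 : point) - (z.2 : point)) : mpoint) =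
  (fun z => (z.1.1.1 - z.2.1.1, z.1.1.2 - z.2.1.2, z.1.2 - z.2.2)) by [].
apply: measurable_fun_pair3; apply: measurable_funB.
- exact: measurableT_comp measurable_c1 measurable_fst.
- exact: measurableT_comp measurable_c1 measurable_snd.
- exact: measurableT_comp measurable_c2 measurable_fst.
- exact: measurableT_comp measurable_c2 measurable_snd.
- exact: measurableT_comp measurable_c3 measurable_fst.
- exact: measurableT_comp measurable_c3 measurable_snd.
Qed.

Lemma cubeC (x y : point) r : cube x r y <-> cube y r x.
Proof. by rewrite /cube /= !(distrC x.1.1) !(distrC x.1.2) !(distrC x.2). Qed.

Lemma cube0 (x y : point) r : cube 0 r (x - y) <-> cube x r y.
Proof.
have e (a b : R) : `|0 - (a - b)| = `|a - b| by rewrite sub0r normrN.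
by rewrite /cube /= !e.
Qed.

(** What the bump kernels and their partial derivatives have in common. As a convolution kernel such
    a [k] is dominated by [M] times the indicator of a cube, which makes its bilinear form bounded
    on square-integrable functions. *)
Definition nice_ker (r M : R) (k : point -> R) :=
  [/\ continuous k, 0 <= r, forall z, `|k z| <= M & forall z, ~ cube 0 r z -> k z = 0].

Section Nice.
Variables (r M : R) (k : point -> R).
Hypothesis nk : nice_ker r M k.

Lemma nice_M0 : 0 <= M.
Proof. by case: nk => _ _ h _; exact: le_trans (h 0). Qed.

Lemma nice_le (x y : mpoint) : `|k ((x : point) - (y : point))| <= M * \1_(cube x r) y.
Proof.
have [_ _ h h0] := nk; have [|n] := pselect (cube x r y).
  by move=> c; rewrite indicE mem_set// mulr1.
by rewrite h0 ?normr0 ?mulr_ge0 ?nice_M0// => /cube0.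
Qed.

Lemma indic_cubeC (x y : mpoint) : \1_(cube x r) y = \1_(cube y r) x :> R.
Proof.
rewrite !indicE; congr (_%:R); congr nat_of_bool.
by apply/idP/idP; rewrite !inE => /cubeC.
Qed.

Lemma measurable_nice :
  measurable_fun setT (fun z : mpoint * mpoint => k ((z.1 : point) - (z.2 : point))).
Proof.
have [ck _ _ _] := nk.
exact: (@measurableT_comp _ _ _ _ _ _ (k : mpoint -> R)) (continuous_measurable3 ck) measurable_sub3.
Qed.

Lemma measurable_indic_cube2 :
  measurable_fun setT (fun z : mpoint * mpoint => \1_(cube z.1 r) z.2 : R).
Proof.
have -> : (fun z : mpoint * mpoint => \1_(cube z.1 r) z.2 : R) =
  (fun z : mpoint * mpoint => \1_(cube 0 r) (((z.1 : point) - (z.2 : point)) : mpoint)).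
  apply/funext => z; rewrite !indicE; congr (_%:R); congr nat_of_bool.
  by apply/idP/idP; rewrite !inE => /cube0.
apply: (@measurableT_comp _ _ _ _ _ _ (\1_(cube 0 r) : mpoint -> R)) measurable_sub3.
by apply: measurable_indic; exact: measurable_cube.
Qed.

Lemma sec1_intg (x : mpoint) : intg leb3s (fun y : mpoint => k ((x : point) - (y : point))).
Proof.
have [ck _ _ _] := nk.
apply: (intg_dom (g := fun y => M * \1_(cube x r) y)).
- exact: (measurableT_comp measurable_nice (measurable_pair1 x)).
- by apply: intgZ; exact: intg_cube.
- by move=> y; exact: nice_le.
Qed.

Lemma sq_ind_intg (g : mpoint -> R) : sq leb3s g ->
  intg m33 (fun z => g z.1 ^+ 2 * \1_(cube z.1 r) z.2) /\
  Int m33 (fun z => g z.1 ^+ 2 * \1_(cube z.1 r) z.2) = (2 * r) ^+ 3 * Int leb3s (fun x => g x ^+ 2).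
Proof.
have [_ r0 _ _] := nk.
move=> /sqP[mg ig].
have h : intg m33 (fun z => g z.1 ^+ 2 * \1_(cube z.1 r) z.2).
  apply: (intg_tonelli12 (G := fun x => (2 * r) ^+ 3 * g x ^+ 2)) => //=.
  - apply: measurable_funM; last exact: measurable_indic_cube2.
    by apply: measurable_funX; exact: measurableT_comp mg measurable_fst.
  - by move=> x; apply: intgZ; exact: intg_cube.
  - move=> x; rewrite mulrC -(Int_cube x r0) -IntZ; last exact: intg_cube.
    rewrite le_eqVlt; apply/orP; left; apply/eqP; apply: Int_ext => y.
    by rewrite ger0_norm// mulr_ge0 ?sqr_ge0// indicE.
  - exact: intgZ.
split => //; rewrite -(fubini12 h).2 -IntZ//; apply: Int_ext => x /=.
by rewrite IntZ ?Int_cube 1?mulrC//; exact: intg_cube.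
Qed.

Lemma sq_ind_intg2 (g : mpoint -> R) : sq leb3s g ->
  intg m33 (fun z => g z.2 ^+ 2 * \1_(cube z.1 r) z.2) /\
  Int m33 (fun z => g z.2 ^+ 2 * \1_(cube z.1 r) z.2) = (2 * r) ^+ 3 * Int leb3s (fun x => g x ^+ 2).
Proof.
have [_ r0 _ _] := nk.
move=> /sqP[mg ig].
have h : intg m33 (fun z => g z.2 ^+ 2 * \1_(cube z.1 r) z.2).
  apply: (intg_tonelli21 (G := fun x => (2 * r) ^+ 3 * g x ^+ 2)) => //=.
  - apply: measurable_funM; last exact: measurable_indic_cube2.
    by apply: measurable_funX; exact: measurableT_comp mg measurable_snd.
  - move=> y; apply: intgZ; apply: intg_ext (intg_cube y r) => x.
    by rewrite indic_cubeC.
  - move=> y; rewrite mulrC -(Int_cube y r0) -IntZ; last exact: intg_cube.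
    rewrite le_eqVlt; apply/orP; left; apply/eqP; apply: Int_ext => x.
    by rewrite indic_cubeC ger0_norm// mulr_ge0 ?sqr_ge0// indicE.
  - exact: intgZ.
split => //; rewrite -(fubini21 h).2 -IntZ//; apply: Int_ext => y /=.
rewrite (@Int_ext _ _ _ _ _ (fun x : mpoint => g y ^+ 2 * \1_(cube y r) x)).
  by rewrite IntZ ?Int_cube 1?mulrC//; exact: intg_cube.
by move=> x; rewrite indic_cubeC.
Qed.

(** The pairing of [g] with the convolution of [w], kept as a double integral so that the smoothing
    can be moved onto either factor by [SkerE1] and [SkerE2]. *)
Definition Sker (g w : mpoint -> R) : R :=
  Int m33 (fun z => g z.1 * w z.2 * k ((z.1 : point) - (z.2 : point))).

(** Young's inequality. The weight [th] is free because [good_approx] first makes the [g] term small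
    and only then the [w] term. *)
Lemma Sker_dom (th : R) (g w : mpoint -> R) (z : mpoint * mpoint) : 0 < th ->
  `|g z.1 * w z.2 * k ((z.1 : point) - (z.2 : point))| <=
  M / 2 * (th * (g z.1 ^+ 2 * \1_(cube z.1 r) z.2) + th^-1 * (w z.2 ^+ 2 * \1_(cube z.1 r) z.2)).
Proof.
move=> th0; rewrite normrM.
apply: le_trans (ler_wpM2l (normr_ge0 _) (nice_le z.1 z.2)) _.
have c0 : 0 <= \1_(cube z.1 r) z.2 :> R by rewrite indicE.
have -> : M / 2 * (th * (g z.1 ^+ 2 * \1_(cube z.1 r) z.2) + th^-1 * (w z.2 ^+ 2 * \1_(cube z.1 r) z.2))
  = (th * g z.1 ^+ 2 + th^-1 * w z.2 ^+ 2) / 2 * (M * \1_(cube z.1 r) z.2) by ring.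
apply: ler_wpM2r; first by rewrite mulr_ge0// nice_M0.
have key s : s ^+ 2 = 1 -> s * (g z.1 * w z.2) <= (th * g z.1 ^+ 2 + th^-1 * w z.2 ^+ 2) / 2.
  move=> s2; rewrite -subr_ge0.
  have -> : (th * g z.1 ^+ 2 + th^-1 * w z.2 ^+ 2) / 2 - s * (g z.1 * w z.2) =
     (th * (g z.1 - s / th * w z.2) ^+ 2) / 2.
    have {1}-> : th^-1 = s ^+ 2 / th by rewrite s2 mul1r.
    by field; rewrite gt_eqF.
  by rewrite divr_ge0// mulr_ge0 ?sqr_ge0// ltW.
rewrite ler_norml lerNl -mulN1r key ?sqrrN ?expr1n//=.
by have := key 1 (expr1n _ _); rewrite mul1r.
Qed.

Lemma Sker_intg (g w : mpoint -> R) : sq leb3s g -> sq leb3s w ->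
  intg m33 (fun z => g z.1 * w z.2 * k ((z.1 : point) - (z.2 : point))).
Proof.
move=> hg hw; apply: (intg_dom _ _ (fun z => Sker_dom g w z ltr01)).
  apply: measurable_funM measurable_nice; apply: measurable_funM.
    exact: measurableT_comp (sq_meas hg) measurable_fst.
  exact: measurableT_comp (sq_meas hw) measurable_snd.
apply: intgZ; apply: intgD; apply: intgZ.
  exact: (sq_ind_intg hg).1.
exact: (sq_ind_intg2 hw).1.
Qed.

Lemma Sker_bound (th : R) (g w : mpoint -> R) : 0 < th -> sq leb3s g -> sq leb3s w ->
  `|Sker g w| <= M / 2 * (2 * r) ^+ 3 *
     (th * Int leb3s (fun x => g x ^+ 2) + th^-1 * Int leb3s (fun x => w x ^+ 2)).
Proof.
move=> th0 hg hw; have h := Sker_intg hg hw.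
have [g1 g2] := sq_ind_intg hg; have [w1 w2] := sq_ind_intg2 hw.
apply: le_trans (ler_Int_norm h) _.
have i1 := intgZ th g1; have i2 := intgZ th^-1 w1; have i3 := intgD i1 i2.
apply: le_trans (Int_le (intg_norm h) (intgZ (M / 2) i3) (fun z => Sker_dom g w z th0)) _.
rewrite IntZ// IntD// !IntZ// g2 w2.
by rewrite le_eqVlt; apply/orP; left; apply/eqP; ring.
Qed.

Lemma sq_cube (c : point) (s : R) : sq leb3s (fun x : mpoint => \1_(cube c s) x : R).
Proof.
apply/sqP; split; first by apply: measurable_indic; exact: measurable_cube.
apply: intg_ext (intg_cube c s) => x.
by rewrite indicE; case: (_ \in _); rewrite ?expr1n ?expr0n.
Qed.

Lemma sec1_sq (x : mpoint) : sq leb3s (fun y : mpoint => k ((x : point) - (y : point))).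
Proof.
apply: (sq_dom_ae (g := fun y => M * \1_(cube x r) y)).
- exact: (measurableT_comp measurable_nice (measurable_pair1 x)).
- by apply: sqZ; exact: sq_cube.
- by apply: aeW => y; exact: le_trans (nice_le x y) (ler_norm _).
Qed.

Lemma sec2_sq (y : mpoint) : sq leb3s (fun x : mpoint => k ((x : point) - (y : point))).
Proof.
apply: (sq_dom_ae (g := fun x => M * \1_(cube y r) x)).
- exact: (measurableT_comp measurable_nice (measurable_pair2 y)).
- by apply: sqZ; exact: sq_cube.
- by apply: aeW => x; rewrite -indic_cubeC; exact: le_trans (nice_le x y) (ler_norm _).
Qed.

Lemma SkerE2 (g w : mpoint -> R) : sq leb3s g -> sq leb3s w ->
  intg leb3s (fun y => w y * Int leb3s (fun x => g x * k ((x : point) - (y : point)))) /\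
  Sker g w = Int leb3s (fun y => w y * Int leb3s (fun x => g x * k ((x : point) - (y : point)))).
Proof.
move=> hg hw; have h := Sker_intg hg hw; have [h1 h2] := fubini21 h.
have e (y : mpoint) : Int leb3s (fun x => g x * w y * k ((x : point) - (y : point))) =
    w y * Int leb3s (fun x => g x * k ((x : point) - (y : point))).
  by rewrite -IntZ; [apply: Int_ext => x; ring|exact: sqM hg (sec2_sq y)].
by split; [apply: intg_ext h1 => y; rewrite -e|rewrite /Sker -h2; apply: Int_ext => y; rewrite -e].
Qed.

Lemma SkerE1 (g w : mpoint -> R) : sq leb3s g -> sq leb3s w ->
  intg leb3s (fun x => g x * Int leb3s (fun y => w y * k ((x : point) - (y : point)))) /\
  Sker g w = Int leb3s (fun x => g x * Int leb3s (fun y => w y * k ((x : point) - (y : point)))).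
Proof.
move=> hg hw; have h := Sker_intg hg hw; have [h1 h2] := fubini12 h.
have e (x : mpoint) : Int leb3s (fun y => g x * w y * k ((x : point) - (y : point))) =
    g x * Int leb3s (fun y => w y * k ((x : point) - (y : point))).
  by rewrite -IntZ; [apply: Int_ext => y; ring|exact: sqM hw (sec1_sq x)].
by split; [apply: intg_ext h1 => y; rewrite -e|rewrite /Sker -h2; apply: Int_ext => y; rewrite -e].
Qed.

Lemma SkerDr (g w w' : mpoint -> R) : sq leb3s g -> sq leb3s w -> sq leb3s w' ->
  Sker g (fun x => w x + w' x) = Sker g w + Sker g w'.
Proof.
move=> hg hw hw'; rewrite /Sker -IntD; try exact: Sker_intg.
by apply: Int_ext => z; ring.
Qed.

Lemma SkerZr (c : R) (g w : mpoint -> R) : sq leb3s g -> sq leb3s w ->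
  Sker g (fun x => c * w x) = c * Sker g w.
Proof.
move=> hg hw; rewrite /Sker -IntZ; last exact: Sker_intg.
by apply: Int_ext => z; ring.
Qed.

End Nice.

Lemma is_Ck_shift (V : normedModType R) k (f : V -> R) (y : V) :
  is_Ck k f -> is_Ck k (fun x => f (x - y)) /\
  (forall v x, 'D_v (fun x => f (x - y)) x = 'D_v f (x - y)).
Proof.
have q (g : V -> R) v x : (fun h : R => h^-1 *: (((fun x => g (x - y)) \o shift x) (h *: v) - g (x - y)))
    = (fun h : R => h^-1 *: ((g \o shift (x - y)) (h *: v) - g (x - y))).
  by apply/funext => h; rewrite /= addrA.
have qd (g : V -> R) v x : 'D_v (fun x => g (x - y)) x = 'D_v g (x - y) by rewrite /derive q.
move=> hf; split; last exact: qd.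
elim: k f hf => [|k IH] f /= [cf hf].
  by split => // x; apply: (@continuous_comp _ _ _ (fun x => x - y) f); [apply: cvgB; [exact: cvg_id|exact: cvg_cst]|exact: cf].
split=> [x|v].
  by apply: (@continuous_comp _ _ _ (fun x => x - y) f); [apply: cvgB; [exact: cvg_id|exact: cvg_cst]|exact: cf].
have [df hf'] := hf v; split => [x|].
  by rewrite /derivable q; exact: df.
by have := IH _ hf'; congr is_Ck; apply/funext => x; rewrite qd.
Qed.

Definition co (i : 'I_3) (x : point) : R := vec x ord0 i.

Lemma co0 x : co 0 x = x.1.1. Proof. by rewrite /co /vec mxE. Qed.
Lemma co1 x : co 1 x = x.1.2. Proof. by rewrite /co /vec mxE. Qed.
Lemma co2 x : co 2 x = x.2. Proof. by rewrite /co /vec mxE. Qed.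

Lemma sum3 (F : 'I_3 -> R) : \sum_(i < 3) F i = F 0 + F 1 + F 2.
Proof.
rewrite !big_ord_recl big_ord0 addr0 addrA.
by congr (_ + _ + _); congr F; apply: val_inj.
Qed.

Lemma I3P (P : 'I_3 -> Prop) : P 0 -> P 1 -> P 2 -> forall i, P i.
Proof.
by move=> p0 p1 p2 [[|[|[|//]]] hi]; [move: p0|move: p1|move: p2]; congr P; apply: val_inj.
Qed.

Lemma I3add : (0 + 1 = 1 :> 'I_3) * (0 + 2 = 2 :> 'I_3) * (1 + 1 = 2 :> 'I_3) *
  (1 + 2 = 0 :> 'I_3) * (2 + 1 = 0 :> 'I_3) * (2 + 2 = 1 :> 'I_3).
Proof. by do !split; apply: val_inj. Qed.

Lemma continuous_co i : continuous (co i).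
Proof.
move: i; apply: I3P => x.
- have -> : co 0 = (fun x => x.1.1) by apply/funext => z; rewrite co0.
  by apply: (@continuous_comp _ _ _ fst fst); exact: cvg_fst.
- have -> : co 1 = (fun x => x.1.2) by apply/funext => z; rewrite co1.
  by apply: (@continuous_comp _ _ _ fst snd); [exact: cvg_fst|exact: cvg_snd].
- have -> : co 2 = (fun x => x.2) by apply/funext => z; rewrite co2.
  exact: cvg_snd.
Qed.

Lemma coD i x y : co i (x + y) = co i x + co i y.
Proof. by move: i; apply: I3P; rewrite ?co0 ?co1 ?co2. Qed.
Lemma coB i x y : co i (x - y) = co i x - co i y.
Proof. by move: i; apply: I3P; rewrite ?co0 ?co1 ?co2. Qed.
Lemma coZ i h x : co i (h *: x) = h * co i x.
Proof. by move: i; apply: I3P; rewrite ?co0 ?co1 ?co2. Qed.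
Lemma co_unit i j : co i (unit_vec j) = (i == j)%:R.
Proof.
by move: i; apply: I3P; move: j; apply: I3P; rewrite ?co0 ?co1 ?co2.
Qed.

(** Even and supported in [|s| <= N^-1]. Evenness makes the gradient of the bump odd, which is what
    symmetrises the smoothed curl; the total mass is divided out only in [avg]. *)
Definition bump1 (N s : R) : R := flat 0 (1 + N * s) * flat 0 (1 + - N * s).
Definition bump3 (N : R) (z : point) : R := bump1 N (co 0 z) * bump1 N (co 1 z) * bump1 N (co 2 z).

Lemma bump1_even N s : bump1 N (- s) = bump1 N s.
Proof. by rewrite /bump1 mulrC; congr (flat 0 _ * flat 0 _); ring. Qed.

Lemma bump3_even N z : bump3 N (- z) = bump3 N z.
Proof.
have e i : co i (- z) = - co i z by rewrite -sub0r coB; move: i; apply: I3P; rewrite ?co0 ?co1 ?co2 sub0r.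
by rewrite /bump3 !e !bump1_even.
Qed.

Lemma bump3_Ck N k : is_Ck k (bump3 N).
Proof.
have h (c : R) i : is_Ck k (fun z : point => flat 0 (1 + c * co i z)).
  apply: (@is_Ck_affine _ _ (fun z => 1 + c * co i z) (fun v => c * co i v)).
  - move=> x; apply: cvgD; first exact: cvg_cst.
    by apply: cvgM; [exact: cvg_cst|exact: continuous_co].
  - by move=> t x v; rewrite coD coZ; ring.
  - exact: flat_Ck.
by apply: is_CkM; [apply: is_CkM|]; apply: is_CkM.
Qed.

Lemma flat0_le1 (t : R) : flat 0 t <= 1.
Proof.
rewrite /flat; case: ifPn => // t0; rewrite expr0 mul1r.
by rewrite expR_le1 oppr_le0 invr_ge0 ltW.
Qed.

Lemma bump1_ge0 N s : 0 <= bump1 N s.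
Proof. by rewrite mulr_ge0 ?flat_ge0. Qed.
Lemma bump1_le1 N s : bump1 N s <= 1.
Proof. by rewrite mulr_ile1 ?flat_ge0 ?flat0_le1. Qed.

Lemma bump1_supp N s : 0 < N -> N^-1 <= `|s| -> bump1 N s = 0.
Proof.
move=> N0; rewrite -(ler_pM2l N0) mulfV ?gt_eqF// -[X in X * `|s|](gtr0_norm N0) -normrM.
rewrite ler_normr /bump1 /flat => /orP[h|h].
  by rewrite [in X in _ * X]ifF ?mulr0// mulNr; apply/negbTE; rewrite -leNgt; lra.
by rewrite ifF ?mul0r//; apply/negbTE; rewrite -leNgt; lra.
Qed.

Lemma flat0_ge (t : R) : 1 / 2 <= t -> expR (- 2) <= flat 0 t.
Proof.
move=> ht; have t0 : 0 < t by lra.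
rewrite /flat t0 expr0 mul1r ler_expR lerN2.
by rewrite -[X in _ <= X]invrK lef_pV2 ?posrE//; lra.
Qed.

Lemma bump1_lower N s : 0 < N -> `|s| <= (2 * N)^-1 -> expR (- 2) ^+ 2 <= bump1 N s.
Proof.
move=> N0 hs; have : `|N * s| <= 1 / 2.
  rewrite normrM gtr0_norm//; apply: le_trans (ler_wpM2l (ltW N0) hs) _.
  by rewrite le_eqVlt; apply/orP; left; apply/eqP; field; rewrite gt_eqF.
rewrite ler_norml expr2 => /andP[? ?].
by apply: ler_pM; rewrite ?expR_ge0//; apply: flat0_ge; lra.
Qed.

Lemma nice_bump3 N : 0 < N -> nice_ker N^-1 1 (bump3 N).
Proof.
move=> N0; split.
- exact: is_Ck_cont (bump3_Ck N 0).
- by rewrite invr_ge0 ltW.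
- move=> z; rewrite /bump3 ger0_norm; last by apply: mulr_ge0; [apply: mulr_ge0|]; exact: bump1_ge0.
  have b i := bump1_ge0 N (co i z); have b' i := bump1_le1 N (co i z).
  have m (a c : R) : 0 <= a -> 0 <= c -> a <= 1 -> c <= 1 -> a * c <= 1.
    by move=> *; exact: mulr_ile1.
  apply: (m (bump1 N _ * bump1 N _) (bump1 N _)) => //; first exact: mulr_ge0.
  exact: (m (bump1 N _) (bump1 N _)).
- move=> z hz.
  have [h|h1] := leP N^-1 `|co 0 z|; first by rewrite /bump3 (bump1_supp N0 h) !mul0r.
  have [h|h2] := leP N^-1 `|co 1 z|; first by rewrite /bump3 (bump1_supp N0 h) mulr0 mul0r.
  have [h|h3] := leP N^-1 `|co 2 z|; first by rewrite /bump3 (bump1_supp N0 h) mulr0.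
  exfalso; apply: hz; rewrite /cube /= !sub0r !normrN.
  by move: h1 h2 h3; rewrite co0 co1 co2.
Qed.

Definition dbump N j (z : point) : R := 'D_(unit_vec j) (bump3 N) z.

Lemma line_derive (V : normedModType R) (f : V -> R) (x v : V) : derivable f x v ->
  is_derive (0 : R) (1 : R) (fun t => f (t *: v + x)) ('D_v f x).
Proof.
move=> df; apply: DeriveDef; first exact: (derivable1P _ _ _).1.
rewrite /derive.
suff -> : (fun h : R => h^-1 *: (((fun t : R => f (t *: v + x)) \o shift (0 : R)) (h *: (1 : R)) -
    f (0 *: v + x))) = (fun h : R => h^-1 *: ((f \o shift x) (h *: v) - f x)) by [].
by apply/funext => h; rewrite /= addr0 scale0r add0r [_%:A]mulr1.
Qed.

Lemma dbump3_odd N j z : dbump N j (- z) = - dbump N j z.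
Proof.
have [_ /(_ (unit_vec j)) [db _]] := bump3_Ck N 1.
have h1 := line_derive (db (- z)).
have hz := line_derive (db z).
have hz' : is_derive (- (0 : R)) (1 : R) (fun t => bump3 N (t *: unit_vec j + z)) (dbump N j z).
  by rewrite oppr0.
have h2 := is_derive1_comp hz' (is_deriveNid (0 : R) 1).
have e : (fun t : R => bump3 N (t *: unit_vec j + z)) \o -%R =
    (fun t : R => bump3 N (t *: unit_vec j + - z)).
  by apply/funext => t; rewrite /= -[in RHS]bump3_even opprD opprK scaleNr.
rewrite e in h2; move: h1 h2 => [_ e1] [_ e2].
by rewrite -[LHS]e1 e2 mulrN1.
Qed.

Lemma dbump3_cont N j : continuous (dbump N j).
Proof. by have [_ /(_ (unit_vec j)) [_ []]] := bump3_Ck N 1. Qed.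

(** The radius is doubled so that at such a [z] both points of every difference quotient with
    [|h| < N^-1] lie outside the support of the bump. *)
Lemma dbump3_supp N j z : 0 < N -> ~ cube 0 (2 / N) z -> dbump N j z = 0.
Proof.
move=> N0 hz; rewrite /dbump /derive; apply: cvg_lim => //.
have Ni : 0 < N^-1 by rewrite invr_gt0.
have b0 x : ~ cube 0 N^-1 x -> bump3 N x = 0.
  by move=> hx; have [_ _ _ ->] := nice_bump3 N0.
apply: cvg_near_cst; near=> h.
have hh : `|h| < N^-1 by near: h; apply: dnbhs0_lt.
rewrite /= !b0 ?subrr ?scaler0//.
  move=> [/= k1 k2 k3]; apply: hz; rewrite /cube /= !sub0r !normrN in k1 k2 k3 *.
  by split; apply: lt_le_trans k1 k2 k3 || (first [apply: lt_le_trans k1 _|apply: lt_le_trans k2 _|apply: lt_le_trans k3 _]); lra.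
rewrite /cube /= !sub0r !normrN => -[k1 k2 k3]; apply: hz; rewrite /cube /= !sub0r !normrN.
have hu (b : bool) : `|h * b%:R| <= `|h| by case: b; rewrite /= ?mulr1n ?mulr0n ?mulr1 ?mulr0 ?normr0.
have tri (b : bool) (a : R) : `|h * b%:R + a| < N^-1 -> `|a| < 2 / N.
  move=> h1; have -> : a = (h * b%:R + a) - h * b%:R by ring.
  by apply: le_lt_trans (ler_normB _ _) _; have := hu b; lra.
by split; [apply: tri k1|apply: tri k2|apply: tri k3].
Unshelve. all: by end_near. Qed.

Lemma compact_cube (y : point) (r : R) : compact [set x : point |
  [/\ `|y.1.1 - x.1.1| <= r, `|y.1.2 - x.1.2| <= r & `|y.2 - x.2| <= r]].
Proof.
have -> : [set x : point | [/\ `|y.1.1 - x.1.1| <= r, `|y.1.2 - x.1.2| <= r & `|y.2 - x.2| <= r]] =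
  `[y.1.1 - r, y.1.1 + r]%classic `*` `[y.1.2 - r, y.1.2 + r]%classic `*` `[y.2 - r, y.2 + r]%classic.
  have e (a b : R) : (`|a - b| <= r) = (b \in `[a - r, a + r]).
    by rewrite in_itv /= ler_norml; apply/andP/andP => -[? ?]; split; lra.
  apply/seteqP; split => x.
    by move=> [/=]; rewrite !e => h1 h2 h3; do !split.
  by move=> [[/= h1 h2] h3]; split; rewrite e.
by apply: compact_setX; [apply: compact_setX|]; exact: segment_compact.
Qed.

Lemma continuous_compact_bounded (K : set point) (f : point -> R) : compact K -> continuous f ->
  exists2 M, 0 <= M & forall x, K x -> `|f x| <= M.
Proof.
move=> cK cf.
have /compact_bounded [M [_ hM]] := continuous_compact (continuous_subspaceT cf) cK.
exists (`|M| + 1); first by rewrite addr_ge0.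
move=> x Kx; apply: (hM (`|M| + 1)); last by exists x.
by rewrite (le_lt_trans (ler_norm M))// ltrDl.
Qed.

Lemma nice_dbump N j : 0 < N -> exists M, nice_ker (2 / N) M (dbump N j).
Proof.
move=> N0; have [M M0 hM] := continuous_compact_bounded (@compact_cube 0 (2 / N)) (@dbump3_cont N j).
exists M; split.
- exact: dbump3_cont.
- by rewrite divr_ge0// ltW.
- move=> z; have [[? ? ?]|h] := pselect (cube 0 (2 / N) z); last by rewrite dbump3_supp ?normr0.
  by apply: hM; split; exact: ltW.
- by move=> z hz; exact: dbump3_supp.
Qed.

Lemma bump3_test N (y : point) : 0 < N -> test_function setT (fun x => bump3 N (x - y)).
Proof.
move=> N0; split=> [k|]; first exact: (is_Ck_shift y (bump3_Ck N k)).1.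
eexists; split; [exact: (@compact_cube y N^-1)|by []|].
move=> x hx; have [_ _ _ ->] := nice_bump3 N0 => //.
by move=> /cube0/cubeC [? ? ?]; apply: hx; split; exact: ltW.
Qed.

End Kernel.

Lemma Int_dct d (T : measurableType d) (R : realType) (m : {measure set T -> \bar R})
    (f_ : nat -> T -> R) (f g : T -> R) :
  (forall n, measurable_fun setT (f_ n)) -> measurable_fun setT f -> intg m g ->
  {ae m, forall x, f_ ^~ x @ \oo --> f x} ->
  {ae m, forall x n, `|f_ n x| <= g x} ->
  intg m f /\ (fun n => Int m (f_ n)) @ \oo --> Int m f.
Proof.
move=> mf_ mf ig cv dom.
have [] := @dominated_convergence _ _ _ m setT measurableT
  (fun n => EFin \o f_ n) (EFin \o f) (EFin \o g).
- by move=> n; exact/measurable_EFinP.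
- exact/measurable_EFinP.
- by apply: filterS cv => x cv _; exact: cvg_EFin (nearW _ _) cv.
- exact: ig.
- by apply: filterS dom => x h n _ /=; rewrite lee_fin.
move=> h _ cvI; split => //.
have hn n : intg m (f_ n).
  apply: intg_dom_ae ig _ => //; apply: filterS dom => x; exact.
by apply: (fine_cvg (f := fun n => _)); rewrite -(Int_fin h); exact: cvI.
Qed.

Lemma le_quarter3 (R : realFieldType) (a b c d e : R) :
  `|a - b| <= e / 4 -> `|c| <= e / 4 -> `|d| <= e / 2 -> `|a - c - (d + b)| <= e.
Proof. by rewrite !ler_norml => /andP[? ?] /andP[? ?] /andP[? ?]; apply/andP; split; lra. Qed.

Lemma le_half2 (R : realFieldType) (a b e : R) : a <= e -> b <= e -> 2^-1 * (a + b) <= e.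
Proof. by move=> ? ?; lra. Qed.

(** * Convergence of smoothed pairings of square-integrable functions *)

Section Density.
Context {R : realType}.
Local Notation point := (R * R * R)%type.
Local Notation mpoint := (measurableTypeR R * measurableTypeR R * measurableTypeR R)%type.
Local Notation m33 := (leb3s \x leb3s)%E.
Local Notation M3 := (@leb3s R).
Implicit Types (g w : mpoint -> R) (N : R).

Definition mass (N : R) : R := Int lebesgue_measure (bump1 N) ^+ 3.

Lemma continuous_bump1 N : continuous (bump1 N : R -> R).
Proof.
have cf : continuous (flat 0 : R -> R) := is_Ck_cont (flat_Ck 0 0).
have h (c : R) : continuous (fun s : R => flat 0 (1 + c * s)).
  move=> s; apply: (@continuous_comp _ _ _ (fun s => 1 + c * s) (flat 0)); last exact: cf.
  by apply: cvgD; [exact: cvg_cst|apply: cvgM; [exact: cvg_cst|exact: cvg_id]].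
by move=> s; apply: cvgM; exact: h.
Qed.

Lemma measurable_bump1 N : measurable_fun setT (bump1 N : R -> R).
Proof. by apply: continuous_measurable_fun; exact: continuous_bump1. Qed.

Lemma intg_bump1 N (a : R) : 0 < N -> intg lebesgue_measure (fun t : R => bump1 N (a - t)).
Proof.
move=> N0; apply: (intg_dom _ (intg_ball1 a N^-1)).
- apply: (@measurableT_comp _ _ _ _ _ _ (bump1 N : R -> R)); first exact: measurable_bump1.
  exact: measurable_funB.
- move=> t; rewrite ger0_norm ?bump1_ge0// indicE.
  have [h|h] := ltP `|a - t| N^-1; first by rewrite mem_set// bump1_le1.
  by rewrite (bump1_supp N0 h).
Qed.

Lemma Int_bump1_shift N (a : R) :
  Int lebesgue_measure (fun t : R => bump1 N (a - t)) = Int lebesgue_measure (bump1 N).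
Proof.
rewrite -(Int_shift (- a) (measurable_bump1 N)); last by move=> t; exact: bump1_ge0.
by apply: Int_ext => t; rewrite -[in RHS]bump1_even opprD opprK.
Qed.

Lemma bump3_mass N (x : mpoint) : 0 < N ->
  Int M3 (fun y : mpoint => bump3 N ((x : point) - (y : point))) = mass N.
Proof.
move=> N0.
have [_ h] := intg_prod3 (intg_bump1 x.1.1 N0) (intg_bump1 x.1.2 N0) (intg_bump1 x.2 N0).
rewrite (@Int_ext _ _ _ _ _ (fun y : mpoint => bump1 N (x.1.1 - y.1.1) *
  bump1 N (x.1.2 - y.1.2) * bump1 N (x.2 - y.2))).
  by rewrite h !Int_bump1_shift /mass; ring.
by move=> y; rewrite /bump3 co0 co1 co2.
Qed.

(** On [|s| <= (2 * N)^-1], an interval of length [N^-1], both factors of [bump1] are at least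
    [expR (- 2)]. *)
Lemma mass_lower N : 0 < N -> (expR (- 2) ^+ 2 / N) ^+ 3 <= mass N.
Proof.
move=> N0; rewrite /mass lerXn2r ?nnegrE ?divr_ge0 ?exprn_ge0 ?expR_ge0 ?(ltW N0)//.
  by apply: Int_ge0 => t; exact: bump1_ge0.
have r0 : 0 <= (2 * N)^-1 by rewrite invr_ge0 mulr_ge0// ltW.
have i1 := intgZ (expR (- 2) ^+ 2) (intg_ball1 0 (2 * N)^-1).
have i0 := intg_bump1 0 N0; rewrite -(Int_bump1_shift N 0).
apply: le_trans (Int_le i1 i0 _).
  rewrite IntZ ?Int_ball1//; last exact: intg_ball1.
  by rewrite le_eqVlt; apply/orP; left; apply/eqP; field; rewrite gt_eqF.
move=> t; rewrite indicE.
have [h|h] := boolP (t \in _); last by rewrite mulr0 bump1_ge0.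
rewrite mulr1; apply: bump1_lower => //.
by move: h; rewrite inE /= !sub0r !normrN => /ltW.
Qed.

Lemma mass_gt0 N : 0 < N -> 0 < mass N.
Proof.
move=> N0; apply: lt_le_trans (mass_lower N0).
by rewrite exprn_gt0// divr_gt0// exprn_gt0// expR_gt0.
Qed.

(** The quotient of the factor [4 / N ^+ 3] from [Sker_bound], with [M = 1] and [r = N^-1], by the
    lower bound of [mass_lower]: the powers of [N] cancel, so the averages are bounded uniformly in
    [N]. *)
Definition Kc : R := 4 / (expR (- 2) ^+ 2) ^+ 3.

Definition avg N g w : R := Sker (bump3 N) g w / mass N.

Lemma avg_bound N (th : R) g w : 0 < N -> 0 < th -> sq M3 g -> sq M3 w ->
  `|avg N g w| <= Kc * (th * Int M3 (fun x => g x ^+ 2) + th^-1 * Int M3 (fun x => w x ^+ 2)).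
Proof.
move=> N0 th0 hg hw; have c0 := mass_gt0 N0.
rewrite /avg normrM (gtr0_norm (x := (mass N)^-1)) ?invr_gt0// ler_pdivrMr//.
apply: le_trans (Sker_bound (nice_bump3 N0) th0 hg hw) _.
rewrite [leRHS]mulrAC; apply: ler_wpM2r.
  by rewrite addr_ge0// mulr_ge0 ?invr_ge0 ?(ltW th0)//; apply: Int_ge0 => x; exact: sqr_ge0.
apply: le_trans (ler_wpM2l _ (mass_lower N0)).
  rewrite le_eqVlt; apply/orP; left; apply/eqP; rewrite /Kc; field.
  by rewrite gt_eqF//= gt_eqF// expR_gt0.
by rewrite /Kc divr_ge0// !exprn_ge0// expR_ge0.
Qed.

Local Notation Nn := (fun n : nat => n.+1%:R : R).
Local Notation Nn0 := (fun n => ltr0Sn R n).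

(** Weak convergence of the smoothed [w] to [w]. The class is closed under linear combinations and
    dominated limits, so it is enlarged from indicators of boxes until it contains all
    square-integrable functions ([good_sq]). *)
Definition good w := sq M3 w /\ forall g, sq M3 g ->
  (fun n => avg (Nn n) g w) @ \oo --> Int M3 (fun x => g x * w x).

Lemma goodD w w' : good w -> good w' -> good (fun x => w x + w' x).
Proof.
move=> [hw cw] [hw' cw']; split=> [|g hg]; first exact: sqD.
rewrite (_ : (fun n => _) = (fun n => avg (Nn n) g w + avg (Nn n) g w')); last first.
  by apply/funext => n; rewrite /avg (SkerDr (nice_bump3 (Nn0 n)))// mulrDl.
rewrite (_ : Int _ _ = Int M3 (fun x => g x * w x) + Int M3 (fun x => g x * w' x)).
  by apply: cvgD; [exact: cw|exact: cw'].
by rewrite -IntD; [apply: Int_ext => x; rewrite mulrDr|exact: sqM|exact: sqM].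
Qed.

Lemma goodZ (c : R) w : good w -> good (fun x => c * w x).
Proof.
move=> [hw cw]; split=> [|g hg]; first exact: sqZ.
rewrite (_ : (fun n => _) = (fun n => c * avg (Nn n) g w)); last first.
  by apply/funext => n; rewrite /avg (SkerZr (nice_bump3 (Nn0 n)))// mulrA.
rewrite (_ : Int _ _ = c * Int M3 (fun x => g x * w x)).
  by apply: cvgM; [exact: cvg_cst|exact: cw].
by rewrite -IntZ; [apply: Int_ext => x; ring|exact: sqM].
Qed.

Lemma good0 : good (fun=> 0).
Proof.
split=> [|g hg]; first exact: sq0.
rewrite (_ : (fun n => _) = (fun=> 0)); last first.
  apply/funext => n; rewrite /avg /Sker (@Int_ext _ _ _ _ _ (fun=> 0)) ?Int0 ?mul0r//.
  by move=> z; rewrite mulr0 mul0r.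
rewrite (@Int_ext _ _ _ _ _ (fun=> 0)) ?Int0; first exact: cvg_cst.
by move=> z; rewrite mulr0.
Qed.

Lemma good_sum (I : Type) (s : seq I) (h : I -> mpoint -> R) :
  (forall i, good (h i)) -> good (fun x => \sum_(i <- s) h i x).
Proof.
move=> hh; elim: s => [|i s IH].
  by have := good0; congr good; apply/funext => x; rewrite big_nil.
by have := goodD (hh i) IH; congr good; apply/funext => x; rewrite big_cons.
Qed.

Lemma good_approx w : sq M3 w ->
  (forall e : R, 0 < e -> exists2 w', good w' & Int M3 (fun x => (w x - w' x) ^+ 2) <= e) ->
  good w.
Proof.
move=> hw ha; split=> // g hg.
apply/cvgrPdist_le => /= e e0.
set G := Int M3 (fun x => g x ^+ 2).
have G0 : 0 <= G by apply: Int_ge0 => x; exact: sqr_ge0.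
have K0 : 0 < Kc by rewrite /Kc divr_gt0// !exprn_gt0// expR_gt0.
have K1 : 0 < Kc + 1 by rewrite addr_gt0.
have G1 : 0 < G + 1 by rewrite ltr_wpDl.
have Kn : Kc + 1 != 0 by rewrite gt_eqF.
have Gn : G + 1 != 0 by rewrite gt_eqF.
have en : e != 0 by rewrite gt_eqF.
have e40 : 0 <= e / 4 by rewrite divr_ge0// ltW.
have k1' : 0 <= Kc / (Kc + 1) by rewrite divr_ge0// ltW.
have k2' : 0 <= G / (G + 1) by rewrite divr_ge0// ltW.
have k1 : Kc / (Kc + 1) <= 1 by rewrite ler_pdivrMr// mul1r lerDl.
have k2 : G / (G + 1) <= 1 by rewrite ler_pdivrMr// mul1r lerDl.
have k4 : 0 <= (Kc + 1)^-1 by rewrite invr_ge0 ltW.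
have k5 : (Kc + 1)^-1 <= 1 by rewrite invf_le1// lerDr ltW.
(* [th] makes [Kc * th * G] at most [e / 4]; then [d] below makes [Kc * d / th] at most [e / 4]. The
   increments by 1 avoid divisions by zero. *)
pose th := e / (4 * (Kc + 1) * (G + 1)).
have th0 : 0 < th by rewrite divr_gt0// mulr_gt0// mulr_gt0.
have thn : th != 0 by rewrite gt_eqF.
pose d := e * th / (4 * (Kc + 1)).
have d0 : 0 < d by rewrite divr_gt0// mulr_gt0.
have [w' gw' hd] := ha _ d0; have [hw' cw'] := gw'.
have hB : sq M3 (fun x => w x - w' x).
  by have := sqD hw (sqZ (-1) hw'); apply: sq_ext => x; rewrite mulN1r.
have t1 : th * G = (Kc + 1)^-1 * (G / (G + 1)) * (e / 4).
  by rewrite /th; field; rewrite Kn Gn.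
have t2 : th^-1 * d = (Kc + 1)^-1 * (e / 4).
  by rewrite /d; field; rewrite thn Kn.
have e1 : Kc * (th * G) + Kc * (th^-1 * d) <= e / 2.
  have -> : Kc * (th^-1 * d) = Kc / (Kc + 1) * (e / 4) by rewrite t2; ring.
  have -> : Kc * (th * G) = Kc / (Kc + 1) * (G / (G + 1)) * (e / 4) by rewrite t1; ring.
  have -> : e / 2 = e / 4 + e / 4 by field.
  by apply: lerD; rewrite ler_piMl// mulr_ile1.
have young (a b : R) : `|a * b| <= (th * a ^+ 2 + th^-1 * b ^+ 2) / 2.
  rewrite normrM -(real_normK (num_real a)) -(real_normK (num_real b)) -subr_ge0.
  have -> : (th * `|a| ^+ 2 + th^-1 * `|b| ^+ 2) / 2 - `|a| * `|b| =
     (th * (`|a| - th^-1 * `|b|) ^+ 2) / 2 by field; rewrite gt_eqF.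
  by rewrite divr_ge0// mulr_ge0 ?sqr_ge0// ltW.
have e2 : `|Int M3 (fun x => g x * (w' x - w x))| <= e / 4.
  have i0 : sq M3 (fun x => w' x - w x).
    by have := sqD hw' (sqZ (-1) hw); apply: sq_ext => x; rewrite mulN1r.
  have i1 := sqM hg i0.
  have i2 : intg M3 (fun x => (th * g x ^+ 2 + th^-1 * (w x - w' x) ^+ 2) / 2).
    apply: (intg_ext (f := fun x => 2^-1 * (th * g x ^+ 2 + th^-1 * (w x - w' x) ^+ 2))).
      by move=> x; rewrite mulrC.
    by apply: intgZ; apply: intgD; apply: intgZ; [have /sqP[] := hg|have /sqP[] := hB].
  apply: le_trans (ler_Int_norm i1) _.
  apply: le_trans (Int_le (intg_norm i1) i2 _) _.
    by move=> x; have := young (g x) (w' x - w x); rewrite -(sqrrN (w' x - w x)) opprB.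
  rewrite (@Int_ext _ _ _ _ _ (fun x => 2^-1 * (th * g x ^+ 2 + th^-1 * (w x - w' x) ^+ 2))); last first.
    by move=> x; rewrite mulrC.
  have gi : intg M3 (fun x => g x ^+ 2) by have /sqP[] := hg.
  have wi : intg M3 (fun x => (w x - w' x) ^+ 2) by have /sqP[] := hB.
  rewrite IntZ; last by apply: intgD; exact: intgZ.
  rewrite IntD ?IntZ//; try exact: intgZ.
  have h1 : th * G <= e / 4.
    by rewrite t1 ler_piMl// mulr_ile1.
  have h2 : th^-1 * Int M3 (fun x => (w x - w' x) ^+ 2) <= e / 4.
    apply: le_trans (ler_wpM2l _ hd) _; first by rewrite invr_ge0 ltW.
    by rewrite t2 ler_piMl.
  exact: le_half2 h1 h2.
have cw := cw' g hg.
near=> n.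
have e3 : `|Int M3 (fun x => g x * w' x) - avg (Nn n) g w'| <= e / 4.
  near: n; move/cvgrPdist_le : cw; apply; exact: divr_gt0.
have e4 : `|avg (Nn n) g (fun x => w x - w' x)| <= e / 2.
  apply: le_trans (avg_bound (Nn0 n) th0 hg hB) _; apply: (le_trans _ e1).
  rewrite -/G -mulrDr; apply: ler_wpM2l; first exact: ltW.
  by rewrite lerD2l; apply: (ler_wpM2l _ hd); rewrite invr_ge0 ltW.
have e5 : avg (Nn n) g w = avg (Nn n) g (fun x => w x - w' x) + avg (Nn n) g w'.
  rewrite /avg -mulrDl -(SkerDr (nice_bump3 (Nn0 n)))//.
  by congr (_ / _); apply: Int_ext => z; rewrite subrK.
have e6 : Int M3 (fun x => g x * w x) = Int M3 (fun x => g x * w' x) - Int M3 (fun x => g x * (w' x - w x)).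
  rewrite -IntB; [by apply: Int_ext => x; ring|exact: sqM|apply: sqM => //].
  by have := sqD hw' (sqZ (-1) hw); apply: sq_ext => x; rewrite mulN1r.
rewrite e5 e6; by apply: le_quarter3; [exact: e3|exact: e2|exact: e4].
Unshelve. all: by end_near. Qed.

Lemma good_dct w (w_ : nat -> mpoint -> R) (G : mpoint -> R) : (forall n, good (w_ n)) ->
  measurable_fun setT w -> sq M3 G -> (forall n x, `|w_ n x| <= G x) ->
  (forall x, w_ ^~ x @ \oo --> w x) -> good w.
Proof.
move=> gw mw hG dom cv.
have hd n : sq M3 (w_ n) by case: (gw n).
have domw x : `|w x| <= G x.
  have c1 : (fun n => `|w_ n x|) @ \oo --> `|w x| by apply: cvg_norm; exact: cv.
  apply: (closed_cvg (fun r => r <= G x)) c1; first exact: closed_le.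
  by apply: nearW => n; exact: dom.
have hw : sq M3 w.
  by apply: sq_dom_ae hG _ => //; apply: aeW => x; exact: le_trans (domw x) (ler_norm _).
apply: good_approx => // e e0.
have [_ hG2] := (sqP _ _).1 hG.
(* The squared errors tend to 0 pointwise under the majorant [4 * G x ^+ 2], so dominated pointwise
   convergence becomes convergence in mean square. *)
have [] := @Int_dct _ _ _ M3 (fun n x => (w x - w_ n x) ^+ 2) (fun=> 0) (fun x => 4 * G x ^+ 2).
- by move=> n; apply: measurable_funX; apply: measurable_funB => //; exact: sq_meas (hd n).
- exact: measurable_cst.
- exact: intgZ.
- apply: aeW => x.
  have h : (fun n => (w x - w_ n x)) @ \oo --> w x - w x.
    by apply: cvgB; [exact: cvg_cst|exact: cv].
  have -> : (fun n => (w x - w_ n x) ^+ 2) = (fun n => (w x - w_ n x) * (w x - w_ n x)).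
    by apply/funext => n; rewrite expr2.
  by have := cvgM h h; rewrite subrr mulr0; exact.
- apply: aeW => x n; rewrite normrX.
  have -> : 4 * G x ^+ 2 = (2 * G x) ^+ 2 by ring.
  have G0 : 0 <= G x := le_trans (normr_ge0 _) (domw x).
  rewrite lerXn2r ?nnegrE ?mulr_ge0//.
  apply: le_trans (ler_normB _ _) _; have := domw x; have := dom n x; lra.
move=> _; rewrite Int0 => /cvgrPdist_le /(_ e e0)[n _ /(_ n (leqnn n))] /=.
rewrite sub0r normrN => h; exists (w_ n); first exact: gw.
exact: le_trans (ler_norm _) h.
Qed.

End Density.

Section Density2.
Context {R : realType}.
Local Notation point := (R * R * R)%type.
Local Notation mpoint := (measurableTypeR R * measurableTypeR R * measurableTypeR R)%type.
Local Notation m33 := (leb3s \x leb3s)%E.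
Local Notation M3 := (@leb3s R).
Implicit Types (g w : mpoint -> R) (N : R).
Local Notation Nn := (fun n : nat => n.+1%:R : R).
Local Notation Nn0 := (fun n => ltr0Sn R n).

Definition I3set (A1 A2 A3 : set R) : mpoint -> R :=
  fun x => \1_A1 x.1.1 * \1_A2 x.1.2 * \1_A3 x.2.

Lemma indic01 (T : Type) (A : set T) (x : T) : 0 <= (\1_A x : R) <= 1.
Proof. by rewrite indicE; case: (_ \in _); rewrite ?lexx ?ler01. Qed.

Lemma I3set01 A1 A2 A3 x : 0 <= I3set A1 A2 A3 x <= 1.
Proof.
have /andP[? ?] := indic01 A1 x.1.1; have /andP[? ?] := indic01 A2 x.1.2.
have /andP[? ?] := indic01 A3 x.2.
by rewrite /I3set !mulr_ge0//= mulr_ile1 ?mulr_ge0// mulr_ile1.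
Qed.

Lemma measurable_I3set A1 A2 A3 : measurable A1 -> measurable A2 -> measurable A3 ->
  measurable_fun setT (I3set A1 A2 A3).
Proof.
move=> m1 m2 m3; apply: measurable_funM; [apply: measurable_funM|].
- by apply: (measurableT_comp _ measurable_c1); exact: measurable_indic.
- by apply: (measurableT_comp _ measurable_c2); exact: measurable_indic.
- by apply: (measurableT_comp _ measurable_c3); exact: measurable_indic.
Qed.

Lemma ae_coord (a : R) (i : 'I_3) : {ae M3, forall x : mpoint, co i x != a}.
Proof.
have ma : measurable ([set a] : set (measurableTypeR R)) by exact: measurable_set1.
have l0 : lebesgue_measure [set a] = 0%E :> \bar R by exact: lebesgue_measure_set1.
have key (A : set mpoint) : measurable A -> M3 A = 0%E -> (forall x, A x <-> co i x = a) ->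
    {ae M3, forall x : mpoint, co i x != a}.
  move=> mA A0 hA; exists A; split => // x /= h; apply/hA.
  by apply/eqP/negPn/negP => h'; exact: h.
have p2 (A B : set R) : measurable A -> measurable B ->
    leb2s (A `*` B) = (lebesgue_measure A * lebesgue_measure B)%E.
  by move=> mA mB; exact: product_measure1E.
have p3 (A : set (R * R)) (B : set R) : measurable (A : set (measurableTypeR R * measurableTypeR R)%type) ->
    measurable B -> M3 (A `*` B) = (leb2s A * lebesgue_measure B)%E.
  by move=> mA mB; exact: product_measure1E.
move: i key; apply: I3P => key.
- apply: (key (([set a] `*` setT) `*` setT)).
  + by apply: measurableX => //; exact: measurableX.
  + by rewrite p3 ?p2 ?l0 ?mul0e ?mule0 ?mul0e//; exact: measurableX.
  + by move=> x; rewrite co0; split=> [[[h _] _]|h]; [exact: h|by split; [split|]].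
- apply: (key ((setT `*` [set a]) `*` setT)).
  + by apply: measurableX => //; exact: measurableX.
  + by rewrite p3 ?p2 ?l0 ?mul0e ?mule0 ?mul0e//; exact: measurableX.
  + by move=> x; rewrite co1; split=> [[[_ h] _]|h]; [exact: h|by split; [split|]].
- apply: (key (setT `*` [set a])).
  + exact: measurableX.
  + by rewrite p3 ?l0 ?mule0.
  + by move=> x; rewrite co2; split=> [[_ h]|h]; [exact: h|by split].
Qed.

Lemma itvoc_lim (a b s : R) : s != a -> s != b ->
  \forall n \near \oo, forall t, `|s - t| < (Nn n)^-1 -> \1_(`]a, b]%classic) t = \1_(`]a, b]%classic) s :> R.
Proof.
move=> sa sb; pose d := Num.min `|s - a| `|s - b|.
have d0 : 0 < d by rewrite lt_min !normr_gt0 !subr_eq0 sa sb.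
near=> n => t ht.
have hd : (Nn n)^-1 < d by near: n; exact: near_infty_natSinv_lt (PosNum d0).
have h := lt_trans ht hd; rewrite lt_min in h; case/andP: h => h1 h2.
rewrite !indicE; congr (_%:R); congr nat_of_bool.
apply/idP/idP; rewrite !inE /= !in_itv /= => /andP[k1 k2].
  apply/andP; split.
    rewrite ltNge; apply/negP => k; move: h1; rewrite !ler0_norm; lra.
  rewrite leNgt; apply/negP => k; move: h2; rewrite !ger0_norm; lra.
apply/andP; split.
  rewrite ltNge; apply/negP => k; move: h1; rewrite !ger0_norm; lra.
rewrite leNgt; apply/negP => k; move: h2; rewrite !ler0_norm; lra.
Unshelve. all: by end_near. Qed.

Lemma itv_pad (a b t x s r : R) : a < t -> t <= b -> s <= 1 -> `|x - t| < s ->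
  2 + (`|a| + `|b|) <= r -> `|x| < r.
Proof.
have na (y : R) : - `|y| <= y <= `|y| by rewrite -ler_norml.
have /andP[a1 a2] := na a; have /andP[b1 b2] := na b.
by rewrite !ltr_norml => h1 h2 h3 /andP[h4 h5] h6; apply/andP; split; lra.
Qed.

(** Off the six planes bounding the box, a null set, the smoothed indicator equals the indicator as
    soon as the kernel is narrow enough. All smoothed indicators are below the indicator of one
    large cube, so dominated convergence applies. *)
Lemma good_box (a1 b1 a2 b2 a3 b3 : R) :
  good (I3set `]a1, b1]%classic `]a2, b2]%classic `]a3, b3]%classic).
Proof.
set w := I3set _ _ _.
have mw : measurable_fun setT w by apply: measurable_I3set; exact: measurable_itv.
pose r := 2 + (`|a1| + `|b1| + (`|a2| + `|b2|) + (`|a3| + `|b3|)).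
have wr y s : w y != 0 -> 0 <= s -> s <= 1 -> forall x : mpoint, cube x s y -> cube 0 r x.
  rewrite /w /I3set !mulf_eq0 !negb_or => /andP[/andP[w1 w2] w3] s0 s1 x.
  have hi (A : set R) t : \1_A t != 0 :> R -> A t.
    by rewrite indicE; case: (boolP (t \in A)); rewrite ?eqxx// inE.
  move: w1 w2 w3 => /hi /= + /hi /= + /hi /=; rewrite !in_itv /= => /andP[l1 u1] /andP[l2 u2] /andP[l3 u3].
  rewrite /cube /= => -[h1 h2 h3].
  have nn6 : [/\ 0 <= `|a1| + `|b1|, 0 <= `|a2| + `|b2| & 0 <= `|a3| + `|b3|] by split; exact: addr_ge0.
  case: nn6 => n1 n2 n3; split; rewrite sub0r normrN.
  - by apply: (itv_pad l1 u1 s1 h1); rewrite /r lerD2l -addrA lerDl addr_ge0.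
  - by apply: (itv_pad l2 u2 s1 h2); rewrite /r lerD2l addrAC lerDr addr_ge0.
  - by apply: (itv_pad l3 u3 s1 h3); rewrite /r lerD2l lerDr addr_ge0.
have sw : sq M3 w.
  apply: (sq_dom_ae mw (sq_cube 0 r)); apply: aeW => x.
  have /andP[w0 w1] := I3set01 `]a1, b1]%classic `]a2, b2]%classic `]a3, b3]%classic x.
  have [w0'|/(wr _ 1) h] := eqVneq (w x) 0; first by rewrite w0' normr0.
  have := h ler01 (lexx _) x; rewrite /cube /= !subrr normr0 ltr01 => /(_ (And3 isT isT isT)) cx.
  by rewrite ger0_norm// indicE mem_set// normr1.
split => // g hg.
pose psi n (x : mpoint) := Int M3 (fun y => w y * bump3 (Nn n) ((x : point) - (y : point))) / mass (Nn n).
have -> : (fun n => avg (Nn n) g w) = (fun n => Int M3 (fun x => g x * psi n x)).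
  apply/funext => n; rewrite /avg.
  have [h1 h2] := SkerE1 (nice_bump3 (Nn0 n)) hg sw.
  by rewrite h2 mulrC -IntZ//; apply: Int_ext => x; rewrite /psi; ring.
have psi01 n x : 0 <= psi n x <= \1_(cube 0 r) x.
  have c0 := mass_gt0 (Nn0 n).
  have b0 z : 0 <= bump3 (Nn n) z.
    by apply: mulr_ge0; [apply: mulr_ge0|]; exact: bump1_ge0.
  have ib := sec1_sq (nice_bump3 (Nn0 n)) x.
  have i1 := sqM sw ib.
  have i2 : intg M3 (fun y : mpoint => bump3 (Nn n) ((x : point) - (y : point))).
    exact: sec1_intg (nice_bump3 (Nn0 n)) x.
  apply/andP; split.
    apply: divr_ge0; last exact: ltW.
    apply: Int_ge0 => y; apply: mulr_ge0; last exact: b0.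
    by have /andP[] := I3set01 `]a1, b1]%classic `]a2, b2]%classic `]a3, b3]%classic y.
  rewrite ler_pdivrMr// indicE; case: (boolP (x \in _)) => hx.
    rewrite mul1r -(bump3_mass x (Nn0 n)); apply: Int_le => // y.
    rewrite ler_piMl//.
    by have /andP[] := I3set01 `]a1, b1]%classic `]a2, b2]%classic `]a3, b3]%classic y.
  rewrite mul0r (@Int_ext _ _ _ _ _ (fun=> 0)) ?Int0// => y.
  have [->|wy] := eqVneq (w y) 0; first by rewrite mul0r.
  have [_ _ _ ->] := nice_bump3 (Nn0 n); first by rewrite mulr0.
  move=> /cube0 hc; move/negP: hx; apply; rewrite inE.
  apply: wr wy _ _ _ hc; first by rewrite invr_ge0.
  by rewrite invf_le1// ler1n.
have mpsi n : measurable_fun setT (psi n).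
  apply: measurable_funM => //.
  have [h1 _] := SkerE1 (nice_bump3 (Nn0 n)) (sq_cube 0 r) sw.
  apply: eq_measurable_fun (intg_meas h1) => x _ /=.
  have /andP[p0 p1] := psi01 n x; rewrite indicE; case: (boolP (x \in _)) => hx.
    by rewrite mul1r.
  move: p1; rewrite indicE (negbTE hx) => p1.
  have /eqP : psi n x = 0 by apply/le_anti/andP.
  by rewrite mulf_eq0 invr_eq0 (gt_eqF (mass_gt0 (Nn0 n))) orbF mul0r => /eqP->.
have [//|||||_] := @Int_dct _ _ _ M3 (fun n x => g x * psi n x) (fun x => g x * w x) (fun x => `|g x * \1_(cube 0 r) x|).
- by move=> n; apply: measurable_funM => //; exact: sq_meas hg.
- by apply: measurable_funM => //; exact: sq_meas hg.
- by apply: intg_norm; exact: sqM (sq_cube 0 r).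
- apply: aeS (aeI (aeI (aeI (ae_coord a1 0) (ae_coord b1 0)) (aeI (ae_coord a2 1) (ae_coord b2 1)))
    (aeI (ae_coord a3 2) (ae_coord b3 2))) => x; rewrite co0 co1 co2 => -[[[k1 k1'] [k2 k2']] [k3 k3']].
  apply: cvg_near_cst; near=> n; congr (_ * _); rewrite /psi.
  have c0 := mass_gt0 (Nn0 n).
  rewrite (@Int_ext _ _ _ _ _ (fun y : mpoint => w x * bump3 (Nn n) ((x : point) - (y : point)))).
    rewrite IntZ; last exact: sec1_intg (nice_bump3 (Nn0 n)) x.
    by rewrite bump3_mass// mulfK// gt_eqF.
  move=> y; have [[/= q1 q2 q3]|nc] := pselect (cube x (Nn n)^-1 y); last first.
    have [_ _ _ ->] := nice_bump3 (Nn0 n); first by rewrite !mulr0.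
    by move=> /cube0.
  congr (_ * _); rewrite /w /I3set; congr (_ * _ * _).
  + by move: y.1.1 q1; near: n; exact: itvoc_lim.
  + by move: y.1.2 q2; near: n; exact: itvoc_lim.
  + by move: y.2 q3; near: n; exact: itvoc_lim.
- apply: aeW => x n; rewrite (normrM (g x) (psi n x)) (normrM (g x) (\1_(cube 0 r) x)).
  apply: ler_wpM2l => //.
  by have /andP[h1 h2] := psi01 n x; rewrite (ger0_norm h1) (le_trans h2)// ler_norm.
exact.
Unshelve. all: by end_near. Qed.

Lemma good_ext w w' : w =1 w' -> good w -> good w'.
Proof. by move=> h; have -> : w' = w by apply/funext => x; rewrite h. Qed.

(** Dynkin's pi-lambda argument in one variable [pi]. The fixed factor [f] plays the part of the
    whole space: complements become [f] minus the function, and [f] dominates the partial sums over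
    disjoint sets. *)
Lemma good_dynkin d (T : measurableType d) (G : set (set T)) (pi : mpoint -> T) (f : mpoint -> R) :
  @measurable _ T = <<s G >> -> setI_closed G -> measurable_fun setT pi ->
  (forall x, 0 <= f x) -> good f ->
  (forall A, G A -> good (fun x => \1_A (pi x) * f x)) ->
  forall A, measurable A -> good (fun x => \1_A (pi x) * f x).
Proof.
move=> mG GI mpi f0 gf hG A mA.
have [sf _] := gf.
have indT (B : set T) x : \1_B (pi x) = \1_(pi @^-1` B) x :> R by [].
apply: (dynkin_induction (P := [set A | good (fun x => \1_A (pi x) * f x)]) mG GI) => //=.
- by apply: good_ext gf => x; rewrite indicE mem_set// mul1r.
- move=> S mS gS.
  apply: (good_ext _ (goodD gf (goodZ (-1) gS))) => x.
  by rewrite !indicE in_setC; case: (_ \in S) => /=; ring.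
- move=> F mF tF gF.
  apply: (good_dct (w_ := fun n x => \sum_(k <- index_iota 0 n) \1_(F k) (pi x) * f x) (G := f)).
  + by move=> n; apply: good_sum.
  + apply: measurable_funM; last exact: sq_meas sf.
    apply: (measurableT_comp (f := \1_(\bigcup_k F k) : T -> R)) => //.
    by apply: measurable_indic; exact: bigcupT_measurable.
  + exact: sf.
  + move=> n x; rewrite -mulr_suml normrM (ger0_norm (f0 x)) ler_piMl//.
    rewrite ger0_norm; last by apply: sumr_ge0 => k _; have /andP[] := indic01 (F k) (pi x).
    elim: n => [|n IH]; first by rewrite big_geq.
    rewrite big_nat_recr//=; have [hn|hn] := pselect (F n (pi x)); last first.
      by rewrite [X in _ + X]indicE memNset// addr0.
    rewrite big_nat_cond big1 ?add0r; first by have /andP[] := indic01 (F n) (pi x).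
    move=> k /andP[/andP[_ kn] _]; rewrite indicE memNset// => hk.
    have e : k = n by apply: (tF k n I I); exists (pi x).
    by rewrite e ltnn in kn.
  + move=> x; apply: cvg_near_cst.
    have [[k _ hk]|hn] := pselect ((\bigcup_k F k) (pi x)); last first.
      apply: nearW => n; rewrite big1 ?indicE ?memNset ?mul0r// => k _.
      by rewrite indicE memNset ?mul0r// => hk; apply: hn; exists k.
    near=> n; rewrite -mulr_suml; congr (_ * _).
    have kn : (k < n)%N by near: n; exact: nbhs_infty_gt.
    rewrite [RHS]indicE mem_set; last by exists k.
    rewrite (bigD1_seq k)/= ?iota_uniq ?mem_index_iota// indicE mem_set// big1 ?addr0//.
    move=> j jk; rewrite indicE memNset// => hj; move/eqP: jk; apply.
    by apply: (tF j k I I); exists (pi x).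
- by rewrite -mG.
Unshelve. all: by end_near. Qed.

Lemma measurable_itvgen : @measurable _ (measurableTypeR R) = <<s (@ocitv R) >>.
Proof. by []. Qed.

Lemma measurable_rectgen d1 d2 (T1 : measurableType d1) (T2 : measurableType d2) :
  @measurable _ (T1 * T2)%type = <<s [set C | exists A, measurable A /\ exists B, measurable B /\ C = A `*` B] >>.
Proof.
rewrite measurable_prod_measurableType; congr (<<s _ >>).
apply/seteqP; split => [_ [A mA [B mB <-]]|_ [A [mA [B [mB ->]]]]].
  by exists A; split => //; exists B.
by exists A => //; exists B.
Qed.

Lemma rectI d1 d2 (T1 : measurableType d1) (T2 : measurableType d2) :
  setI_closed [set C : set (T1 * T2) | exists A, measurable A /\ exists B, measurable B /\ C = A `*` B].
Proof.
move=> _ _ [A [mA [B [mB ->]]]] [A' [mA' [B' [mB' ->]]]].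
exists (A `&` A'); split; first exact: measurableI.
by exists (B `&` B'); split; [exact: measurableI|rewrite setXI].
Qed.

Lemma indicM (T : Type) (A B : set T) x : \1_A x * \1_B x = \1_(A `&` B) x :> R.
Proof. by rewrite !indicE in_setI; do 2 case: (_ \in _); rewrite ?mulr1 ?mulr0. Qed.

(** [good_dynkin] replaces intervals by measurable sets one coordinate at a time. The factor []- r,
    r]] keeps the fixed function [f] square integrable. *)
Lemma good_rect (r : R) (A1 A2 A3 : set R) : measurable A1 -> measurable A2 -> measurable A3 ->
  good (I3set (A1 `&` `]- r, r]%classic) (A2 `&` `]- r, r]%classic) (A3 `&` `]- r, r]%classic)).
Proof.
set J := `]- r, r]%classic => m1 m2 m3.
have oJ : ocitv J by exact: is_ocitv.
have s0 (B1 B2 B3 : set R) : ocitv B1 -> ocitv B2 -> ocitv B3 -> good (I3set B1 B2 B3).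
  by move=> [[a1 b1] _ <-] [[a2 b2] _ <-] [[a3 b3] _ <-]; exact: good_box.
have pos B1 B2 B3 x : 0 <= I3set B1 B2 B3 x by have /andP[] := I3set01 B1 B2 B3 x.
have s1 (B1 B2 B3 : set R) : measurable B1 -> ocitv B2 -> ocitv B3 -> good (I3set (B1 `&` J) B2 B3).
  move=> mB1 o2 o3.
  apply: (good_ext _ (good_dynkin (pi := fun x : mpoint => x.1.1) measurable_itvgen (@ocitvI R)
    measurable_c1 (pos J B2 B3) (s0 _ _ _ oJ o2 o3) _ mB1)) => [x|C oC].
    by rewrite /I3set -indicM !mulrA.
  apply: (good_ext _ (s0 _ _ _ (ocitvI oC oJ) o2 o3)) => x.
  by rewrite /I3set -indicM !mulrA.
have s2 (B1 B2 B3 : set R) : measurable B1 -> measurable B2 -> ocitv B3 -> good (I3set (B1 `&` J) (B2 `&` J) B3).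
  move=> mB1 mB2 o3.
  apply: (good_ext _ (good_dynkin (pi := fun x : mpoint => x.1.2) measurable_itvgen (@ocitvI R)
    measurable_c2 (pos (B1 `&` J) J B3) (s1 _ _ _ mB1 oJ o3) _ mB2)) => [x|C oC].
    by rewrite /I3set -(indicM B2); ring.
  apply: (good_ext _ (s1 _ _ _ mB1 (ocitvI oC oJ) o3)) => x.
  by rewrite /I3set -(indicM C); ring.
apply: (good_ext _ (good_dynkin (pi := fun x : mpoint => x.2) measurable_itvgen (@ocitvI R)
    measurable_c3 (pos (A1 `&` J) (A2 `&` J) J) (s2 _ _ _ m1 m2 oJ) _ m3)) => [x|C oC].
  by rewrite /I3set -(indicM A3); ring.
apply: (good_ext _ (s2 _ _ _ m1 m2 (ocitvI oC oJ))) => x.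
by rewrite /I3set -(indicM C); ring.
Qed.

(** The same induction along the two products: first measurable sets of the first two coordinates,
    generated by rectangles, then measurable sets of R^3. *)
Lemma good_set (r : R) (A : set mpoint) : measurable A ->
  good (fun x => \1_A x * I3set `]- r, r]%classic `]- r, r]%classic `]- r, r]%classic x).
Proof.
set J := `]- r, r]%classic => mA.
have pos B1 B2 B3 x : 0 <= I3set B1 B2 B3 x by have /andP[] := I3set01 B1 B2 B3 x.
have mJ : measurable J by exact: measurable_itv.
have g0 (A1 A2 A3 : set R) := @good_rect r A1 A2 A3.
have IJ : setT `&` J = J by rewrite setTI.
have prodE (T1 T2 : Type) (B1 : set T1) (B2 : set T2) (z : T1 * T2) :
    \1_(B1 `*` B2) z = \1_B1 z.1 * \1_B2 z.2 :> R.
  rewrite !indicE -natrM mulnb; congr (_%:R); congr nat_of_bool.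
  by apply/idP/andP; rewrite !inE => -[].
have g2 (B : set (measurableTypeR R * measurableTypeR R)%type) (A3 : set R) : measurable B -> measurable A3 ->
    good (fun x => \1_B x.1 * I3set J J (A3 `&` J) x).
  move=> mB m3.
  apply: (good_dynkin (pi := fun x : mpoint => x.1) (measurable_rectgen _ _) (@rectI _ _ _ _)
     measurable_fst (pos J J (A3 `&` J))) mB.
    by have := g0 setT setT A3 measurableT measurableT m3; rewrite IJ.
  move=> _ [A1 [m1 [A2 [m2 ->]]]].
  apply: (good_ext _ (g0 A1 A2 A3 m1 m2 m3)) => x.
  by rewrite prodE /I3set -(indicM A1) -(indicM A2) -(indicM A3); ring.
apply: (good_dynkin (pi := idfun) (measurable_rectgen _ _) (@rectI _ _ _ _)
     (@measurable_id _ _ _) (pos J J J)) mA.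
  by have := g0 setT setT setT measurableT measurableT measurableT; rewrite IJ.
move=> _ [B [mB [A3 [m3 ->]]]].
apply: (good_ext _ (g2 B A3 mB m3)) => x.
by rewrite prodE /I3set -(indicM A3) /=; ring.
Qed.

End Density2.

Section Density3.
Context {R : realType}.
Local Notation point := (R * R * R)%type.
Local Notation mpoint := (measurableTypeR R * measurableTypeR R * measurableTypeR R)%type.
Local Notation field := (point -> 'rV[R]_3).
Local Notation M3 := (@leb3s R).
Implicit Types (g w : mpoint -> R) (N : R).
Local Notation Nn := (fun n : nat => n.+1%:R : R).
Local Notation Nn0 := (fun n => ltr0Sn R n).
Import HBSimple HBNNSimple.

Lemma good_nneg w : sq M3 w -> (forall x, 0 <= w x) -> good w.
Proof.
move=> sw w0; have mw := sq_meas sw.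
have mew : measurable_fun setT (EFin \o w) by exact/measurable_EFinP.
(* Cut to a growing cube, each simple approximation is a finite combination of functions covered by
   [good_set]. *)
pose J n : set R := `]- (Nn n), Nn n]%classic.
pose a n := nnsfun_approx measurableT mew n.
apply: (good_dct (w_ := fun n x => a n x * I3set (J n) (J n) (J n) x) (G := w)) => //.
- move=> n.
  have h y := goodZ y (good_set (Nn n) (measurable_sfunP (a n) (measurable_set1 y))).
  have gs := @good_sum R _ (finmap.enum_fset (fset_set (range (a n)))) _ h; apply: good_ext gs => x.
  rewrite (fimfunE (a n) x) fsbig_finite//= mulr_suml; apply: eq_bigr => y _.
  by rewrite mulrA.
- move=> n x; have /andP[i0 i1] := I3set01 (J n) (J n) (J n) x.
  have a0 : 0 <= a n x by [].
  rewrite ger0_norm ?mulr_ge0//; apply: le_trans (ler_piMr a0 i1) _.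
  rewrite -lee_fin /a nnsfun_approxE.
  by apply: (@le_approx _ _ _ setT (EFin \o w) n x _ _) => // y _; rewrite lee_fin.
- move=> x.
  have c1 : (fun n => a n x) @ \oo --> w x.
    have := @cvg_nnsfun_approx _ _ _ setT measurableT (EFin \o w) mew (fun y _ => w0 y) x I.
    by move/fine_cvgP => [_].
  have c2 : (fun n => I3set (J n) (J n) (J n) x) @ \oo --> (1 : R).
    apply: cvg_near_cst; near=> n.
    have hJ (t : R) : `|t| < n%:R -> \1_(J n) t = 1 :> R.
      move=> ht; rewrite indicE mem_set// /J /= in_itv /=.
      have nn : (n%:R : R) <= Nn n by rewrite ler_nat.
      by move: (lt_le_trans ht nn); rewrite ltr_norml => /andP[-> /ltW ->].
    rewrite /I3set !hJ ?mulr1//; near: n; exact: nbhs_infty_gtr.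
  by have := cvgM c1 c2; rewrite mulr1; exact.
Unshelve. all: by end_near. Qed.

Lemma good_sq w : sq M3 w -> good w.
Proof.
move=> sw; have mw := sq_meas sw.
have sp : sq M3 (fun x => Num.max (w x) 0).
  apply: sq_dom_ae sw _; first exact: measurable_maxr.
  by apply: aeW => x; rewrite /Num.max; case: ifP; rewrite ?normr0.
have sn : sq M3 (fun x => Num.max (- w x) 0).
  apply: sq_dom_ae sw _; first by apply: measurable_maxr => //; exact: measurable_funN.
  by apply: aeW => x; rewrite /Num.max; case: ifP; rewrite ?normr0 ?normrN.
have := goodD (good_nneg sp _) (goodZ (-1) (good_nneg sn _)).
move=> h; apply: (good_ext _ (h _ _)) => x; rewrite ?le_max ?lexx ?orbT//.
rewrite /Num.max; case: ifPn => h1; case: ifPn => h2; rewrite ?oppr_lt0 -?leNgt in h1 h2 *; lra.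
Qed.

End Density3.

(** * Green's formula for weak curls *)

Section Green.
Context {R : realType}.
Local Notation point := (R * R * R)%type.
Local Notation mpoint := (measurableTypeR R * measurableTypeR R * measurableTypeR R)%type.
Local Notation field := (point -> 'rV[R]_3).
Local Notation M3 := (@leb3s R).
Implicit Types (u v cu cv : field) (N : R).
Local Notation Nn := (fun n : nat => n.+1%:R : R).
Local Notation Nn0 := (fun n => ltr0Sn R n).

Lemma curl_delta (U D : 'I_3 -> R) j :
  \sum_i U i * (D (i + 1) * (i + 2 == j)%:R - D (i + 2) * (i + 1 == j)%:R) =
  U (j + 1) * D (j + 2) - U (j + 2) * D (j + 1).
Proof. by rewrite sum3 !I3add; move: j; apply: I3P; rewrite !I3add /=; ring. Qed.

Lemma sum_delta (U : 'I_3 -> R) (b : R) j : \sum_i U i * (b * (i == j)%:R) = U j * b.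
Proof. by rewrite sum3; move: j; apply: I3P => /=; ring. Qed.

Lemma mulr_eqB (a b c d : R) : b = c - d -> a * b = a * c - a * d.
Proof. by move=> ->; rewrite mulrBr. Qed.

Definition cmp (u : field) (i : 'I_3) : mpoint -> R := fun x => u x ord0 i.

Lemma cmp_sq u i : L2 u -> sq M3 (cmp u i).
Proof. by move=> hu; exact: (hu i). Qed.

(** The test field is the bump times the [j]-th basis vector, which isolates the [j]-th component of
    the curl. *)
Lemma test_bump N u cu (j : 'I_3) (y : point) : 0 < N -> weak_curl u cu ->
  Int M3 (fun x : mpoint => cmp u (j + 1) x * dbump N (j + 2) ((x : point) - y)
     - cmp u (j + 2) x * dbump N (j + 1) ((x : point) - y)) =
  Int M3 (fun x : mpoint => cmp cu j x * bump3 N ((x : point) - y)).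
Proof.
move=> N0 [hu hcu hw].
pose phi : field := fun x => \row_i (bump3 N (x - y) * (i == j)%:R).
have phiE m : (fun x => phi x ord0 m) = (fun x => bump3 N (x - y) * (m == j)%:R).
  by apply/funext => x; rewrite mxE.
have tphi m : test_function setT (fun x => phi x ord0 m).
  rewrite phiE; case: eqP => _ /=.
    rewrite (_ : (fun x => _) = (fun x => bump3 N (x - y))); first exact: bump3_test.
    by apply/funext => x; rewrite mulr1.
  rewrite (_ : (fun x => _) = (fun=> 0)); last by apply/funext => x; rewrite mulr0.
  split=> [k|]; first exact: is_Ck_cst.
  by exists set0; split => //; exact: compact0.
have dphi k m x : 'D_(unit_vec k) (fun x => phi x ord0 m) x = dbump N k (x - y) * (m == j)%:R.
  rewrite phiE; case: eqP => _ /=.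
    rewrite (_ : (fun x => _) = (fun x => bump3 N (x - y))); last first.
      by apply/funext => z; rewrite mulr1.
    by rewrite (is_Ck_shift y (bump3_Ck N 0)).2 mulr1.
  rewrite (_ : (fun x => _) = (fun=> 0)); last by apply/funext => z; rewrite mulr0.
  by rewrite derive_cst mulr0.
have h := hw phi tphi.
transitivity (Int leb3 (fun x => dot (u x) (curl phi x))).
  rewrite -leb3E; apply: Int_ext => x; rewrite -(curl_delta (cmp u ^~ x) (fun k => dbump N k (x - y))).
  by apply: eq_bigr => i _; rewrite mxE !dphi.
rewrite [LHS]h -leb3E; apply: Int_ext => x; rewrite -(sum_delta (cmp cu ^~ x)).
by apply: eq_bigr => i _; rewrite mxE.
Qed.

Lemma Sker_curl N u cu v cv : 0 < N -> weak_curl u cu -> weak_curl v cv ->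
  \sum_i Sker (bump3 N) (cmp cu i) (cmp v i) = \sum_i Sker (bump3 N) (cmp u i) (cmp cv i).
Proof.
move=> N0 hu hv; have [Lu Lcu _] := hu; have [Lv Lcv _] := hv.
have nb := nice_bump3 N0.
(* Here [k] is the direction in which the kernel is differentiated. Both sides reduce to the same
   alternating sum of the six forms [Q k i l] with distinct indices, up to a cyclic relabelling. *)
pose Q k i l := Sker (dbump N k) (cmp u i) (cmp v l).
have h1 j : Sker (bump3 N) (cmp cu j) (cmp v j) = Q (j + 2) (j + 1) j - Q (j + 1) (j + 2) j.
  have [M2 n2] := nice_dbump (j + 2) N0; have [M1 n1] := nice_dbump (j + 1) N0.
  have [_ ->] := SkerE2 nb (cmp_sq j Lcu) (cmp_sq j Lv).
  have [i1 e1] := SkerE2 n2 (cmp_sq (j + 1) Lu) (cmp_sq j Lv).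
  have [i2 e2] := SkerE2 n1 (cmp_sq (j + 2) Lu) (cmp_sq j Lv).
  apply: etrans (esym (f_equal2 (fun a b => a - b) e1 e2)).
  apply: etrans (IntB i1 i2); apply: Int_ext => y; apply: mulr_eqB.
  rewrite -IntB; last first.
  - exact: sqM (cmp_sq _ Lu) (sec2_sq n1 y).
  - exact: sqM (cmp_sq _ Lu) (sec2_sq n2 y).
  exact: esym (test_bump j y N0 hu).
have h2 j : Sker (bump3 N) (cmp u j) (cmp cv j) = Q (j + 1) j (j + 2) - Q (j + 2) j (j + 1).
  have [M2 n2] := nice_dbump (j + 2) N0; have [M1 n1] := nice_dbump (j + 1) N0.
  have [_ ->] := SkerE1 nb (cmp_sq j Lu) (cmp_sq j Lcv).
  have [i1 e1] := SkerE1 n2 (cmp_sq j Lu) (cmp_sq (j + 1) Lv).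
  have [i2 e2] := SkerE1 n1 (cmp_sq j Lu) (cmp_sq (j + 2) Lv).
  apply: etrans (esym (f_equal2 (fun a b => a - b) e2 e1)).
  apply: etrans (IntB i2 i1); apply: Int_ext => x; apply: mulr_eqB.
  rewrite -IntB; last first.
  - exact: sqM (cmp_sq _ Lv) (sec1_sq n2 x).
  - exact: sqM (cmp_sq _ Lv) (sec1_sq n1 x).
  transitivity (Int M3 (fun y : mpoint => cmp cv j y * bump3 N ((y : point) - (x : point)))).
    by apply: Int_ext => y; rewrite -bump3_even opprB.
  rewrite -(test_bump j x N0 hv); apply: Int_ext => y.
  by rewrite -(opprB (x : point) (y : point)) !dbump3_odd !mulrN opprK addrC.
clearbody Q; transitivity (\sum_i (Q (i + 2) (i + 1) i - Q (i + 1) (i + 2) i)).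
  by apply: eq_bigr => i _; exact: h1.
transitivity (\sum_i (Q (i + 1) i (i + 2) - Q (i + 2) i (i + 1))).
  by clear; rewrite !sum3 !I3add; ring.
by apply: eq_bigr => i _; rewrite h2.
Qed.

(* Testing one curl identity with [bump3 N (x - y)] at fixed [y] and the other
   at fixed [x], both sides agree after smoothing by [bump3 N] since its
   gradient is odd; the smoothing is removed by letting [N] tend to infinity. *)
Lemma green_curl u cu v cv : weak_curl u cu -> weak_curl v cv ->
  ip cu v = ip u cv.
Proof.
move=> hu hv; have [Lu Lcu _] := hu; have [Lv Lcv _] := hv.
have ipE a b : L2 a -> L2 b -> ip a b = \sum_i Int M3 (fun x => cmp a i x * cmp b i x).
  move=> ha hb; rewrite -Int_sum; last by move=> i; exact: sqM (cmp_sq _ ha) (cmp_sq _ hb).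
  by rewrite /ip -leb3E.
have lim a b : L2 a -> L2 b ->
    (fun n => \sum_i avg (Nn n) (cmp a i) (cmp b i)) @ \oo --> ip a b.
  move=> ha hb; rewrite ipE//.
  have c i : (fun n => avg (Nn n) (cmp a i) (cmp b i)) @ \oo --> Int M3 (fun x => cmp a i x * cmp b i x).
    exact: (good_sq (cmp_sq i hb)).2 (cmp_sq i ha).
  rewrite sum3 (_ : (fun n => _) = (fun n => avg (Nn n) (cmp a 0) (cmp b 0) + avg (Nn n) (cmp a 1) (cmp b 1)
    + avg (Nn n) (cmp a 2) (cmp b 2))); last by apply/funext => n; rewrite sum3.
  by apply: cvgD; [apply: cvgD|]; exact: c.
have e : (fun n => \sum_i avg (Nn n) (cmp cu i) (cmp v i)) =
         (fun n => \sum_i avg (Nn n) (cmp u i) (cmp cv i)).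
  by apply/funext => n; rewrite /avg -!mulr_suml (Sker_curl (Nn0 n) hu hv).
have l1 := lim _ _ Lcu Lv; have l2 := lim _ _ Lu Lcv; rewrite e in l1.
exact: cvg_unique l1 l2.
Qed.

End Green.

(** * Integration by parts for radial functions *)

Section LineIBP.
Context {R : realType}.
Local Notation point := (R * R * R)%type.
Local Notation mpoint := (measurableTypeR R * measurableTypeR R * measurableTypeR R)%type.
Local Notation leb := (@lebesgue_measure R).
Local Notation M3 := (@leb3s R).

Lemma is_derive_continuous (F f : R -> R) : (forall t, is_derive t (1 : R) F (f t)) -> continuous F.
Proof.
by move=> h t; apply: differentiable_continuous; apply/derivable1_diffP; case: (h t).
Qed.

Lemma ftc_ball (F f : R -> R) (c r : R) : 0 < r ->
  (forall t, is_derive t (1 : R) F (f t)) -> continuous f ->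
  intg leb (fun t => \1_[set t | `|c - t| < r] t * f t) /\
  Int leb (fun t => \1_[set t | `|c - t| < r] t * f t) = F (c + r) - F (c - r).
Proof.
move=> r0 dF cf.
have cF := is_derive_continuous dF.
have ab : c - r < c + r by lra.
have mb := measurable_ball1 c r.
have be : [set t | `|c - t| < r] = `]c - r, c + r[%classic.
  apply/seteqP; split => t /=; rewrite in_itv /= ltr_norml => /andP[? ?];
    apply/andP; split; lra.
have ic : leb.-integrable `[c - r, c + r] (EFin \o f).
  apply: continuous_compact_integrable; first exact: segment_compact.
  exact: continuous_subspaceT.
have io : leb.-integrable [set t | `|c - t| < r] (EFin \o f).
  rewrite be; apply: (integrableS _ _ _ ic) => //.
  by move=> t /=; rewrite !in_itv /= => /andP[/ltW -> /ltW ->].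
have fE : (fun t => \1_[set t | `|c - t| < r] t * f t) = f \_ [set t | `|c - t| < r].
  apply/funext => t; rewrite /patch indicE; case: ifP => _; by rewrite ?mul1r ?mul0r.
split.
  rewrite /intg fE; have /integrable_mkcond := io => /(_ mb).
  by congr integrable; apply/funext => t; rewrite /patch /=; case: ifP.
rewrite fE /Int -Rintegral_mkcond be /Rintegral.
rewrite -(@integral_itv_bndoo _ _ _ _ true false); last first.
  by apply/measurable_EFinP; apply: measurable_funTS; exact: continuous_measurable_fun.
rewrite (@continuous_FTC2 R f F) //.
- exact: continuous_subspaceT.
- split; first by move=> t _; case: (dF t).
  + by apply: cvg_at_right_filter; exact: cF.
  + by apply: cvg_at_left_filter; exact: cF.
- by move=> t _; rewrite derive1E; case: (dF t).
Qed.

(** The integrand is the derivative of [fo * psi] on the whole line plus, inside the interval of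
    radius [rho], the derivative of [(fi - fo) * psi]. The first has no boundary terms because [psi]
    vanishes at [c + L] and [c - L], the second because the two branches agree at the interface. *)
Lemma line_ibp (fo fi dfo dfi psi dpsi : R -> R) (c rho L : R) :
  (forall t, is_derive t (1 : R) fo (dfo t)) -> (forall t, is_derive t (1 : R) fi (dfi t)) ->
  (forall t, is_derive t (1 : R) psi (dpsi t)) ->
  continuous dfo -> continuous dfi -> continuous dpsi ->
  (0 < rho -> fo (c + rho) = fi (c + rho) /\ fo (c - rho) = fi (c - rho)) ->
  0 < L -> (forall t, L <= `|c - t| -> psi t = 0 /\ dpsi t = 0) ->
  Int leb (fun t => (if `|c - t| < rho then fi t else fo t) * dpsi t +
                    (if `|c - t| < rho then dfi t else dfo t) * psi t) = 0.
Proof.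
move=> do_ di dp co_ ci cp agree L0 supp.
have cfo := is_derive_continuous do_; have cfi := is_derive_continuous di.
have cpsi := is_derive_continuous dp.
pose go t := fo t * dpsi t + dfo t * psi t.
pose gi t := (fi t - fo t) * dpsi t + (dfi t - dfo t) * psi t.
have dgo t : is_derive t (1 : R) (fun s => fo s * psi s) (go t).
  by have h := is_deriveM (do_ t) (dp t); apply: (is_derive_eq h); rewrite /go /GRing.scale /=; ring.
have dgi t : is_derive t (1 : R) (fun s => (fi s - fo s) * psi s) (gi t).
  have h := is_deriveM (is_deriveB (di t) (do_ t)) (dp t).
  by apply: (is_derive_eq h); rewrite /gi /GRing.scale /= -[(fi - fo) t]/(fi t - fo t); ring.
have cgo : continuous go.
  by move=> t; apply: cvgD; apply: cvgM; [exact: cfo|exact: cp|exact: co_|exact: cpsi].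
have cgi : continuous gi.
  move=> t; apply: cvgD; apply: cvgM; [apply: cvgB|exact: cp|apply: cvgB|exact: cpsi];
    [exact: cfi|exact: cfo|exact: ci|exact: co_].
have [io eo] := ftc_ball c L0 dgo cgo.
have z1 : psi (c + L) = 0 by apply: (supp _ _).1; rewrite opprD addNKr normrN ger0_norm// ltW.
have z2 : psi (c - L) = 0 by apply: (supp _ _).1; rewrite opprB addrCA subrr addr0 ger0_norm// ltW.
rewrite z1 z2 !mulr0 subrr in eo.
have goE t : \1_[set t | `|c - t| < L] t * go t = go t.
  rewrite indicE; have [h|/supp[h1 h2]] := ltP `|c - t| L; first by rewrite mem_set// mul1r.
  by rewrite /go h1 h2 !mulr0 addr0 mulr0.
have [r0|r0] := ltP 0 rho; last first.
  rewrite -eo; apply: Int_ext => t; rewrite goE.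
  by rewrite ltNge (le_trans r0).
have [ii ei] := ftc_ball c r0 dgi cgi.
have [e1 e2] := agree r0; rewrite e1 e2 !subrr !mul0r subrr in ei.
transitivity (0 + 0 : R); last by rewrite addr0.
rewrite -{1}eo -ei -IntD//; apply: Int_ext => t; rewrite goE indicE.
case: ifPn => h; first by rewrite mem_set//= mulr1n /go /gi; ring.
by rewrite memNset//= ?mulr0n ?mul0r ?addr0 ?/go; [ring|exact/negP].
Qed.

Definition upd (j : 'I_3) (x : point) (t : R) : point :=
  if j == 0 then (t, x.1.2, x.2) else if j == 1 then (x.1.1, t, x.2) else (x.1.1, x.1.2, t).

Lemma co_upd j k x t : co k (upd j x t) = if k == j then t else co k x.
Proof.
by move: j k; apply: I3P; apply: I3P; rewrite ?co0 ?co1 ?co2.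
Qed.

Lemma upd_shift j x t h : upd j x (h + t) = h *: unit_vec j + upd j x t.
Proof.
have e (a b d : point) : (forall i, co i a = co i b + co i d) -> a = b + d.
  case: a b d => [[a1 a2] a3] [[b1 b2] b3] [[d1 d2] d3] hi.
  by have := hi 0; have := hi 1; have := hi 2; rewrite !co0 !co1 !co2 /= => -> -> ->.
apply: e => i; rewrite coZ co_unit !co_upd.
by case: eqVneq => _ /=; rewrite ?mulr1 ?mulr0 ?add0r.
Qed.

Lemma derive_upd (f : point -> R) j x t : derivable f (upd j x t) (unit_vec j) ->
  is_derive t (1 : R) (fun s => f (upd j x s)) ('D_(unit_vec j) f (upd j x t)).
Proof.
have q : (fun h : R => h^-1 *: (((fun s => f (upd j x s)) \o shift t) (h *: (1 : R)) - f (upd j x t))) =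
   (fun h : R => h^-1 *: ((f \o shift (upd j x t)) (h *: unit_vec j) - f (upd j x t))).
  by apply/funext => h; rewrite /= [_ *: 1]mulr1 upd_shift.
by move=> df; apply: DeriveDef; rewrite /derivable /derive q.
Qed.

Lemma measurable_pair2_fst d1 d2 (T1 : measurableType d1) (T2 : measurableType d2) (w : T1 * T2 -> R) y :
  measurable_fun setT w -> measurable_fun setT (fun x => w (x, y)).
Proof. by move=> mw; exact: (measurableT_comp mw (measurable_pair2 y)). Qed.

Lemma Int_ae0 (f : R -> R) (a : R) : measurable_fun setT f -> (forall t, t != a -> f t = 0) -> Int leb f = 0.
Proof.
move=> mf h; rewrite -(Int0 leb); apply: Int_ae => //.
exists [set a]; split; [exact: measurable_set1|exact: lebesgue_measure_set1|].
by move=> t /= ht; apply/eqP/negPn/negP => /h.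
Qed.

Lemma line_zero (j : 'I_3) (p : point) (w : mpoint -> R) (M L : R) :
  measurable_fun setT w -> (forall x, `|w x| <= M * \1_(cube p L) x) ->
  (forall x : point, (exists2 k, k != j & co k x != co k p) ->
     Int leb (fun t => w (upd j x t)) = 0) ->
  Int M3 w = 0.
Proof.
move=> mw dw hz.
have iw : intg M3 w by apply: intg_dom mw (intgZ M (intg_cube p L)) _.
pose b (a : R) (t : R) : R := \1_[set t | `|a - t| < L] t.
have ib a : intg leb (b a) by exact: intg_ball1.
have ib2 : intg leb2s (fun z : (measurableTypeR R * measurableTypeR R)%type => b p.1.1 z.1 * b p.1.2 z.2).
  exact: (@intg_prod _ _ _ _ R leb1s leb1s _ _ (ib p.1.1) (ib p.1.2)).
have dw' (x : mpoint) : `|w x| <= M * b p.2 x.2 * (b p.1.1 x.1.1 * b p.1.2 x.1.2).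
  by apply: le_trans (dw x) _; rewrite indic_cube le_eqVlt; apply/orP; left; apply/eqP; rewrite /b; ring.
have isec (t : R) : intg leb2s (fun z => w (z, t)).
  apply: (intg_dom _ (intgZ (M * b p.2 t) ib2) (fun z => dw' (z, t))).
  exact: measurable_pair2_fst mw.
(* The direction [j] is integrated first. It suffices to leave out one value of another coordinate,
   that of [p], which is a null set for the last integration. *)
move: j hz; apply: I3P => hz.
- have [i2 <-] := @fubini21 _ _ _ _ R leb2s leb1s w iw.
  apply: (@Int_ae0 _ p.2); first exact: intg_meas i2.
  move=> t tp; have [_ <-] := @fubini21 _ _ _ _ R leb1s leb1s _ (isec t).
  rewrite -[RHS](Int0 leb1s); apply: Int_ext => y.
  by have := hz (0, y, t); rewrite /upd /=; apply; exists 2 => //; rewrite !co2.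
- have [i2 <-] := @fubini21 _ _ _ _ R leb2s leb1s w iw.
  apply: (@Int_ae0 _ p.2); first exact: intg_meas i2.
  move=> t tp; have [_ <-] := @fubini12 _ _ _ _ R leb1s leb1s _ (isec t).
  rewrite -[RHS](Int0 leb1s); apply: Int_ext => y.
  by have := hz (y, 0, t); rewrite /upd /=; apply; exists 2 => //; rewrite !co2.
- have [i1 <-] := @fubini12 _ _ _ _ R leb2s leb1s w iw.
  have [i2 <-] := @fubini12 _ _ _ _ R leb1s leb1s _ i1.
  apply: (@Int_ae0 _ p.1.1); first exact: intg_meas i2.
  move=> t tp; rewrite -[RHS](Int0 leb1s); apply: Int_ext => y.
  by have := hz (t, y, 0); rewrite /upd /=; apply; exists 0 => //; rewrite !co0.
Qed.

End LineIBP.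

Section RadialIBP.
Context {R : realType}.
Local Notation point := (R * R * R)%type.
Local Notation mpoint := (measurableTypeR R * measurableTypeR R * measurableTypeR R)%type.
Local Notation leb := (@lebesgue_measure R).
Local Notation M3 := (@leb3s R).

Lemma test_derive0 (V : normedModType R) (f : V -> R) (K : set V) (v x : V) :
  closed K -> (forall y, ~ K y -> f y = 0) -> ~ K x -> 'D_v f x = 0.
Proof.
move=> cK f0 nK.
have oK : open (~` K) by exact: closed_openC.
rewrite (near_eq_derive (g := cst 0)); first by rewrite derive_cst.
by near=> y; apply: f0; near: y; exact: open_nbhs_nbhs.
Unshelve. all: by end_near. Qed.

Lemma test_props (psi : point -> R) (p : point) : test_function setT psi ->
  exists L M : R, [/\ 0 < L, 0 <= M, (forall x, ~ cube p L x -> psi x = 0),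
   (forall j x, ~ cube p L x -> 'D_(unit_vec j) psi x = 0) &
   (forall x, `|psi x| <= M) /\ (forall j x, `|'D_(unit_vec j) psi x| <= M)].
Proof.
move=> [Ck [K [cK _ K0]]].
have clK : closed K by apply: compact_closed => //; exact: norm_hausdorff.
have bco i : exists2 m, 0 <= m & forall x, K x -> `|co i x - co i p| <= m.
  apply: continuous_compact_bounded => // x; apply: cvgB; last exact: cvg_cst.
  exact: continuous_co.
have [m0 m00 h0] := bco 0; have [m1 m10 h1] := bco 1; have [m2 m20 h2] := bco 2.
pose L := m0 + m1 + m2 + 1.
have KL x : K x -> cube p L x.
  move=> Kx; have := h0 x Kx; have := h1 x Kx; have := h2 x Kx.
  rewrite !co0 !co1 !co2 => k2 k1 k0.
  by split; rewrite distrC; [apply: le_lt_trans k0 _|apply: le_lt_trans k1 _|apply: le_lt_trans k2 _]; rewrite /L; lra.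
have cpsi : continuous psi by exact: is_Ck_cont (Ck 0%N).
have cd j : continuous (fun x => 'D_(unit_vec j) psi x).
  by have [_ /(_ (unit_vec j)) [_ [h _]]] := Ck 1%N.
have [M M0 hM] := continuous_compact_bounded cK cpsi.
have bd j : exists2 m, 0 <= m & forall x, K x -> `|'D_(unit_vec j) psi x| <= m.
  exact: continuous_compact_bounded cK (cd j).
have [d0 d00 k0] := bd 0; have [d1 d10 k1] := bd 1; have [d2 d20 k2] := bd 2.
have dK j x : ~ K x -> 'D_(unit_vec j) psi x = 0 by exact: test_derive0.
exists L, (M + d0 + d1 + d2); split.
- by rewrite /L; lra.
- by rewrite !addr_ge0.
- by move=> x h; apply: K0 => /KL.
- by move=> j x h; apply: dK => /KL.
split=> [x|j x].
  have [Kx|nK] := pselect (K x); first by apply: le_trans (hM x Kx) _; lra.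
  by rewrite K0// normr0 !addr_ge0.
have [Kx|nK] := pselect (K x); last by rewrite dK// normr0 !addr_ge0.
move: j; apply: I3P; [apply: le_trans (k0 x Kx) _|apply: le_trans (k1 x Kx) _|apply: le_trans (k2 x Kx) _]; lra.
Qed.

Definition rad (p x : point) : R := Num.sqrt (\sum_(i < 3) (co i x - co i p) ^+ 2).

Lemma edistE x p : Defs.edist x p = rad p x.
Proof.
rewrite /Defs.edist /enorm /rad /dot; congr Num.sqrt; apply: eq_bigr => i _.
by rewrite !mxE /co /vec !mxE expr2.
Qed.

Lemma rad_ge0 p x : 0 <= rad p x. Proof. exact: sqrtr_ge0. Qed.

Lemma rad2 p x : rad p x ^+ 2 = \sum_(i < 3) (co i x - co i p) ^+ 2.
Proof. by rewrite sqr_sqrtr// sumr_ge0// => i _; exact: sqr_ge0. Qed.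

Lemma co_le_rad i p x : `|co i x - co i p| <= rad p x.
Proof.
rewrite -(@ler_pXn2r _ 2)// ?nnegrE ?rad_ge0// rad2 real_normK ?num_real//.
by rewrite (bigD1 i)//= lerDl sumr_ge0// => k _; exact: sqr_ge0.
Qed.

Lemma measurable_co i : measurable_fun setT (co i : mpoint -> R).
Proof. by apply: continuous_measurable3; exact: continuous_co. Qed.

Lemma measurable_rad p : measurable_fun setT (rad p : mpoint -> R).
Proof.
apply: (measurableT_comp (f := @Num.sqrt R)).
  by apply: continuous_measurable_fun; exact: sqrt_continuous.
have -> : (fun x : mpoint => \sum_(i < 3) (co i x - co i p) ^+ 2) =
  (fun x => (co 0 x - co 0 p) ^+ 2 + (co 1 x - co 1 p) ^+ 2 + (co 2 x - co 2 p) ^+ 2).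
  by apply/funext => x; rewrite sum3.
have h i : measurable_fun setT (fun x : mpoint => (co i x - co i p) ^+ 2).
  by apply: measurable_funX; apply: measurable_funB => //; exact: measurable_co.
by apply: measurable_funD; [apply: measurable_funD|].
Qed.

(* [X] and [Y] are radial profiles with [X' = r Y], so that on a line
   [t |-> X (sqrt ((t - c)^2 + m))] has derivative [Y * (t - c)] *)
Definition radpair (X Y : R -> R) := forall r : R, 0 < r ->
  is_derive r (1 : R) X (r * Y r) /\ {for r, continuous Y}.

Lemma radpair_line X Y (c m t : R) : radpair X Y -> 0 < m ->
  is_derive t (1 : R) (fun s => X (Num.sqrt ((s - c) ^+ 2 + m)))
    (Y (Num.sqrt ((t - c) ^+ 2 + m)) * (t - c)) /\
  {for t, continuous (fun s => Y (Num.sqrt ((s - c) ^+ 2 + m)))}.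
Proof.
move=> XY m0; set r := Num.sqrt ((t - c) ^+ 2 + m).
have q0 s : 0 < (s - c) ^+ 2 + m by rewrite ltr_wpDl// sqr_ge0.
have r0 : 0 < r by rewrite sqrtr_gt0.
have [dX cY] := XY r r0.
have dq : is_derive t (1 : R) (fun s => (s - c) ^+ 2 + m) (2 * (t - c)).
  have e : (fun s : R => (s - c) ^+ 2 + m) = ((id - cst c) ^+ 2 + cst m : R -> R).
    by apply/funext => s; rewrite expr2.
  rewrite e; apply: is_derive_eq; rewrite /GRing.scale /=.
  by rewrite -[(id - cst c) t]/(t - c) subr0 addr0 expr1 mulr1 mulr2n; ring.
have ds := @is_derive1_comp R (@Num.sqrt R) (fun s => (s - c) ^+ 2 + m) t _ _ (is_derive1_sqrt (q0 t)) dq.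
split.
  have h := is_derive1_comp (f := X) (g := Num.sqrt \o (fun s => (s - c) ^+ 2 + m)) dX ds.
  apply: (is_derive_eq h); rewrite -/r; field; by rewrite gt_eqF.
apply: (@continuous_comp _ _ _ (fun s => Num.sqrt ((s - c) ^+ 2 + m)) Y) => //.
apply: (@continuous_comp _ _ _ (fun s => (s - c) ^+ 2 + m) (@Num.sqrt R)).
  by apply: differentiable_continuous; apply/derivable1_diffP; case: dq.
exact: sqrt_continuous.
Qed.

Lemma continuous_pair (T U V : topologicalType) (f : T -> U) (g : T -> V) :
  continuous f -> continuous g -> continuous (fun t => (f t, g t)).
Proof. by move=> cf cg t; apply: cvg_pair; [exact: cf|exact: cg]. Qed.

Lemma continuous_upd j (x : point) : continuous (upd j x : R -> point).
Proof.
have ci : continuous (fun t : R => t) by move=> t; exact: cvg_id.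
have cc (T : topologicalType) (a : T) : continuous (fun _ : R => a) by exact: cst_continuous.
move: j; apply: I3P; rewrite /upd /=.
- by apply: (@continuous_pair _ _ _ (fun t : R => (t, x.1.2)) (fun=> x.2)) => //; apply: (@continuous_pair _ _ _ (fun t : R => t) (fun=> x.1.2)).
- by apply: (@continuous_pair _ _ _ (fun t : R => (x.1.1, t)) (fun=> x.2)) => //; apply: (@continuous_pair _ _ _ (fun=> x.1.1) (fun t : R => t)).
- by apply: (@continuous_pair _ _ _ (fun=> (x.1.1, x.1.2)) (fun t : R => t)).
Qed.

Definition cutr (eta : R) (Xi Xo : R -> R) (r : R) : R := if r < eta then Xi r else Xo r.

(* Integration by parts along the lines parallel to the [j]-th axis that avoid
   [p]; the remaining lines form a negligible set. *)
Lemma radial_ibp (p : point) (eta : R) (Xi Xo Yi Yo : R -> R) (j : 'I_3) (pi : point -> R) (dpi : R) (M : R) (psi : point -> R) :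
  0 < eta -> radpair Xi Yi -> radpair Xo Yo -> Xi eta = Xo eta ->
  (forall x t, is_derive t (1 : R) (fun s => pi (upd j x s)) dpi) ->
  let u x := cutr eta Xi Xo (rad p x) * pi x in
  let du x := cutr eta Xi Xo (rad p x) * dpi +
     cutr eta Yi Yo (rad p x) * (co j x - co j p) * pi x in
  measurable_fun setT (u : mpoint -> R) -> measurable_fun setT (du : mpoint -> R) ->
  (forall x, `|u x| <= M) -> (forall x, `|du x| <= M) ->
  test_function setT psi ->
  Int leb3 (fun x => u x * 'D_(unit_vec j) psi x) = - Int leb3 (fun x => du x * psi x).
Proof.
move=> eta0 pXi pXo agree dpiE u du mu_ mdu bu bdu tpsi.
have [L [M' [L0 M'0 z1 z2 [b1 b2]]]] := test_props p tpsi.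
have [Ck _] := tpsi.
have M0 : 0 <= M := le_trans (normr_ge0 _) (bu p).
have mpsi : measurable_fun setT (psi : mpoint -> R).
  by apply: continuous_measurable3; exact: is_Ck_cont (Ck 0%N).
have [_ /(_ (unit_vec j)) [derpsi [cd _]]] := Ck 1%N.
have cpsi := is_Ck_cont (Ck 0%N).
have md : measurable_fun setT ((fun x => 'D_(unit_vec j) psi x) : mpoint -> R).
  exact: continuous_measurable3.
have dom (a b : mpoint -> R) : (forall x, `|a x| <= M) -> (forall x, `|b x| <= M') ->
    (forall x, ~ cube p L x -> b x = 0) -> forall x, `|a x * b x| <= M * M' * \1_(cube p L) x.
  move=> ha hb hb0 x; have [c|n] := pselect (cube p L x).
    by rewrite indicE mem_set// mulr1 normrM ler_pM.
  by rewrite hb0// mulr0 normr0 mulr_ge0// mulr_ge0.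
have i1 : intg M3 (fun x : mpoint => u x * 'D_(unit_vec j) psi x).
  apply: (intg_dom _ (intgZ (M * M') (intg_cube p L)) (dom u _ bu (b2 j) (z2 j))).
  exact: measurable_funM.
have i2 : intg M3 (fun x : mpoint => du x * psi x).
  apply: (intg_dom _ (intgZ (M * M') (intg_cube p L)) (dom du psi bdu b1 z1)).
  exact: measurable_funM.
rewrite -leb3E; apply/eqP; rewrite -addr_eq0 -IntD//; apply/eqP.
apply: (@line_zero _ j p _ (M * M' + M * M') L).
- exact: intg_meas (intgD i1 i2).
- move=> x; apply: le_trans (ler_normD _ _) _; rewrite [leRHS]mulrDl; apply: lerD.
    exact: (dom u (fun x => 'D_(unit_vec j) psi x) bu (b2 j) (z2 j)).
  exact: (dom du psi bdu b1 z1).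
move=> x [k kj kp].
(* [m] is the squared distance from [p] to the line, positive by the choice of the line, so the
   radius stays away from the singularity at 0. *)
pose c := co j p; pose m := \sum_(i < 3 | i != j) (co i x - co i p) ^+ 2.
have m0 : 0 < m.
  rewrite /m (bigD1 k)//= ltr_pwDl ?sumr_ge0// => [|i _]; last exact: sqr_ge0.
  by rewrite exprn_even_gt0//= subr_eq0.
have radE t : rad p (upd j x t) = Num.sqrt ((t - c) ^+ 2 + m).
  rewrite /rad (bigD1 j)//= co_upd eqxx; congr (Num.sqrt (_ + _)).
  by apply: eq_bigr => i ij; rewrite co_upd (negbTE ij).
(* Half the chord cut out of the line by the ball. If the line misses the ball the argument is not
   positive, the root is 0 by convention, and there is no interface. *)
pose rho := Num.sqrt (eta ^+ 2 - m).
have cutE t : (rad p (upd j x t) < eta) = (`|c - t| < rho).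
  rewrite radE distrC -[in LHS](ger0_norm (ltW eta0)) -!sqrtr_sqr.
  have [me|me] := ltP m (eta ^+ 2); last first.
    rewrite /rho (_ : Num.sqrt (eta ^+ 2 - m) = 0); last by apply/eqP; rewrite sqrtr_eq0 subr_le0.
    rewrite (ltNge (Num.sqrt _) 0) sqrtr_ge0 /=; apply/negbTE; rewrite -leNgt ler_sqrt; last first.
      by rewrite addr_ge0 ?sqr_ge0// ltW.
    by rewrite (le_trans me)// lerDr sqr_ge0.
  rewrite /rho !ltr_sqrt ?subr_gt0//; last by rewrite exprn_gt0.
  by rewrite ltrBrDr.
have pl := radpair_line _ _ pXi m0.
have Xl X Y (XY : radpair X Y) t : is_derive t (1 : R)
    (fun s => X (Num.sqrt ((s - c) ^+ 2 + m)) * pi (upd j x s))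
    (X (Num.sqrt ((t - c) ^+ 2 + m)) * dpi + Y (Num.sqrt ((t - c) ^+ 2 + m)) * (t - c) * pi (upd j x t)).
  have h := is_deriveM (radpair_line c t XY m0).1 (dpiE x t).
  by apply: (is_derive_eq h); rewrite /GRing.scale /=; ring.
have Xc X Y (XY : radpair X Y) : continuous (fun t => X (Num.sqrt ((t - c) ^+ 2 + m)) * dpi +
    Y (Num.sqrt ((t - c) ^+ 2 + m)) * (t - c) * pi (upd j x t)).
  move=> t; have [d1 c1] := radpair_line c t XY m0.
  apply: cvgD; apply: cvgM.
  - by apply: differentiable_continuous; apply/derivable1_diffP; case: d1.
  - exact: cvg_cst.
  - by apply: cvgM; [exact: c1|apply: cvgB; [exact: cvg_id|exact: cvg_cst]].
  - by apply: differentiable_continuous; apply/derivable1_diffP; case: (dpiE x t).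
have := @line_ibp R _ _ _ _ (fun t => psi (upd j x t)) (fun t => 'D_(unit_vec j) psi (upd j x t)) c rho L
  (Xl _ _ pXo) (Xl _ _ pXi) (fun t => derive_upd (derpsi _)) (Xc _ _ pXo) (Xc _ _ pXi).
move=> /(_ _ _ L0) <-.
- apply: Int_ext => t; rewrite /u /du /cutr cutE radE co_upd eqxx.
  by case: ifP => _.
- have cu := @continuous_upd j x.
  by move=> t; apply: (@continuous_comp _ _ _ (upd j x) (fun y => 'D_(unit_vec j) psi y)); [exact: cu|exact: cd].
- move=> r0; have me : 0 <= eta ^+ 2 - m by rewrite ltW// -sqrtr_gt0.
  have e s : s ^+ 2 = eta ^+ 2 - m -> Num.sqrt (s ^+ 2 + m) = eta.
    by move=> ->; rewrite subrK sqrtr_sqr ger0_norm// ltW.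
  have ee : rho ^+ 2 = eta ^+ 2 - m by rewrite sqr_sqrtr.
  rewrite addrAC subrr add0r e// (addrAC c) subrr add0r e ?sqrrN//.
  by rewrite agree.
- move=> t hL; have nc : ~ cube p L (upd j x t).
    rewrite /cube /= -!co0 -!co1 -!co2 => -[k0 k1 k2]; move: hL; apply/negP; rewrite -ltNge /c.
    have hk i : `|co i p - co i (upd j x t)| < L by move: i; apply: I3P.
    by have := hk j; rewrite co_upd eqxx.
  by split; [exact: z1|exact: z2].
Qed.

End RadialIBP.

(** * The explicit background field *)

Section Profile.
Context {R : realType}.
Implicit Types l r k eta : R.

(** [prE l] is the radial solution [exp(l r) / r] of [Laplacian u = l^2 u] away from 0; [prG] is its
    derivative divided by [r], and [prH] the derivative of [prG] divided by [r]. *)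
Definition prE l r := expR (l * r) * r^-1.
Definition prG l r := expR (l * r) * (l * r^-1 ^+ 2 - r^-1 ^+ 3).
Definition prH l r := expR (l * r) * (l ^+ 2 * r^-1 ^+ 3 - 3 * l * r^-1 ^+ 4 + 3 * r^-1 ^+ 5).

Lemma is_derive_expl l r : is_derive r (1 : R) (fun s => expR (l * s)) (l * expR (l * r)).
Proof.
have h1 : is_derive r (1 : R) (fun s : R => l * s) l.
  by have h := is_deriveZ (f := id) l (is_derive_id r (1 : R)); apply: (is_derive_eq h); rewrite [_ *: _]mulr1.
have := @is_derive1_comp R expR (fun s => l * s) r _ _ (is_derive_expR _) h1.
by move=> h; apply: (is_derive_eq h); rewrite mulrC.
Qed.

Lemma is_derive_invn n r : 0 < r ->
  is_derive r (1 : R) (fun s => s^-1 ^+ n) (- n%:R * r^-1 ^+ n.+1).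
Proof.
move=> r0; have rn : r != 0 by rewrite gt_eqF.
have hv : is_derive r (1 : R) (fun s : R => s^-1) (- (r ^- 2) *: 1).
  exact: (is_deriveV (f := id) rn).
elim: n => [|n IH].
  rewrite (_ : (fun s => _) = cst 1); last by apply/funext => s; rewrite expr0.
  by rewrite oppr0 mul0r; exact: is_derive_cst.
rewrite (_ : (fun s => s^-1 ^+ n.+1) = (fun s : R => s^-1) * (fun s => s^-1 ^+ n)); last first.
  by apply/funext => s; rewrite exprS.
apply: (is_derive_eq (is_deriveM hv IH)).
by rewrite /GRing.scale /= -natr1 !exprS expr0; field.
Qed.

Lemma radpair_EG l : radpair (prE l) (prG l).
Proof.
move=> r r0; have rn : r != 0 by rewrite gt_eqF.
have d1 := is_derive_expl l r.
have e (n : nat) := is_derive_invn n r0.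
split.
  have h := is_deriveM d1 (e 1%N).
  rewrite (_ : prE l = (fun s => expR (l * s)) * (fun s => s^-1 ^+ 1)); last first.
    by [].
  by apply: (is_derive_eq h); rewrite /prG /GRing.scale /=; field.
apply: differentiable_continuous; apply/derivable1_diffP.
have h := is_deriveM d1 (is_deriveB (is_deriveZ l (e 2%N)) (e 3%N)).
by case: h.
Qed.

Lemma radpair_GH l : radpair (prG l) (prH l).
Proof.
move=> r r0; have rn : r != 0 by rewrite gt_eqF.
have d1 := is_derive_expl l r.
have e (n : nat) := is_derive_invn n r0.
split.
  have h := is_deriveM d1 (is_deriveB (is_deriveZ l (e 2%N)) (e 3%N)).
  rewrite (_ : prG l = (fun s => expR (l * s)) * ((l \*: (fun s : R => s^-1 ^+ 2)) - (fun s => s^-1 ^+ 3))); last first.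
    by apply/funext => s; rewrite /prG.
  apply: (is_derive_eq h); rewrite /prH /GRing.scale /= -[(_ - _) r]/(l * r^-1 ^+ 2 - r^-1 ^+ 3).
  by field.
apply: differentiable_continuous; apply/derivable1_diffP.
have h := is_deriveM d1 (is_deriveD (is_deriveB (is_deriveZ (l ^+ 2) (e 3%N)) (is_deriveZ (3 * l) (e 4%N)))
  (is_deriveZ 3 (e 5%N))).
by case: h.
Qed.

Lemma radpairZ (c : R) X Y : radpair X Y -> radpair (fun r => c * X r) (fun r => c * Y r).
Proof.
move=> XY r r0; have [dX cY] := XY r r0; split.
  by have h := is_deriveZ c dX; apply: (is_derive_eq h); rewrite /GRing.scale /=; ring.
by apply: cvgM; [exact: cvg_cst|exact: cY].
Qed.

Lemma radpairB X Y X' Y' : radpair X Y -> radpair X' Y' ->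
  radpair (fun r => X r - X' r) (fun r => Y r - Y' r).
Proof.
move=> XY XY' r r0; have [dX cY] := XY r r0; have [dX' cY'] := XY' r r0; split.
  by have h := is_deriveB dX dX'; apply: (is_derive_eq h); rewrite mulrBr.
by apply: cvgB; [exact: cY|exact: cY'].
Qed.

Lemma radpairC (c : R) X Y : radpair X Y -> radpair (fun r => c - X r) (fun r => - Y r).
Proof.
move=> XY r r0; have [dX cY] := XY r r0; split.
  by have h := is_deriveB (is_derive_cst c r (1 : R)) dX; apply: (is_derive_eq h); rewrite sub0r mulrN.
by apply: cvgN; exact: cY.
Qed.

Variables (k eta : R).
Hypotheses (k0 : 0 < k) (eta0 : 0 < eta).

(* The convolution of the indicator of the ball of radius [eta] with the
   Yukawa kernel [expR (- k r) / (4 pi r)] is radial, with profile [Fi] for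
   [r < eta] and [Fo] for [r > eta]; [F1 = F' / r] and [F2 = F1' / r]. *)
Definition ampA := (k * eta * (expR (k * eta) + expR (- (k * eta))) -
   (expR (k * eta) - expR (- (k * eta)))) / (2 * k ^+ 3).
Definition ampB := (1 + k * eta) * expR (- (k * eta)) / (2 * k ^+ 3).

Definition Fo r := ampA * prE (- k) r.
Definition F1o r := ampA * prG (- k) r.
Definition F2o r := ampA * prH (- k) r.
Definition Fi r := k ^- 2 - ampB * (prE k r - prE (- k) r).
Definition F1i r := - (ampB * (prG k r - prG (- k) r)).
Definition F2i r := - (ampB * (prH k r - prH (- k) r)).

Lemma radpair_Fo : radpair Fo F1o. Proof. exact: radpairZ (radpair_EG _). Qed.
Lemma radpair_F1o : radpair F1o F2o. Proof. exact: radpairZ (radpair_GH _). Qed.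
Lemma radpair_Fi : radpair Fi F1i.
Proof. by apply: radpairC; apply: radpairZ; apply: radpairB; exact: radpair_EG. Qed.
Lemma radpair_F1i : radpair F1i F2i.
Proof.
have h := radpairC 0 (radpairZ ampB (radpairB (radpair_GH k) (radpair_GH (- k)))).
by rewrite /F1i (_ : (fun r => _) = (fun r => 0 - ampB * (prG k r - prG (- k) r)))//; apply/funext => r; rewrite sub0r.
Qed.

Lemma expR_inv (x : R) : expR x * expR (- x) = 1.
Proof. by rewrite -expRD subrr expR0. Qed.

(** [ampA] and [ampB] are the solution of the two matching conditions at [eta], for the value here
    and for the slope in [agree_F1]. With [x = k eta], [ampA] is [(x cosh x - sinh x) / k^3]. *)
Lemma agree_F : Fi eta = Fo eta.
Proof.
rewrite /Fi /Fo /ampA /ampB /prE mulNr.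
(* Only the relation [a * b = 1] between the two exponentials matters; after [a = b^-1] the identity
   is rational in [b]. *)
have := expR_inv (k * eta); move: (expR (k * eta)) (expR (- (k * eta))) => a b ab.
have bn : b != 0 by apply/eqP => b0; move: ab; rewrite b0 mulr0 => /eqP; rewrite eq_sym oner_eq0.
have ba : a = b^-1 by rewrite -[a]mulr1 -(mulfV bn) mulrA ab mul1r.
by rewrite ba; field; rewrite bn !gt_eqF.
Qed.

Lemma agree_F1 : F1i eta = F1o eta.
Proof.
rewrite /F1i /F1o /ampA /ampB /prG mulNr.
have := expR_inv (k * eta); move: (expR (k * eta)) (expR (- (k * eta))) => a b ab.
have bn : b != 0 by apply/eqP => b0; move: ab; rewrite b0 mulr0 => /eqP; rewrite eq_sym oner_eq0.
have ba : a = b^-1 by rewrite -[a]mulr1 -(mulfV bn) mulrA ab mul1r.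
by rewrite ba; field; rewrite bn !gt_eqF.
Qed.

(** For a radial function with profiles [F], [F1], [F2] the trace of the Hessian is [3 F1 + r^2 F2],
    so this is the equation [Laplacian u = l^2 u]. *)
Lemma helm_E l r : 0 < r -> 3 * prG l r + r ^+ 2 * prH l r = l ^+ 2 * prE l r.
Proof. by move=> r0; rewrite /prG /prH /prE; field; rewrite gt_eqF. Qed.

Lemma helm_o r : 0 < r -> 3 * F1o r + r ^+ 2 * F2o r = k ^+ 2 * Fo r.
Proof.
move=> r0; rewrite /F1o /F2o /Fo; have := helm_E (- k) r0; rewrite sqrrN => h.
by transitivity (ampA * (3 * prG (- k) r + r ^+ 2 * prH (- k) r)); [ring|rewrite h; ring].
Qed.

Lemma helm_i r : 0 < r -> 3 * F1i r + r ^+ 2 * F2i r = k ^+ 2 * Fi r - 1.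
Proof.
move=> r0; rewrite /F1i /F2i /Fi; have := helm_E (- k) r0; rewrite sqrrN => h.
have h' := helm_E k r0.
transitivity (- (ampB * ((3 * prG k r + r ^+ 2 * prH k r) - (3 * prG (- k) r + r ^+ 2 * prH (- k) r)))); first by ring.
by rewrite h h'; field; rewrite gt_eqF.
Qed.

Lemma sinh_bound (x : R) : 0 <= x -> 0 <= expR x - expR (- x) <= 2 * x * expR x.
Proof.
move=> x0; have xx : - x <= x by lra.
rewrite subr_ge0 ler_expR xx /=.
have h1 := expR_ge1Dx (- x); have := expR_inv x; have e0 := expR_gt0 x.
have h2 : expR x * (1 - x) <= expR x * expR (- x) by rewrite ler_pM2l.
have e1 : 1 <= expR x by have := expR_ge1Dx x; lra.
have : x * 1 <= x * expR x by rewrite ler_wpM2l.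
by nra.
Qed.

(** The derivative of [x cosh x - sinh x] is [x sinh x], of second order at 0, so the function is of
    third order there. This cancels the factor [r^-3] in [prG k r - prG (- k) r]. *)
Lemma sinh_cosh_bound (x : R) : 0 <= x ->
  0 <= x * (expR x + expR (- x)) - (expR x - expR (- x)) <= 2 * x ^+ 3 * expR x.
Proof.
move=> x0.
pose f := fun t : R => t * (expR t + expR (- t)) - (expR t - expR (- t)).
pose df := fun t : R => t * (expR t - expR (- t)).
have dN t : is_derive t (1 : R) (fun s : R => expR (- s)) (- expR (- t)).
  have := is_derive_expl (- 1) t; rewrite !mulN1r.
  by rewrite (_ : (fun s => expR (- 1 * s)) = (fun s => expR (- s)))//; apply/funext => s; rewrite mulN1r.
have dfP t : is_derive t (1 : R) f (df t).
  have h := is_deriveB (is_deriveM (is_derive_id t (1 : R)) (is_deriveD (is_derive_expR t) (dN t)))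
     (is_deriveB (is_derive_expR t) (dN t)).
  by apply: (is_derive_eq h); rewrite /df /GRing.scale /= -[(_ + _) t]/(expR t + expR (- t)); ring.
have cf : {within `[0, x], continuous f}.
  by apply: continuous_subspaceT; exact: is_derive_continuous dfP.
have [c] := MVT_segment x0 (fun t _ => dfP t) cf.
rewrite in_itv /= => /andP[c0 cx].
have f0 : f 0 = 0 by rewrite /f mul0r sub0r oppr0 subrr oppr0.
rewrite f0 !subr0 -/(f x) => ->.
have /andP[s0 s1] := sinh_bound c0.
rewrite /df; apply/andP; split; first by rewrite !mulr_ge0.
have ec : expR c <= expR x by rewrite ler_expR.
have h1 : c * (expR c - expR (- c)) <= x * (2 * x * expR x).
  apply: ler_pM => //; apply: le_trans s1 _.
  by apply: ler_pM => //; rewrite ?mulr_ge0 ?expR_ge0// ler_wpM2l.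
apply: le_trans (ler_wpM2r x0 h1) _.
by rewrite le_eqVlt; apply/orP; left; apply/eqP; ring.
Qed.

Lemma ampB_ge0 : 0 <= ampB.
Proof.
by rewrite /ampB divr_ge0 ?mulr_ge0 ?exprn_ge0 ?expR_ge0 ?addr_ge0 ?mulr_ge0// ltW.
Qed.

(** The singularities at the centre cancel in the differences that define [Fi] and [F1i]. The
    profile [F2i] is needed only with the factor [r ^+ 2] that it carries in the Hessian, and there
    the equation itself bounds it. *)
Lemma inner_bound : exists2 C : R, 0 <= C & forall r, 0 <= r -> r < eta ->
  [/\ `|Fi r| <= C, `|F1i r| <= C & `|F2i r| * r ^+ 2 <= C].
Proof.
have k0' := ltW k0; pose e := expR (k * eta); pose B := ampB.
have B0 : 0 <= B := ampB_ge0.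
have e0 : 0 <= e by exact: expR_ge0.
pose c0 := k ^- 2 + B * (2 * k * e); pose c1 := B * (2 * k ^+ 3 * e).
have h0 : 0 <= k ^- 2 by rewrite invr_ge0 exprn_ge0// ltW.
have k20' : 0 <= 2 * k by apply: mulr_ge0.
have ke0 : 0 <= 2 * k * e by apply: mulr_ge0.
have hB : 0 <= B * (2 * k * e) by apply: mulr_ge0.
have c00 : 0 <= c0 by apply: addr_ge0.
have k3 : 0 <= k ^+ 3 by apply: exprn_ge0.
have k3' : 0 <= 2 * k ^+ 3 by apply: mulr_ge0.
have c10 : 0 <= c1 by apply: mulr_ge0 => //; apply: mulr_ge0.
have k20 : 0 <= k ^+ 2 by exact: sqr_ge0.
pose d := k ^+ 2 * c0 + 1 + 3 * c1; pose C := c0 + c1 + d.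
have d0 : 0 <= d by apply: addr_ge0; [apply: addr_ge0 => //|]; apply: mulr_ge0.
have cC0 : c0 <= C by rewrite /C -addrA lerDl; apply: addr_ge0.
have cC1 : c1 <= C by rewrite /C addrAC lerDr; apply: addr_ge0.
have cCd : d <= C by rewrite /C lerDr; apply: addr_ge0.
have kC : k ^- 2 <= C by apply: le_trans cC0; rewrite /c0 lerDl.
have C0 : 0 <= C := le_trans c00 cC0.
exists C => //.
(* At [r = 0] the convention [0^-1 = 0] gives [Fi] the value [k ^- 2] and the other two profiles the
   value 0. *)
move=> r; rewrite le_eqVlt => /orP[/eqP<- _|r0 re].
  have z l n : (0 : R)^-1 ^+ n.+1 = 0 by rewrite invr0 exprS mul0r.
  rewrite /Fi /F1i /F2i /prE /prG /prH invr0 !mulr0 subrr mulr0 subr0 expr0n /= mulr0.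
  split.
  - by rewrite ger0_norm.
  - by rewrite !exprS !mul0r !mulr0 subr0 !mulr0 subrr mulr0 oppr0 normr0.
  - by rewrite ?expr0n /= ?mulr0.
have x0 : 0 <= k * r by rewrite mulr_ge0// ltW.
have ee : expR (k * r) <= e by rewrite ler_expR ler_pM2l// ltW.
have ri : 0 < r^-1 by rewrite invr_gt0.
have E1 : 0 <= prE k r - prE (- k) r <= 2 * k * e.
  have /andP[s0 s1] := sinh_bound x0.
  have -> : prE k r - prE (- k) r = (expR (k * r) - expR (- (k * r))) * r^-1.
    by rewrite /prE mulNr mulrBl.
  rewrite mulr_ge0 ?(ltW ri)//= ler_pdivrMr//.
  apply: le_trans s1 _; rewrite [leRHS]mulrAC -[2 * k * r]mulrA.
  by rewrite ler_wpM2l// mulr_ge0.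
have G1 : 0 <= prG k r - prG (- k) r <= 2 * k ^+ 3 * e.
  have /andP[s0 s1] := sinh_cosh_bound x0.
  have -> : prG k r - prG (- k) r = (k * r * (expR (k * r) + expR (- (k * r))) - (expR (k * r) - expR (- (k * r)))) * r^-1 ^+ 3.
    by rewrite /prG mulNr; field; rewrite gt_eqF.
  have r3 : 0 < r ^+ 3 by rewrite exprn_gt0.
  rewrite exprVn mulr_ge0 ?invr_ge0 ?(ltW r3)//= ler_pdivrMr//.
  apply: le_trans s1 _; rewrite exprMn [leRHS]mulrAC [2 * k ^+ 3 * _]mulrAC mulrA.
  rewrite [2 * k ^+ 3 * r ^+ 3]mulrAC.
  apply: ler_wpM2l => //; apply: mulr_ge0 => //; apply: mulr_ge0 => //; exact: ltW.
have FiB : `|Fi r| <= c0.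
  move/andP: E1 => [e1 e2]; rewrite /Fi /c0 -/B.
  apply: le_trans (ler_normB _ _) _; rewrite ger0_norm//; apply: lerD => //.
  by rewrite ger0_norm; [apply: ler_wpM2l|apply: mulr_ge0].
have F1B : `|F1i r| <= c1.
  move/andP: G1 => [e1 e2]; rewrite /F1i /c1 -/B normrN.
  by rewrite ger0_norm; [apply: ler_wpM2l|apply: mulr_ge0].
split.
- exact: le_trans FiB _.
- exact: le_trans F1B _.
apply: le_trans cCd.
rewrite -[r ^+ 2]ger0_norm ?sqr_ge0// -normrM.
have -> : F2i r * r ^+ 2 = k ^+ 2 * Fi r - 1 - 3 * F1i r.
  by rewrite -helm_i//; ring.
apply: le_trans (ler_normB _ _) _.
apply: (le_trans (lerD (ler_normB _ _) (lexx _))).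
rewrite normr1 (normrM (k ^+ 2)) (normrM 3) (ger0_norm k20) (ger0_norm (ler0n R 3)).
apply: lerD; last by rewrite ler_wpM2l.
by rewrite lerD2r ler_wpM2l.
Qed.

End Profile.

Section Decay.
Context {R : realType}.
Local Notation point := (R * R * R)%type.
Local Notation mpoint := (measurableTypeR R * measurableTypeR R * measurableTypeR R)%type.
Local Notation leb := (@lebesgue_measure R).
Local Notation M3 := (@leb3s R).
Variables (p : point) (k eta : R).
Hypotheses (k0 : 0 < k) (eta0 : 0 < eta).

Lemma measurable_expl (c : R) : measurable_fun setT (fun r : R => expR (c * r)).
Proof.
by apply: continuous_measurable_fun; apply: is_derive_continuous => t; exact: is_derive_expl.
Qed.

Lemma measurable_invn n : measurable_fun setT (fun r : R => r^-1 ^+ n).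
Proof. by apply: measurable_funX; exact: measurable_invr. Qed.

Lemma measurable_prE l : measurable_fun setT (@prE R l).
Proof. by apply: measurable_funM; [exact: measurable_expl|exact: measurable_invr]. Qed.
Lemma measurable_prG l : measurable_fun setT (@prG R l).
Proof.
apply: measurable_funM; first exact: measurable_expl.
by apply: measurable_funB; [apply: measurable_funM => //|]; exact: measurable_invn.
Qed.
Lemma measurable_prH l : measurable_fun setT (@prH R l).
Proof.
apply: measurable_funM; first exact: measurable_expl.
by apply: measurable_funD; [apply: measurable_funB|]; apply: measurable_funM => //; exact: measurable_invn.
Qed.

Lemma measurable_cutr (X Y : R -> R) : measurable_fun setT X -> measurable_fun setT Y ->
  measurable_fun setT (cutr eta X Y).
Proof.
by move=> mX mY; apply: measurable_fun_ifT => //; exact: measurable_fun_ltr.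
Qed.

Definition pF := cutr eta (Fi k eta) (Fo k eta).
Definition pF1 := cutr eta (F1i k eta) (F1o k eta).
Definition pF2 := cutr eta (F2i k eta) (F2o k eta).

Lemma measurable_pF : measurable_fun setT pF.
Proof.
apply: measurable_cutr.
  apply: measurable_funB => //; apply: measurable_funM => //.
  by apply: measurable_funB; exact: measurable_prE.
by apply: measurable_funM => //; exact: measurable_prE.
Qed.
Lemma measurable_pF1 : measurable_fun setT pF1.
Proof.
apply: measurable_cutr.
  apply: measurable_funN => //; apply: measurable_funM => //.
  by apply: measurable_funB; exact: measurable_prG.
by apply: measurable_funM => //; exact: measurable_prG.
Qed.
Lemma measurable_pF2 : measurable_fun setT pF2.
Proof.
apply: measurable_cutr.
  apply: measurable_funN => //; apply: measurable_funM => //.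
  by apply: measurable_funB; exact: measurable_prH.
by apply: measurable_funM => //; exact: measurable_prH.
Qed.

Lemma outer_bound : exists2 C : R, 0 <= C & forall r, eta <= r ->
  [/\ `|Fo k eta r| <= C * expR (- (k * r)), `|F1o k eta r| <= C * expR (- (k * r)),
      `|F1o k eta r| * r <= C * expR (- (k * r)) & `|F2o k eta r| * r ^+ 2 <= C * expR (- (k * r))].
Proof.
pose A := `|ampA k eta|; pose h := eta^-1.
have A0 : 0 <= A by exact: normr_ge0.
have h0 : 0 <= h by rewrite invr_ge0 ltW.
have k0' := ltW k0.
pose c0 := A * h; pose c1 := A * (k * h ^+ 2 + h ^+ 3); pose c2 := A * (k * h + h ^+ 2).
have hn n : 0 <= h ^+ n by exact: exprn_ge0.
have s1 : 0 <= k * h ^+ 2 + h ^+ 3 by apply: addr_ge0 => //; apply: mulr_ge0.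
have s2 : 0 <= k * h + h ^+ 2 by apply: addr_ge0 => //; apply: mulr_ge0.
have c00 : 0 <= c0 by apply: mulr_ge0.
have c10 : 0 <= c1 by apply: mulr_ge0.
have c20 : 0 <= c2 by apply: mulr_ge0.
pose d := k ^+ 2 * c0 + 3 * c1.
have k2 : 0 <= k ^+ 2 by exact: sqr_ge0.
have d0 : 0 <= d by apply: addr_ge0; apply: mulr_ge0.
pose C := c0 + c1 + c2 + d.
have [q0 q1 q2 q3] : [/\ c0 <= C, c1 <= C, c2 <= C & d <= C] by rewrite /C; split; lra.
exists C; first exact: le_trans q0.
move=> r er; have r0 : 0 < r by exact: lt_le_trans er.
set e := expR (- (k * r)); have e0 : 0 <= e by exact: expR_ge0.
have i0 : 0 <= r^-1 by rewrite invr_ge0 ltW.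
have ih : r^-1 <= h by rewrite lef_pV2 ?posrE.
have ihn n : r^-1 ^+ n <= h ^+ n by rewrite lerXn2r ?nnegrE.
have b0 : `|Fo k eta r| <= c0 * e.
  rewrite /Fo /prE mulNr -/e normrM (ger0_norm (mulr_ge0 e0 i0)) -/A /c0 -[leRHS]mulrA (mulrC h).
  by apply: ler_wpM2l => //; apply: ler_wpM2l.
have G1 : F1o k eta r = - (ampA k eta * (e * (k * r^-1 ^+ 2 + r^-1 ^+ 3))).
  by rewrite /F1o /prG mulNr -/e; ring.
have i1 : 0 <= k * r^-1 ^+ 2 + r^-1 ^+ 3.
  by apply: addr_ge0; [apply: mulr_ge0 => //|]; exact: exprn_ge0.
have b1 : `|F1o k eta r| <= c1 * e.
  rewrite G1 normrN normrM (ger0_norm (mulr_ge0 e0 i1)) -/A /c1 -[leRHS]mulrA [X in _ <= A * X]mulrC.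
  apply: ler_wpM2l => //; apply: ler_wpM2l => //; apply: lerD => //; exact: ler_wpM2l.
have b2 : `|F1o k eta r| * r <= c2 * e.
  rewrite G1 normrN normrM (ger0_norm (mulr_ge0 e0 i1)) -/A /c2.
  have -> : A * (e * (k * r^-1 ^+ 2 + r^-1 ^+ 3)) * r = A * (e * (k * r^-1 + r^-1 ^+ 2)).
    by field; rewrite gt_eqF.
  rewrite -[leRHS]mulrA [X in _ <= A * X]mulrC.
  apply: ler_wpM2l => //; apply: ler_wpM2l => //; apply: lerD => //; exact: ler_wpM2l.
have w c : c <= C -> c * e <= C * e by move=> h'; apply: ler_wpM2r.
split; [exact: le_trans b0 (w _ q0)|exact: le_trans b1 (w _ q1)|exact: le_trans b2 (w _ q2)|].
apply: le_trans (w _ q3).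
rewrite -[r ^+ 2](ger0_norm (sqr_ge0 r)) -normrM.
have -> : F2o k eta r * r ^+ 2 = k ^+ 2 * Fo k eta r - 3 * F1o k eta r.
  by rewrite -helm_o//; ring.
apply: le_trans (ler_normB _ _) _.
rewrite (normrM (k ^+ 2)) (normrM 3) (ger0_norm k2) (ger0_norm (ler0n R 3)).
have -> : d * e = k ^+ 2 * (c0 * e) + 3 * (c1 * e) by rewrite /d; ring.
apply: lerD; [exact: ler_wpM2l b0|].
by apply: ler_wpM2l b1; exact: ler0n.
Qed.

Lemma profile_bound : exists2 C : R, 0 <= C & forall r, 0 <= r ->
  [/\ `|pF r| <= C * expR (- (k * r)), `|pF1 r| <= C * expR (- (k * r)),
      `|pF1 r| * r <= C * expR (- (k * r)) & `|pF2 r| * r ^+ 2 <= C * expR (- (k * r))].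
Proof.
have [Co Co0 ho] := outer_bound.
have [Ci Ci0 hi] := inner_bound k0 eta0.
pose E := expR (k * eta); have E0 : 0 <= E := expR_ge0 _.
have D0 : 0 <= Ci * (1 + eta) * E by rewrite !mulr_ge0// addr_ge0// ltW.
(* Inside the ball the exponential is at least [expR (- (k * eta))], whence the factor [E]; the
   factor [1 + eta] covers the extra [r] in the third bound. *)
exists (Co + Ci * (1 + eta) * E); first exact: addr_ge0.
move=> r r0; rewrite /pF /pF1 /pF2 /cutr; have e0 := expR_ge0 (- (k * r)).
case: ltP => h.
  have [h0 h1 h2] := hi r r0 h.
  have eE : 1 <= E * expR (- (k * r)).
    rewrite -expRD; apply: le_trans (expR_ge1Dx _); rewrite lerDl subr_ge0 ler_pM2l//.
    exact: ltW.
  have w : Ci * (1 + eta) <= (Co + Ci * (1 + eta) * E) * expR (- (k * r)).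
    rewrite mulrDl -[X in _ <= _ + X]mulrA; apply: ler_wpDl; first exact: mulr_ge0.
    by rewrite ler_peMr// mulr_ge0// addr_ge0// ltW.
  have w1 : Ci <= Ci * (1 + eta) by rewrite ler_peMr// lerDl ltW.
  split.
  - exact: le_trans h0 (le_trans w1 w).
  - exact: le_trans h1 (le_trans w1 w).
  - apply: le_trans w; apply: ler_pM => //; apply: le_trans (ltW h) _; rewrite lerDr; exact: ler01.
  - exact: le_trans h2 (le_trans w1 w).
have [h0 h1 h2 h3] := ho r h.
have w : Co * expR (- (k * r)) <= (Co + Ci * (1 + eta) * E) * expR (- (k * r)).
  by apply: ler_wpM2r => //; rewrite lerDl.
by split; apply: le_trans w.
Qed.

Lemma cvg_expN (c : R) : 0 < c -> expR (- c * t) @[t --> +oo] --> 0.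
Proof.
move=> c0; apply/cvgrPdist_le => e e0; near=> t.
rewrite sub0r normrN ger0_norm ?expR_ge0// mulNr expRN -[e]invrK lef_pV2 ?posrE ?expR_gt0 ?invr_gt0//.
apply: le_trans (expR_ge1Dx _); apply: (@le_trans _ _ (c * t)); last by rewrite lerDr.
by rewrite -ler_pdivrMl//; near: t; apply: nbhs_pinfty_ge; rewrite num_real.
Unshelve. all: by end_near. Qed.

Lemma intg_exp_abs (c a : R) : 0 < c -> intg leb (fun t : R => expR (- (c * `|t - a|))).
Proof.
move=> c0.
have cf : continuous (fun t : R => expR (- (c * `|t|))).
  move=> t; apply: (@continuous_comp _ _ _ (fun t : R => - (c * `|t|)) expR); last exact: continuous_expR.
  by apply: cvgN; apply: cvgM; [exact: cvg_cst|exact: norm_continuous].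
have i0 : intg leb (fun t : R => expR (- (c * `|t|))).
  apply/integrableP; split.
    by apply/measurable_EFinP; exact: continuous_measurable_fun.
  under eq_integral do rewrite /= ger0_norm ?expR_ge0//.
  rewrite ge0_symfun_integralT//; last first.
    by move=> t; rewrite /= normrN.
  have -> : [set x : R | 0 <= x] = `[0, +oo[%classic by apply/seteqP; split => t /=; rewrite in_itv /= andbT.
  have -> : (\int[leb]_(x in `[0%R, +oo[) (expR (- (c * `|x|)))%:E)%E =
     (\int[leb]_(x in `[0%R, +oo[) (expR (- c * x))%:E)%E.
    by apply: eq_integral => t; rewrite inE /= in_itv /= andbT => t0; rewrite ger0_norm// mulNr.
  have dF t : is_derive t (1 : R) (fun t : R => - c^-1 * expR (- c * t)) (expR (- c * t)).
    have h := is_deriveZ (- c^-1) (is_derive_expl (- c) t).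
    by apply: (is_derive_eq h); rewrite /GRing.scale /= mulrA mulNr mulrN opprK mulVf ?gt_eqF// mul1r.
  rewrite (@ge0_continuous_FTC2y R _ (fun t : R => - c^-1 * expR (- c * t)) 0 0).
  - by rewrite -EFinB -EFinM ltry.
  - by move=> t _; exact: expR_ge0.
  - by apply: continuous_subspaceT; apply: is_derive_continuous => t; exact: is_derive_expl.
  - rewrite -(mulr0 (- c^-1)); apply: cvgM; first exact: cvg_cst.
    exact: cvg_expN.
  - by move=> t _; case: (dF t).
  - by apply: cvg_at_right_filter; exact: (is_derive_continuous dF).
  - by move=> t _; rewrite derive1E; case: (dF t).
apply: (intg_dom _ (intgZ (expR (c * `|a|)) i0)).
  apply: continuous_measurable_fun => t.
  apply: (@continuous_comp _ _ _ (fun t : R => t - a) (fun t : R => expR (- (c * `|t|)))); last exact: cf.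
  by apply: cvgB; [exact: cvg_id|exact: cvg_cst].
move=> t; rewrite ger0_norm ?expR_ge0// -expRD ler_expR.
have h : `|t| <= `|t - a| + `|a| by rewrite -[X in `|X| <= _](subrK a t) ler_normD.
by have := ler_wpM2l (ltW c0) h; rewrite mulrDr; lra.
Qed.

Definition dec (x : point) : R := expR (- (k * rad p x)).

Lemma sq_dec : sq M3 (dec : mpoint -> R).
Proof.
(* The radius is at least the mean of the three coordinate distances, so the square of [dec] is
   below a product of three one-dimensional exponentials of rate [2 * k / 3]. *)
have c0 : 0 < 2 * k / 3 by rewrite divr_gt0// mulr_gt0.
have [h _] := intg_prod3 (intg_exp_abs p.1.1 c0) (intg_exp_abs p.1.2 c0) (intg_exp_abs p.2 c0).
have md : measurable_fun setT (dec : mpoint -> R).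
  rewrite (_ : (dec : mpoint -> R) = (fun x => expR (- k * x)) \o (rad p : mpoint -> R)); last first.
    by apply/funext => x; rewrite /dec /= mulNr.
  by apply: measurableT_comp; [exact: measurable_expl|exact: measurable_rad].
apply/sqP; split => //.
apply: (intg_dom _ h); first exact: measurable_funX.
move=> x; rewrite /dec ger0_norm ?sqr_ge0// -expRM_natl -!expRD ler_expR.
have := co_le_rad 0 p x; have := co_le_rad 1 p x; have := co_le_rad 2 p x.
rewrite co0 co1 co2 !co0 !co1 !co2; set a := `|_|; set b := `|_|; set c := `|_| => h2 h1 h0'.
have -> : 2%:R * - (k * rad p x) = - (2 * k / 3 * (3 * rad p x)) by field.
rewrite -!opprD lerN2 -!mulrDr ler_wpM2l ?(ltW c0)//; lra.
Qed.

End Decay.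

(** * Test functions, symmetry of second derivatives, and a componentwise criterion for weak
    curls *)

Section TestFunctions.
Context {R : realType}.
Local Notation point := (R * R * R)%type.
Local Notation mpoint := (measurableTypeR R * measurableTypeR R * measurableTypeR R)%type.
Local Notation field := (point -> 'rV[R]_3).
Local Notation M3 := (@leb3s R).

Lemma derive_ray (V : normedModType R) (f : V -> R) (x v : V) (t : R) :
  derivable f (t *: v + x) v ->
  is_derive t (1 : R) (fun s => f (s *: v + x)) ('D_v f (t *: v + x)).
Proof.
move=> /line_derive h.
have h1 : is_derive t (1 : R) (fun s : R => s - t) 1.
  have h1 := is_deriveB (is_derive_id t (1 : R)) (is_derive_cst t t (1 : R)).
  by apply: (is_derive_eq h1); rewrite subr0.
rewrite -(subrr t) in h.
have := @is_derive1_comp R (fun s => f (s *: v + (t *: v + x))) (fun s => s - t) t _ _ h h1.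
rewrite mulr1 (_ : _ \o _ = (fun s => f (s *: v + x)))//.
by apply/funext => s /=; rewrite addrA -scalerDl subrK.
Qed.

(* The second difference of [f] over a small parallelogram is, by the mean
   value theorem applied twice, a value of either mixed derivative. *)
Lemma second_diff (V : normedModType R) (f : V -> R) (x u v : V) (h : R) : 0 <= h ->
  (forall y, derivable f y u) -> (forall y, derivable (fun y => 'D_u f y) y v) ->
  exists s t, [/\ 0 <= s <= h, 0 <= t <= h &
   f (h *: u + (h *: v + x)) - f (h *: u + x) - (f (h *: v + x) - f x) =
   'D_v (fun y => 'D_u f y) (s *: u + (t *: v + x)) * h * h].
Proof.
move=> h0 du dvu.
have cc (W : normedModType R) (g : W -> R) (y w : W) : (forall y, derivable g y w) ->
    continuous (fun s : R => g (s *: w + y)).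
  by move=> dg; apply: (@is_derive_continuous _ _ (fun s => 'D_w g (s *: w + y))) => t; apply: derive_ray.
have [s] := @MVT_segment R (fun s => f (s *: u + (h *: v + x)) - f (s *: u + x))
  (fun s => 'D_u f (s *: u + (h *: v + x)) - 'D_u f (s *: u + x)) 0 h h0
  (fun s _ => is_deriveB (derive_ray (du _)) (derive_ray (du _)))
  (continuous_subspaceT (fun s => cvgB (cc _ _ _ _ du s) (cc _ _ _ _ du s))).
rewrite in_itv /= => sh; rewrite !scale0r !add0r subr0 => e.
have [t] := @MVT_segment R (fun t => 'D_u f (t *: v + (s *: u + x)))
  (fun t => 'D_v (fun y => 'D_u f y) (t *: v + (s *: u + x))) 0 h h0
  (fun s _ => derive_ray (dvu _)) (continuous_subspaceT (cc _ _ _ _ dvu)).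
rewrite in_itv /= => th; rewrite !scale0r !add0r subr0 => e'.
exists s, t; split => //.
rewrite opprB addrACA [- _ + _]addrC -opprB in e *.
by rewrite e (addrCA (s *: u)) e' (addrCA (s *: u)).
Qed.

(** The second difference is symmetric in [u] and [v], so by [second_diff] some value of each mixed
    derivative close to [x] is the same number; by continuity this contradicts a gap between the two
    at [x]. *)
Lemma derive_sym (V : normedModType R) (f : V -> R) (u v x : V) : is_Ck 2 f ->
  'D_u (fun y => 'D_v f y) x = 'D_v (fun y => 'D_u f y) x.
Proof.
move=> [_ h]; have [du [_ hu]] := h u; have [dv [_ hv]] := h v.
have [dvu [cvu _]] := hu v; have [duv [cuv _]] := hv u.
have loc (g : V -> R) : continuous g -> forall e : R, 0 < e -> exists2 d : R, 0 < d &
    forall y, `|y - x| < d -> `|g y - g x| < e.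
  move=> cg e e0; have /cvgrPdist_lt/(_ e e0) := cg x.
  move=> /nbhs_normP[d /= d0 hd]; exists d => // y yd; rewrite distrC.
  by apply: hd; rewrite /= /ball_ /= distrC.
apply/eqP; apply/contraT => ne.
have e0 : 0 < `|'D_u (fun y => 'D_v f y) x - 'D_v (fun y => 'D_u f y) x| / 2.
  by rewrite divr_gt0// normr_gt0 subr_eq0.
have [d1 d10 h1] := loc _ cuv _ e0; have [d2 d20 h2] := loc _ cvu _ e0.
pose d := Num.min d1 d2; have d0 : 0 < d by rewrite lt_min d10.
pose m := `|u| + `|v| + 1; have m0 : 0 < m by rewrite ltr_wpDl// addr_ge0.
(* With this side length the whole parallelogram spanned at [x] lies within [d] of [x]. *)
pose q := d / (2 * m); have q0 : 0 < q by rewrite divr_gt0// mulr_gt0.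
have [s [t [/andP[s0 s1] /andP[t0 t1] e1]]] := second_diff x (ltW q0) dv duv.
have [s' [t' [/andP[s'0 s'1] /andP[t'0 t'1] e2]]] := second_diff x (ltW q0) du dvu.
have near0 (a b : V) (r r' : R) : `|a| + `|b| <= `|u| + `|v| -> 0 <= r -> r <= q -> 0 <= r' -> r' <= q ->
    `|r *: a + (r' *: b + x) - x| < d.
  move=> ab r0 r1 r'0 r'1; rewrite addrA addrK; apply: le_lt_trans (ler_normD _ _) _.
  rewrite !normrZ !ger0_norm//; apply: (@le_lt_trans _ _ (q * m)).
    apply: (@le_trans _ _ (q * (`|a| + `|b|))).
      by rewrite mulrDr; apply: lerD; apply: ler_wpM2r.
    by apply: ler_wpM2l; [exact: ltW|rewrite /m; apply: le_trans ab _; rewrite lerDl].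
  by rewrite /q invfM mulrA divfK ?gt_eqF// ltr_pdivrMr// mulr_natr mulr2n ltrDl.
have k1 := h1 _ (lt_le_trans (near0 v u s t _ s0 s1 t0 t1) (_ : d <= d1)).
have k2 := h2 _ (lt_le_trans (near0 u v s' t' (lexx _) s'0 s'1 t'0 t'1) (_ : d <= d2)).
have e3 : f (q *: v + (q *: u + x)) - f (q *: v + x) - (f (q *: u + x) - f x) =
    f (q *: u + (q *: v + x)) - f (q *: u + x) - (f (q *: v + x) - f x).
  rewrite (addrCA (q *: v)); move: (f _) (f _) (f _) (f _) => b1 b2 b3 b4; clear; ring.
move: (etrans (etrans (esym e1) e3) e2) k1 k2 e0.
set B := ('D_u _ x); set C := ('D_v _ x); set A := ('D_u _ _); set A' := ('D_v _ _).
move=> E k1 k2 e0.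
have l1 : `|A - B| < `|B - C| / 2.
  by apply: k1; [rewrite addrC|rewrite ge_min lexx].
have l2 : `|A' - C| < `|B - C| / 2 by apply: k2; rewrite ge_min lexx orbT.
have AA : A = A' := mulIf (lt0r_neq0 q0) (mulIf (lt0r_neq0 q0) E).
rewrite -AA in l2; clear - l1 l2 e0; clearbody A B C.
have := ler_normB (A - C) (A - B); rewrite (_ : A - C - (A - B) = B - C); last by ring.
by lra.
Qed.

Lemma test_derive (f : point -> R) (j : 'I_3) : test_function setT f ->
  test_function setT (fun x => 'D_(unit_vec j) f x).
Proof.
move=> [Ck [K [cK KT K0]]]; split=> [k|].
  by have [_ /(_ (unit_vec j)) []] := Ck k.+1.
exists K; split => // x nK; apply: test_derive0 nK => //.
by apply: compact_closed => //; exact: norm_hausdorff.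
Qed.

Lemma test_sq (f : point -> R) : test_function setT f -> sq M3 (f : mpoint -> R).
Proof.
move=> tf; have [L [M [L0 M0 z1 _ [b1 _]]]] := test_props 0 tf.
apply: (@sq_dom_ae _ _ _ _ _ (fun x : mpoint => M * \1_(cube 0 L) x)).
- by apply: continuous_measurable3; case: tf => /(_ 0%N) /is_Ck_cont.
- by apply: sqZ; exact: sq_cube.
apply: aeW => x; have [c|n] := pselect (cube 0 L x).
  by rewrite indicE mem_set// mulr1 (ger0_norm M0).
by rewrite z1// normr0.
Qed.

Lemma curl_sum (U : 'I_3 -> R) (D : 'I_3 -> 'I_3 -> R) :
  \sum_m (U (m + 1) * D (m + 2) m - U (m + 2) * D (m + 1) m) =
  \sum_i U i * (D (i + 1) (i + 2) - D (i + 2) (i + 1)).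
Proof. by rewrite !sum3 !I3add; ring. Qed.

(** Apply the criterion to each component of a test field, add, and regroup by the components of
    [u]: this is the pairing with the curl of the test field. *)
Lemma weak_curlI (u c : field) : L2 u -> L2 c ->
  (forall (m : 'I_3) (psi : point -> R), test_function setT psi ->
    Int M3 (fun x : mpoint => u x ord0 (m + 1) * 'D_(unit_vec (m + 2)) psi x)
    - Int M3 (fun x : mpoint => u x ord0 (m + 2) * 'D_(unit_vec (m + 1)) psi x) =
    Int M3 (fun x : mpoint => c x ord0 m * psi x)) -> weak_curl u c.
Proof.
move=> Lu Lc h; split => // phi tphi.
have i1 i j k : intg M3 (fun x : mpoint => u x ord0 i * 'D_(unit_vec j) (fun y => phi y ord0 k) x).
  by apply: (@sqM _ _ _ _ (fun x : mpoint => u x ord0 i)); [rewrite leb3E; exact: Lu|exact/test_sq/test_derive].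
have i2 i k : intg M3 (fun x : mpoint => c x ord0 i * phi x ord0 k).
  by apply: (@sqM _ _ _ _ (fun x : mpoint => c x ord0 i)); [rewrite leb3E; exact: Lc|exact/test_sq].
rewrite -/(Int _ _) -/(Int _ _) -leb3E.
transitivity (\sum_(m < 3) (Int M3 (fun x : mpoint => u x ord0 (m + 1) * 'D_(unit_vec (m + 2)) (fun y => phi y ord0 m) x)
    - Int M3 (fun x : mpoint => u x ord0 (m + 2) * 'D_(unit_vec (m + 1)) (fun y => phi y ord0 m) x))).
  under eq_bigr do rewrite -IntB//.
  rewrite -Int_sum; last by move=> i; exact: intgB.
  apply: Int_ext => x; rewrite (curl_sum (fun i => u x ord0 i) (fun j k => 'D_(unit_vec j) (fun y => phi y ord0 k) x)) (_ : dot _ _ = \sum_i u x ord0 i * curl phi x ord0 i)//.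
  by apply: eq_bigr => i _; rewrite mxE.
under eq_bigr do rewrite h//.
by rewrite -Int_sum.
Qed.

End TestFunctions.

(** * The potential of the ball and the weak curls of the background field *)

Section Background.
Context {R : realType}.
Local Notation point := (R * R * R)%type.
Local Notation mpoint := (measurableTypeR R * measurableTypeR R * measurableTypeR R)%type.
Local Notation field := (point -> 'rV[R]_3).
Local Notation M3 := (@leb3s R).
Variables (p : point) (k eta : R).
Hypotheses (k0 : 0 < k) (eta0 : 0 < eta).

(* [pot] solves [k^2 pot - Laplacian pot = 1_B], [gpot] is its gradient and
   [hpot] its Hessian. *)
Definition pot (x : point) : R := pF k eta (rad p x).
Definition gpot (i : 'I_3) (x : point) : R := pF1 k eta (rad p x) * (co i x - co i p).
Definition hpot (i j : 'I_3) (x : point) : R :=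
  pF1 k eta (rad p x) * (i == j)%:R + pF2 k eta (rad p x) * (co j x - co j p) * (co i x - co i p).

Lemma hpotC i j x : hpot i j x = hpot j i x.
Proof. by rewrite /hpot eq_sym mulrAC. Qed.

Lemma measurable_prof (X : R -> R) : measurable_fun setT X ->
  measurable_fun setT (fun x : mpoint => X (rad p x)).
Proof. by move=> mX; apply: (measurableT_comp mX); exact: measurable_rad. Qed.

Lemma measurable_dco i : measurable_fun setT (fun x : mpoint => co i x - co i p).
Proof. by apply: measurable_funB => //; exact: measurable_co. Qed.

Lemma measurable_pot : measurable_fun setT (pot : mpoint -> R).
Proof. exact: measurable_prof (measurable_pF _ _). Qed.

Lemma measurable_gpot i : measurable_fun setT (gpot i : mpoint -> R).
Proof. exact: measurable_funM (measurable_prof (measurable_pF1 _ _)) (measurable_dco i). Qed.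

Lemma measurable_hpot i j : measurable_fun setT (hpot i j : mpoint -> R).
Proof.
apply: measurable_funD.
  by apply: measurable_funM => //; exact: measurable_prof (measurable_pF1 _ _).
apply: measurable_funM (measurable_dco i); apply: measurable_funM (measurable_dco j).
exact: measurable_prof (measurable_pF2 _ _).
Qed.

Lemma pot_bound : exists2 C : R, 0 <= C & forall x,
  [/\ `|pot x| <= C * dec p k x, forall i, `|gpot i x| <= C * dec p k x &
      forall i j, `|hpot i j x| <= C * dec p k x].
Proof.
have [C C0 h] := profile_bound k0 eta0.
have C2 : C <= C + C by rewrite lerDl.
exists (C + C); first exact: addr_ge0.
move=> x; have [h0 h1 h2 h3] := h _ (rad_ge0 p x).
have e0 : 0 <= dec p k x by exact: expR_ge0.
have w a : a <= C * dec p k x -> a <= (C + C) * dec p k x.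
  by move=> ha; apply: le_trans ha _; apply: ler_wpM2r.
split=> [|i|i j]; first exact: w.
  apply: w; rewrite /gpot normrM; apply: le_trans h2; apply: ler_wpM2l => //.
  exact: co_le_rad.
rewrite mulrDl; apply: le_trans (ler_normD _ _) _; apply: lerD.
  rewrite normrM; apply: le_trans h1; rewrite ler_piMr//.
  by case: eqP; rewrite ?normr1// normr0.
rewrite -mulrA normrM; apply: le_trans h3; apply: ler_wpM2l => //.
by rewrite normrM expr2; apply: ler_pM => //; exact: co_le_rad.
Qed.

Lemma sq_dec_dom (f : mpoint -> R) (C : R) : measurable_fun setT f ->
  (forall x, `|f x| <= C * dec p k x) -> sq M3 f.
Proof.
move=> mf hf; apply: (@sq_dom_ae _ _ _ _ _ (fun x : mpoint => C * dec p k x)) => //.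
  by apply: sqZ; exact: sq_dec.
by apply: aeW => x; apply: le_trans (hf x) (ler_norm _).
Qed.

Lemma sq_pot : sq M3 (pot : mpoint -> R).
Proof.
have [C _ h] := pot_bound.
by apply: (@sq_dec_dom _ C); [exact: measurable_pot|move=> x; have [] := h x].
Qed.

Lemma sq_gpot i : sq M3 (gpot i : mpoint -> R).
Proof.
have [C _ h] := pot_bound.
by apply: (@sq_dec_dom _ C); [exact: measurable_gpot|move=> x; have [_ /(_ i)] := h x].
Qed.

Lemma sq_hpot i j : sq M3 (hpot i j : mpoint -> R).
Proof.
have [C _ h] := pot_bound.
by apply: (@sq_dec_dom _ C); [exact: measurable_hpot|move=> x; have [_ _ /(_ i j)] := h x].
Qed.

Lemma dec_le1 x : dec p k x <= 1.
Proof. by rewrite -expR0 ler_expR oppr_le0 mulr_ge0 ?rad_ge0// ltW. Qed.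

Lemma pot_bound1 : exists M : R, forall x,
  [/\ `|pot x| <= M, forall i, `|gpot i x| <= M & forall i j, `|hpot i j x| <= M].
Proof.
have [C C0 h] := pot_bound; exists C => x; have [h1 h2 h3] := h x.
have w a : a <= C * dec p k x -> a <= C.
  by move=> ha; apply: le_trans ha _; rewrite ler_piMr// dec_le1.
by split=> [|i|i j]; apply: w.
Qed.

Lemma ibp_pot (j : 'I_3) (psi : point -> R) : test_function setT psi ->
  Int M3 (fun x : mpoint => pot x * 'D_(unit_vec j) psi x) =
  - Int M3 (fun x : mpoint => gpot j x * psi x).
Proof.
move=> tp; have [M h] := pot_bound1.
have h1 : pot =1 fun x => cutr eta (Fi k eta) (Fo k eta) (rad p x) * 1.
  by move=> x; rewrite mulr1.
have h2 : gpot j =1 fun x => cutr eta (Fi k eta) (Fo k eta) (rad p x) * 0 +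
     cutr eta (F1i k eta) (F1o k eta) (rad p x) * (co j x - co j p) * 1.
  by move=> x; rewrite mulr0 add0r mulr1.
have := @radial_ibp R p eta _ _ _ _ j (fun=> 1) 0 M psi eta0
  (@radpair_Fi R k eta) (@radpair_Fo R k eta) (agree_F k0 eta0) (fun x t => is_derive_cst (1 : R) t (1 : R)).
rewrite -(funext h1) -(funext h2) leb3E; apply => //.
- exact: measurable_pot.
- exact: measurable_gpot.
- by move=> x; have [] := h x.
- by move=> x; have [_ /(_ j)] := h x.
Qed.

Lemma ibp_gpot (i j : 'I_3) (psi : point -> R) : test_function setT psi ->
  Int M3 (fun x : mpoint => gpot i x * 'D_(unit_vec j) psi x) =
  - Int M3 (fun x : mpoint => hpot i j x * psi x).
Proof.
move=> tp; have [M h] := pot_bound1.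
have dd x t : is_derive t (1 : R) (fun s => co i (upd j x s) - co i p) ((i == j)%:R).
  have := eqVneq i j; case => [<-|ij].
    have h1 := is_deriveB (is_derive_id t (1 : R)) (is_derive_cst (co i p) t (1 : R)).
    rewrite (_ : (fun s => _) = id - cst (co i p)); last by apply/funext => s; rewrite co_upd eqxx.
    by apply: (is_derive_eq h1); rewrite subr0.
  rewrite (_ : (fun s => _) = cst (co i x - co i p)); last by apply/funext => s; rewrite co_upd (negbTE ij).
  exact: is_derive_cst.
have := @radial_ibp R p eta _ _ _ _ j (fun x => co i x - co i p) ((i == j)%:R) M psi eta0
  (@radpair_F1i R k eta) (@radpair_F1o R k eta) (agree_F1 k0 eta0) dd.
rewrite leb3E; apply => //.
- exact: measurable_gpot.
- exact: measurable_hpot.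
- by move=> x; have [_ /(_ i)] := h x.
- by move=> x; have [_ _ /(_ i j)] := h x.
Qed.

(* Both sides are integrals of the gradient against a mixed second derivative
   of the test function. *)
Lemma ibp_hpot (l i j : 'I_3) (psi : point -> R) : test_function setT psi ->
  Int M3 (fun x : mpoint => hpot l i x * 'D_(unit_vec j) psi x) =
  Int M3 (fun x : mpoint => hpot l j x * 'D_(unit_vec i) psi x).
Proof.
move=> tp; apply: oppr_inj.
apply: etrans (esym (ibp_gpot l i (test_derive j tp))) (etrans _ (ibp_gpot l j (test_derive i tp))).
by apply: Int_ext => x; exact: (congr1 (fun z => gpot l x * z) (derive_sym _ _ _ (tp.1 2%N))).
Qed.

(* At the center the identity holds thanks to [0^-1 = 0]. *)
Lemma pot_helm x : \sum_(i < 3) hpot i i x = k ^+ 2 * pot x - ((rad p x < eta)%R)%:R.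
Proof.
transitivity (3 * pF1 k eta (rad p x) + rad p x ^+ 2 * pF2 k eta (rad p x)).
  by rewrite rad2 /hpot !sum3 !eqxx (_ : (true : nat)%:R = 1 :> R)//; ring.
rewrite /pot /pF /pF1 /pF2 /cutr; have := rad_ge0 p x; rewrite le_eqVlt => /orP[/eqP<-|r0].
  rewrite eta0 /F1i /F2i /Fi /prE /prG invr0 !expr0n /= !(mulr0, mul0r, subrr, subr0, oppr0, addr0, add0r).
  by rewrite divff ?subrr// gt_eqF// exprn_gt0.
case: ltP => h; first by rewrite helm_i.
by rewrite helm_o// subr0.
Qed.

Variable (a : 'rV[R]_3).
Local Notation al i := (a ord0 i).

(* [Pf = k^2 pot a - grad div (pot a)] and [Nf = curl (pot a)], so that
   [curl Pf = k^2 Nf] and [curl Nf = 1_B a - Pf]. *)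
Definition Pf : field := fun x => \row_i (k ^+ 2 * pot x * al i - \sum_(j < 3) al j * hpot j i x).
Definition Nf : field := fun x => \row_i (gpot (i + 1) x * al (i + 2) - gpot (i + 2) x * al (i + 1)).

Lemma L2I (u : field) : (forall i, sq M3 (cmp u i)) -> L2 u.
Proof. by move=> h i; have := h i; rewrite leb3E. Qed.

Lemma L2_Pf : L2 Pf.
Proof.
apply: L2I => i; have h (c : R) f : sq M3 f -> sq M3 (fun x => c * f x) := @sqZ _ _ _ _ c f.
apply: (@sq_ext _ _ _ _ (fun x : mpoint => (k ^+ 2 * al i) * pot x +
   ((- al 0) * hpot 0 i x + ((- al 1) * hpot 1 i x + (- al 2) * hpot 2 i x)))).
  by move=> x; rewrite /cmp mxE sum3; ring.
apply: sqD; first exact: h sq_pot.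
by apply: sqD; [|apply: sqD]; apply: h; exact: sq_hpot.
Qed.

Lemma L2_Nf : L2 Nf.
Proof.
apply: L2I => i; have h (c : R) f : sq M3 f -> sq M3 (fun x => c * f x) := @sqZ _ _ _ _ c f.
apply: (@sq_ext _ _ _ _ (fun x : mpoint => al (i + 2) * gpot (i + 1) x + (- al (i + 1)) * gpot (i + 2) x)).
  by move=> x; rewrite /cmp mxE; ring.
by apply: sqD; apply: h; exact: sq_gpot.
Qed.

Lemma indic_sq : sq M3 (fun x : mpoint => \1_(eball p eta) x : R).
Proof.
have me : measurable_fun setT (fun x : mpoint => \1_(eball p eta) x : R).
  rewrite (_ : (fun x => _) = (fun x => if rad p x < eta then 1 else 0)).
    apply: measurable_fun_ifT => //; apply: measurable_fun_ltr => //; exact: measurable_rad.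
  apply/funext => x; rewrite indicE /eball; case: ifP => h.
    by rewrite mem_set//= edistE.
  by rewrite memNset//= edistE h.
(* On the ball [dec] is at least [expR (- (k * eta))], so a multiple of it dominates the
   indicator. *)
apply: (@sq_dec_dom _ (expR (k * eta))) => // x; rewrite indicE.
have [/set_mem /=|_] := boolP (x \in _); last by rewrite normr0 mulr_ge0 ?expR_ge0.
rewrite /eball /= edistE normr1 -expRD => h; rewrite -[X in X <= _]expR0 ler_expR subr_ge0.
by rewrite ler_pM2l// ltW.
Qed.

Lemma L2_src : L2 (fun x => \1_(eball p eta) x *: a).
Proof.
apply: L2I => i.
apply: (@sq_ext _ _ _ _ (fun x : mpoint => al i * \1_(eball p eta) x)).
  by move=> x; rewrite /cmp mxE mulrC.
exact: sqZ indic_sq.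
Qed.

(** The gradient of [div (pot a)] has no weak curl, by the symmetry in [ibp_hpot]; only
    [k^2 curl (pot a)] remains. *)
Lemma weak_curl_Pf : weak_curl Pf (fun x => k ^+ 2 *: Nf x).
Proof.
apply: weak_curlI => [||m psi tp]; [exact: L2_Pf|exact: L2Z L2_Nf|].
have sd j := test_sq (test_derive j tp); have sp := test_sq tp.
have e i j : Int M3 (fun x : mpoint => Pf x ord0 i * 'D_(unit_vec j) psi x) =
   - (k ^+ 2 * al i * Int M3 (fun x : mpoint => gpot j x * psi x)) -
   \sum_(l < 3) al l * Int M3 (fun x : mpoint => hpot l i x * 'D_(unit_vec j) psi x).
  have ih l : intg M3 (fun x : mpoint => hpot l i x * 'D_(unit_vec j) psi x).
    exact: sqM (sq_hpot _ _) (sd j).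
  have ip := sqM sq_pot (sd j).
  rewrite -mulrN -ibp_pot// -IntZ// -[X in - X](eq_bigr _ (fun l _ => IntZ _ (ih l))).
  rewrite -Int_sum; last by move=> l; exact: intgZ.
  rewrite -IntB; [|exact: intgZ|by apply: intg_sum => l; exact: intgZ].
  apply: Int_ext => x; rewrite mxE mulrBl mulr_suml; congr (_ - _).
    by rewrite -!mulrA (mulrCA (pot x)).
  by apply: eq_bigr => l _; rewrite mulrA.
have es : \sum_(l < 3) al l * Int M3 (fun x : mpoint => hpot l (m + 1) x * 'D_(unit_vec (m + 2)) psi x) =
    \sum_(l < 3) al l * Int M3 (fun x : mpoint => hpot l (m + 2) x * 'D_(unit_vec (m + 1)) psi x).
  by apply: eq_bigr => l _; exact: (congr1 (fun z => al l * z) (ibp_hpot l _ _ tp)).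
have ig j : intg M3 (fun x : mpoint => gpot j x * psi x) by exact: sqM (sq_gpot _) sp.
transitivity (k ^+ 2 * (al (m + 2) * Int M3 (fun x : mpoint => gpot (m + 1) x * psi x) -
   al (m + 1) * Int M3 (fun x : mpoint => gpot (m + 2) x * psi x))).
  apply: etrans (congr2 (fun y z => y - z) (e _ _) (e _ _)) _.
  apply: etrans (congr1 (fun y => _ - y - _) es) _.
  by move: (Int _ _) (Int _ _) (\sum_l _) => ? ? ?; ring.
apply: etrans (congr1 (fun z => k ^+ 2 * z) (etrans (congr2 (fun y z => y - z) (esym (IntZ _ (ig _)))
  (esym (IntZ _ (ig _)))) (esym (IntB (intgZ _ (ig _)) (intgZ _ (ig _)))))) _.
apply: etrans (esym (IntZ _ (intgB (intgZ _ (ig _)) (intgZ _ (ig _))))) _.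
by apply: Int_ext => x; rewrite !mxE; ring.
Qed.

(** This is [curl curl = grad div - Laplacian] applied to [pot a], with the Laplacian, the trace of
    [hpot], replaced by means of [pot_helm]. *)
Lemma weak_curl_Nf : weak_curl Nf (fun x => \1_(eball p eta) x *: a - Pf x).
Proof.
apply: weak_curlI => [||m psi tp]; [exact: L2_Nf|exact: L2B L2_src L2_Pf|].
have sd j := test_sq (test_derive j tp); have sp := test_sq tp.
have e i j : Int M3 (fun x : mpoint => Nf x ord0 i * 'D_(unit_vec j) psi x) =
   al (i + 1) * Int M3 (fun x : mpoint => hpot (i + 2) j x * psi x) -
   al (i + 2) * Int M3 (fun x : mpoint => hpot (i + 1) j x * psi x).
  have ig l : intg M3 (fun x : mpoint => gpot l x * 'D_(unit_vec j) psi x).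
    exact: sqM (sq_gpot _) (sd j).
  transitivity (al (i + 2) * Int M3 (fun x : mpoint => gpot (i + 1) x * 'D_(unit_vec j) psi x) -
    al (i + 1) * Int M3 (fun x : mpoint => gpot (i + 2) x * 'D_(unit_vec j) psi x)).
    rewrite -!IntZ// -IntB; [|exact: intgZ|exact: intgZ].
    by apply: Int_ext => x; rewrite mxE; ring.
  by apply: etrans (congr2 (fun y z => _ * y - _ * z) (ibp_gpot _ _ tp) (ibp_gpot _ _ tp)) _; ring.
have ih l j : intg M3 (fun x : mpoint => hpot l j x * psi x) by exact: sqM (sq_hpot _ _) sp.
pose I l j := Int M3 (fun x : mpoint => hpot l j x * psi x).
transitivity (\sum_(l < 3) al l * I l m - al m * \sum_(l < 3) I l l).
  have {}e i j : Int M3 (fun x : mpoint => Nf x ord0 i * 'D_(unit_vec j) psi x) = al (i + 1) * I (i + 2) j - al (i + 2) * I (i + 1) j by exact: e.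
  rewrite !e; have IC l j : I l j = I j l by apply: Int_ext => x; rewrite hpotC.
  move: m; apply: I3P; rewrite !I3add !sum3.
  - by rewrite (IC 1 0) (IC 2 0); ring.
  - by rewrite (IC 0 1) (IC 2 1); ring.
  - by rewrite (IC 0 2) (IC 1 2); ring.
rewrite /I -(eq_bigr _ (fun l _ => IntZ _ (ih l m))) -!Int_sum//; last by move=> l; exact: intgZ.
rewrite -IntZ; last exact: intg_sum.
rewrite -IntB; [|by apply: intg_sum => l; exact: intgZ|by apply: intgZ; exact: intg_sum].
apply: Int_ext => x; rewrite -mulr_suml pot_helm !mxE.
have -> : \1_(eball p eta) x = ((rad p x < eta)%R)%:R :> R.
  rewrite indicE; case h : (rad p x < eta)%R.
    by rewrite mem_set// /eball/= edistE.
  by rewrite memNset// /eball/= edistE h.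
rewrite (eq_bigr (fun l => al l * hpot l m x * psi x)); last by move=> l _; rewrite mulrA.
by rewrite -mulr_suml; ring.
Qed.

End Background.

(** * Riemann sums of the time-dependent fields *)

Section RiemannSums.
Context {R : realType}.
Variable T : R.
Hypothesis T0 : 0 < T.

(* Continuity on [0, T] with respect to a pseudo-distance [w] on parameters. *)
Definition edc (w : R -> R -> R) := forall t, 0 <= t <= T -> forall e : R, 0 < e ->
  exists2 d : R, 0 < d & forall s, 0 <= s <= T -> `|s - t| < d -> w s t < e.

(** The Heine-Cantor theorem, stated for a pseudo-distance so that it serves real functions and
    [L2]-valued ones alike. *)
Lemma edc_unif (w : R -> R -> R) : edc w -> 
  (forall r s t, w r t <= w r s + w s t) -> (forall s t, w s t = w t s) ->
  forall e : R, 0 < e -> exists2 d : R, 0 < d & forall s t, 0 <= s <= T -> 0 <= t <= T ->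
    `|s - t| < d -> w s t < e.
Proof.
move=> cw tri sym e e0.
pose P (d x : R) := forall s, 0 <= s <= T -> 0 <= x <= T -> `|s - x| < d -> w s x < e.
have cK : compact (`[0, T] : set R) by exact: segment_compact.
have := (compact_near_coveringP _).1 cK R (0^'+) P _.
case=> [x xK|d /= d0 hd].
  have xT : 0 <= x <= T by move: xK; rewrite /= in_itv.
  have e2 : 0 < e / 2 by rewrite divr_gt0.
  have [d d0 hd] := cw x xT _ e2.
  exists ([set y | `|x - y| < d / 2], [set y | y < d / 2]).
    split; last by apply: nbhs_right_lt; rewrite divr_gt0.
    by apply/nbhs_ballP; exists (d / 2); rewrite //= divr_gt0.
  move=> [y r] /= [xy rd] s sT yT sy.
  apply: le_lt_trans (tri s x y) _; rewrite [e]splitr; apply: ltrD.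
    apply: hd => //; rewrite -(subrK y s) -addrA [d]splitr; apply: le_lt_trans (ler_normD _ _) _.
    by apply: ltrD; [exact: lt_trans sy rd|rewrite distrC].
  by rewrite sym; apply: hd => //; rewrite distrC; apply: lt_le_trans xy _; rewrite ler_pdivrMr// ler_peMr ?ler1n// ltW.
have h := hd (d / 2).
exists (d / 2); first by rewrite divr_gt0.
move=> s t sT tT st; apply: h => //=.
- by rewrite sub0r normrN gtr0_norm ?divr_gt0// ltr_pdivrMr// ltr_pMr// ltr1n.
- by rewrite divr_gt0.
Qed.

Lemma within_edc (f : R -> R) :
  edc (fun s t => `|f s - f t|) <-> {within `[0, T], continuous f}.
Proof.
split=> [h|/subspace_continuousP h].
  apply/subspace_continuousP => x /=; rewrite in_itv /= => xT.
  apply/cvgrPdist_lt => e e0; have [d d0 hd] := h x xT e e0.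
  rewrite near_withinE; apply/nbhs_ballP; exists d => // s /= xs.
  rewrite in_itv /= => sT; rewrite distrC; apply: hd => //.
  by move: xs; rewrite /ball /= distrC.
move=> t tT e e0; have := h t; rewrite /= in_itv /= => /(_ tT) /cvgrPdist_lt /(_ e e0).
rewrite near_withinE => /nbhs_ballP [d /= d0 hd]; exists d => // s sT st.
by rewrite distrC; apply: hd; rewrite /= ?in_itv//= /ball /= distrC.
Qed.

Definition node (N i : nat) : R := T / N.+1%:R * i%:R.
(** Midpoints serve as tags because the Maxwell equations are given on the open time interval, so
    every tag has to be an interior time. *)
Definition mid (N i : nat) : R := T / N.+1%:R * (i%:R + 2^-1).

Lemma step_gt0 N : 0 < T / N.+1%:R.
Proof. by rewrite divr_gt0// ltr0Sn. Qed.

Lemma node_le N i : (i <= N.+1)%N -> 0 <= node N i <= T.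
Proof.
move=> iN; apply/andP; split.
  by apply: mulr_ge0; [exact: ltW (step_gt0 N)|exact: ler0n].
rewrite /node -mulrA [_^-1 * _]mulrC ler_piMr ?(ltW T0)//.
by rewrite ler_pdivrMr ?ltr0Sn// mul1r ler_nat.
Qed.

Lemma nodeS N i : node N i.+1 = node N i + T / N.+1%:R.
Proof. by rewrite /node -[i.+1%:R]natr1 mulrDr mulr1. Qed.

Lemma mid_in N i : node N i < mid N i < node N i.+1.
Proof.
have h := step_gt0 N; rewrite /node /mid -[i.+1%:R]natr1 !ltr_pM2l//.
by rewrite ltrDl invr_gt0 ltr0Sn/= ltrD2l invf_lt1 ?ltr0Sn// ltr1n.
Qed.

Lemma mid_oo N i : (i < N.+1)%N -> 0 < mid N i < T.
Proof.
move=> iN; have /andP[h1 h2] := mid_in N i.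
have /andP[h3 _] := node_le (ltnW iN); have /andP[_ h4] := node_le iN.
by rewrite (le_lt_trans h3 h1) (lt_le_trans h2 h4).
Qed.

(** On each cell the increment of [F] is the step times [f] at an intermediate point, which is less
    than two steps away from the tag. *)
Lemma riemann_mvt (F f : R -> R) (N : nat) (om : R) :
  {within `[0, T], continuous F} -> (forall t, 0 < t < T -> is_derive t (1 : R) F (f t)) ->
  (forall s t, 0 <= s <= T -> 0 <= t <= T -> `|s - t| < T / N.+1%:R + T / N.+1%:R -> `|f s - f t| <= om) ->
  `|\sum_(i < N.+1) T / N.+1%:R * f (mid N i) - (F T - F 0)| <= T * om.
Proof.
move=> cF dF hf; set h := T / N.+1%:R; have h0 : 0 < h := step_gt0 N.
have -> : F T - F 0 = \sum_(i < N.+1) (F (node N i.+1) - F (node N i)).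
  rewrite -(big_mkord xpredT (fun i => F (node N i.+1) - F (node N i))) telescope_sumr//.
  by rewrite /node mulr0 divfK.
rewrite -sumrB; apply: le_trans (ler_norm_sum _ _ _) _.
have -> : T * om = \sum_(i < N.+1) h * om.
  by rewrite sumr_const card_ord -mulr_natr mulrAC divfK.
apply: ler_sum => i _.
have /andP[i0 iT] := node_le (ltnW (ltn_ord i)); have /andP[j0 jT] := node_le (ltn_ord i).
have ij : node N i <= node N i.+1 by rewrite nodeS lerDl ltW.
have [c] : exists2 c, c \in `[node N i, node N i.+1] & F (node N i.+1) - F (node N i) = f c * (node N i.+1 - node N i).
  apply: MVT_segment => //.
    move=> x; rewrite in_itv /= => /andP[x0 x1]; apply: dF.
    by rewrite (le_lt_trans i0 x0) (lt_le_trans x1 jT).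
  apply: continuous_subspaceW cF => x /=; rewrite !in_itv /= => /andP[x0 x1].
  by rewrite (le_trans i0 x0) (le_trans x1 jT).
rewrite in_itv /= => /andP[c0 c1] ->.
have /andP[m0 m1] := mid_in N i.
rewrite nodeS [node N i + _]addrC addrK -/h [f c * _]mulrC -mulrBr normrM (gtr0_norm h0) ler_pM2l//.
apply: hf.
- by rewrite (le_trans i0 (ltW m0)) (le_trans (ltW m1) jT).
- by rewrite (le_trans i0 c0) (le_trans c1 jT).
rewrite -/h; move: c0 c1 m0 m1; rewrite nodeS -/h ltr_norml => c0 c1 m0 m1.
by apply/andP; split; lra.
Qed.

Lemma riemann_scalar (f : R -> R) : {within `[0, T], continuous f} -> forall e : R, 0 < e ->
  exists2 d : R, 0 < d & forall N : nat, T / N.+1%:R < d ->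
    `|\sum_(i < N.+1) T / N.+1%:R * f (mid N i) - \int[lebesgue_measure]_(t in `[0, T]) f t| <= e.
Proof.
move=> cf e e0.
have tri r s t : `|f r - f t| <= `|f r - f s| + `|f s - f t|.
  by apply: le_trans (ler_normD _ _); rewrite addrA subrK.
have eT : 0 < e / T by rewrite divr_gt0.
have [d d0 hd] := edc_unif ((within_edc f).2 cf) tri (fun s t => distrC _ _) eT.
exists (d / 2); first by rewrite divr_gt0.
move=> N hN.
have fi : lebesgue_measure.-integrable `[0, T] (EFin \o f).
  by apply: continuous_compact_integrable => //; exact: segment_compact.
pose F x := (\int[lebesgue_measure]_(t in `[0, x]) f t)%R.
have F0 : F 0 = 0 by rewrite /F set_itv1 Rintegral_set1.
have -> : (\int[lebesgue_measure]_(t in `[0, T]) f t)%R = F T - F 0 by rewrite F0 subr0.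
have eE : T * (e / T) = e by rewrite mulrC divfK// gt_eqF.
rewrite -[leRHS]eE; apply: riemann_mvt.
- exact: parameterized_integral_continuous (ltW T0) fi.
- move=> t /andP[t0 tT].
  have ct : {for t, continuous f}.
    have /(continuous_within_itvP _ T0) [h _ _] := cf.
    by apply: h; rewrite in_itv /= t0.
  have [h1 h2] := continuous_FTC1_closed tT fi t0 ct.
  have h3 : 'D_1 F t = f t := etrans (esym (derive1E F t)) h2.
  by apply: (@DeriveDef _ _ _ t (1 : R) F (f t)).
- move=> s t sT tT st; apply/ltW; apply: hd => //; apply: lt_trans st _.
  by rewrite [d]splitr; exact: ltrD.
Qed.

End RiemannSums.

(** * Calculus of [L2]-valued functions of time *)

Section L2Calculus.
Context {R : realType}.
Local Notation point := (R * R * R)%type.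
Local Notation field := (point -> 'rV[R]_3).
Variable T : R.
Hypothesis T0 : 0 < T.

Definition fd (u v : field) : field := fun x => u x - v x.

Lemma nrm_fdC u v : nrm (fd u v) = nrm (fd v u).
Proof. by congr Num.sqrt; apply: Int_ext => x; rewrite /fd -opprB dotNl dotNr opprK. Qed.

Lemma nrm_fd_tri u v w : L2 u -> L2 v -> L2 w -> nrm (fd u w) <= nrm (fd u v) + nrm (fd v w).
Proof.
move=> hu hv hw; apply: le_trans (nrmD (L2B hu hv) (L2B hv hw)).
by rewrite (nrm_ext (v := fun x => u x - v x + (v x - w x)))// => x; rewrite addrA subrK.
Qed.

Lemma L2norm_near0 (F : set_system R) {FF : Filter F} (u : R -> field) :
  L2norm (u s) @[s --> F] --> 0%E -> forall e : R, 0 < e -> 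
  \forall s \near F, L2 (u s) -> nrm (u s) < e.
Proof.
move=> cu e e0.
have ob : nbhs (0%E : \bar R) [set y | (y < e%:E)%E].
  by apply: open_nbhs_nbhs; split; [exact: open_ereal_lt_ereal|rewrite /= lte_fin].
have h : F (fun s => (L2norm (u s) < e%:E)%E) := cu _ ob.
apply: filterS h => s /= h Ls.
by move: h; rewrite L2normE// lte_fin.
Qed.

Lemma L2_continuousP (u : R -> field) : L2_continuous T u ->
  (forall t, 0 <= t <= T -> L2 (u t)) /\ edc T (fun s t => nrm (fd (u s) (u t))).
Proof.
move=> [Lu cu]; split => // t tT e e0.
have := L2norm_near0 (cu t tT) e0.
move=> /(_ (within_filter _ _)); rewrite near_withinE => /nbhs_ballP[d /= d0 hd].
exists d => // s sT st; apply: hd => //=.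
- by rewrite /ball /= distrC.
- exact: L2B (Lu _ sT) (Lu _ tT).
Qed.

Lemma ip_lip u v w : L2 u -> L2 v -> L2 w -> `|ip u w - ip v w| <= nrm (fd u v) * nrm w.
Proof. by move=> hu hv hw; rewrite -ipBl//; exact: ip_le_nrm (L2B hu hv) hw. Qed.

Lemma ip_edc (u : R -> field) (w : field) : (forall t, 0 <= t <= T -> L2 (u t)) -> L2 w ->
  edc T (fun s t => nrm (fd (u s) (u t))) -> edc T (fun s t => `|ip (u s) w - ip (u t) w|).
Proof.
move=> Lu Lw cu t tT e e0.
have n0 : 0 < nrm w + 1 by rewrite ltr_wpDl ?nrm_ge0.
have [d d0 hd] := cu t tT (e / (nrm w + 1)) (divr_gt0 e0 n0).
exists d => // s sT st; apply: le_lt_trans (ip_lip (Lu _ sT) (Lu _ tT) Lw) _.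
have := hd s sT st; rewrite ltr_pdivlMr//; apply: le_lt_trans.
by apply: ler_wpM2l; [exact: nrm_ge0|rewrite lerDl].
Qed.

Lemma ip_is_derive (u du : R -> field) (w : field) (t : R) : L2_C1 T u du -> L2 w -> 0 < t < T ->
  is_derive t (1 : R) (fun s => ip (u s) w) (ip (du t) w).
Proof.
move=> [/L2_continuousP[Lu _] /L2_continuousP[Ldu _] hd] Lw /andP[t0 tT].
have tI : 0 <= t <= T by rewrite !ltW.
have cv : (fun h => h^-1 *: (((fun s => ip (u s) w) \o shift t) (h *: (1 : R)) - ip (u t) w)) @ 0^' --> ip (du t) w.
  apply/cvgrPdist_lt => e e0.
  have n0 : 0 < nrm w + 1 by rewrite ltr_wpDl ?nrm_ge0.
  have := L2norm_near0 (hd t tI) (divr_gt0 e0 n0).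
  move=> /(_ (within_filter _ _)).
  rewrite near_withinE => /nbhs_ballP[d /= d0 hd'].
  (* The minimum with [t] and [T - t] keeps [h + t] inside [[0, T]], where the fields are
     controlled. *)
  pose d' := Num.min d (Num.min t (T - t)).
  have d'0 : 0 < d' by rewrite !lt_min d0 t0 subr_gt0.
  apply/nbhs_ballP; exists d' => // h; rewrite /ball /= sub0r normrN => hh h0.
  rewrite [h *: _]mulr1.
  have [k1 k2 k3] : [/\ `|h| < d, `|h| < t & `|h| < T - t].
    by move: hh; rewrite !lt_min => /andP[-> /andP[-> ->]].
  have sT : 0 <= h + t <= T.
    have := ler_norm h; have := ler_normr `|h| (- h); rewrite normrN => _ ?.
    have := ler_norm (- h); rewrite normrN => ?.
    by apply/andP; split; lra.
  have Ls := Lu _ sT; have Lt := Lu _ tI; have Ld := Ldu _ tI.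
  have LL := L2B (L2Z (h + t - t)^-1 (L2B Ls Lt)) Ld.
  have hne : h + t != t by rewrite -subr_eq0 addrK.
  have hb : ball t d (h + t) by rewrite /ball /= opprD addrCA subrr addr0 normrN.
  have lt := hd' (h + t) hb hne _ LL.
  rewrite addrK in LL lt.
  have -> : h^-1 *: (ip (u (h + t)) w - ip (u t) w) = ip (fun x => h^-1 *: (u (h + t) x - u t x)) w.
    by rewrite ipZl//; [rewrite ipBl|exact: L2B].
  rewrite distrC; apply: le_lt_trans (ip_lip (L2Z _ (L2B Ls Lt)) Ld Lw) _.
  have {}lt := lt (_ : `[0, T]%classic (h + t)); rewrite /= in_itv /= ltr_pdivlMr// in lt.
  apply: le_lt_trans (lt sT).
  by apply: ler_wpM2l; [exact: nrm_ge0|rewrite lerDl].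
by apply: DeriveDef; [apply/cvg_ex; exists (ip (du t) w)|apply: cvg_lim].
Qed.

Variable tau : R.
Hypothesis tau0 : 0 <= tau.

Local Notation ex t := (expR (- (tau * t))).

Lemma ex_le1 t : 0 <= t -> ex t <= 1.
Proof. by move=> t0; rewrite -expR0 ler_expR oppr_le0 mulr_ge0. Qed.

Lemma is_derive_ex t : is_derive t (1 : R) (fun s => ex s) (- tau * ex t).
Proof.
have h := is_derive_expl (- tau) t.
have e : (fun s : R => ex s) = (fun s => expR (- tau * s)) by apply/funext => s; rewrite mulNr.
by rewrite e; apply: (is_derive_eq h); rewrite [- tau * t]mulNr.
Qed.

Lemma edc_ex : edc T (fun s t => `|ex s - ex t|).
Proof.
apply/within_edc; apply: continuous_subspaceT.
exact: is_derive_continuous is_derive_ex.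
Qed.

Lemma edc_exZ (u : R -> field) : (forall t, 0 <= t <= T -> L2 (u t)) ->
  edc T (fun s t => nrm (fd (u s) (u t))) ->
  edc T (fun s t => nrm (fd (fun x => ex s *: u s x) (fun x => ex t *: u t x))).
Proof.
move=> Lu cu t tT e e0.
have n0 : 0 < nrm (u t) + 1 by rewrite ltr_wpDl ?nrm_ge0.
have e2 : 0 < e / 2 by rewrite divr_gt0.
have [d1 d10 h1] := cu t tT _ e2; have [d2 d20 h2] := edc_ex tT (divr_gt0 e2 n0).
exists (Num.min d1 d2); first by rewrite lt_min d10.
move=> s sT; rewrite lt_min => /andP[s1 s2].
rewrite (nrm_ext (v := fun x => ex s *: (u s x - u t x) + (ex s - ex t) *: u t x)); last first.
  by move=> x; rewrite /fd scalerBr scalerBl addrA subrK.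
have Ls := Lu _ sT; have Lt := Lu _ tT.
apply: le_lt_trans (nrmD (L2Z _ (L2B Ls Lt)) (L2Z _ Lt)) _.
rewrite !nrmZ//; last exact: L2B.
rewrite [e]splitr; apply: ltr_leD.
  apply: le_lt_trans (h1 s sT s1); rewrite ler_piMl ?nrm_ge0// ger0_norm ?expR_ge0//.
  by apply: ex_le1; case/andP: sT.
have := h2 s sT s2; rewrite ltr_pdivlMr// => /ltW; apply: le_trans.
by apply: ler_wpM2l => //; rewrite lerDl.
Qed.

Lemma edcD (u v : R -> field) : (forall t, 0 <= t <= T -> L2 (u t)) -> (forall t, 0 <= t <= T -> L2 (v t)) ->
  edc T (fun s t => nrm (fd (u s) (u t))) -> edc T (fun s t => nrm (fd (v s) (v t))) ->
  edc T (fun s t => nrm (fd (fun x => u s x + v s x) (fun x => u t x + v t x))).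
Proof.
move=> Lu Lv cu cv t tT e e0.
have e2 : 0 < e / 2 by rewrite divr_gt0.
have [d1 d10 h1] := cu t tT _ e2; have [d2 d20 h2] := cv t tT _ e2.
exists (Num.min d1 d2); first by rewrite lt_min d10.
move=> s sT; rewrite lt_min => /andP[s1 s2].
rewrite (nrm_ext (v := fun x => (u s x - u t x) + (v s x - v t x))); last first.
  by move=> x; rewrite /fd opprD addrACA.
apply: le_lt_trans (nrmD (L2B (Lu _ sT) (Lu _ tT)) (L2B (Lv _ sT) (Lv _ tT))) _.
by rewrite [e]splitr; apply: ltrD; [exact: h1|exact: h2].
Qed.

Lemma edcZ (c : R) (u : R -> field) : (forall t, 0 <= t <= T -> L2 (u t)) ->
  edc T (fun s t => nrm (fd (u s) (u t))) ->
  edc T (fun s t => nrm (fd (fun x => c *: u s x) (fun x => c *: u t x))).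
Proof.
move=> Lu cu t tT e e0.
have n0 : 0 < `|c| + 1 by rewrite ltr_wpDl.
have [d d0 h] := cu t tT _ (divr_gt0 e0 n0).
exists d => // s sT st.
rewrite (nrm_ext (v := fun x => c *: (u s x - u t x))); last by move=> x; rewrite /fd scalerBr.
rewrite nrmZ; last by exact: L2B (Lu _ sT) (Lu _ tT).
have := h s sT st; rewrite ltr_pdivlMr// mulrC; apply: le_lt_trans.
by apply: ler_wpM2r; [exact: nrm_ge0|rewrite lerDl].
Qed.

Definition Lsum (N : nat) (u : R -> field) : field :=
  fun x => \sum_(i < N.+1) (T / N.+1%:R * ex (mid T N i)) *: u (mid T N i) x.

Lemma mid_cc N (i : 'I_N.+1) : 0 <= mid T N i <= T.
Proof. by have /andP[h1 h2] := mid_oo T0 (ltn_ord i); rewrite !ltW. Qed.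

Lemma L2_Lsum N (u : R -> field) : (forall t, 0 <= t <= T -> L2 (u t)) -> L2 (Lsum N u).
Proof. by move=> Lu; apply: L2_sum => i; apply: L2Z; apply: Lu; exact: mid_cc. Qed.

(* Paired with a fixed field [w], the sum is a Riemann sum of the derivative of
   [t |-> expR (- tau t) (u t, w)], which the mean value theorem compares with
   the increment of that function; then [w] is taken to be the error itself. *)
Lemma riemann_L2 (u du : R -> field) : L2_C1 T u du -> forall e : R, 0 < e ->
  exists2 d : R, 0 < d & forall N : nat, T / N.+1%:R < d ->
    nrm (fun x => Lsum N du x - tau *: Lsum N u x - (ex T *: u T x - u 0 x)) <= e.
Proof.
move=> C1 e e0; have [cu cdu _] := C1.
have [Lu eu] := L2_continuousP cu; have [Ldu edu] := L2_continuousP cdu.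
pose g t : field := fun x => du t x + - tau *: u t x.
have Lg t : 0 <= t <= T -> L2 (g t).
  by move=> tT; exact: L2D (Ldu _ tT) (L2Z _ (Lu _ tT)).
have Lu' t : 0 <= t <= T -> L2 (fun x => - tau *: u t x) by move=> tT; exact: L2Z (Lu _ tT).
have eg := edcD Ldu Lu' edu (edcZ (- tau) Lu eu).
have Leg t : 0 <= t <= T -> L2 (fun x => ex t *: g t x) by move=> tT; exact: L2Z (Lg _ tT).
have eeg := edc_exZ Lg eg.
(* Extended by zero, the family is square integrable for every real parameter, so the triangle
   inequality required by [edc_unif] holds without restriction. *)
pose gg t := if 0 <= t <= T then (fun x => ex t *: g t x) else (fun=> 0 : 'rV[R]_3).
have Lgg t : L2 (gg t).
  by rewrite /gg; case: ifPn => [/Leg//|_]; exact: L2_0.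
have egg : edc T (fun s t => nrm (fd (gg s) (gg t))).
  move=> t tT e' e'0; have [d d0 hd] := eeg t tT e' e'0.
  by exists d => // s sT st; rewrite /gg sT tT; exact: hd.
have eT : 0 < e / T by rewrite divr_gt0.
have [d d0 hd] := edc_unif egg (fun r s t => nrm_fd_tri (Lgg r) (Lgg s) (Lgg t)) (fun s t => nrm_fdC _ _) eT.
have e2 : T * (e / T) = e by rewrite mulrC divfK// gt_eqF.
exists (d / 2); first by rewrite divr_gt0.
move=> N hN.
set D := (fun x => _).
have I0 : (0 : R) <= (0 : R) <= T by rewrite lexx ltW.
have IT : 0 <= T <= T by rewrite lexx ltW.
have LS := L2_Lsum N Lu; have LdS := L2_Lsum N Ldu.
have LD : L2 D := L2B (L2B LdS (L2Z _ LS)) (L2B (L2Z _ (Lu _ IT)) (Lu _ I0)).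
have DE w : L2 w -> ip D w = \sum_(i < N.+1) T / N.+1%:R * (ex (mid T N i) * ip (g (mid T N i)) w)
     - (ex T * ip (u T) w - ex 0 * ip (u 0) w).
  move=> Lw; rewrite /D ipBl//; [|exact: L2B LdS (L2Z _ LS)|exact: L2B (L2Z _ (Lu _ IT)) (Lu _ I0)].
  rewrite ipBl//; last exact: L2Z.
  rewrite [ip (fun x => ex T *: _ - _) w]ipBl//; [|exact: L2Z (Lu _ IT)|exact: Lu].
  rewrite ipZl// ipZl//; last exact: Lu.
  rewrite mulr0 oppr0 expR0 mul1r; congr (_ - _).
  rewrite /Lsum !ip_suml//; [|by move=> i; apply: L2Z; apply: Lu; exact: mid_cc
                             |by move=> i; apply: L2Z; apply: Ldu; exact: mid_cc].
  rewrite mulr_sumr -sumrB; apply: eq_bigr => i _; have mi := mid_cc i.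
  have Li := Lu _ mi; have Ldi := Ldu _ mi.
  rewrite !ipZl// /g ipDl//; last exact: L2Z.
  by rewrite ipZl//; ring.
have key w : L2 w -> `|ip D w| <= T * (e / T * nrm w).
  move=> Lw; rewrite DE//.
  have cF : {within `[0, T], continuous (fun t => ex t * ip (u t) w)}.
    have h1 : {within `[0, T], continuous (fun t => ip (u t) w)}.
      by apply/within_edc; exact: ip_edc.
    have h2 : {within `[0, T], continuous (fun t => ex t)}.
      by apply/within_edc; exact: edc_ex.
    by move=> t; apply: cvgM; [exact: h2|exact: h1].
  apply: (riemann_mvt T0 (F := fun t => ex t * ip (u t) w) (f := fun t => ex t * ip (g t) w)) => //.
    move=> t t0T; have /andP[t0 tT] := t0T; have tI : 0 <= t <= T by rewrite !ltW.
    have h := is_deriveM (is_derive_ex t) (ip_is_derive C1 Lw t0T).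
    apply: (is_derive_eq h); rewrite /GRing.scale /= /g ipDl//; [|exact: Ldu|exact: Lu'].
    by rewrite ipZl//; [ring|exact: Lu].
  move=> s t sT tT st.
  have -> : ex s * ip (g s) w = ip (gg s) w by rewrite /gg sT ipZl//; exact: Lg.
  have -> : ex t * ip (g t) w = ip (gg t) w by rewrite /gg tT ipZl//; exact: Lg.
  apply: le_trans (ip_lip (Lgg _) (Lgg _) Lw) _; apply: ler_wpM2r; first exact: nrm_ge0.
  by apply/ltW; apply: hd => //; apply: lt_trans st _; rewrite [d]splitr; exact: ltrD.
have := key D LD; rewrite mulrA e2 ger0_norm ?ip_ge0// -nrm2 expr2.
have [->|n0] := eqVneq (nrm D) 0; first by move=> _; exact: ltW.
by rewrite ler_pM2r// lt_neqAle eq_sym n0 nrm_ge0.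
Qed.

End L2Calculus.

Lemma ae_fin d (T : measurableType d) (R : realType) (m : {measure set T -> \bar R})
    (I : finType) (P : I -> T -> Prop) :
  (forall i, {ae m, forall x, P i x}) -> {ae m, forall x, forall i, P i x}.
Proof. by move=> h; apply: filter_forall. Qed.

(** * Approximate stationary Maxwell systems at fixed [tau] *)

Section Approximation.
Context {R : realType}.
Local Notation point := (R * R * R)%type.
Local Notation mpoint := (measurableTypeR R * measurableTypeR R * measurableTypeR R)%type.
Local Notation field := (point -> 'rV[R]_3).

Lemma L2_curl_test (phi : field) : (forall i, test_function setT (fun x => phi x ord0 i)) ->
  L2 (curl phi) /\ L2 phi.
Proof.
move=> tp; split; apply: L2I => i; last exact: (test_sq (tp i)).
have h1 := test_sq (test_derive (i + 1) (tp (i + 2))); have h2 := test_sq (test_derive (i + 2) (tp (i + 1))).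
apply: (@sq_ext _ _ _ _ (fun x : mpoint => 'D_(unit_vec (i + 1)) (fun y => phi y ord0 (i + 2)) x +
   (- 1) * 'D_(unit_vec (i + 2)) (fun y => phi y ord0 (i + 1)) x)).
  by move=> x; rewrite /cmp mxE mulN1r.
exact: sqD h1 (sqZ _ h2).
Qed.

Lemma weak_curl_lin (a b : R) (u cu v cv : field) : weak_curl u cu -> weak_curl v cv ->
  weak_curl (fun x => a *: u x + b *: v x) (fun x => a *: cu x + b *: cv x).
Proof.
move=> [Lu Lcu hu] [Lv Lcv hv]; split; [exact: L2D (L2Z _ Lu) (L2Z _ Lv)|exact: L2D (L2Z _ Lcu) (L2Z _ Lcv)|].
move=> phi tp; have [Lc Lp] := L2_curl_test tp.
rewrite -/(Int _ _) -/(Int _ _) -/(ip _ _) -/(ip _ _).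
rewrite !ipDl ?ipZl//; try exact: L2Z.
by congr (_ * _ + _ * _); [exact: hu|exact: hv].
Qed.

Lemma weak_curlZ (a : R) (u cu : field) : weak_curl u cu ->
  weak_curl (fun x => a *: u x) (fun x => a *: cu x).
Proof.
move=> h; have := weak_curl_lin a 0 h h.
have e (w : field) : (fun x => a *: w x + 0 *: w x) = (fun x => a *: w x).
  by apply/funext => x; rewrite scale0r addr0.
by rewrite !e.
Qed.

Lemma weak_curlB (u cu v cv : field) : weak_curl u cu -> weak_curl v cv ->
  weak_curl (fun x => u x - v x) (fun x => cu x - cv x).
Proof.
move=> hu hv; have := weak_curl_lin 1 (- 1) hu hv.
have e (w z : field) : (fun x => 1 *: w x + (- 1) *: z x) = (fun x => w x - z x).
  by apply/funext => x; rewrite scale1r scaleN1r.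
by rewrite !e.
Qed.

Lemma weak_curl_sum (n : nat) (u cu : 'I_n -> field) : (forall i, weak_curl (u i) (cu i)) ->
  weak_curl (fun x => \sum_(i < n) u i x) (fun x => \sum_(i < n) cu i x).
Proof.
move=> h; split; [by apply: L2_sum => i; case: (h i)|by apply: L2_sum => i; case: (h i)|].
move=> phi tp; have [Lc Lp] := L2_curl_test tp.
rewrite -/(Int _ _) -/(Int _ _) -/(ip _ _) -/(ip _ _).
rewrite !ip_suml//; [|by move=> i; case: (h i)|by move=> i; case: (h i)].
by apply: eq_bigr => i _; case: (h i) => _ _; exact.
Qed.

Lemma nrm_mul_le (c : point -> R) (u : field) (M : R) : bmul leb3 c -> L2 u -> 0 <= M ->
  {ae leb3, forall x, `|c x| <= M} -> nrm (fun x => c x *: u x) <= M * nrm u.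
Proof.
move=> bc Lu M0 hM; have L := L2mul bc Lu.
rewrite -(@ler_pXn2r _ 2)// ?nnegrE ?mulr_ge0 ?nrm_ge0// exprMn !nrm2 /ip -IntZ; last exact: intg_dot.
apply: Int_le_ae; [exact: intg_dot|by apply: intgZ; exact: intg_dot|].
apply: aeS hM => x hx; rewrite dotZl dotZr mulrA -expr2.
apply: ler_wpM2r; first exact: dot_ge0.
by rewrite -real_normK ?num_real// lerXn2r ?nnegrE.
Qed.

Lemma step_small (T d : R) : 0 < T -> 0 < d -> exists N : nat, T / N.+1%:R < d.
Proof.
move=> T0 d0; exists (Num.bound (T / d)); rewrite ltr_pdivrMr ?ltr0Sn// mulrC -ltr_pdivrMr//.
have := archi_boundP (ltW (divr_gt0 T0 d0)); move/lt_le_trans; apply.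
by rewrite ler_nat.
Qed.

Lemma bmul_bound (c : point -> R) : bmul leb3 c -> exists2 M : R, 0 <= M & {ae leb3, forall x, `|c x| <= M}.
Proof.
move=> [_ [M hM]]; exists (Num.max 0 M); first by rewrite le_max lexx.
by apply: aeS hM => x hx; rewrite le_max hx orbT.
Qed.

Variables (T : R) (f : R -> R) (chi : point -> R) (a : 'rV[R]_3) (eps mu sigma : point -> R).
Hypotheses (T0 : 0 < T) (cf : {within `[0, T], continuous f}) (Lchi : L2 (fun x => chi x *: a)).
Hypotheses (beps : bmul leb3 eps) (bmu : bmul leb3 mu) (bsig : bmul leb3 sigma).

(* The Laplace transform of the field is replaced by Riemann sums, whose weak
   curls are available term by term; integration by parts in time leaves the
   residuals [se] and [sm], governed by the values at time [T]. *)
Lemma maxwell_approx (E H : R -> field) :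
  maxwell_solution eps mu sigma T (fun t x => (f t * chi x) *: a) E H ->
  exists2 K : R, 0 <= K & forall tau W, 0 < tau ->
    L2_integral T (fun t x => expR (- (tau * t)) *: E t x) W -> forall d : R, 0 < d ->
    exists U cU Y cY se sm : field,
    [/\ weak_curl U cU /\ weak_curl Y cY, nrm (fd U W) <= d,
        L2 se /\ L2 sm,
        {ae leb3, forall x, (tau * eps x + sigma x) *: U x - cY x = (laplace T f tau * chi x) *: a + se x} /\
        {ae leb3, forall x, (tau * mu x) *: Y x + cU x = sm x} &
        nrm se <= K * expR (- (tau * T)) + d /\ nrm sm <= K * expR (- (tau * T)) + d].
Proof.
move=> [dE [dH [cE [cH [[C1E HcE] [C1H HcH] eqE eqH [E0 H0]]]]]].
have [M1 M10 hM1] := bmul_bound beps; have [M2 M20 hM2] := bmul_bound bmu.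
pose nE := nrm (E T); pose nH := nrm (H T).
have nE0 : 0 <= nE by exact: nrm_ge0.
have nH0 : 0 <= nH by exact: nrm_ge0.
(* Integration by parts leaves the fields at time [T], multiplied by [eps] or [mu] and by
   [expR (- (tau * T))]; this constant bounds their norms independently of [tau]. *)
exists (M1 * nE + M2 * nH); first by rewrite addr_ge0 ?mulr_ge0.
move=> tau W tau0 [LW hW] d d0.
have [cEt cdE _] := C1E; have [cHt cdH _] := C1H.
have [LE eE] := L2_continuousP cEt; have [LdE _] := L2_continuousP cdE.
have [LH eH] := L2_continuousP cHt; have [LdH _] := L2_continuousP cdH.
have [_ _ wE] := HcE; have [_ _ wH] := HcH.
pose nc := nrm (fun x => chi x *: a); have nc0 : 0 <= nc by exact: nrm_ge0.
(* The tolerance [d'] gets amplified by the norm [nc] of the source profile and by the bounds [M1],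
   [M2] of [eps] and [mu]; dividing by [m] keeps the total below [d]. *)
pose m := nc + M1 + M2 + 1.
have m0 : 0 < m by rewrite /m; apply: ltr_wpDl => //; rewrite !addr_ge0.
pose d' := d / m; have d'0 : 0 < d' by rewrite divr_gt0.
have dm : m * d' = d by rewrite /d' mulrC divfK// gt_eqF.
have [k1 k10 h1] := riemann_L2 T0 (ltW tau0) C1E d'0.
have [k2 k20 h2] := riemann_L2 T0 (ltW tau0) C1H d'0.
have cef : {within `[0, T], continuous (fun t => expR (- (tau * t)) * f t)}.
  have c1 : {within `[0, T], continuous (fun t => expR (- (tau * t)))}.
    by apply/within_edc; exact: edc_ex.
  by move=> t; apply: cvgM; [exact: c1|exact: cf].
have [k3 k30 h3] := riemann_scalar T0 cef d'0.
have [k4 k40 h4] := hW d d0.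
have [N] : exists N : nat, T / N.+1%:R < Num.min (Num.min k1 k2) (Num.min k3 k4).
  by apply: step_small => //; rewrite !lt_min k10 k20 k30.
rewrite !lt_min => /andP[/andP[N1 N2] /andP[N3 N4]].
pose S := Lsum T tau N.
have LS (u : R -> field) : (forall t, 0 <= t <= T -> L2 (u t)) -> L2 (S u) by exact: L2_Lsum.
have wS (u cu : R -> field) : (forall t, 0 <= t <= T -> weak_curl (u t) (cu t)) -> weak_curl (S u) (S cu).
  by move=> h; apply: weak_curl_sum => i; apply: weak_curlZ; apply: h; exact: mid_cc.
pose Sf := \sum_(i < N.+1) T / N.+1%:R * (expR (- (tau * mid T N i)) * f (mid T N i)).
pose fl := laplace T f tau.
have hSf : `|Sf - fl| <= d' := h3 N N3.
pose dSE : field := fun x => S dE x - tau *: S E x; pose dSH : field := fun x => S dH x - tau *: S H x.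
have LdSE : L2 dSE := L2B (LS _ LdE) (L2Z _ (LS _ LE)).
have LdSH : L2 dSH := L2B (LS _ LdH) (L2Z _ (LS _ LH)).
have bd (u du : R -> field) (Lu : forall t, 0 <= t <= T -> L2 (u t)) (Ldu : forall t, 0 <= t <= T -> L2 (du t)) :
   {ae leb3, forall x, u 0 x = 0} ->
   nrm (fun x => Lsum T tau N du x - tau *: Lsum T tau N u x - (expR (- (tau * T)) *: u T x - u 0 x)) <= d' ->
   nrm (fun x => S du x - tau *: S u x) <= d' + expR (- (tau * T)) * nrm (u T).
  move=> u0 hn.
  have IT : 0 <= T <= T by rewrite lexx ltW.
  have I0 : (0 : R) <= (0 : R) <= T by rewrite lexx ltW.
  have LT := Lu _ IT; have L0 := Lu _ I0; have LZ := L2Z (expR (- (tau * T))) LT.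
  have LD : L2 (fun x => S du x - tau *: S u x) := L2B (LS _ Ldu) (L2Z _ (LS _ Lu)).
  have LD' : L2 (fun x => S du x - tau *: S u x - (expR (- (tau * T)) *: u T x - u 0 x)) := L2B LD (L2B LZ L0).
  rewrite (nrm_ae (v := fun x => (S du x - tau *: S u x - (expR (- (tau * T)) *: u T x - u 0 x)) + expR (- (tau * T)) *: u T x)) //.
  - apply: le_trans (nrmD LD' LZ) _; apply: lerD => //.
    by rewrite nrmZ// ger0_norm ?expR_ge0.
  - exact: L2D LD' LZ.
  by apply: aeS u0 => x ->; rewrite subr0 subrK.
have bE := bd E dE LE LdE E0 (h1 N N1); have bH := bd H dH LH LdH H0 (h2 N N2).
pose se : field := fun x => (Sf - fl) *: (chi x *: a) - eps x *: dSE x.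
pose sm : field := fun x => - (mu x *: dSH x).
have Lse : L2 se := L2B (L2Z _ Lchi) (L2mul beps LdSE).
have Lsm : L2 sm := L2N (L2mul bmu LdSH).
(* Each time has its own exceptional null set; only finitely many tags occur, so one null set
   suffices. *)
have wk (P : R -> point -> Prop) : (forall t, 0 < t < T -> {ae leb3, forall x, P t x}) ->
    {ae leb3, forall x, forall i : 'I_N.+1, P (mid T N i) x}.
  by move=> h; apply: ae_fin => i; apply: h; exact: mid_oo.
exists (S E), (S cE), (S H), (S cH), se, sm; split.
- by split; apply: wS.
- have := h4 N.+1 (node T N) (mid T N).
  have n0 : node T N 0 = 0 by rewrite /node mulr0.
  have nT : node T N N.+1 = T by rewrite /node divfK.
  move=> /(_ n0 nT) hh; apply/ltW.
  have {}hh := hh _.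
  have LSW : L2 (fd (S E) W) := L2B (LS _ LE) LW.
  rewrite -lte_fin -L2normE//; move: hh; rewrite /fd /S /Lsum.
  have -> : (fun x => \sum_(i < N.+1) (node T N i.+1 - node T N i) *: (expR (- (tau * mid T N i)) *: E (mid T N i) x) - W x)
     = (fun x => \sum_(i < N.+1) (T / N.+1%:R * expR (- (tau * mid T N i))) *: E (mid T N i) x - W x).
    by apply/funext => x; congr (_ - _); apply: eq_bigr => i _; rewrite nodeS addrAC subrr add0r scalerA.
  apply=> i _; have /andP[m1 m2] := mid_in T0 N i.
  by rewrite (ltW m1) (ltW m2) nodeS addrAC subrr add0r.
- by [].
- split.
    have := wk _ eqE; apply: aeS => x hx.
    have key : eps x *: S dE x - S cH x = - (sigma x *: S E x) + (Sf * chi x) *: a.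
      rewrite /S /Lsum /Sf !scaler_sumr mulr_suml scaler_suml -!sumrN -!big_split /=.
      apply: eq_bigr => i _; set c := _ * expR _.
      transitivity (c *: (eps x *: dE (mid T N i) x - cH (mid T N i) x)).
        by rewrite scalerBr !scalerA [eps x * _]mulrC.
      rewrite hx scalerDr scalerN !scalerA [sigma x * _]mulrC; congr (_ + _ *: _).
      by rewrite /c; ring.
    apply/rowP => j; have := congr1 (fun M : 'rV[R]_3 => M ord0 j) key.
    rewrite /se /dSE -/fl !mxE; move: (S E x ord0 j) (S dE x ord0 j) (S cH x ord0 j) (eps x) (sigma x) (chi x) (a ord0 j).
    clear => e1 e2 e3 e4 e5 e6 e7 h; have -> : e3 = e4 * e2 - (e4 * e2 - e3) by ring.
    by rewrite h; ring.
  have := wk _ eqH; apply: aeS => x hx.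
  have key : mu x *: S dH x + S cE x = 0.
    rewrite /S /Lsum !scaler_sumr -big_split /= big1// => i _.
    set c := _ * expR _.
    transitivity (c *: (mu x *: dH (mid T N i) x + cE (mid T N i) x)).
      by rewrite scalerDr !scalerA [mu x * _]mulrC.
    by rewrite hx scaler0.
  apply/rowP => j; have := congr1 (fun M : 'rV[R]_3 => M ord0 j) key.
  rewrite /sm /dSH !mxE; move: (S H x ord0 j) (S dH x ord0 j) (S cE x ord0 j) (mu x).
  by clear => e1 e2 e3 e4 /eqP; rewrite addr_eq0 => /eqP e; rewrite mulrBr e; ring.
- have eT0 := expR_ge0 (- (tau * T)).
  have b1 : nrm se <= d' * nc + M1 * (d' + expR (- (tau * T)) * nE).
    rewrite /se (nrm_ext (v := fun x => (Sf - fl) *: (chi x *: a) + (- 1) *: (eps x *: dSE x))); last first.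
      by move=> x; rewrite scaleN1r.
    have Le := L2mul beps LdSE.
    apply: le_trans (nrmD (L2Z _ Lchi) (L2Z _ Le)) _; rewrite !nrmZ// normrN normr1 mul1r.
    apply: lerD; first by apply: ler_wpM2r.
    apply: le_trans (nrm_mul_le beps LdSE M10 hM1) _.
    by apply: ler_wpM2l.
  have b2 : nrm sm <= M2 * (d' + expR (- (tau * T)) * nH).
    rewrite /sm (nrm_ext (v := fun x => (- 1) *: (mu x *: dSH x))); last first.
      by move=> x; rewrite scaleN1r.
    rewrite nrmZ; last exact: L2mul.
    rewrite normrN normr1 mul1r.
    apply: le_trans (nrm_mul_le bmu LdSH M20 hM2) _.
    by apply: ler_wpM2l.
  have p1 := mulr_ge0 M10 (mulr_ge0 eT0 nE0); have p2 := mulr_ge0 M20 (mulr_ge0 eT0 nH0).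
  have q1 := mulr_ge0 nc0 (ltW d'0); have q2 := mulr_ge0 M10 (ltW d'0).
  have q3 := mulr_ge0 M20 (ltW d'0).
  clear - b1 b2 dm p1 p2 q1 q2 q3 d'0.
  move: (expR _) p1 p2 b1 b2 => e p1 p2 b1 b2.
  rewrite -dm /m; split; [apply: le_trans b1 _|apply: le_trans b2 _]; rewrite -subr_ge0.
    rewrite (_ : _ - _ = M2 * (e * nH) + M2 * d' + d'); last by ring.
    by rewrite !addr_ge0// ltW.
  rewrite (_ : _ - _ = M1 * (e * nE) + nc * d' + M1 * d' + d'); last by ring.
  by rewrite !addr_ge0// ltW.
Qed.

End Approximation.

(** * Two-sided bounds for the indicator function *)

Section Variational.
Context {R : realType}.
Local Notation point := (R * R * R)%type.
Local Notation field := (point -> 'rV[R]_3).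

(* The difference of the two sides is
   [(al re - se/2)^2 / al + (be rm + (be - be0) vm - sm/2)^2 / be]. *)
Lemma scalar_lower (al be al0 be0 re rm ve vm ce cm cve cvm F se sm : R) : 0 < al -> 0 < be ->
  al * re - cm = (al0 - al) * ve + se -> be * rm + ce = (be0 - be) * vm + sm ->
  al0 * ve - cvm = F -> be0 * vm + cve = 0 ->
  (al0 - al) * (ve * ve) + be0 * (1 - be0 / be) * (vm * vm) + (ve * se - be0 / be * (vm * sm)
    - ((4 * al)^-1 * (se * se) + (4 * be)^-1 * (sm * sm))) <=
  F * re - (vm * ce - cvm * re) - (ve * cm - cve * rm) - (rm * ce - cm * re).
Proof.
move=> al1 be1 h1 h2 <- h4.
have -> : cm = al * re - (al0 - al) * ve - se by rewrite -addrA -opprD -h1; ring.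
have -> : ce = (be0 - be) * vm + sm - be * rm by rewrite -h2; ring.
have -> : cve = - (be0 * vm) by apply/eqP; rewrite -addr_eq0 addrC h4.
rewrite -subr_ge0 (_ : _ - _ = (al * re - se / 2) ^+ 2 / al + (be * rm + (be - be0) * vm - sm / 2) ^+ 2 / be).
  by apply: addr_ge0; apply: mulr_ge0; rewrite ?sqr_ge0// invr_ge0 ltW.
by field; rewrite !gt_eqF.
Qed.

(* The difference of the two sides is
   [(al re - (al0 - al) ve - se/2)^2 / al + (be rm - sm/2)^2 / be]. *)
Lemma scalar_upper (al be al0 be0 re rm ve vm ce cm cve cvm F se sm : R) : 0 < al -> 0 < be ->
  al * re - cm = (al0 - al) * ve + se -> be * rm + ce = (be0 - be) * vm + sm ->
  al0 * ve - cvm = F -> be0 * vm + cve = 0 ->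
  F * re - (vm * ce - cvm * re) - (ve * cm - cve * rm) + (rm * ce - cm * re) <=
  al0 * (al0 / al - 1) * (ve * ve) + (be - be0) * (vm * vm) + (al0 / al * (ve * se) - vm * sm
    + ((4 * al)^-1 * (se * se) + (4 * be)^-1 * (sm * sm))).
Proof.
move=> al1 be1 h1 h2 <- h4.
have -> : cm = al * re - (al0 - al) * ve - se by rewrite -addrA -opprD -h1; ring.
have -> : ce = (be0 - be) * vm + sm - be * rm by rewrite -h2; ring.
have -> : cve = - (be0 * vm) by apply/eqP; rewrite -addr_eq0 addrC h4.
rewrite -subr_ge0 (_ : _ - _ = (al * re - (al0 - al) * ve - se / 2) ^+ 2 / al + (be * rm - sm / 2) ^+ 2 / be).
  by apply: addr_ge0; apply: mulr_ge0; rewrite ?sqr_ge0// invr_ge0 ltW.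
by field; rewrite !gt_eqF.
Qed.

Lemma lower_sum (a b c d e : R) (ve vm se sm : 'rV[R]_3) :
  let t i := a * (ve ord0 i * ve ord0 i) + b * (vm ord0 i * vm ord0 i) + (ve ord0 i * se ord0 i - c * (vm ord0 i * sm ord0 i)
    - (d * (se ord0 i * se ord0 i) + e * (sm ord0 i * sm ord0 i))) in
  a * dot ve ve + b * dot vm vm + (1 * dot ve se - c * dot vm sm - (d * dot se se + e * dot sm sm)) =
  t 0 + t 1 + t 2.
Proof. by rewrite /dot !sum3 /=; ring. Qed.

Lemma upper_sum (a b c d e : R) (ve vm se sm : 'rV[R]_3) :
  let t i := a * (ve ord0 i * ve ord0 i) + b * (vm ord0 i * vm ord0 i) + (c * (ve ord0 i * se ord0 i) - vm ord0 i * sm ord0 i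
    + (d * (se ord0 i * se ord0 i) + e * (sm ord0 i * sm ord0 i))) in
  t 0 + t 1 + t 2 =
  a * dot ve ve + b * dot vm vm + (c * dot ve se - 1 * dot vm sm + (d * dot se se + e * dot sm sm)).
Proof. by rewrite /dot !sum3 /=; ring. Qed.

Lemma mixed_sum (f re vm ce cvm ve cm cve rm : 'rV[R]_3) :
  let t i := f ord0 i * re ord0 i - (vm ord0 i * ce ord0 i - cvm ord0 i * re ord0 i) -
    (ve ord0 i * cm ord0 i - cve ord0 i * rm ord0 i) - (rm ord0 i * ce ord0 i - cm ord0 i * re ord0 i) in
  t 0 + t 1 + t 2 =
  dot f re - (dot vm ce - dot cvm re) - (dot ve cm - dot cve rm) - (dot rm ce - dot cm re).
Proof. by rewrite /dot !sum3 /=; ring. Qed.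

Lemma mixed_sum' (f re vm ce cvm ve cm cve rm : 'rV[R]_3) :
  let t i := f ord0 i * re ord0 i - (vm ord0 i * ce ord0 i - cvm ord0 i * re ord0 i) -
    (ve ord0 i * cm ord0 i - cve ord0 i * rm ord0 i) + (rm ord0 i * ce ord0 i - cm ord0 i * re ord0 i) in
  dot f re - (dot vm ce - dot cvm re) - (dot ve cm - dot cve rm) + (dot rm ce - dot cm re) =
  t 0 + t 1 + t 2.
Proof. by rewrite /dot !sum3 /=; ring. Qed.

Lemma intg_mdot (c : point -> R) (u v : field) : bmul leb3 c -> L2 u -> L2 v ->
  intg leb3 (fun x => c x * dot (u x) (v x)).
Proof.
move=> bc Lu Lv; apply: (intg_ext _ (intg_dot (L2mul bc Lu) Lv)) => x.
by rewrite dotZl.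
Qed.

Lemma Int_mdot_le (c : point -> R) (u v : field) (M : R) : bmul leb3 c -> L2 u -> L2 v -> 0 <= M ->
  {ae leb3, forall x, `|c x| <= M} ->
  `|Int leb3 (fun x => c x * dot (u x) (v x))| <= M * (nrm u * nrm v).
Proof.
move=> bc Lu Lv M0 hM.
rewrite (_ : Int _ _ = ip (fun x => c x *: u x) v); last by apply: Int_ext => x; rewrite dotZl.
apply: le_trans (ip_le_nrm (L2mul bc Lu) Lv) _; rewrite mulrA.
by apply: ler_wpM2r; [exact: nrm_ge0|exact: nrm_mul_le].
Qed.

Lemma green0 (u cu v cv : field) : weak_curl u cu -> weak_curl v cv ->
  intg leb3 (fun x => dot (u x) (cv x) - dot (cu x) (v x)) /\
  Int leb3 (fun x => dot (u x) (cv x) - dot (cu x) (v x)) = 0.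
Proof.
move=> hu hv; have [Lu Lcu _] := hu; have [Lv Lcv _] := hv.
split; first by apply: intgB; exact: intg_dot.
rewrite IntB; [|exact: intg_dot|exact: intg_dot].
by rewrite -/(ip _ _) -/(ip _ _) (green_curl hu hv) subrr.
Qed.

Variables (al be : point -> R) (al0 be0 : R).
Variables (Re cRe Rm cRm Ve cVe Vm cVm F se sm : field).
Hypotheses (bal : bmul leb3 al) (bbe : bmul leb3 be).
Variables (b M : R).
Hypotheses (b0 : 0 < b) (hb : {ae leb3, forall x, b <= al x /\ b <= be x}) (M1 : 1 <= M)
  (hM : {ae leb3, forall x, `|al0 / al x| <= M /\ `|be0 / be x| <= M}).
Hypotheses (wRe : weak_curl Re cRe) (wRm : weak_curl Rm cRm) (wVe : weak_curl Ve cVe) (wVm : weak_curl Vm cVm).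
Hypotheses (Lse : L2 se) (Lsm : L2 sm) (LF : L2 F).
Hypotheses (hRe : {ae leb3, forall x, al x *: Re x - cRm x = (al0 - al x) *: Ve x + se x})
  (hRm : {ae leb3, forall x, be x *: Rm x + cRe x = (be0 - be x) *: Vm x + sm x})
  (hVe : {ae leb3, forall x, al0 *: Ve x - cVm x = F x})
  (hVm : {ae leb3, forall x, be0 *: Vm x + cVe x = 0}).

(** The part of [scalar_lower], and for [Qup] of [scalar_upper], that involves the background fields
    alone. It vanishes wherever the coefficients equal their background values. *)
Definition Qlow (al be : point -> R) (al0 be0 : R) (Ve Vm : field) (x : point) : R :=
  (al0 - al x) * dot (Ve x) (Ve x) + be0 * (1 - be0 / be x) * dot (Vm x) (Vm x).
Definition Qup (al be : point -> R) (al0 be0 : R) (Ve Vm : field) (x : point) : R :=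
  al0 * (al0 / al x - 1) * dot (Ve x) (Ve x) + (be x - be0) * dot (Vm x) (Vm x).

Lemma bmul_Vinv (c : point -> R) : bmul leb3 c -> {ae leb3, forall x, b <= c x} ->
  bmul leb3 (fun x => (c x)^-1).
Proof. by move=> [mc _] h; exact: bmulV mc b0 h. Qed.

Lemma bmul_balV : bmul leb3 (fun x => (al x)^-1).
Proof. by apply: bmul_Vinv => //; apply: aeS hb => x []. Qed.
Lemma bmul_bbeV : bmul leb3 (fun x => (be x)^-1).
Proof. by apply: bmul_Vinv => //; apply: aeS hb => x []. Qed.

Lemma intg_Qlow : intg leb3 (Qlow al be al0 be0 Ve Vm).
Proof.
have [LVe _ _] := wVe; have [LVm _ _] := wVm.
apply: intgD; apply: intg_mdot => //; first by apply: bmulB => //; exact: bmul_cst.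
apply: bmulM; first exact: bmul_cst.
by apply: bmulB; [exact: bmul_cst|apply: bmulM; [exact: bmul_cst|exact: bmul_bbeV]].
Qed.

Lemma intg_Qup : intg leb3 (Qup al be al0 be0 Ve Vm).
Proof.
have [LVe _ _] := wVe; have [LVm _ _] := wVm.
apply: intgD; apply: intg_mdot => //; last by apply: bmulB => //; exact: bmul_cst.
apply: bmulM; first exact: bmul_cst.
by apply: bmulB; [apply: bmulM; [exact: bmul_cst|exact: bmul_balV]|exact: bmul_cst].
Qed.

(** Residuals enter linearly, paired with the background fields, and quadratically, through the
    completed squares with weights [(4 * al)^-1] and [(4 * be)^-1]. *)
Definition err : R := M * (nrm Ve * nrm se + nrm Vm * nrm sm) + b^-1 * (nrm se ^+ 2 + nrm sm ^+ 2).

Lemma quad_err : let q := Int leb3 (fun x => (4 * al x)^-1 * dot (se x) (se x) + (4 * be x)^-1 * dot (sm x) (sm x)) in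
  intg leb3 (fun x => (4 * al x)^-1 * dot (se x) (se x) + (4 * be x)^-1 * dot (sm x) (sm x)) /\
  `|q| <= b^-1 * (nrm se ^+ 2 + nrm sm ^+ 2).
Proof.
have aux (c : point -> R) : bmul leb3 (fun x => (c x)^-1) -> {ae leb3, forall x, b <= c x} ->
    bmul leb3 (fun x => (4 * c x)^-1) /\ {ae leb3, forall x, `|(4 * c x)^-1| <= b^-1}.
  move=> bc hc; split.
    have := bmulM (bmul_cst leb3 (4^-1)) bc; congr bmul; apply/funext => x.
    by rewrite invfM.
  apply: aeS hc => x hc; have c0 : 0 < c x := lt_le_trans b0 hc.
  have c4 : 0 < 4 * c x by rewrite mulr_gt0// ltr0n.
  rewrite gtr0_norm ?invr_gt0// lef_pV2 ?posrE//.
  by apply: le_trans hc _; rewrite ler_peMl ?ler1n// ltW.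
have [ba1 ba2] := aux al bmul_balV (aeS (fun x => @proj1 _ _) hb).
have [bb1 bb2] := aux be bmul_bbeV (aeS (fun x => @proj2 _ _) hb).
have i1 := intg_mdot ba1 Lse Lse; have i2 := intg_mdot bb1 Lsm Lsm.
have bi : 0 <= b^-1 by rewrite invr_ge0 ltW.
split; first exact: intgD.
rewrite IntD//; apply: le_trans (ler_normD _ _) _; rewrite mulrDr !expr2.
by apply: lerD; exact: Int_mdot_le.
Qed.

Lemma lin_err (c1 c2 : point -> R) : bmul leb3 c1 -> bmul leb3 c2 ->
  {ae leb3, forall x, `|c1 x| <= M} -> {ae leb3, forall x, `|c2 x| <= M} ->
  intg leb3 (fun x => c1 x * dot (Ve x) (se x) - c2 x * dot (Vm x) (sm x)) /\
  `|Int leb3 (fun x => c1 x * dot (Ve x) (se x) - c2 x * dot (Vm x) (sm x))| <=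
     M * (nrm Ve * nrm se + nrm Vm * nrm sm).
Proof.
move=> b1 b2 h1 h2; have [LVe _ _] := wVe; have [LVm _ _] := wVm.
have M0 : 0 <= M := le_trans ler01 M1.
have i1 := intg_mdot b1 LVe Lse; have i2 := intg_mdot b2 LVm Lsm.
split; first exact: intgB.
rewrite IntB//; apply: le_trans (ler_normB _ _) _; rewrite mulrDr.
by apply: lerD; exact: Int_mdot_le.
Qed.

Lemma ae_M1 : {ae leb3, forall x : point, `|(1 : R)| <= M}.
Proof. by apply: aeW => x; rewrite normr1. Qed.

Lemma pointwise_sum (x : point) :
  al x *: Re x - cRm x = (al0 - al x) *: Ve x + se x ->
  be x *: Rm x + cRe x = (be0 - be x) *: Vm x + sm x ->
  al0 *: Ve x - cVm x = F x -> be0 *: Vm x + cVe x = 0 -> forall i : 'I_3,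
  [/\ al x * Re x ord0 i - cRm x ord0 i = (al0 - al x) * Ve x ord0 i + se x ord0 i,
      be x * Rm x ord0 i + cRe x ord0 i = (be0 - be x) * Vm x ord0 i + sm x ord0 i,
      al0 * Ve x ord0 i - cVm x ord0 i = F x ord0 i & be0 * Vm x ord0 i + cVe x ord0 i = 0].
Proof.
move=> h1 h2 h3 h4 i; have pr (u v : 'rV[R]_3) : u = v -> u ord0 i = v ord0 i by move->.
by split; [have := pr _ _ h1|have := pr _ _ h2|have := pr _ _ h3|have := pr _ _ h4]; rewrite !mxE.
Qed.

(** [scalar_lower] is integrated after summation over the components. Its three brackets exchange a
    curl between two fields and integrate to zero by [green0], so the right side becomes [ip F Re].
    Adding instead of subtracting the third bracket yields [variational_upper]. *)
Lemma variational_lower : Int leb3 (Qlow al be al0 be0 Ve Vm) - err <= ip F Re.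
Proof.
have [LVe _ _] := wVe; have [LVm _ _] := wVm; have [LRe _ _] := wRe.
have [i1 z1] := green0 wVm wRe; have [i2 z2] := green0 wVe wRm; have [i3 z3] := green0 wRm wRe.
have [iq hq] := quad_err.
have bc1 := bmul_cst (@leb3 R) (1 : R).
have bc2 : bmul leb3 (fun x => be0 / be x) by apply: bmulM; [exact: bmul_cst|exact: bmul_bbeV].
have [il hl] := lin_err bc1 bc2 ae_M1 (aeS (fun x => @proj2 _ _) hM).
have iF := intg_dot LF LRe.
pose lhs x := Qlow al be al0 be0 Ve Vm x + (1 * dot (Ve x) (se x) - be0 / be x * dot (Vm x) (sm x) -
  ((4 * al x)^-1 * dot (se x) (se x) + (4 * be x)^-1 * dot (sm x) (sm x))).
pose rhs x := dot (F x) (Re x) - (dot (Vm x) (cRe x) - dot (cVm x) (Re x)) -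
  (dot (Ve x) (cRm x) - dot (cVe x) (Rm x)) - (dot (Rm x) (cRe x) - dot (cRm x) (Re x)).
have ir : intg leb3 rhs by exact: intgB (intgB (intgB iF i1) i2) i3.
have iL : intg leb3 lhs by apply: intgD; [exact: intg_Qlow|apply: intgB].
have <- : Int leb3 rhs = ip F Re.
  rewrite /rhs IntB//; last by exact: intgB (intgB iF i1) i2.
  rewrite IntB//; last by exact: intgB iF i1.
  by rewrite IntB// z1 z2 z3 !subr0.
apply: (@le_trans _ _ (Int leb3 lhs)).
  rewrite /lhs (IntD intg_Qlow (intgB il iq)).
  rewrite (IntB il iq) lerD2l /err opprD; apply: lerD.
    by rewrite lerNl; apply: le_trans hl; rewrite -normrN ler_norm.
  by rewrite lerN2; apply: le_trans hq; exact: ler_norm.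
apply: Int_le_ae => //.
apply: aeS (aeI (aeI hRe hRm) (aeI (aeI hVe hVm) hb)) => x [[h1 h2] [[h3 h4] [hb1 hb2]]].
have al1 := lt_le_trans b0 hb1; have be1 := lt_le_trans b0 hb2.
have h i : _ := let: And4 k1 k2 k3 k4 := pointwise_sum h1 h2 h3 h4 i in scalar_lower al1 be1 k1 k2 k3 k4.
have hs := lerD (lerD (h 0) (h 1)) (h 2).
rewrite /lhs /rhs /Qlow; apply: le_trans (le_trans _ hs) _; rewrite le_eqVlt; apply/orP; left; apply/eqP.
  exact: lower_sum.
exact: mixed_sum.
Qed.

Lemma variational_upper : ip F Re <= Int leb3 (Qup al be al0 be0 Ve Vm) + err.
Proof.
have [LVe _ _] := wVe; have [LVm _ _] := wVm; have [LRe _ _] := wRe.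
have [i1 z1] := green0 wVm wRe; have [i2 z2] := green0 wVe wRm; have [i3 z3] := green0 wRm wRe.
have [iq hq] := quad_err.
have bc1 := bmul_cst (@leb3 R) (1 : R).
have bc2 : bmul leb3 (fun x => al0 / al x) by apply: bmulM; [exact: bmul_cst|exact: bmul_balV].
have [il hl] := lin_err bc2 bc1 (aeS (fun x => @proj1 _ _) hM) ae_M1.
have iF := intg_dot LF LRe.
pose lhs x := Qup al be al0 be0 Ve Vm x + (al0 / al x * dot (Ve x) (se x) - 1 * dot (Vm x) (sm x) +
  ((4 * al x)^-1 * dot (se x) (se x) + (4 * be x)^-1 * dot (sm x) (sm x))).
pose rhs x := dot (F x) (Re x) - (dot (Vm x) (cRe x) - dot (cVm x) (Re x)) -
  (dot (Ve x) (cRm x) - dot (cVe x) (Rm x)) + (dot (Rm x) (cRe x) - dot (cRm x) (Re x)).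
have ir : intg leb3 rhs by exact: intgD (intgB (intgB iF i1) i2) i3.
have iL : intg leb3 lhs by apply: intgD; [exact: intg_Qup|apply: intgD].
have <- : Int leb3 rhs = ip F Re.
  rewrite /rhs IntD//; last by exact: intgB (intgB iF i1) i2.
  rewrite IntB//; last by exact: intgB iF i1.
  by rewrite IntB// z1 z2 z3 !subr0 addr0.
apply: (@le_trans _ _ (Int leb3 lhs)); last first.
  rewrite /lhs IntD//; [|exact: intg_Qup|exact: intgD].
  rewrite lerD2l IntD// /err; apply: lerD.
    by apply: le_trans hl; exact: ler_norm.
  by apply: le_trans hq; exact: ler_norm.
apply: Int_le_ae => //.
apply: aeS (aeI (aeI hRe hRm) (aeI (aeI hVe hVm) hb)) => x [[h1 h2] [[h3 h4] [hb1 hb2]]].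
have al1 := lt_le_trans b0 hb1; have be1 := lt_le_trans b0 hb2.
have h i : _ := let: And4 k1 k2 k3 k4 := pointwise_sum h1 h2 h3 h4 i in scalar_upper al1 be1 k1 k2 k3 k4.
have hs := lerD (lerD (h 0) (h 1)) (h 2).
rewrite /lhs /rhs /Qup; apply: le_trans (le_trans _ hs) _; rewrite le_eqVlt; apply/orP; left; apply/eqP.
  exact: mixed_sum'.
exact: upper_sum.
Qed.

End Variational.

(** * Energy estimates and bounds for the indicator function at fixed [tau] *)

Section IndicatorBounds.
Context {R : realType}.
Local Notation point := (R * R * R)%type.
Local Notation mpoint := (measurableTypeR R * measurableTypeR R * measurableTypeR R)%type.
Local Notation field := (point -> 'rV[R]_3).

Lemma nrmM_le (u v : field) (b c : R) : nrm u <= b -> nrm v <= c -> nrm u * nrm v <= b * c.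
Proof. by move=> hu hv; apply: ler_pM hu hv; exact: nrm_ge0. Qed.

Lemma ip_le (u v : field) (b c : R) : L2 u -> L2 v -> nrm u <= b -> nrm v <= c -> `|ip u v| <= b * c.
Proof. by move=> Lu Lv hu hv; apply: le_trans (ip_le_nrm Lu Lv) _; exact: nrmM_le. Qed.

(** Pairing the first equation with [Ve] and the second with [Vm] gives [F . Ve] as the sum of the
    two energies. *)
Lemma background_energy (Ve cVe Vm cVm F : field) (al0 be0 : R) : 0 < al0 -> 0 < be0 ->
  weak_curl Ve cVe -> weak_curl Vm cVm -> L2 F ->
  {ae leb3, forall x, al0 *: Ve x - cVm x = F x} -> {ae leb3, forall x, be0 *: Vm x + cVe x = 0} ->
  nrm Ve <= nrm F / al0 /\ be0 * nrm Vm ^+ 2 <= nrm F ^+ 2 / al0.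
Proof.
move=> al1 be1 wVe wVm LF hVe hVm.
have [LVe LcVe _] := wVe; have [LVm LcVm _] := wVm.
have e1 : ip F Ve = al0 * nrm Ve ^+ 2 + be0 * nrm Vm ^+ 2.
  transitivity (ip (fun x => al0 *: Ve x - cVm x) Ve).
    by apply/esym; apply: ip_ae => //; exact: L2B (L2Z _ LVe) LcVm.
  rewrite ipBl//; last exact: L2Z.
  rewrite ipZl// (green_curl wVm wVe) !nrm2; congr (_ + _).
  have : ip (fun x => be0 *: Vm x + cVe x) Vm = 0.
    rewrite (ip_ae (v := fun=> 0)) //; [|exact: L2D (L2Z _ LVm) LcVe|exact: L2_0].
    by rewrite /ip -[RHS](@Int0 _ _ _ (@leb3 R)); apply: Int_ext => x; rewrite dot0l.
  rewrite ipDl//; last exact: L2Z.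
  by rewrite ipZl// [ip cVe Vm]ipC => h; apply/eqP; rewrite eq_sym -subr_eq0 opprK h.
have h := le_trans (ler_norm _) (ip_le_nrm LF LVe).
have n0 := nrm_ge0 Ve; have m0 := nrm_ge0 F; have v0 : 0 <= be0 * nrm Vm ^+ 2 by rewrite mulr_ge0 ?sqr_ge0// ltW.
have h1 : nrm Ve <= nrm F / al0.
  rewrite ler_pdivlMr//; have [->|nz] := eqVneq (nrm Ve) 0; first by rewrite mul0r.
  have np : 0 < nrm Ve by rewrite lt_neqAle eq_sym nz.
  rewrite -(ler_pM2r np); apply: le_trans h; rewrite e1 mulrAC -expr2 mulrC lerDl//.
split => //; rewrite e1 in h.
apply: (@le_trans _ _ (nrm F * nrm Ve)).
  by apply: le_trans h; rewrite lerDr mulr_ge0 ?sqr_ge0// ltW.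
by rewrite expr2 -mulrA ler_wpM2l.
Qed.

(** Reciprocity. [Ze], [Zm] stand for the error of the approximate background transform, driven by
    the residuals; by the symmetry of the system its pairing with [F] becomes the pairing of the
    residuals with the exact background, so the error itself need not be estimated. *)
Lemma background_pert (Ve cVe Vm cVm F Ze cZe Zm cZm se sm : field) (al0 be0 : R) :
  weak_curl Ve cVe -> weak_curl Vm cVm -> weak_curl Ze cZe -> weak_curl Zm cZm ->
  L2 F -> L2 se -> L2 sm ->
  {ae leb3, forall x, al0 *: Ve x - cVm x = F x} -> {ae leb3, forall x, be0 *: Vm x + cVe x = 0} ->
  {ae leb3, forall x, al0 *: Ze x - cZm x = se x} -> {ae leb3, forall x, be0 *: Zm x + cZe x = sm x} ->
  ip F Ze = ip Ve se - ip Vm sm.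
Proof.
move=> wVe wVm wZe wZm LF Lse Lsm hVe hVm hZe hZm.
have [LVe LcVe _] := wVe; have [LVm LcVm _] := wVm; have [LZe LcZe _] := wZe; have [LZm LcZm _] := wZm.
have e1 : ip F Ze = al0 * ip Ve Ze - ip Vm cZe.
  transitivity (ip (fun x => al0 *: Ve x - cVm x) Ze).
    by apply/esym; apply: ip_ae => //; exact: L2B (L2Z _ LVe) LcVm.
  rewrite ipBl//; last exact: L2Z.
  by rewrite ipZl// (green_curl wVm wZe).
have e2 : be0 * ip Vm Zm + ip Ve cZm = 0.
  have : ip (fun x => be0 *: Vm x + cVe x) Zm = 0.
    rewrite (ip_ae (v := fun=> 0)) //; [|exact: L2D (L2Z _ LVm) LcVe|exact: L2_0].
    by rewrite /ip -[RHS](@Int0 _ _ _ (@leb3 R)); apply: Int_ext => x; rewrite dot0l.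
  rewrite ipDl//; last exact: L2Z.
  by rewrite ipZl// (green_curl wVe wZm).
have e3 : ip se Ve = al0 * ip Ze Ve - ip cZm Ve.
  transitivity (ip (fun x => al0 *: Ze x - cZm x) Ve).
    by apply/esym; apply: ip_ae => //; exact: L2B (L2Z _ LZe) LcZm.
  by rewrite ipBl//; [rewrite ipZl|exact: L2Z].
have e4 : ip sm Vm = be0 * ip Zm Vm + ip cZe Vm.
  transitivity (ip (fun x => be0 *: Zm x + cZe x) Vm).
    by apply/esym; apply: ip_ae => //; exact: L2D (L2Z _ LZm) LcZe.
  by rewrite ipDl//; [rewrite ipZl|exact: L2Z].
rewrite e1 (ipC Ve se) (ipC Vm sm) e3 e4 (ipC Ze) (ipC Zm) (ipC cZm) (ipC cZe).
move: (ip Ve Ze) (ip Vm cZe) (ip Vm Zm) (ip Ve cZm) e2 => i1 i2 i3 i4 e2.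
by have -> : i4 = - (be0 * i3); [apply/eqP; rewrite -addr_eq0 addrC e2|ring].
Qed.

Lemma ess_inf_lower (c : point -> R) : (0 < ess_inf leb3 (EFin \o c))%E ->
  exists2 e : R, 0 < e & {ae leb3, forall x, e <= c x}.
Proof.
have := ess_inf_le leb3 (EFin \o c); case: (ess_inf _ _) => [r||] //= h r0.
  by exists r => //; apply: aeS h => x /=; rewrite lee_fin.
by exists 1 => //; apply: aeS h => x /=; rewrite leye_eq.
Qed.

Lemma laplace_bound (T : R) (f : R -> R) : 0 < T -> {within `[0, T], continuous f} ->
  exists2 C : R, 0 <= C & forall tau, 0 <= tau -> `|laplace T f tau| <= C.
Proof.
move=> T0 cf.
have ii (g : R -> R) : {within `[0, T], continuous g} -> (@lebesgue_measure R).-integrable `[0, T] (EFin \o g).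
  by move=> cg; apply: continuous_compact_integrable => //; exact: segment_compact.
have cn (g : R -> R) : {within `[0, T], continuous g} -> {within `[0, T], continuous (fun t => `|g t|)}.
  by move=> cg t; apply: cvg_norm; exact: cg.
exists (\int[lebesgue_measure]_(t in `[0, T]) `|f t|)%R.
  by apply: Rintegral_ge0 => t _; exact: normr_ge0.
move=> tau tau0.
have cef : {within `[0, T], continuous (fun t => expR (- (tau * t)) * f t)}.
  have c1 : {within `[0, T], continuous (fun t => expR (- (tau * t)))}.
    by apply/within_edc; exact: edc_ex.
  by move=> t; apply: cvgM; [exact: c1|exact: cf].
apply: le_trans (le_normr_Rintegral _ (ii _ cef)) _ => //.
apply: le_Rintegral => //; [exact: ii (cn _ cef)|exact: ii (cn _ cf)|].
move=> t /=; rewrite in_itv /= => /andP[t0 _].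
by rewrite normrM ler_piMl// ger0_norm ?expR_ge0// ex_le1.
Qed.

(** Lets the Riemann tolerance tend to 0. The restriction [d <= 1] allows squares of residuals to be
    bounded linearly in [d] beforehand. *)
Lemma le_of_small (x y Y : R) : (forall d, 0 < d -> d <= 1 -> x <= y + d * Y) -> x <= y.
Proof.
move=> h; apply/ler_addgt0Pr => e e0.
pose q := `|Y| + 1; have q0 : 0 < q by rewrite ltr_wpDl.
pose d := Num.min 1 (e / q).
have d0 : 0 < d by rewrite lt_min ltr01 divr_gt0.
apply: le_trans (h d d0 _) _; first by rewrite ge_min lexx.
rewrite lerD2l; apply: le_trans (ler_norm _) _; rewrite normrM gtr0_norm//.
apply: (@le_trans _ _ (e / q * q)); last by rewrite divfK// gt_eqF.
apply: ler_pM => //; [exact: ltW|by rewrite ge_min lexx orbT|by rewrite lerDl].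
Qed.

Lemma residual_e (al al0 : R) (u ve cy cvm f s : 'rV[R]_3) :
  al *: u - cy = f + s -> al0 *: ve - cvm = f ->
  al *: (u - ve) - (cy - cvm) = (al0 - al) *: ve + s.
Proof.
move=> h1 h2; apply/rowP => j; have := congr1 (fun w : 'rV[R]_3 => w ord0 j) h1.
have := congr1 (fun w : 'rV[R]_3 => w ord0 j) h2; rewrite !mxE; clear.
move: (u ord0 j) (ve ord0 j) (cy ord0 j) (cvm ord0 j) (f ord0 j) (s ord0 j) => a1 a2 a3 a4 a5 a6.
by move=> k2 k1; lra.
Qed.

Lemma residual_m (be be0 : R) (y vm cu cve s : 'rV[R]_3) :
  be *: y + cu = s -> be0 *: vm + cve = 0 ->
  be *: (y - vm) + (cu - cve) = (be0 - be) *: vm + s.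
Proof.
move=> h1 h2; apply/rowP => j; have := congr1 (fun w : 'rV[R]_3 => w ord0 j) h1.
have := congr1 (fun w : 'rV[R]_3 => w ord0 j) h2; rewrite !mxE; clear.
move: (y ord0 j) (vm ord0 j) (cu ord0 j) (cve ord0 j) (s ord0 j) => a1 a2 a3 a4 a6.
by move=> k2 k1; lra.
Qed.

Variables (eps0 mu0 sigma0 : R) (eps mu sigma : point -> R) (p : point) (eta T : R) (f : R -> R) (a : 'rV[R]_3).
Hypotheses (eps00 : 0 < eps0) (mu00 : 0 < mu0) (sigma00 : 0 <= sigma0) (eta0 : 0 < eta) (T0 : 0 < T)
  (cf : {within `[0, T], continuous f}).
Hypotheses (beps : bmul leb3 eps) (bmu : bmul leb3 mu) (bsig : bmul leb3 sigma).
Variable e1 : R.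
Hypotheses (e10 : 0 < e1) (heps : {ae leb3, forall x, e1 <= eps x}) (hmu : {ae leb3, forall x, e1 <= mu x})
   (hsig : {ae leb3, forall x, 0 <= sigma x}).

(* [Vel] and [Vmg] solve exactly the background problem
   [al0 Vel - curl Vmg = src], [be0 Vmg + curl Vel = 0] with
   [al0 = tau eps0 + sigma0], [be0 = tau mu0]. *)
Definition kap tau := Num.sqrt ((tau * eps0 + sigma0) * (tau * mu0)).
Definition Vel tau : field := fun x => (laplace T f tau / (tau * eps0 + sigma0)) *: Pf p (kap tau) eta a x.
Definition Vmg tau : field := fun x => (- laplace T f tau) *: Nf p (kap tau) eta a x.
Definition src tau : field := fun x => (laplace T f tau * \1_(eball p eta) x) *: a.

Lemma al0_gt0 tau : 0 < tau -> 0 < tau * eps0 + sigma0.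
Proof. by move=> h; apply: ltr_wpDr => //; exact: mulr_gt0. Qed.

Lemma kap_gt0 tau : 0 < tau -> 0 < kap tau.
Proof. by move=> h; rewrite sqrtr_gt0 mulr_gt0 ?al0_gt0// mulr_gt0. Qed.

Lemma kap2 tau : 0 < tau -> kap tau ^+ 2 = (tau * eps0 + sigma0) * (tau * mu0).
Proof. by move=> h; rewrite sqr_sqrtr// mulr_ge0// ltW ?al0_gt0// mulr_gt0. Qed.

Lemma background_field tau : 0 < tau -> exists cVe cVm : field,
  [/\ weak_curl (Vel tau) cVe, weak_curl (Vmg tau) cVm,
     {ae leb3, forall x, (tau * eps0 + sigma0) *: Vel tau x - cVm x = src tau x} &
     {ae leb3, forall x, (tau * mu0) *: Vmg tau x + cVe x = 0}].
Proof.
move=> tau0; have k0 := kap_gt0 tau0; have al1 := al0_gt0 tau0.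
have w1 := weak_curlZ (laplace T f tau / (tau * eps0 + sigma0)) (weak_curl_Pf p k0 eta0 a).
have w2 := weak_curlZ (- laplace T f tau) (weak_curl_Nf p k0 eta0 a).
exists (fun x => (laplace T f tau / (tau * eps0 + sigma0)) *: (kap tau ^+ 2 *: Nf p (kap tau) eta a x)),
  (fun x => (- laplace T f tau) *: (\1_(eball p eta) x *: a - Pf p (kap tau) eta a x)).
split => //; apply: aeW => x.
  rewrite /Vel /src scalerA mulrC divfK ?gt_eqF// scaleNr opprK scalerBr scalerA.
  by rewrite addrC subrK.
rewrite /Vmg kap2// !scalerA -scalerDl (_ : _ + _ = 0) ?scale0r//.
by field; rewrite gt_eqF.
Qed.

Local Notation B := (eball p eta).

(** The energy estimate gives background norms of order [1 / tau], and residuals are of order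
    [expR (- (tau * T))]. Their products, and the squared residuals weighted by inverse
    coefficients, are thus of order [expR (- (tau * T)) / tau]. *)
Lemma indicator_bounds I : indicator_function eps0 mu0 sigma0 eps mu sigma T f B a I ->
  exists2 C : R, 0 <= C & forall tau, 1 <= tau ->
    let al x := tau * eps x + sigma x in let be x := tau * mu x in
    let al0 := tau * eps0 + sigma0 in let be0 := tau * mu0 in
    Int leb3 (Qlow al be al0 be0 (Vel tau) (Vmg tau)) - C * expR (- (tau * T)) / tau <= I tau /\
    I tau <= Int leb3 (Qup al be al0 be0 (Vel tau) (Vmg tau)) + C * expR (- (tau * T)) / tau.
Proof.
move=> [E [H [E0 [H0 [W [V []]]]]]] solE solE0 hI.
have Lchi := L2_src p eta ltr01 a.
have [K1 K10 hK1] := maxwell_approx T0 cf Lchi beps bmu solE.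
have [K2 K20 hK2] := maxwell_approx T0 cf Lchi (bmul_cst _ _) (bmul_cst _ _) solE0.
have [Cf Cf0 hCf] := laplace_bound T0 cf.
pose nc := nrm (fun x => \1_B x *: a); have nc0 : 0 <= nc by exact: nrm_ge0.
pose G := Cf * nc; have G0 : 0 <= G by exact: mulr_ge0.
pose c := Num.min e1 (Num.min eps0 mu0).
have c0 : 0 < c by rewrite !lt_min e10 eps00.
(* For [tau >= 1] this bounds both [al0 / al] and [be0 / be]. *)
pose M := 1 + (eps0 + sigma0) / e1 + mu0 / e1.
have M1 : 1 <= M.
  by rewrite /M -addrA lerDl addr_ge0// divr_ge0 ?addr_ge0// ltW.
pose K := K1 + K2; have K0 : 0 <= K by exact: addr_ge0.
(* The three terms come from the error of the approximate background, from the linear part of [err]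
   and from its quadratic part, in this order. *)
pose Q := (2 * G + 2 * M * G + 2 * (K + 1)) / c.
have M0 : 0 <= M := le_trans ler01 M1.
have Q0 : 0 <= Q.
  apply: divr_ge0; last exact: ltW.
  apply: addr_ge0; last by apply: mulr_ge0 => //; exact: addr_ge0.
  by apply: addr_ge0; apply: mulr_ge0 => //; exact: mulr_ge0.
exists (K * Q); first exact: mulr_ge0.
move=> tau tau1 al be al0 be0.
have tau0 : 0 < tau by exact: lt_le_trans tau1.
have al01 : 0 < al0 := al0_gt0 tau0.
have be01 : 0 < be0 by exact: mulr_gt0.
have tc0 : 0 < tau * c by exact: mulr_gt0.
have bal : bmul leb3 al by apply: bmulD => //; apply: bmulM => //; exact: bmul_cst.
have bbe : bmul leb3 be by apply: bmulM => //; exact: bmul_cst.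
have ce1 : c <= e1 by rewrite ge_min lexx.
have ceps : c <= eps0 by rewrite !ge_min lexx orbT.
have cmu : c <= mu0 by rewrite !ge_min lexx !orbT.
have lowal x : e1 <= eps x -> 0 <= sigma x -> tau * e1 <= al x.
  by move=> h1 h2; apply: (@le_trans _ _ (tau * eps x)); [rewrite ler_pM2l|rewrite lerDl].
have hb : {ae leb3, forall x, tau * c <= al x /\ tau * c <= be x}.
  apply: aeS (aeI heps (aeI hmu hsig)) => x [h1 [h2 h3]]; split.
    by apply: le_trans (lowal x h1 h3); rewrite ler_pM2l.
  by rewrite ler_pM2l//; exact: le_trans h2.
have te0 : 0 < tau * e1 by exact: mulr_gt0.
have hM : {ae leb3, forall x, `|al0 / al x| <= M /\ `|be0 / be x| <= M}.
  apply: aeS (aeI heps (aeI hmu hsig)) => x [h1 [h2 h3]].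
  have a1 := lowal x h1 h3; have a0 := lt_le_trans te0 a1.
  have b1 : tau * e1 <= be x by rewrite ler_pM2l.
  have b0 := lt_le_trans te0 b1.
  split; rewrite ger0_norm ?divr_ge0 ?(ltW al01) ?(ltW be01) ?(ltW a0) ?(ltW b0)//.
    apply: (@le_trans _ _ ((eps0 + sigma0) / e1)).
      rewrite ler_pdivrMr// (le_trans _ (ler_wpM2l _ a1)) ?divr_ge0 ?addr_ge0 ?(ltW eps00) ?(ltW e10)//.
      rewrite mulrCA divfK ?gt_eqF// mulrDr lerD2l.
      by rewrite ler_peMl.
    by rewrite /M addrAC lerDr addr_ge0// divr_ge0// ltW.
  apply: (@le_trans _ _ (mu0 / e1)).
    rewrite ler_pdivrMr// (le_trans _ (ler_wpM2l _ b1)) ?divr_ge0 ?(ltW mu00) ?(ltW e10)//.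
    by rewrite mulrCA divfK ?gt_eqF.
  by rewrite /M lerDr addr_ge0// divr_ge0 ?addr_ge0// ltW.
have [cVe [cVm [wVe wVm hVe hVm]]] := background_field tau0.
have [LVe _ _] := wVe; have [LVm _ _] := wVm.
pose F := src tau.
have FE : F = (fun x => laplace T f tau *: (\1_B x *: a)) by apply/funext => x; rewrite /F /src scalerA.
have LF : L2 F by rewrite FE; exact: L2Z.
have nF : nrm F <= G.
  rewrite FE nrmZ//; apply: ler_wpM2r => //; apply: hCf; exact: ltW.
have nF0 := nrm_ge0 F.
have [en1 en2] := background_energy al01 be01 wVe wVm LF hVe hVm.
pose v := G / (tau * c).
have v0 : 0 <= v by rewrite divr_ge0// ltW.
have tal : tau * c <= al0.
  by apply: (@le_trans _ _ (tau * eps0)); [rewrite ler_pM2l|rewrite lerDl].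
have tbe : tau * c <= be0 by rewrite ler_pM2l.
have nVe : nrm (Vel tau) <= v.
  apply: le_trans en1 _; apply: ler_pM => //; first by rewrite invr_ge0 ltW.
  by rewrite lef_pV2 ?posrE.
have nVm : nrm (Vmg tau) <= v.
  rewrite -(@ler_pXn2r _ 2)// ?nnegrE ?nrm_ge0//.
  rewrite -(ler_pM2l tc0); apply: (@le_trans _ _ (be0 * nrm (Vmg tau) ^+ 2)).
    by apply: ler_wpM2r => //; exact: sqr_ge0.
  apply: le_trans en2 _; rewrite /v (_ : tau * c * _ = G ^+ 2 / (tau * c)); last by field; rewrite !gt_eqF.
  apply: ler_pM; [exact: sqr_ge0|by rewrite invr_ge0 ltW|by rewrite lerXn2r ?nnegrE|by rewrite lef_pV2 ?posrE].
have [iW iV IE] := hI tau tau0.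
have [LW _] := iW; have [LV _] := iV.
set e := expR (- (tau * T)); have e0 : 0 <= e by exact: expR_ge0.
have e1' : e <= 1 by apply: ex_le1 => //; exact: ltW.
suff key d : 0 < d -> d <= 1 ->
    Int leb3 (Qlow al be al0 be0 (Vel tau) (Vmg tau)) <= I tau + K * Q * e / tau + d * (2 * G + Q / tau) /\
    I tau <= Int leb3 (Qup al be al0 be0 (Vel tau) (Vmg tau)) + K * Q * e / tau + d * (2 * G + Q / tau).
  split; last by apply: (@le_of_small _ _ (2 * G + Q / tau)) => d d0 d1; case: (key d d0 d1).
  by rewrite lerBlDr; apply: (@le_of_small _ _ (2 * G + Q / tau)) => d d0 d1; case: (key d d0 d1).
move=> d0 d1.
have [U [cU [Y [cY [se [sm [[wU wY] nU [Lse Lsm] [hU hY] [nse nsm]]]]]]]] := hK1 tau _ tau0 iW d d0.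
have [U0 [cU0 [Y0 [cY0 [se0 [sm0 [[wU0 wY0] nU0 [Lse0 Lsm0] [hU0 hY0] [nse0 nsm0]]]]]]]] := hK2 tau _ tau0 iV d d0.
pose s := K * e + d.
have s0 : 0 <= s by rewrite addr_ge0 ?mulr_ge0// ltW.
have sK : s <= K + 1 by apply: lerD => //; rewrite ler_piMr.
have KK1 : K1 * e + d <= s by rewrite /s lerD2r ler_wpM2r// lerDl.
have KK2 : K2 * e + d <= s by rewrite /s lerD2r ler_wpM2r// lerDr.
have {}nse := le_trans nse KK1; have {}nsm := le_trans nsm KK1.
have {}nse0 := le_trans nse0 KK2; have {}nsm0 := le_trans nsm0 KK2.
have [LU _ _] := wU; have [LU0 _ _] := wU0.
have wRe := weak_curlB wU wVe; have wRm := weak_curlB wY wVm.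
have wZe := weak_curlB wU0 wVe; have wZm := weak_curlB wY0 wVm.
have LRe : L2 (fun x => U x - Vel tau x) := L2B LU LVe.
have LZe : L2 (fun x => U0 x - Vel tau x) := L2B LU0 LVe.
have hRe : {ae leb3, forall x, al x *: (U x - Vel tau x) - (cY x - cVm x) = (al0 - al x) *: Vel tau x + se x}.
  apply: aeS (aeI hU hVe) => x [k1 k2].
  exact: residual_e k1 k2.
have hRm : {ae leb3, forall x, be x *: (Y x - Vmg tau x) + (cU x - cVe x) = (be0 - be x) *: Vmg tau x + sm x}.
  apply: aeS (aeI hY hVm) => x [k1 k2].
  exact: residual_m k1 k2.
have hZe : {ae leb3, forall x, al0 *: (U0 x - Vel tau x) - (cY0 x - cVm x) = se0 x}.
  apply: aeS (aeI hU0 hVe) => x [k1 k2].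
  by rewrite (residual_e k1 k2) subrr scale0r add0r.
have hZm : {ae leb3, forall x, be0 *: (Y0 x - Vmg tau x) + (cU0 x - cVe x) = sm0 x}.
  apply: aeS (aeI hY0 hVm) => x [k1 k2].
  by rewrite (residual_m k1 k2) subrr scale0r add0r.
have lo := variational_lower bal bbe tc0 hb M1 hM wRe wRm wVe wVm Lse Lsm LF hRe hRm hVe hVm.
have up := variational_upper bal bbe tc0 hb M1 hM wRe wRm wVe wVm Lse Lsm LF hRe hRm hVe hVm.
have pert := background_pert wVe wVm wZe wZm LF Lse0 Lsm0 hVe hVm hZe hZm.
(* Both transforms are compared with the same exact background; the last two terms are the Riemann
   errors of the two transforms. *)
have IE' : I tau = ip F (fun x => U x - Vel tau x) - ip F (fun x => U0 x - Vel tau x)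
   - ip F (fd U (W tau)) + ip F (fd U0 (V tau)).
  have L1 := L2B LU LW; have L2' := L2B LU0 LV.
  have LWV : L2 (fun x => W tau x - V tau x) := L2B LW LV.
  have sw w z : L2 w -> L2 z -> ip F (fun x => w x - z x) = ip F w - ip F z.
    by move=> Lw Lz; rewrite ipC ipBl// (ipC w) (ipC z).
  rewrite IE -/(Int _ _) -/(ip F _) /fd !sw//; clear.
  move: (ip _ _) (ip _ _) (ip _ _) (ip _ _) (ip _ _) => i1 i2 i3 i4 i5; ring.
have b1 : `|ip F (fd U (W tau))| <= G * d.
  exact: ip_le LF (L2B LU LW) nF nU.
have b2 : `|ip F (fd U0 (V tau))| <= G * d.
  exact: ip_le LF (L2B LU0 LV) nF nU0.
have b3 : `|ip F (fun x => U0 x - Vel tau x)| <= 2 * v * s.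
  rewrite pert -mulrA mulr2n mulrDl mul1r; apply: le_trans (ler_normB _ _) _.
  by apply: lerD; [exact: ip_le LVe Lse0 nVe nse0|exact: ip_le LVm Lsm0 nVm nsm0].
have b4 : err (Vel tau) (Vmg tau) se sm (tau * c) M <= 2 * M * v * s + 2 * (K + 1) * s / (tau * c).
  have sq1 (z : R) : 0 <= z -> z <= s -> z ^+ 2 <= (K + 1) * s.
    by move=> z0 zs; rewrite expr2; apply: ler_pM => //; exact: le_trans zs sK.
  rewrite /err; apply: lerD.
    rewrite (_ : 2 * M * v * s = M * (v * s + v * s)); last by ring.
    by apply: (ler_wpM2l M0); apply: lerD; [exact: nrmM_le nVe nse|exact: nrmM_le nVm nsm].
  rewrite (_ : 2 * (K + 1) * s / (tau * c) = (tau * c)^-1 * ((K + 1) * s + (K + 1) * s)); last by ring.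
  by apply: ler_wpM2l; [rewrite invr_ge0 ltW|apply: lerD; [exact: sq1 (nrm_ge0 _) nse|exact: sq1 (nrm_ge0 _) nsm]].
have tot : 2 * v * s + (2 * M * v * s + 2 * (K + 1) * s / (tau * c)) + (G * d + G * d) =
   K * Q * e / tau + d * (2 * G + Q / tau).
  by rewrite /v /Q /s; field; rewrite !gt_eqF.
move: lo up b1 b2 b3 b4 tot; rewrite IE'; clear.
move: (Int _ _) (Int _ _) (err _ _ _ _ _ _) (ip _ _) (ip _ _) (ip _ _) (ip _ _) => q1 q2 er i1 i2 i3 i4.
move: (2 * v * s) (2 * M * v * s + _) (K * Q * e / tau) (d * _) (G * d) => x1 x2 x3 x4 x5.
move=> lo up; rewrite !ler_norml => /andP[h1 h2] /andP[h3 h4] /andP[h5 h6] h7 h8.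
by split; lra.
Qed.

End IndicatorBounds.

(** * The distance from D to B *)

Section Geometry.
Context {R : realType}.
Local Notation point := (R * R * R)%type.

(** Lagrange's identity: the difference of the two sides is the sum of the squares of the minors. *)
Lemma dot_cs (u v : 'rV[R]_3) : dot u v ^+ 2 <= dot u u * dot v v.
Proof.
rewrite -subr_ge0 /dot !sum3.
move: (u ord0 0) (u ord0 1) (u ord0 2) (v ord0 0) (v ord0 1) (v ord0 2) => a b c x y z.
rewrite (_ : _ - _ = (a * y - b * x) ^+ 2 + (b * z - c * y) ^+ 2 + (a * z - c * x) ^+ 2); last by ring.
by rewrite !addr_ge0 ?sqr_ge0.
Qed.

Lemma enorm_tri (u v : 'rV[R]_3) : enorm (u + v) <= enorm u + enorm v.
Proof.
have s0 (w : 'rV[R]_3) : 0 <= enorm w by exact: sqrtr_ge0.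
have s2 (w : 'rV[R]_3) : enorm w ^+ 2 = dot w w by rewrite sqr_sqrtr// dot_ge0.
rewrite -(@ler_pXn2r _ 2)// ?nnegrE ?addr_ge0// sqrrD !s2 dotDl !dotDr (dotC v u).
have k : dot u v <= enorm u * enorm v.
  apply: le_trans (ler_norm _) _; rewrite -(@ler_pXn2r _ 2)// ?nnegrE ?mulr_ge0//.
  by rewrite real_normK ?num_real// exprMn !s2 dot_cs.
by move: (dot u u) (dot v v) (dot u v) (enorm u * enorm v) k => ? ? ? ?; clear; lra.
Qed.

Lemma rad_tri (p x y : point) : rad p x <= rad y x + rad p y.
Proof. by rewrite -!edistE /Defs.edist; apply: le_trans (enorm_tri _ _); rewrite addrA subrK. Qed.

Lemma rad_le_sum (p x : point) (e : R) : (forall i, `|co i x - co i p| <= e) -> rad p x <= e + e + e.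
Proof.
move=> h; have e0 : 0 <= e := le_trans (normr_ge0 _) (h 0).
rewrite -(@ler_pXn2r _ 2)// ?nnegrE ?rad_ge0 ?addr_ge0// rad2 sum3.
have k i : (co i x - co i p) ^+ 2 <= e ^+ 2.
  by rewrite -real_normK ?num_real// lerXn2r ?nnegrE.
apply: le_trans (lerD (lerD (k 0) (k 1)) (k 2)) _; rewrite -subr_ge0.
by rewrite (_ : _ - _ = 6 * e ^+ 2); [rewrite mulr_ge0 ?sqr_ge0|ring].
Qed.

Lemma split_six (a b c e f : R) : a < c + e / 2 -> f <= e / 6 -> b <= f + f + f -> b + a <= c + e.
Proof. lra. Qed.

Variables (D : set point) (p : point) (eta : R).
Hypotheses (eta0 : 0 < eta) (D0 : D !=set0) (DB : forall x, D x -> eta <= rad p x).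
Local Notation d := (set_dist D (eball p eta)).

Lemma eballP x : eball p eta x <-> rad p x < eta.
Proof. by rewrite /eball /= edistE. Qed.

Let S := [set Defs.edist x y | x in D & y in eball p eta].

Lemma dist_lb : has_lbound S.
Proof. by exists 0 => _ [x _ [y _ <-]]; rewrite edistE rad_ge0. Qed.

Lemma rad_center : rad p p = 0.
Proof. by rewrite /rad sum3 !subrr !expr0n /= !addr0 sqrtr0. Qed.

Lemma dist_neq0 : S !=set0.
Proof.
have [x Dx] := D0; exists (Defs.edist x p), x => //; exists p => //.
by apply/eballP; rewrite rad_center.
Qed.

Lemma dist_ge0 : 0 <= d.
Proof. by apply: lb_le_inf; [exact: dist_neq0|move=> _ [x _ [y _ <-]]; rewrite edistE rad_ge0]. Qed.

Lemma dist_le x : D x -> d + eta <= rad p x.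
Proof.
move=> Dx; have r0 := lt_le_trans eta0 (DB Dx); set r := rad p x in r0 *.
have [rx rn] : eta <= r /\ r != 0 by split; [exact: DB|rewrite gt_eqF].
rewrite -lerBrDr; apply/ler_addgt0Pr => e e0.
(* The competitor [y] is the point of the segment from [p] to [x] at radius [s]. It has to lie
   strictly inside the open ball, so [s] stays below [eta]; the maximum with 0 covers [e > eta]. *)
pose s := Num.max 0 (eta - e).
have s0 : 0 <= s by rewrite le_max lexx.
have s1 : s < eta by rewrite gt_max eta0 ltrBlDr ltrDl.
pose y : point := p + (s / r) *: (x - p).
have radZ (c : R) (z w : point) : 0 <= c -> (forall i, co i z - co i w = c * (co i x - co i p)) -> rad w z = c * r.
  move=> c0 h; rewrite /rad; under eq_bigr do rewrite h exprMn.
  by rewrite -mulr_sumr sqrtrM ?sqr_ge0// sqrtr_sqr ger0_norm.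
have ry : rad p y = s.
  rewrite (radZ (s / r)); [by rewrite divfK|by rewrite divr_ge0// ltW|].
  by move=> i; rewrite /y coD coZ coB addrC addKr.
have yx : rad y x = r - s.
  rewrite (radZ (1 - s / r)).
  - by rewrite mulrBl mul1r divfK.
  - by rewrite subr_ge0 ler_pdivrMr// mul1r (le_trans (ltW s1)).
  by move=> i; rewrite /y coD coZ coB; ring.
apply: (@le_trans _ _ (r - s)).
  apply: ge_inf; first exact: dist_lb.
  by exists x => //; exists y; [apply/eballP; rewrite ry|rewrite edistE].
have : eta - e <= s by rewrite le_max lexx orbT.
by lra.
Qed.

Lemma dist_near (e : R) : 0 < e -> exists2 x, D x & rad p x < d + eta + e.
Proof.
move=> e0; have [_ [x Dx [y yB <-]] h] := inf_adherent e0 (conj dist_neq0 dist_lb).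
exists x => //; apply: le_lt_trans (rad_tri p x y) _; rewrite addrAC.
by apply: ltrD; [rewrite -edistE|exact/eballP].
Qed.

Lemma dist_cube (e : R) : open D -> 0 < e ->
  exists c r, 0 < r /\ forall z, cube c r z -> D z /\ rad p z <= d + eta + e.
Proof.
move=> oD e0; have e2 : 0 < e / 2 by rewrite divr_gt0.
have [x Dx xr] := dist_near e2.
have /nbhs_ballP[r0 /= r00 hr] : nbhs x D by apply: open_nbhs_nbhs.
(* A cube of radius [e / 6] has Euclidean radius at most [3 * (e / 6) = e / 2], and its centre is
   within [e / 2] of optimal. *)
pose r := Num.min r0 (e / 6); have rpos : 0 < r by rewrite lt_min r00 divr_gt0.
exists x, r; split => // z [z1 z2 z3].
have rr : r <= r0 by rewrite ge_min lexx.
split; first by apply: hr; split; [split|]; apply: lt_le_trans rr.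
apply: le_trans (rad_tri p z x) _.
have : rad x z <= r + r + r.
  by apply: rad_le_sum; apply: I3P; rewrite ?co0 ?co1 ?co2 distrC ltW.
have : r <= e / 6 by rewrite ge_min lexx orbT.
exact: split_six xr.
Qed.

Lemma bounded_cube : bounded_set D -> exists2 r : R, 0 < r & forall z, D z -> cube p r z.
Proof.
move=> [M [_ hM]]; pose N := `|M| + 1.
have MN : M < N by rewrite (le_lt_trans (ler_norm _))// ltrDl.
have hN := hM N MN.
exists (N + `|p| + 1); first by rewrite ltr_wpDl// addr_ge0// addr_ge0.
move=> z Dz; have nz := hN z Dz; have npz : `|p - z| < N + `|p| + 1.
  by apply: le_lt_trans (ler_normB _ _) _; rewrite addrC -addrA; apply: ler_ltD => //; rewrite ltrDl.
have pn (U V : normedZmodType R) (x : U * V) : `|x.1| <= `|x| /\ `|x.2| <= `|x|.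
  by rewrite prod_normE !le_max !lexx orbT.
have [h1 h2] := pn _ _ (p - z); have [h3 h4] := pn _ _ (p - z).1.
by split; [apply: le_lt_trans (le_trans h3 h1) npz|apply: le_lt_trans (le_trans h4 h1) npz|apply: le_lt_trans h2 npz].
Qed.

End Geometry.

(** * Two linearly independent directions *)

Section Directions.
Context {R : realType}.
Implicit Types a b n : 'rV[R]_3.

(** The part of [a] orthogonal to [b] is nonzero by independence, and its squared length is
    [1 - (a . b)^2]. *)
Lemma free_dot_lt1 a b : free [:: a; b] -> dot a a = 1 -> dot b b = 1 -> `|dot a b| < 1.
Proof.
move=> fr a1 b1; set c := dot a b.
have ne : a - c *: b != 0.
  apply/eqP => /eqP; rewrite subr_eq0 => /eqP e.
  by move: fr; rewrite free_cons span_seq1 e memvZ// memv_line.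
have pos : 0 < dot (a - c *: b) (a - c *: b).
  rewrite lt_neqAle dot_ge0 andbT eq_sym; apply: contra ne => /eqP h.
  apply/eqP/rowP => i; rewrite [RHS]mxE; apply/eqP; rewrite -sqrf_eq0 expr2.
  have /eqP := h; rewrite /dot psumr_eq0; last by move=> j _; rewrite -expr2 sqr_ge0.
  by move/allP/(_ i); rewrite mem_index_enum => /(_ isT).
move: pos; rewrite dotBl !dotBr !dotZl !dotZr a1 b1 (dotC b a) -/c.
rewrite (_ : _ - _ = 1 - c ^+ 2); last by ring.
by rewrite subr_gt0 -real_normK ?num_real// expr_lt1.
Qed.

(* The largest eigenvalue of [a a^T + b b^T] is [1 + |a . b|]. *)
Lemma dot_pair_le a b n : dot a a = 1 -> dot b b = 1 -> dot n n = 1 ->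
  dot a n ^+ 2 + dot b n ^+ 2 <= 1 + `|dot a b|.
Proof.
move=> a1 b1 n1; set s := dot a n; set t := dot b n; set c := dot a b.
have h := dot_cs (s *: a + t *: b) n.
rewrite n1 mulr1 dotDl !dotZl -/s -/t in h.
rewrite dotDl !dotDr !dotZl !dotZr a1 b1 (dotC b a) -/c in h.
have S0 : 0 <= s ^+ 2 + t ^+ 2 by rewrite addr_ge0 ?sqr_ge0.
have st : 2 * (s * t * c) <= (s ^+ 2 + t ^+ 2) * `|c|.
  apply: (@le_trans _ _ (2 * (`|s| * `|t|) * `|c|)).
    by rewrite -[leRHS]mulrA ler_pM2l ?ltr0n// -!normrM ler_norm.
  apply: ler_wpM2r => //; rewrite -[s ^+ 2]real_normK ?num_real// -[t ^+ 2]real_normK ?num_real//.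
  by rewrite -subr_ge0 (_ : _ - _ = (`|s| - `|t|) ^+ 2) ?sqr_ge0//; ring.
have [->|Sn] := eqVneq (s ^+ 2 + t ^+ 2) 0; first by rewrite addr_ge0.
have Sp : 0 < s ^+ 2 + t ^+ 2 by rewrite lt_neqAle eq_sym Sn.
rewrite -(ler_pM2l Sp) -expr2.
have {}h : (s ^+ 2 + t ^+ 2) ^+ 2 <= s ^+ 2 + t ^+ 2 + 2 * (s * t * c).
  have e1 : s ^+ 2 + t ^+ 2 = s * s + t * t by rewrite !expr2.
  by rewrite {1}e1; apply: le_trans h _; rewrite le_eqVlt; apply/orP; left; apply/eqP; ring.
by apply: le_trans h _; rewrite mulrDr mulr1 lerD2l.
Qed.

End Directions.

(** * Size of the bounds as tau tends to infinity *)

Section Density.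
Context {R : realType}.
Local Notation point := (R * R * R)%type.

(** For [x = k eta >= 2] the term [sinh x] is at most half of [x cosh x], so [x cosh x - sinh x] is
    comparable to [x exp x]. *)
Lemma ampA_bounds (k eta : R) : 0 < eta -> 2 <= k * eta -> 0 < k ->
  eta * expR (k * eta) / (4 * k ^+ 2) <= ampA k eta <= eta * expR (k * eta) / k ^+ 2.
Proof.
move=> eta0 ke k0; rewrite /ampA; set x := k * eta in ke *.
have eE : eta = x / k by rewrite /x mulrC mulKf// gt_eqF.
have e0 : 0 < expR x by exact: expR_gt0.
have e1 : 0 <= expR (- x) by exact: expR_ge0.
have e2 : expR (- x) <= expR x by rewrite ler_expR; lra.
have k3 : 0 < 2 * k ^+ 3 by rewrite mulr_gt0// exprn_gt0.
rewrite eE; move: (expR x) (expR (- x)) e0 e1 e2 => a b a0 b0 ab.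
apply/andP; split.
  rewrite ler_pdivlMr// (_ : x / k * a / (4 * k ^+ 2) * (2 * k ^+ 3) = x * a / 2); last by field; rewrite gt_eqF.
  by nra.
rewrite ler_pdivrMr// (_ : x / k * a / k ^+ 2 * (2 * k ^+ 3) = 2 * (x * a)); last by field; rewrite gt_eqF.
by nra.
Qed.

Variables (p : point) (eta : R).
Hypothesis (eta0 : 0 < eta).

Definition rdir (x : point) : 'rV[R]_3 := \row_i ((co i x - co i p) / rad p x).

Lemma rdir1 x : 0 < rad p x -> dot (rdir x) (rdir x) = 1.
Proof.
move=> r0; rewrite /dot; under eq_bigr do rewrite !mxE mulrACA -expr2 -invfM.
rewrite -mulr_suml -rad2 expr2 mulfV// mulf_neq0// gt_eqF//.
Qed.

Variables (k : R) (a : 'rV[R]_3).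
Hypotheses (k0 : 0 < k) (a1 : dot a a = 1).

(* Squared length of the component of [a] orthogonal to the radial direction. *)
Definition trans (x : point) : R := 1 - dot a (rdir x) ^+ 2.

Lemma trans01 x : 0 < rad p x -> 0 <= trans x <= 1.
Proof.
move=> r0; rewrite /trans lerBlDr lerDl sqr_ge0 andbT subr_ge0.
by have := dot_cs a (rdir x); rewrite a1 rdir1// mulr1.
Qed.

Lemma outer x : eta <= rad p x -> [/\ 0 < rad p x, pF k eta (rad p x) = Fo k eta (rad p x),
  pF1 k eta (rad p x) = F1o k eta (rad p x) & pF2 k eta (rad p x) = F2o k eta (rad p x)].
Proof.
move=> er; split; first exact: lt_le_trans er.
- by rewrite /pF /cutr ltNge er.
- by rewrite /pF1 /cutr ltNge er.
- by rewrite /pF2 /cutr ltNge er.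
Qed.

(** Lagrange's identity for the vector product of [u] and [v], scaled by [c]. *)
Lemma cross_dot (u v : 'rV[R]_3) (c : R) (w : 'rV[R]_3) :
  (forall i, w ord0 i = c * (u ord0 (i + 1) * v ord0 (i + 2) - u ord0 (i + 2) * v ord0 (i + 1))) ->
  dot w w = c ^+ 2 * (dot u u * dot v v - dot v u ^+ 2).
Proof.
move=> h; rewrite /dot !sum3 !h !I3add.
by move: (u ord0 0) (u ord0 1) (u ord0 2) (v ord0 0) (v ord0 1) (v ord0 2) => *; ring.
Qed.

Lemma hess_sum (z1 z2 : R) (b q : 'I_3 -> R) (i : 'I_3) :
  \sum_j b j * (z1 * (j == i)%:R + z2 * q i * q j) = z1 * b i + z2 * q i * \sum_j b j * q j.
Proof.
under eq_bigr do rewrite mulrDr.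
rewrite big_split /= mulr_sumr; congr (_ + _).
  rewrite (bigD1 i)//= eqxx mulr1 big1 ?addr0 1?mulrC// => j /negbTE ->.
  by rewrite !mulr0.
by apply: eq_bigr => j _; rewrite mulrCA.
Qed.

Lemma Nf_density x : eta <= rad p x ->
  dot (Nf p k eta a x) (Nf p k eta a x) = (F1o k eta (rad p x) * rad p x) ^+ 2 * trans x.
Proof.
move=> er; have [r0 _ h1 _] := outer er.
rewrite (@cross_dot (rdir x) a (F1o k eta (rad p x) * rad p x)).
  by rewrite rdir1// a1 mulr1.
move=> i; rewrite !mxE /gpot h1; move: (F1o _ _ _) => z.
by field; rewrite gt_eqF.
Qed.

(** [Pf] is a multiple of [a] plus a multiple of the radial direction. Its transversal coefficient
    is [k^2 Fo - F1o], and the Helmholtz equation reduces the radial one to [2 F1o]. *)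
Lemma Pf_density x : eta <= rad p x ->
  dot (Pf p k eta a x) (Pf p k eta a x) =
  (k ^+ 2 * Fo k eta (rad p x) - F1o k eta (rad p x)) ^+ 2 * trans x +
  4 * F1o k eta (rad p x) ^+ 2 * (1 - trans x).
Proof.
move=> er; have [r0 h0 h1 h2] := outer er; have := helm_o k eta r0.
have Pi i : Pf p k eta a x ord0 i = (k ^+ 2 * Fo k eta (rad p x) - F1o k eta (rad p x)) * a ord0 i
    - F2o k eta (rad p x) * rad p x ^+ 2 * dot a (rdir x) * rdir x ord0 i.
  rewrite mxE /pot h0 /hpot h1 h2.
  move: (Fo _ _ _) (F1o _ _ _) (F2o _ _ _) => z0 z1 z2.
  have q j : co j x - co j p = rad p x * rdir x ord0 j by rewrite mxE mulrC divfK// gt_eqF.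
  under eq_bigr do rewrite !q.
  rewrite (hess_sum z1 z2 (fun j => a ord0 j) (fun j => rad p x * rdir x ord0 j)).
  have -> : \sum_j a ord0 j * (rad p x * rdir x ord0 j) = rad p x * dot a (rdir x).
    by rewrite /dot mulr_sumr; apply: eq_bigr => j _; ring.
  by ring.
set al := _ - _ in Pi *; set t := dot a (rdir x) in Pi *; set z := F2o _ _ _ * _ in Pi *.
have -> : dot (Pf p k eta a x) (Pf p k eta a x) = al ^+ 2 * dot a a - 2 * al * z * t * dot a (rdir x) + z ^+ 2 * t ^+ 2 * dot (rdir x) (rdir x).
  rewrite /dot !sum3 !Pi; clear.
  by move: al z t (a ord0 0) (a ord0 1) (a ord0 2) (rdir x ord0 0) (rdir x ord0 1) (rdir x ord0 2) => *; ring.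
rewrite a1 rdir1// -/t /trans -/t => hh.
have zE : z = k ^+ 2 * Fo k eta (rad p x) - 3 * F1o k eta (rad p x) by rewrite -hh /z; ring.
by rewrite zE /al; ring.
Qed.

Definition amp (r : R) : R := ampA k eta * expR (- (k * r)) / r.

Lemma F1o_amp r : 0 < r -> F1o k eta r * r = - (amp r * k * (1 + (k * r)^-1)).
Proof. by move=> r0; rewrite /F1o /prG /amp mulNr; field; rewrite !gt_eqF. Qed.

Lemma Fo_amp r : 0 < r -> k ^+ 2 * Fo k eta r - F1o k eta r =
  amp r * k ^+ 2 * (1 + (k * r)^-1 + (k * r)^-1 ^+ 2).
Proof. by move=> r0; rewrite /Fo /F1o /prG /prE /amp mulNr; field; rewrite !gt_eqF. Qed.

(* With [g = (k r)^-1] and [s = trans], outside the ball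
   [al0 |Vel|^2 = dens * ue g s] and [be0 |Vmg|^2 = dens * um g s]. *)
Definition dens (ft be0 : R) (r : R) : R := ft ^+ 2 * amp r ^+ 2 * be0 * k ^+ 2.
Definition ue (g s : R) := (1 + g + g ^+ 2) ^+ 2 * s + 4 * (g ^+ 2 * (1 + g) ^+ 2) * (1 - s).
Definition um (g s : R) := (1 + g) ^+ 2 * s.

Lemma Ve_dens (ft al0 be0 : R) x : 0 < al0 -> k ^+ 2 = al0 * be0 -> eta <= rad p x ->
  al0 * dot ((ft / al0) *: Pf p k eta a x) ((ft / al0) *: Pf p k eta a x) =
  dens ft be0 (rad p x) * ue (k * rad p x)^-1 (trans x).
Proof.
move=> al1 kk er; have [r0 _ _ _] := outer er.
rewrite dotZl dotZr Pf_density// Fo_amp//.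
have -> : F1o k eta (rad p x) ^+ 2 = (amp (rad p x) * k ^+ 2 * ((k * rad p x)^-1 * (1 + (k * rad p x)^-1))) ^+ 2.
  have -> : F1o k eta (rad p x) = F1o k eta (rad p x) * rad p x / rad p x by rewrite mulfK// gt_eqF.
  by rewrite F1o_amp//; field; rewrite !gt_eqF.
rewrite /dens /ue; have -> : be0 = k ^+ 2 / al0 by rewrite kk mulrAC divff ?mul1r// gt_eqF.
by move: (trans x) (amp _) ((k * _)^-1) => s y g; field; rewrite gt_eqF.
Qed.

Lemma Vm_dens (ft be0 : R) x : eta <= rad p x ->
  be0 * dot ((- ft) *: Nf p k eta a x) ((- ft) *: Nf p k eta a x) =
  dens ft be0 (rad p x) * um (k * rad p x)^-1 (trans x).
Proof.
move=> er; have [r0 _ _ _] := outer er.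
rewrite dotZl dotZr Nf_density// F1o_amp// /dens /um.
by move: (trans x) (amp _) ((k * _)^-1) => s y g; ring.
Qed.

End Density.

(** * Leading terms of the electric and magnetic weights *)

Section Weights.
Context {R : realType}.
Implicit Types g s M C h : R.

(** Both weights equal [s] up to order [g], the inverse of [k r]; hence electric and magnetic jumps
    enter with equal weight in the limit and only their sum matters. *)
Lemma ue_bounds g s : 0 <= g <= 1 -> 0 <= s <= 1 -> s <= ue g s <= s + 16 * g.
Proof.
move=> /andP[g0 g1] /andP[s0 s1].
have g2 : 0 <= g ^+ 2 <= g.
  by rewrite sqr_ge0 expr2 ler_piMl.
case/andP: g2 => g2 g2'.
have p1 : 0 <= (1 + g + g ^+ 2) ^+ 2 - 1 <= 16 * g.
  rewrite (_ : _ - 1 = (g + g ^+ 2) * (2 + g + g ^+ 2)); last by ring.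
  rewrite mulr_ge0 ?addr_ge0//=.
  apply: (@le_trans _ _ (2 * g * 4)); last lra.
  by apply: ler_pM; rewrite ?addr_ge0//; lra.
have p2 : 0 <= 4 * (g ^+ 2 * (1 + g) ^+ 2) <= 16 * g.
  apply/andP; split.
    by apply: mulr_ge0; [exact: ler0n|apply: mulr_ge0; exact: sqr_ge0].
  have q : (1 + g) ^+ 2 <= 2 ^+ 2 by rewrite lerXn2r ?nnegrE ?addr_ge0//; lra.
  rewrite (_ : 16 * g = 4 * (g * 2 ^+ 2)); last by ring.
  by rewrite ler_pM2l ?ltr0n//; apply: ler_pM => //; exact: sqr_ge0.
rewrite /ue; move: p1 p2; move: ((1 + g + g ^+ 2) ^+ 2) (4 * _) => u v /andP[u0 u1] /andP[v0 v1].
apply/andP; split; nra.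
Qed.

Lemma um_bounds g s : 0 <= g <= 1 -> 0 <= s <= 1 -> s <= um g s <= s + 16 * g.
Proof.
move=> /andP[g0 g1] /andP[s0 s1]; rewrite /um; apply/andP; split; nra.
Qed.

(** Replacing each of the two weights by [s] costs [16 * M * g]; the jump may be negative in one of
    the two coefficients as long as the sum is controlled. *)
Lemma weight_lower M C h A1 B1 g s : `|A1| <= M -> `|B1| <= M -> C - h <= A1 + B1 -> 0 <= h ->
  0 <= g <= 1 -> 0 <= s <= 1 -> C * s - h - 32 * M * g <= A1 * ue g s + B1 * um g s.
Proof.
move=> hA hB hC h0 hg hs; have /andP[u1 u2] := ue_bounds hg hs; have /andP[w1 w2] := um_bounds hg hs.
case/andP: hg => g0 g1; case/andP: hs => s0 s1.
have key (A u : R) : `|A| <= M -> s <= u -> u <= s + 16 * g -> A * s - 16 * M * g <= A * u.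
  move=> hA' su us; have : `|A * (u - s)| <= M * (16 * g).
    rewrite normrM; apply: ler_pM => //; rewrite ger0_norm ?subr_ge0//; lra.
  by rewrite ler_norml => /andP[h1 _]; lra.
have k1 := key _ _ hA u1 u2; have k2 := key _ _ hB w1 w2.
have : (C - h) * s <= (A1 + B1) * s by apply: ler_wpM2r.
have : h * s <= h by rewrite ler_piMr.
by lra.
Qed.

Lemma weight_abs M A1 B1 g s : `|A1| <= M -> `|B1| <= M ->
  0 <= g <= 1 -> 0 <= s <= 1 -> `|A1 * ue g s + B1 * um g s| <= 34 * M.
Proof.
move=> hA hB hg hs; have /andP[u1 u2] := ue_bounds hg hs; have /andP[w1 w2] := um_bounds hg hs.
case/andP: hg => g0 g1; case/andP: hs => s0 s1.
have key (A u : R) : `|A| <= M -> s <= u -> u <= s + 16 * g -> `|A * u| <= M * 17.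
  move=> hA' su us; rewrite normrM; apply: ler_pM => //; rewrite ger0_norm; lra.
have k1 := key _ _ hA u1 u2; have k2 := key _ _ hB w1 w2.
by apply: le_trans (ler_normD _ _) _; lra.
Qed.

End Weights.

Ltac nneg := repeat first [ assumption | (apply: ltW; assumption) | exact: expR_ge0 | exact: sqr_ge0
  | exact: ler0n | (rewrite invr_ge0) | (apply: addr_ge0) | (apply: exprn_ge0) | (apply: mulr_ge0) ].

Section DensityBounds.
Context {R : realType}.
Variables (k eta al0 be0 d ft : R).
Hypotheses (eta0 : 0 < eta) (k0 : 0 < k) (ke : 2 <= k * eta) (al01 : 0 < al0) (be01 : 0 < be0)
  (kk : k ^+ 2 = al0 * be0) (d0 : 0 <= d).

Lemma amp_ge0 r : 0 < r -> 0 <= amp eta k r.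
Proof.
move=> r0; have /andP[h _] := ampA_bounds eta0 ke k0.
have : 0 <= ampA k eta.
  by apply: le_trans h; nneg.
by move=> A0; rewrite /amp; nneg.
Qed.

(** The factor [expR (k * eta)] of [ampA] turns the decay in [r] into decay in the distance
    [r - eta] to the ball; [eta / r <= 1] absorbs the remaining factor. *)
Lemma dens_upper r : d + eta <= r -> dens eta k ft be0 r <= ft ^+ 2 * expR (- (k * d)) ^+ 2 / al0.
Proof.
move=> dr; have er : eta <= r by apply: le_trans dr; rewrite lerDr.
have r0 : 0 < r by exact: lt_le_trans er.
have /andP[_ h] := ampA_bounds eta0 ke k0.
have k2 : 0 < k ^+ 2 by rewrite exprn_gt0.
have ha : amp eta k r <= expR (- (k * d)) / k ^+ 2.
  rewrite /amp ler_pdivrMr//; apply: (@le_trans _ _ (eta * expR (k * eta) / k ^+ 2 * expR (- (k * r)))).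
    by apply: ler_wpM2r => //; exact: expR_ge0.
  rewrite (_ : eta * _ / _ * _ = eta * (expR (k * eta) * expR (- (k * r))) / k ^+ 2); last by ring.
  rewrite [leRHS]mulrAC ler_pM2r ?invr_gt0// [leRHS]mulrC; apply: ler_pM => //; try by nneg.
  rewrite -expRD ler_expR -mulrN -mulrDr -mulrN ler_pM2l//; lra.
rewrite /dens; have -> : be0 = k ^+ 2 / al0 by rewrite kk mulrAC divff ?mul1r// gt_eqF.
have a0 := amp_ge0 r0.
apply: (@le_trans _ _ (ft ^+ 2 * (expR (- (k * d)) / k ^+ 2) ^+ 2 * (k ^+ 2 / al0) * k ^+ 2)).
  apply: ler_wpM2r; first exact: ltW.
  apply: ler_wpM2r; first by nneg.
  by apply: ler_wpM2l; rewrite ?sqr_ge0// lerXn2r ?nnegrE// divr_ge0 ?expR_ge0// ltW.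
by rewrite le_eqVlt; apply/orP; left; apply/eqP; field; rewrite !gt_eqF.
Qed.

(** The factor 16 is the square of the 4 in [ampA_bounds], and [1 / r] is bounded below by the
    inverse of the largest radius allowed. *)
Lemma dens_lower r e : eta <= r -> 0 <= e -> r <= d + eta + e ->
  ft ^+ 2 * eta ^+ 2 / (16 * (d + eta + e) ^+ 2) * expR (- (k * (d + e))) ^+ 2 / al0 <= dens eta k ft be0 r.
Proof.
move=> er e0 rr; have r0 : 0 < r by exact: lt_le_trans er.
have rho0 : 0 < d + eta + e by exact: lt_le_trans rr.
set rho := d + eta + e in rr rho0 *.
have /andP[h _] := ampA_bounds eta0 ke k0.
have k2 : 0 < k ^+ 2 by rewrite exprn_gt0.
have q0 : 0 <= eta / (4 * k ^+ 2 * rho) * expR (- (k * (d + e))).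
  by rewrite mulr_ge0 ?expR_ge0// divr_ge0 ?ltW// !mulr_gt0.
have ha : eta / (4 * k ^+ 2 * rho) * expR (- (k * (d + e))) <= amp eta k r.
  rewrite /amp; apply: (@le_trans _ _ (eta * expR (k * eta) / (4 * k ^+ 2) * expR (- (k * r)) / r)); last first.
    apply: ler_wpM2r; first by rewrite invr_ge0 ltW.
    by apply: ler_wpM2r => //; exact: expR_ge0.
  rewrite (_ : eta * _ / _ * _ / _ = eta / (4 * k ^+ 2) * ((expR (k * eta) * expR (- (k * r))) / r)); last by ring.
  rewrite (_ : eta / (4 * k ^+ 2 * rho) * expR (- (k * (d + e))) = eta / (4 * k ^+ 2) * (expR (- (k * (d + e))) / rho)); last first.
    by rewrite invfM; ring.
  apply: ler_wpM2l.
    by nneg.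
  apply: ler_pM; [exact: expR_ge0|by rewrite invr_ge0 ltW| |by rewrite lef_pV2 ?posrE].
  by rewrite -expRD ler_expR -!mulrN -mulrDr ler_pM2l//; rewrite /rho in rr; lra.
rewrite /dens; have -> : be0 = k ^+ 2 / al0 by rewrite kk mulrAC divff ?mul1r// gt_eqF.
apply: (@le_trans _ _ (ft ^+ 2 * (eta / (4 * k ^+ 2 * rho) * expR (- (k * (d + e)))) ^+ 2 * (k ^+ 2 / al0) * k ^+ 2)).
  by rewrite le_eqVlt; apply/orP; left; apply/eqP; field; rewrite !gt_eqF.
apply: ler_wpM2r; first exact: ltW.
apply: ler_wpM2r; first by nneg.
by apply: ler_wpM2l; rewrite ?sqr_ge0// lerXn2r ?nnegrE// (le_trans q0 ha).
Qed.

End DensityBounds.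

Section Coefficients.
Context {R : realType}.
Variables (eps0 mu0 sigma0 e1 E : R).
Hypotheses (eps00 : 0 < eps0) (mu00 : 0 < mu0) (sigma00 : 0 <= sigma0) (e10 : 0 < e1) (E0 : 0 <= E).

(** After the 1, the summands bound [al / al0], [be0 / be], [al0 / al] and [be / be0] for
    [tau >= 1]. *)
Definition coefM : R := 1 + 2 * E / eps0 + mu0 / e1 + (eps0 + sigma0) / e1 + E / mu0.
(** [coefh / tau] is the cost of dropping the conductivity from [al / al0] (first summand) and from
    [al0 / al] (second); both differences have numerator [sigma * eps0 - eps * sigma0] up to
    sign. *)
Definition coefh : R := E * (eps0 + sigma0) / eps0 ^+ 2 + E * (eps0 + sigma0) / e1 ^+ 2.

Lemma coef_bounds (tau eps mu sigma : R) : 1 <= tau -> e1 <= eps -> e1 <= mu -> 0 <= sigma ->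
  eps <= E -> mu <= E -> sigma <= E ->
  let al := tau * eps + sigma in let be := tau * mu in
  let al0 := tau * eps0 + sigma0 in let be0 := tau * mu0 in
  [/\ `|1 - al / al0| <= coefM /\ `|1 - be0 / be| <= coefM,
      `|al0 / al - 1| <= coefM /\ `|be / be0 - 1| <= coefM,
      (1 - eps / eps0) + (1 - 1 / (mu / mu0)) - coefh / tau <= (1 - al / al0) + (1 - be0 / be) &
      (1 - 1 / (eps / eps0)) + (1 - mu / mu0) - coefh / tau <= - (al0 / al - 1) - (be / be0 - 1)].
Proof.
move=> t1 he hm s0 hE hM hS al be al0 be0.
have t0 : 0 < tau by exact: lt_le_trans t1.
have ep : 0 < eps by exact: lt_le_trans he.
have mp : 0 < mu by exact: lt_le_trans hm.
have te : tau * eps0 <= al0 by rewrite lerDl.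
have te0 : 0 < tau * eps0 by exact: mulr_gt0.
have al00 : 0 < al0 by exact: lt_le_trans te.
have ae : tau * e1 <= al by apply: (@le_trans _ _ (tau * eps)); [rewrite ler_pM2l|rewrite lerDl].
have te1 : 0 < tau * e1 by exact: mulr_gt0.
have alp : 0 < al by exact: lt_le_trans ae.
have bep : 0 < be by exact: mulr_gt0.
have be00 : 0 < be0 by exact: mulr_gt0.
pose m1 := 2 * E / eps0; pose m2 := mu0 / e1; pose m3 := (eps0 + sigma0) / e1; pose m4 := E / mu0.
have m10 : 0 <= m1 by nneg.
have m20 : 0 <= m2 by nneg.
have m30 : 0 <= m3 by nneg.
have m40 : 0 <= m4 by nneg.
have c1 : 0 <= al / al0 <= m1.
  apply/andP; split; first by rewrite /al0 /be0 /be /al; nneg.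
  rewrite ler_pdivrMr//.
  apply: (@le_trans _ _ (m1 * (tau * eps0))); last exact: ler_wpM2l.
  have -> : m1 * (tau * eps0) = tau * E + tau * E by rewrite /m1; field; rewrite gt_eqF.
  apply: lerD.
    by rewrite ler_pM2l.
  by apply: le_trans hS _; rewrite ler_peMl.
have c2 : 0 <= be0 / be <= m2.
  apply/andP; split; first by rewrite /al0 /be0 /be /al; nneg.
  rewrite ler_pdivrMr// /be mulrCA ler_pM2l// /m2 mulrAC -mulrA.
  by rewrite ler_peMr ?(ltW mu00)// ler_pdivlMr// mul1r.
have c3 : 0 <= al0 / al <= m3.
  apply/andP; split; first by rewrite /al0 /be0 /be /al; nneg.
  rewrite ler_pdivrMr//.
  apply: (@le_trans _ _ (m3 * (tau * e1))); last exact: ler_wpM2l.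
  by rewrite /m3 mulrCA divfK ?gt_eqF// mulrDr lerD2l ler_peMl.
have c4 : 0 <= be / be0 <= m4.
  apply/andP; split; first by rewrite /be /be0; nneg.
  by rewrite ler_pdivrMr// /be0 mulrCA ler_pM2l// /m4 divfK// gt_eqF.
have cm : coefM = 1 + m1 + m2 + m3 + m4 by [].
have b1 (z m : R) : 0 <= z <= m -> 1 + m <= coefM -> `|1 - z| <= coefM.
  by move=> /andP[z0 zm] mC; apply: le_trans (ler_normB _ _) _; rewrite normr1 ger0_norm//; apply: le_trans mC; rewrite lerD2l.
have n1 : E * (eps0 + sigma0) / eps0 ^+ 2 >= 0 by nneg.
have n2 : E * (eps0 + sigma0) / e1 ^+ 2 >= 0 by nneg.
have num : `|sigma * eps0 - eps * sigma0| <= E * (eps0 + sigma0).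
  apply: le_trans (ler_normB _ _) _; rewrite mulrDr (ger0_norm (mulr_ge0 s0 (ltW eps00))) (ger0_norm (mulr_ge0 (ltW ep) sigma00)).
  by apply: lerD; apply: ler_pM => //; exact: ltW.
have d1 : `|al / al0 - eps / eps0| <= coefh / tau.
  have -> : al / al0 - eps / eps0 = (sigma * eps0 - eps * sigma0) / (al0 * eps0).
    by rewrite /al /al0; field; rewrite (gt_eqF eps00) /=; exact: lt0r_neq0 al00.
  rewrite normrM normfV (gtr0_norm (mulr_gt0 al00 eps00)).
  apply: (@le_trans _ _ (E * (eps0 + sigma0) / (tau * eps0 ^+ 2))).
    apply: ler_pM => //; first by nneg.
    rewrite lef_pV2 ?posrE ?mulr_gt0 ?exprn_gt0//.
    by rewrite expr2 mulrA ler_pM2r.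
  by rewrite invfM mulrA mulrAC ler_pM2r ?invr_gt0// /coefh lerDl.
have d2 : `|al0 / al - eps0 / eps| <= coefh / tau.
  have -> : al0 / al - eps0 / eps = - (sigma * eps0 - eps * sigma0) / (al * eps).
    by rewrite /al /al0; field; rewrite (gt_eqF ep) /=; exact: lt0r_neq0 alp.
  rewrite normrM normrN normfV (gtr0_norm (mulr_gt0 alp ep)).
  apply: (@le_trans _ _ (E * (eps0 + sigma0) / (tau * e1 ^+ 2))).
    apply: ler_pM => //; first by nneg.
    rewrite lef_pV2 ?posrE ?mulr_gt0 ?exprn_gt0//.
    by rewrite expr2 mulrA; apply: ler_pM => //; exact: ltW.
  by rewrite invfM mulrA mulrAC ler_pM2r ?invr_gt0// /coefh lerDr.
have e2 : be0 / be = 1 / (mu / mu0) by rewrite /be0 /be; field; rewrite !gt_eqF.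
have e4 : be / be0 = mu / mu0 by rewrite /be0 /be; field; rewrite !gt_eqF.
have e3 : eps0 / eps = 1 / (eps / eps0) by field; rewrite !gt_eqF.
split.
- by split; [apply: b1 c1 _|apply: b1 c2 _]; rewrite cm; lra.
- by rewrite distrC [`|be / be0 - 1|]distrC; split; [apply: b1 c3 _|apply: b1 c4 _]; rewrite cm; lra.
- by move: d1; rewrite e2 ler_norml => /andP[_ h1]; clear - h1; move: (1 / _) (al / _) (eps / _) (coefh / _) h1 => *; lra.
- by move: d2; rewrite e3 e4 ler_norml => /andP[_ h2]; clear - h2; move: (1 / _) (al0 / _) (mu / _) (coefh / _) h2 => *; lra.
Qed.

End Coefficients.

(** * Integrals of the quadratic forms over [D] *)

Section Integrals.
Context {R : realType}.
Local Notation point := (R * R * R)%type.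
Local Notation mpoint := (measurableTypeR R * measurableTypeR R * measurableTypeR R)%type.
Local Notation field := (point -> 'rV[R]_3).

Lemma Int_abs_cube (q : mpoint -> R) (D : set point) (c : point) (r m : R) : 0 <= r -> 0 <= m ->
  intg leb3 q -> (forall z, D z -> cube c r z) ->
  {ae leb3, forall x, (D x -> `|q x| <= m) /\ (~ D x -> q x = 0)} ->
  `|Int leb3 q| <= m * (2 * r) ^+ 3.
Proof.
move=> r0 m0 iq Dc h; apply: le_trans (ler_Int_norm iq) _.
have ic : intg leb3 (fun x : mpoint => m * \1_(cube c r) x).
  by rewrite -leb3E; apply: intgZ; exact: intg_cube.
have <- : Int leb3 (fun x : mpoint => m * \1_(cube c r) x) = m * (2 * r) ^+ 3.
  by rewrite -leb3E IntZ ?Int_cube//; exact: intg_cube.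
apply: Int_le_ae => //; first exact: intg_norm.
apply: aeS h => x [h1 h2]; have [Dx|nD] := pselect (D x).
  by rewrite indicE mem_set ?mulr1; [exact: h1|exact: Dc].
by rewrite h2// normr0 mulr_ge0.
Qed.

Lemma Int_lower_cube (q : mpoint -> R) (D : set point) (c : point) (r m : R) : 0 <= r ->
  intg leb3 q -> (forall z, cube c r z -> D z) ->
  {ae leb3, forall x, (D x -> 0 <= q x /\ (cube c r x -> m <= q x)) /\ (~ D x -> q x = 0)} ->
  m * (2 * r) ^+ 3 <= Int leb3 q.
Proof.
move=> r0 iq Dc h.
have ic : intg leb3 (fun x : mpoint => m * \1_(cube c r) x).
  by rewrite -leb3E; apply: intgZ; exact: intg_cube.
have <- : Int leb3 (fun x : mpoint => m * \1_(cube c r) x) = m * (2 * r) ^+ 3.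
  by rewrite -leb3E IntZ ?Int_cube//; exact: intg_cube.
apply: Int_le_ae => //.
apply: aeS h => x [h1 h2]; have [cx|nc] := pselect (cube c r x).
  by rewrite indicE mem_set ?mulr1//; have [_] := h1 (Dc _ cx); apply.
rewrite indicE memNset// mulr0; have [Dx|nD] := pselect (D x).
  by have [] := h1 Dx.
by rewrite h2.
Qed.

Lemma weight_sum (w y1 y2 y3 y4 y5 : R) : 2 * y1 + y2 <= w -> y5 + y5 <= y2 -> 2 * w <= y3 + y4 ->
  w <= y3 - y1 - y5 + (y4 - y1 - y5).
Proof. lra. Qed.

Variables (eps0 mu0 sigma0 : R) (eps mu sigma : point -> R) (D : set point) (p : point) (eta T : R) (f : R -> R).
Hypotheses (eps00 : 0 < eps0) (mu00 : 0 < mu0) (sigma00 : 0 <= sigma0) (eta0 : 0 < eta).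
Hypotheses (beps : bmul leb3 eps) (bmu : bmul leb3 mu) (bsig : bmul leb3 sigma).
Variables (e1 E : R).
Hypotheses (e10 : 0 < e1) (E0 : 0 <= E)
  (hco : {ae leb3, forall x, [/\ e1 <= eps x, e1 <= mu x & 0 <= sigma x]})
  (hE : {ae leb3, forall x, [/\ eps x <= E, mu x <= E & sigma x <= E]})
  (hD : {ae leb3, forall x, ~ D x -> [/\ eps x = eps0, mu x = mu0 & sigma x = sigma0]}).
Hypotheses (D0 : D !=set0) (DB : forall x, D x -> eta <= rad p x) (oD : open D) (bD : bounded_set D).

Local Notation d := (set_dist D (eball p eta)).
Local Notation k := (kap eps0 mu0 sigma0).
Local Notation c := (Num.sqrt (mu0 * eps0)).
Local Notation ft := (laplace T f).
Local Notation al := (fun tau x => tau * eps x + sigma x).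
Local Notation be := (fun tau x => tau * mu x).
Local Notation al0 := (fun tau => tau * eps0 + sigma0).
Local Notation be0 := (fun tau => tau * mu0).
Definition QL a tau : point -> R := Qlow (al tau) (be tau) (al0 tau) (be0 tau)
  (Vel eps0 mu0 sigma0 p eta T f a tau) (Vmg eps0 mu0 sigma0 p eta T f a tau).
Definition QU a tau : point -> R := Qup (al tau) (be tau) (al0 tau) (be0 tau)
  (Vel eps0 mu0 sigma0 p eta T f a tau) (Vmg eps0 mu0 sigma0 p eta T f a tau).

Lemma speed_gt0 : 0 < c. Proof. by rewrite sqrtr_gt0 mulr_gt0. Qed.

Lemma speed_sqr : c ^+ 2 = mu0 * eps0. Proof. by rewrite sqr_sqrtr// mulr_ge0// ltW. Qed.

Lemma kap_lower tau : 0 < tau -> tau * c <= k tau.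
Proof.
move=> t0; have c0 := speed_gt0.
have h0 : 0 <= tau * c by nneg.
rewrite -(@ler_pXn2r _ 2)// ?nnegrE ?sqrtr_ge0// kap2// exprMn speed_sqr.
by rewrite -subr_ge0 (_ : _ - _ = sigma0 * (tau * mu0)); [nneg|ring].
Qed.

(** The shift is chosen so that the cross term of the square equals the conductivity term of
    [k ^+ 2]. It is independent of [tau], so conductivity costs a bounded factor in the
    exponentials. *)
Lemma kap_upper tau : 0 < tau -> k tau <= tau * c + sigma0 * mu0 / (2 * c).
Proof.
move=> t0; have c0 := speed_gt0.
have h0 : 0 <= tau * c + sigma0 * mu0 / (2 * c) by nneg.
rewrite -(@ler_pXn2r _ 2)// ?nnegrE ?sqrtr_ge0// kap2//.
have -> : (tau * c + sigma0 * mu0 / (2 * c)) ^+ 2 = tau ^+ 2 * c ^+ 2 + tau * (sigma0 * mu0) + (sigma0 * mu0 / (2 * c)) ^+ 2.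
  by field; rewrite gt_eqF.
rewrite speed_sqr -subr_ge0 (_ : _ - _ = (sigma0 * mu0 / (2 * c)) ^+ 2); first exact: sqr_ge0.
by ring.
Qed.

Lemma Q_intg a tau : 0 < tau -> intg leb3 (QL a tau) /\ intg leb3 (QU a tau).
Proof.
move=> t0; have [cVe [cVm [wVe wVm _ _]]] := background_field p T f a eps00 mu00 sigma00 eta0 t0.
have bal : bmul leb3 (al tau) by apply: bmulD => //; apply: bmulM => //; exact: bmul_cst.
have bbe : bmul leb3 (be tau) by apply: bmulM => //; exact: bmul_cst.
have te0 : 0 < tau * e1 by exact: mulr_gt0.
have hb : {ae leb3, forall x, tau * e1 <= al tau x /\ tau * e1 <= be tau x}.
  apply: aeS hco => x [h1 h2 h3]; split; last by rewrite ler_pM2l.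
  by apply: (@le_trans _ _ (tau * eps x)); [rewrite ler_pM2l|rewrite lerDl].
by split; [exact: (intg_Qlow _ _ bal bbe te0 hb wVe wVm)|exact: (intg_Qup _ _ bal bbe te0 hb wVe wVm)].
Qed.

Definition gr tau x : R := (k tau * rad p x)^-1.
Definition dn tau x : R := dens eta (k tau) (ft tau) (be0 tau) (rad p x).

Lemma rep_low (X u w P N x x0 y y0 : R) : 0 < x0 -> x0 * P = X * u -> y0 * N = X * w ->
  (x0 - x) * P + y0 * (1 - y) * N = X * ((1 - x / x0) * u + (1 - y) * w).
Proof.
move=> x00 h1 h2; rewrite [RHS]mulrDr ![X * (_ * _)]mulrCA -h1 -h2; congr (_ + _).
  by field; rewrite gt_eqF.
by ring.
Qed.

Lemma rep_up (X u w P N x x0 y y0 : R) : 0 < y0 -> x0 * P = X * u -> y0 * N = X * w ->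
  x0 * (x - 1) * P + (y - y0) * N = X * ((x - 1) * u + (y / y0 - 1) * w).
Proof.
move=> y00 h1 h2; rewrite [RHS]mulrDr ![X * (_ * _)]mulrCA -h1 -h2; congr (_ + _).
  by ring.
by field; rewrite gt_eqF.
Qed.

Lemma Q_rep a tau x : dot a a = 1 -> 0 < tau -> D x -> e1 <= eps x -> e1 <= mu x -> 0 <= sigma x ->
  QL a tau x = dn tau x * ((1 - al tau x / al0 tau) * ue (gr tau x) (trans p a x) +
     (1 - be0 tau / be tau x) * um (gr tau x) (trans p a x)) /\
  QU a tau x = dn tau x * ((al0 tau / al tau x - 1) * ue (gr tau x) (trans p a x) +
     (be tau x / be0 tau - 1) * um (gr tau x) (trans p a x)).
Proof.
move=> a1 t0 Dx h1 h2 h3.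
have k0 := kap_gt0 eps00 mu00 sigma00 t0; have kk := kap2 eps00 mu00 sigma00 t0.
have al01 := al0_gt0 eps00 sigma00 t0; have be01 : 0 < be0 tau by exact: mulr_gt0.
have ve := Ve_dens eta0 k0 a1 (ft tau) al01 kk (DB Dx).
have vm := Vm_dens eta0 k0 a1 (ft tau) (be0 tau) (DB Dx).
by split; [exact: rep_low|exact: rep_up].
Qed.

Lemma Q_off a tau x : 0 < tau -> [/\ eps x = eps0, mu x = mu0 & sigma x = sigma0] ->
  QL a tau x = 0 /\ QU a tau x = 0.
Proof.
move=> t0 [h1 h2 h3].
have al01 := al0_gt0 eps00 sigma00 t0; have be01 : 0 < be0 tau by exact: mulr_gt0.
rewrite /QL /QU /Qlow /Qup h1 h2 h3 !divff ?gt_eqF//.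
by rewrite !subrr !mulr0 !mul0r addr0.
Qed.

Lemma dn_ge0 tau x : 0 < tau -> 0 <= dn tau x.
Proof.
move=> t0; have be01 : 0 < be0 tau by exact: mulr_gt0.
by rewrite /dn /dens; apply: mulr_ge0; [apply: mulr_ge0; [apply: mulr_ge0|exact: ltW]|]; exact: sqr_ge0.
Qed.

(** Beyond this threshold [tau >= 1] and [k tau * eta >= 2], the condition of [ampA_bounds]. *)
Definition tau1 : R := 1 + 2 / (c * eta).

Lemma tau1_le tau : tau1 <= tau -> [/\ 1 <= tau, 0 < tau & 2 <= k tau * eta].
Proof.
have c0 := speed_gt0; have h0 : 0 <= 2 / (c * eta) by nneg.
move=> h; have t1 : 1 <= tau by apply: le_trans h; rewrite lerDl.
have t0 : 0 < tau by exact: lt_le_trans t1.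
split => //; apply: (@le_trans _ _ (tau * c * eta)); last by rewrite ler_pM2r// kap_lower.
have ce : 0 < c * eta by exact: mulr_gt0.
by rewrite -mulrA -ler_pdivrMr//; apply: le_trans h; rewrite lerDr.
Qed.

Lemma gr_bounds tau x : tau1 <= tau -> D x -> 0 <= gr tau x <= 1 /\ gr tau x <= (c * eta)^-1 / tau.
Proof.
move=> ht Dx; have [t1 t0 ke] := tau1_le ht; have c0 := speed_gt0.
have k0 := kap_gt0 eps00 mu00 sigma00 t0; have er := DB Dx.
have r0 : 0 < rad p x by exact: lt_le_trans er.
have kr : 0 < k tau * rad p x by exact: mulr_gt0.
split.
  rewrite /gr invr_ge0 ltW//= invf_le1//; apply: (@le_trans _ _ 2); first by rewrite ler1n.
  by apply: le_trans ke _; rewrite ler_pM2l.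
rewrite /gr -invfM lef_pV2 ?posrE ?mulr_gt0// mulrC mulrA.
by apply: ler_pM => //; [nneg|exact: ltW|exact: kap_lower].
Qed.

Local Notation M := (coefM eps0 mu0 sigma0 e1 E).
Local Notation h := (coefh eps0 sigma0 e1 E).

Lemma Q_abs : exists2 C : R, 0 <= C & forall a tau, dot a a = 1 -> tau1 <= tau ->
  `|Int leb3 (QL a tau)| <= C * (ft tau ^+ 2 * expR (- (k tau * d)) ^+ 2 / al0 tau) /\
  `|Int leb3 (QU a tau)| <= C * (ft tau ^+ 2 * expR (- (k tau * d)) ^+ 2 / al0 tau).
Proof.
have [r r0 Dr] := bounded_cube p bD.
have M0 : 0 <= M by rewrite /coefM; nneg.
exists (34 * M * (2 * r) ^+ 3); first by nneg.
move=> a tau a1 ht; have [t1 t0 ke] := tau1_le ht; have [i1 i2] := Q_intg a t0.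
have k0 := kap_gt0 eps00 mu00 sigma00 t0; have kk := kap2 eps00 mu00 sigma00 t0.
have al01 := al0_gt0 eps00 sigma00 t0; have be01 : 0 < be0 tau by exact: mulr_gt0.
set m := ft tau ^+ 2 * _ / _.
have m0 : 0 <= m by rewrite /m; nneg.
have main : {ae leb3, forall x, [/\ (D x -> `|QL a tau x| <= 34 * M * m), (D x -> `|QU a tau x| <= 34 * M * m) &
    (~ D x -> QL a tau x = 0 /\ QU a tau x = 0)]}.
  apply: aeS (aeI (aeI hco hE) hD) => x [[[h1 h2 h3] [h4 h5 h6]] h7].
  have [[c1 c2'] [c3 c4] _ _] := coef_bounds eps00 mu00 sigma00 e10 E0 t1 h1 h2 h3 h4 h5 h6.
  have key A1 B1 : D x -> `|A1| <= M -> `|B1| <= M -> 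
      `|dn tau x * (A1 * ue (gr tau x) (trans p a x) + B1 * um (gr tau x) (trans p a x))| <= 34 * M * m.
    move=> Dx hA hB; rewrite normrM ger0_norm ?dn_ge0// mulrC.
    have [g01 _] := gr_bounds ht Dx.
    have r1 : 0 < rad p x by apply: lt_le_trans (DB Dx).
    apply: ler_pM => //; first exact: dn_ge0.
      exact: (weight_abs hA hB g01 (trans01 a1 r1)).
    exact: (dens_upper (ft tau) eta0 k0 ke al01 kk (dist_ge0 p eta0 D0) (dist_le eta0 DB Dx)).
  split=> [Dx|Dx|nD]; last exact: Q_off t0 (h7 nD).
  - by have [-> _] := Q_rep a1 t0 Dx h1 h2 h3; exact: key.
  - by have [_ ->] := Q_rep a1 t0 Dx h1 h2 h3; exact: key.
rewrite [X in _ <= X /\ _ <= X](_ : _ = 34 * M * m * (2 * r) ^+ 3); last by ring.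
have m1 : 0 <= 34 * M * m by nneg.
split; apply: (Int_abs_cube (ltW r0) m1 _ Dr) => //.
  by apply: aeS main => x [k1 k2 k3]; split => // /k3 [].
by apply: aeS main => x [k1 k2 k3]; split => // /k3 [].
Qed.

(** Stated for abstract weights [A], [B] so that it applies to [QL] under (A.II) and to [- QU] under
    (A.I). The integrand is nonnegative on [D] once [tau] is large, so a cube near a closest point
    suffices for the lower bound. *)
Lemma Q_low_gen (q : 'rV[R]_3 -> R -> point -> R) (A B : R -> point -> R) (jump : point -> R) (C : R) (a1 a2 : 'rV[R]_3) (e : R) :
  (forall a tau, 0 < tau -> intg leb3 (q a tau)) ->
  {ae leb3, forall x, forall tau, 1 <= tau ->
    (~ D x -> forall a, q a tau x = 0) /\ (D x -> 
    [/\ forall a, dot a a = 1 -> q a tau x = dn tau x * (A tau x * ue (gr tau x) (trans p a x) + B tau x * um (gr tau x) (trans p a x)),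
       `|A tau x| <= M, `|B tau x| <= M & jump x - h / tau <= A tau x + B tau x])} ->
  0 < C -> {ae leb3, forall x, D x -> C <= jump x} ->
  dot a1 a1 = 1 -> dot a2 a2 = 1 -> `|dot a1 a2| < 1 -> 0 < e ->
  exists2 c' : R, 0 < c' & exists2 t1, tau1 <= t1 & forall tau, t1 <= tau ->
   c' * (ft tau ^+ 2 * expR (- (k tau * (d + e))) ^+ 2 / al0 tau) <= Int leb3 (q a1 tau) + Int leb3 (q a2 tau).
Proof.
move=> iq hq C0 hC n1 n2 n12 e0.
have [cc [r [r0 hr]]] := dist_cube p eta0 D0 oD e0.
have c0 := speed_gt0.
pose s := 1 - `|dot a1 a2|; have s0 : 0 < s by rewrite subr_gt0.
have d0 := dist_ge0 p eta0 D0.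
have rho0 : 0 < d + eta + e by rewrite addr_gt0// ltr_wpDl.
pose w := C * s / 2; have w0 : 0 < w by rewrite divr_gt0// mulr_gt0.
have M0 : 0 <= M by rewrite /coefM; nneg.
have h0 : 0 <= h by rewrite /coefh; nneg.
(* [z / tau] collects the errors of both directions from [weight_lower]. The main term is at least
   [C * s = 2 * w], so [w] survives once [tau >= z / w]. *)
pose z := 2 * h + 64 * M * (c * eta)^-1.
have z0 : 0 <= z by rewrite /z; nneg.
exists (w * (eta ^+ 2 / (16 * (d + eta + e) ^+ 2)) * (2 * r) ^+ 3).
  have p1 : 0 < eta ^+ 2 by exact: exprn_gt0.
  have p2 : 0 < (d + eta + e) ^+ 2 by exact: exprn_gt0.
  have p3 : 0 < (2 * r) ^+ 3 by rewrite exprn_gt0// mulr_gt0.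
  by rewrite mulr_gt0// mulr_gt0// divr_gt0// mulr_gt0.
exists (tau1 + z / w); first by rewrite lerDl divr_ge0// ltW.
move=> tau ht.
have ht1 : tau1 <= tau by apply: le_trans ht; rewrite lerDl divr_ge0// ltW.
have [t1 t0 ke] := tau1_le ht1.
have k0 := kap_gt0 eps00 mu00 sigma00 t0; have kk := kap2 eps00 mu00 sigma00 t0.
have al01 := al0_gt0 eps00 sigma00 t0; have be01 : 0 < be0 tau by exact: mulr_gt0.
have zt : z / tau <= w.
  rewrite ler_pdivrMr// mulrC -ler_pdivrMr//; apply: le_trans ht; rewrite lerDr.
  by rewrite addr_ge0// divr_ge0// ?ltW// mulr_gt0.
have iq1 := iq a1 tau t0; have iq2 := iq a2 tau t0.
rewrite -IntD//.
rewrite (_ : _ * (_ / _) = w * (ft tau ^+ 2 * eta ^+ 2 / (16 * (d + eta + e) ^+ 2) * expR (- (k tau * (d + e))) ^+ 2 / al0 tau) * (2 * r) ^+ 3); last by ring.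
apply: (@Int_lower_cube _ D cc) => //; [exact: ltW|exact: intgD|by move=> x /hr[]|].
apply: aeS (aeI hq hC) => x [hx hCx]; have [hx1 hx2] := hx tau t1; split=> [Dx|nD]; last first.
  by rewrite !hx1// addr0.
have [hq' hA hB hj] := hx2 Dx; rewrite !hq'//.
have [g01 g2] := gr_bounds ht1 Dx.
have r1 : 0 < rad p x by apply: lt_le_trans (DB Dx).
have ht0 : 0 <= h / tau by rewrite divr_ge0// ltW.
have hCj : C - h / tau <= A tau x + B tau x.
  by apply: le_trans hj; rewrite lerD2r; exact: hCx.
have l1 := weight_lower hA hB hCj ht0 g01 (trans01 n1 r1).
have l2 := weight_lower hA hB hCj ht0 g01 (trans01 n2 r1).
have ss : s <= trans p a1 x + trans p a2 x.
  have := dot_pair_le n1 n2 (rdir1 r1); rewrite /trans /s.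
  by move: (`|dot a1 a2|) (dot a1 _ ^+ 2) (dot a2 _ ^+ 2) => u v w' uvw; rewrite addrACA -opprD -subr_ge0; move: uvw; rewrite -subr_ge0; congr (_ <= _); ring.
have Cs : C * s <= C * (trans p a1 x + trans p a2 x) by rewrite ler_pM2l.
have Mg : 64 * M * gr tau x <= 64 * M * ((c * eta)^-1 / tau) by apply: ler_wpM2l => //; nneg.
have dn0 := dn_ge0 x t0.
rewrite -mulrDr.
have W : w <= A tau x * ue (gr tau x) (trans p a1 x) + B tau x * um (gr tau x) (trans p a1 x) +
   (A tau x * ue (gr tau x) (trans p a2 x) + B tau x * um (gr tau x) (trans p a2 x)).
  apply: le_trans (lerD l1 l2).
  have zE : z / tau = 2 * (h / tau) + 64 * M * ((c * eta)^-1 / tau) by rewrite /z; ring.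
  rewrite zE in zt; have wE : 2 * w = C * s by rewrite /w mulrC divfK.
  have Mg' : 32 * M * gr tau x + 32 * M * gr tau x <= 64 * M * ((c * eta)^-1 / tau).
    by apply: le_trans Mg; rewrite le_eqVlt; apply/orP; left; apply/eqP; ring.
  rewrite -wE mulrDr in Cs.
  exact: weight_sum zt Mg' Cs.
split; first by apply: mulr_ge0 => //; apply: le_trans W; exact: ltW.
move=> cx; have [_ rx] := hr x cx.
rewrite [leRHS]mulrC; apply: ler_pM => //; first exact: ltW.
  by nneg.
exact: (dens_lower (ft tau) eta0 k0 ke al01 kk (DB Dx) (ltW e0) rx).
Qed.

End Integrals.

(** * Limits *)

Section Limits.
Context {R : realType}.
Implicit Types (I : R -> R) (L T tau : R).

Definition ev (P : R -> Prop) := exists t0 : R, forall tau, t0 <= tau -> P tau.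

Lemma evI (P Q : R -> Prop) : ev P -> ev Q -> ev (fun t => P t /\ Q t).
Proof.
move=> [a ha] [b hb]; exists (Num.max a b) => t; rewrite ge_max => /andP[h1 h2].
by split; [exact: ha|exact: hb].
Qed.

Lemma evS (P Q : R -> Prop) : (forall t, P t -> Q t) -> ev P -> ev Q.
Proof. by move=> h [a ha]; exists a => t /ha /h. Qed.

Lemma ev_ge (a : R) : ev (fun t => a <= t).
Proof. by exists a. Qed.

Lemma ev_near (P : R -> Prop) : ev P <-> \forall t \near +oo, P t.
Proof.
split=> [[a ha]|[a [_ ha]]].
  by near=> t; apply: ha; near: t; apply: nbhs_pinfty_ge; rewrite num_real.
by exists (a + 1) => t at1; apply: ha; apply: lt_le_trans at1; rewrite ltrDl.
Unshelve. all: by end_near. Qed.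

(** The factor [1 / tau] makes even the part of order [expR (- (tau * T))] vanish after
    multiplication by [expR (tau * T)]. *)
Definition upper_rate I L T := exists2 C : R, 0 <= C &
  ev (fun tau => `|I tau| <= C * (expR (- (tau * L)) + expR (- (tau * T))) / tau).

(** An arbitrarily small loss [e] in the exponent absorbs all subexponential factors; [L + e < T]
    keeps the bound above the error of order [expR (- (tau * T))]. *)
Definition lower_rate I L T := forall e : R, 0 < e -> L + e < T ->
  ev (fun tau => expR (- (tau * (L + e))) <= I tau).

Lemma limit_zero I L T : upper_rate I L T -> T < L -> expR (tau * T) * I tau @[tau --> +oo] --> 0.
Proof.
move=> [C C0 hC] TL; apply/cvgrPdist_le => e e0; apply/ev_near.
apply: evS (evI hC (evI (ev_ge 1) (ev_ge (2 * C / e)))) => t [h [t1 te]].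
have t0 : 0 < t by exact: lt_le_trans t1.
rewrite sub0r normrN normrM ger0_norm ?expR_ge0//.
apply: (@le_trans _ _ (2 * C / t)); last first.
  by rewrite ler_pdivrMr// [e * t]mulrC -ler_pdivrMr.
apply: le_trans (ler_wpM2l (expR_ge0 _) h) _.
rewrite mulrA ler_pM2r ?invr_gt0// mulrCA mulrC; apply: ler_wpM2r => //.
rewrite mulrDr -!expRD subrr expR0 -[2]/(1 + 1 : R) lerD2r -expR0 ler_expR.
by rewrite subr_le0 ler_pM2l// ltW.
Qed.

Lemma limit_pinfty I L T : lower_rate I L T -> L < T -> expR (tau * T) * I tau @[tau --> +oo] --> +oo.
Proof.
move=> hI LT; apply/cvgryPge => A; apply/ev_near.
pose q := (T - L) / 2; have q0 : 0 < q by rewrite divr_gt0// subr_gt0.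
have Lq : L + q < T by rewrite /q; lra.
apply: evS (evI (hI q q0 Lq) (evI (ev_ge 1) (ev_ge (A / q)))) => t [h [t1 tA]].
have t0 : 0 < t by exact: lt_le_trans t1.
apply: le_trans (ler_wpM2l (expR_ge0 _) h); rewrite -expRD.
apply: (@le_trans _ _ (1 + t * q)).
  by rewrite ler_pdivrMr// in tA; apply: le_trans tA _; rewrite lerDr ler01.
have -> : t * T + - (t * (L + q)) = t * q by rewrite /q; field.
exact: expR_ge1Dx.
Qed.

Lemma limit_ninfty I L T : lower_rate (fun t => - I t) L T -> L < T ->
  expR (tau * T) * I tau @[tau --> +oo] --> -oo.
Proof.
move=> hI LT; have /cvgryPge h := limit_pinfty hI LT; apply/cvgrNyPle => A.
by have := h (- A); apply: filterS => t; rewrite mulrN lerN2.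
Qed.

Lemma log_squeeze (L q e z : R) : - (L + q) <= z -> z <= - L -> q <= e -> `|- L - z| <= e.
Proof. by move=> *; rewrite ler_norml; apply/andP; split; lra. Qed.

Lemma limit_log I L T : upper_rate I L T -> L < T ->
  (forall e : R, 0 < e -> L + e < T -> ev (fun tau => expR (- (tau * (L + e))) <= `|I tau|)) ->
  tau^-1 * ln `|I tau| @[tau --> +oo] --> - L.
Proof.
move=> [C C0 hC] LT hI; apply/cvgrPdist_le => e e0; apply/ev_near.
pose q := Num.min e ((T - L) / 2).
have q0 : 0 < q by rewrite lt_min e0 divr_gt0// subr_gt0.
have qe : q <= e by rewrite ge_min lexx.
have qT : q <= (T - L) / 2 by rewrite ge_min lexx orbT.
have Lq : L + q < T.
  by apply: (@le_lt_trans _ _ (L + (T - L) / 2)); [rewrite lerD2l|lra].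
apply: evS (evI (hI q q0 Lq) (evI hC (evI (ev_ge 1) (ev_ge (2 * C))))) => t [h1 [h2 [t1 tC]]].
have t0 : 0 < t by exact: lt_le_trans t1.
have I0 : 0 < `|I t| by apply: lt_le_trans h1; exact: expR_gt0.
have l1 : - (t * (L + q)) <= ln `|I t| by rewrite -[X in X <= _]expRK ler_ln ?posrE ?expR_gt0.
have l2 : ln `|I t| <= - (t * L).
  rewrite -[X in _ <= X]expRK ler_ln ?posrE ?expR_gt0//; apply: le_trans h2 _.
  rewrite ler_pdivrMr//; apply: (@le_trans _ _ (C * (expR (- (t * L)) + expR (- (t * L))))).
    by apply: ler_wpM2l => //; rewrite lerD2l ler_expR lerN2 ler_pM2l// ltW.
  rewrite (_ : C * _ = expR (- (t * L)) * (2 * C)); last by ring.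
  by apply: ler_wpM2l => //; exact: expR_ge0.
have m1 : - (L + q) <= t^-1 * ln `|I t|.
  by rewrite ler_pdivlMl// mulrN.
have m2 : t^-1 * ln `|I t| <= - L by rewrite ler_pdivrMl// mulrN.
exact: log_squeeze m1 m2 qe.
Qed.

Lemma exp_beats_linear (K C q : R) : 0 < K -> 0 <= C -> 0 < q ->
  ev (fun tau => (tau + C) * expR (- (tau * q)) <= K).
Proof.
move=> K0 C0 q0.
apply: evS (evI (ev_ge 1) (evI (ev_ge C) (ev_ge (8 / (K * q ^+ 2))))) => t [t1 [tC tK]].
have t0 : 0 < t by exact: lt_le_trans t1.
rewrite expRN ler_pdivrMr ?expR_gt0//.
(* The square of [y <= expR y] at [y = t * q / 2] gives quadratic growth, enough to beat the linear
   factor. *)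
have h : (t * q / 2) ^+ 2 <= expR (t * q).
  have -> : t * q = t * q / 2 + t * q / 2 by field.
  rewrite expRD -expr2 lerXn2r ?nnegrE ?expR_ge0//.
    by rewrite -splitr; nneg.
  by rewrite -splitr; apply: le_trans (expR_ge1Dx _); rewrite lerDr.
apply: (@le_trans _ _ (K * (t * q / 2) ^+ 2)); last by rewrite ler_pM2l.
apply: (@le_trans _ _ (2 * t)); first by rewrite mulr2n mulrDl mul1r lerD2l.
have Kq : 0 < K * q ^+ 2 by rewrite mulr_gt0// exprn_gt0.
rewrite ler_pdivrMr// in tK.
have := ler_wpM2l (ltW t0) tK.
rewrite (_ : t * (t * (K * q ^+ 2)) = 4 * (K * (t * q / 2) ^+ 2)); last by field.
by move: (K * _ ^+ 2) => z; lra.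
Qed.

Lemma einf_lower (g : R -> R) : (0 < limf_einf (fun tau => (g tau)%:E) (+oo%R : set_system R))%E ->
  exists2 c : R, 0 < c & ev (fun tau => c <= g tau).
Proof.
rewrite /limf_einf /limf_esup oppe_gt0 => /ereal_inf_lt [_ [V FV <-] hs].
have key s : (ereal_sup [set (\- (fun tau => (g tau)%:E))%E x | x in V] <= s%:E)%E -> s < 0 ->
    exists2 c : R, 0 < c & ev (fun tau => c <= g tau).
  move=> h s0; exists (- s); first by rewrite oppr_gt0.
  apply/ev_near; apply: filterS FV => t Vt.
  have : (- (g t)%:E <= s%:E)%E.
    by apply: le_trans h; apply: ereal_sup_ubound; exists t.
  by rewrite -EFinN lee_fin lerNl.
(* [s] is the supremum of [- g] near infinity, so [- s] bounds [g] from below; if the supremum is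
   [-oo], the constant 1 serves. *)
move: hs; case E: (ereal_sup _) => [s||] // hs.
  by apply: (key s); rewrite ?E// -lte_fin.
by apply: (key (- 1)); rewrite ?E ?leNye// oppr_lt0.
Qed.

Lemma powR_subexp (gamma : R) (g : R -> R) : (forall tau, 0 <= g tau) ->
  (exists2 c : R, 0 < c & ev (fun tau => c <= tau `^ gamma * g tau)) ->
  forall e : R, 0 < e -> ev (fun tau => expR (- (tau * e)) <= g tau).
Proof.
move=> g0 [c c0 hc] e e0.
pose b := `|gamma| + 1; have b0 : 0 < b by rewrite ltr_wpDl.
(* [ln (r * t) <= r * t] with [b * r = e / 2] bounds the power of [t] at the cost of half the
   exponent; the other half absorbs the constant [K]. *)
pose r := e / (2 * b); have r0 : 0 < r by rewrite divr_gt0// mulr_gt0.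
pose K := - (b * ln r) - ln c.
apply: evS (evI hc (evI (ev_ge 1) (ev_ge (2 * K / e)))) => t [h [t1 tK]].
have t0 : 0 < t by exact: lt_le_trans t1.
have l0 : 0 <= ln t by rewrite ln_ge0.
have lt : ln t <= r * t - ln r.
  have := ltW (ln_sublinear (mulr_gt0 r0 t0)); rewrite lnM ?posrE//; lra.
have p1 : t `^ gamma <= expR (t * e / 2 - b * ln r).
  rewrite /powR gt_eqF// ler_expR; apply: (@le_trans _ _ (b * ln t)).
    by apply: ler_wpM2r => //; apply: le_trans (ler_norm _) _; rewrite lerDl.
  apply: (@le_trans _ _ (b * (r * t - ln r))); first by rewrite ler_pM2l.
  by rewrite le_eqVlt; apply/orP; left; apply/eqP; rewrite /r; field; rewrite gt_eqF.
have {}h : c <= expR (t * e / 2 - b * ln r) * g t.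
  by apply: le_trans h _; apply: ler_wpM2r.
have -> : - (t * e) = ln c + - (t * e / 2 - b * ln r) + - (t * e / 2 - K) by rewrite /K; field.
rewrite !expRD lnK ?posrE//.
rewrite mulrC in h; rewrite -ler_pdivrMr ?expR_gt0// -expRN in h.
apply: le_trans h; rewrite ler_piMr ?mulr_ge0 ?expR_ge0 ?(ltW c0)//.
rewrite -[leRHS]expR0 ler_expR oppr_le0 subr_ge0.
by rewrite ler_pdivrMr// in tK; rewrite ler_pdivlMr// mulrC.
Qed.

End Limits.

(** * From bounds on the integrals to exponential rates *)

Section Rates.
Context {R : realType}.
Variables (eps0 mu0 sigma0 T d : R) (ft : R -> R).
Hypotheses (eps00 : 0 < eps0) (mu00 : 0 < mu0) (sigma00 : 0 <= sigma0) (T0 : 0 < T) (d0 : 0 <= d).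
Local Notation k := (kap eps0 mu0 sigma0).
Local Notation c := (Num.sqrt (mu0 * eps0)).
Local Notation al0 := (fun tau => tau * eps0 + sigma0).
Local Notation L := (2 * c * d).

Lemma expR_sqr (x : R) : expR x ^+ 2 = expR (2 * x).
Proof. by rewrite expr2 -expRD mulr2n mulrDl mul1r. Qed.

Lemma rate_upper (Cf tau : R) : 0 < tau -> `|ft tau| <= Cf ->
  ft tau ^+ 2 * expR (- (k tau * d)) ^+ 2 / al0 tau <= Cf ^+ 2 / eps0 * expR (- (tau * L)) / tau.
Proof.
move=> t0 hf; have al01 := al0_gt0 eps00 sigma00 t0.
have te : 0 < tau * eps0 by exact: mulr_gt0.
rewrite (_ : Cf ^+ 2 / eps0 * _ / _ = Cf ^+ 2 * expR (- (tau * L)) / (tau * eps0)); last first.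
  by field; rewrite !gt_eqF.
have Cf0 : 0 <= Cf := le_trans (normr_ge0 _) hf.
apply: ler_pM; first by nneg.
- by rewrite invr_ge0 ltW.
- apply: ler_pM; first exact: sqr_ge0.
  + exact: sqr_ge0.
  + by rewrite -[ft tau ^+ 2]real_normK ?num_real// lerXn2r ?nnegrE.
  rewrite expR_sqr ler_expR mulrN lerN2 (_ : tau * L = 2 * (tau * c * d)); last by ring.
  by rewrite ler_pM2l ?ltr0n// ler_wpM2r// kap_lower.
by rewrite lef_pV2 ?posrE// lerDl.
Qed.

Hypothesis hft : forall e : R, 0 < e -> ev (fun tau => expR (- (tau * e)) <= `|ft tau|).

Lemma rate_lower (G : R -> R) (C : R) : 0 <= C ->
  (forall e : R, 0 < e -> exists2 c' : R, 0 < c' & ev (fun tau =>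
     c' * (ft tau ^+ 2 * expR (- (k tau * (d + e))) ^+ 2 / al0 tau) - C * expR (- (tau * T)) / tau <= G tau)) ->
  lower_rate G L T.
Proof.
move=> C0 hG e e0 LT; have c0 := speed_gt0 eps00 mu00.
(* The geometric loss [e1] costs [2 * c * e1 = e / 4] in the exponent and the loss [e2] in the
   Laplace transform of [f] costs [2 * e2 = e / 4]. The remaining [e / 2] pays for the factor
   [1 / tau] and the term with [expR (- (tau * T))]. *)
pose e1 := e / (8 * c); have e10 : 0 < e1 by rewrite divr_gt0// mulr_gt0.
pose e2 := e / 8; have e20 : 0 < e2 by rewrite divr_gt0.
have [c' c'0 hc] := hG e1 e10.
(* The bounded excess of [k tau] over [tau * c] from [kap_upper]; it enters only the constant
   [K]. *)
pose k1 := sigma0 * mu0 / (2 * c).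
have k10 : 0 <= k1 by rewrite /k1; nneg.
pose K := c' * expR (- (2 * k1 * (d + e1))) / (eps0 + sigma0).
have es0 : 0 < eps0 + sigma0 by rewrite ltr_wpDr.
have K0 : 0 < K by rewrite divr_gt0// mulr_gt0// expR_gt0.
have q0 : 0 < e / 2 by rewrite divr_gt0.
apply: evS (evI hc (evI (hft e20) (evI (ev_ge 1) (exp_beats_linear K0 C0 q0)))) => t [h1 [h2 [t1 h3]]].
have t0 : 0 < t by exact: lt_le_trans t1.
have al01 := al0_gt0 eps00 sigma00 t0.
apply: le_trans h1.
have f2 : expR (- (t * e2)) ^+ 2 <= ft t ^+ 2.
  by rewrite -[ft t ^+ 2]real_normK ?num_real// lerXn2r ?nnegrE ?expR_ge0.
have x2 : expR (- ((t * c + k1) * (d + e1))) ^+ 2 <= expR (- (k t * (d + e1))) ^+ 2.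
  rewrite lerXn2r ?nnegrE ?expR_ge0// ler_expR lerN2.
  by apply: ler_wpM2r; [rewrite addr_ge0// ltW|exact: kap_upper].
have a2 : (t * (eps0 + sigma0))^-1 <= (al0 t)^-1.
  rewrite lef_pV2 ?posrE ?mulr_gt0// mulrDr lerD2l ler_peMl//.
have main : c' * (expR (- (t * e2)) ^+ 2 * expR (- ((t * c + k1) * (d + e1))) ^+ 2 / (t * (eps0 + sigma0))) <=
    c' * (ft t ^+ 2 * expR (- (k t * (d + e1))) ^+ 2 / al0 t).
  apply: ler_wpM2l; first exact: ltW.
  apply: ler_pM => //; try by nneg.
  by apply: ler_pM => //; exact: sqr_ge0.
apply: le_trans (lerB main (lexx _)).
have -> : c' * (expR (- (t * e2)) ^+ 2 * expR (- ((t * c + k1) * (d + e1))) ^+ 2 / (t * (eps0 + sigma0))) =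
   K * expR (- (t * (L + e / 2))) / t.
  rewrite !expR_sqr -expRD /K.
  have -> : 2 * - (t * e2) + 2 * - ((t * c + k1) * (d + e1)) = - (2 * k1 * (d + e1)) + - (t * (L + e / 2)).
    by rewrite /e1 /e2; field; rewrite gt_eqF.
  by rewrite expRD; field; rewrite !gt_eqF.
rewrite -mulrBl ler_pdivlMr//.
have xT : C * expR (- (t * T)) <= C * expR (- (t * (L + e))).
  by apply: ler_wpM2l => //; rewrite ler_expR lerN2 ler_pM2l// ltW.
apply: le_trans (lerB (lexx _) xT); rewrite lerBrDr.
have -> : expR (- (t * (L + e))) * t + C * expR (- (t * (L + e))) =
    (t + C) * expR (- (t * (e / 2))) * expR (- (t * (L + e / 2))).
  rewrite -[RHS]mulrA -expRD (_ : - (t * (e / 2)) + - (t * (L + e / 2)) = - (t * (L + e))); last by field.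
  by ring.
by apply: ler_wpM2r => //; exact: expR_ge0.
Qed.

End Rates.

Lemma two_sided (R : realType) (i1 i2 l1 l2 u1 u2 m e1 e2 : R) :
  l1 - e1 <= i1 -> i1 <= u1 + e1 -> l2 - e2 <= i2 -> i2 <= u2 + e2 ->
  `|l1| <= m -> `|u1| <= m -> `|l2| <= m -> `|u2| <= m -> `|i1 + i2| <= 2 * m + e1 + e2.
Proof.
rewrite !ler_norml => h1 h2 h3 h4 /andP[? ?] /andP[? ?] /andP[? ?] /andP[? ?].
by apply/andP; split; lra.
Qed.

Lemma two_upper (R : realType) (i1 i2 u1 u2 m e1 e2 : R) :
  i1 <= u1 + e1 -> i2 <= u2 + e2 -> m <= - u1 - u2 -> m - (e1 + e2) <= - (i1 + i2).
Proof. lra. Qed.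

Theorem corollary1p1 (R : realType)
    (eps0 mu0 sigma0 : R) (eps mu sigma : R * R * R -> R)
    (D : set (R * R * R)) (p : R * R * R) (eta T : R) (f : R -> R)
    (a1 a2 : 'rV[R]_3) (I1 I2 : R -> R) :
  0 < eps0 -> 0 < mu0 -> 0 <= sigma0 ->
  eps \in Lfun leb3 +oo%E -> mu \in Lfun leb3 +oo%E ->
  sigma \in Lfun leb3 +oo%E ->
  (0 < ess_inf leb3 (EFin \o eps))%E -> (0 < ess_inf leb3 (EFin \o mu))%E ->
  {ae leb3, forall x, 0 <= sigma x} ->
  D !=set0 -> bounded_set D -> open D -> connected (~` closure D) ->
  {ae leb3, forall x, ~ D x ->
     [/\ eps x = eps0, mu x = mu0 & sigma x = sigma0]} ->
  C2_boundary D ->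
  0 < eta -> closure (eball p eta) `&` closure D = set0 ->
  0 < T -> sobolev_H1 T f -> {within `[0, T], continuous f} -> f 0 = 0 ->
  (exists gamma : R,
     0 < limf_einf (fun tau => (tau `^ gamma * `|laplace T f tau|)%:E)
           (+oo%R : set_system R))%E ->
  free [:: a1; a2] -> enorm a1 = 1 -> enorm a2 = 1 ->
  indicator_function eps0 mu0 sigma0 eps mu sigma T f (eball p eta) a1 I1 ->
  indicator_function eps0 mu0 sigma0 eps mu sigma T f (eball p eta) a2 I2 ->
  let I := fun tau => I1 tau + I2 tau in
  let L := 2 * Num.sqrt (mu0 * eps0) * set_dist D (eball p eta) in
  [/\ T < L -> expR (tau * T) * I tau @[tau --> +oo] --> 0,
      L < T -> jump_AI eps0 mu0 eps mu D ->
        expR (tau * T) * I tau @[tau --> +oo] --> -oo,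
      L < T -> jump_AII eps0 mu0 eps mu D ->
        expR (tau * T) * I tau @[tau --> +oo] --> +oo &
      jump_AI eps0 mu0 eps mu D \/ jump_AII eps0 mu0 eps mu D -> L < T ->
        tau^-1 * ln `|I tau| @[tau --> +oo] --> - L].
Proof.
move=> eps00 mu00 sigma00 Leps Lmu Lsig ieps imu hsig D0 bD oD _ hD _ eta0 cBD T0 _ cf _ [gamma hgam] fr na1 na2 ind1 ind2 I L.
have beps := Lfunoo_bmul Leps; have bmu := Lfunoo_bmul Lmu; have bsig := Lfunoo_bmul Lsig.
have [x1 x10 hx1] := ess_inf_lower ieps; have [x2 x20 hx2] := ess_inf_lower imu.
pose e1 := Num.min x1 x2; have e10 : 0 < e1 by rewrite lt_min x10.
have heps : {ae leb3, forall x, e1 <= eps x} by apply: aeS hx1 => x; apply: le_trans; rewrite ge_min lexx.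
have hmu : {ae leb3, forall x, e1 <= mu x} by apply: aeS hx2 => x; apply: le_trans; rewrite ge_min lexx orbT.
have hco : {ae leb3, forall x, [/\ e1 <= eps x, e1 <= mu x & 0 <= sigma x]}.
  by apply: aeS (aeI heps (aeI hmu hsig)) => x [? [? ?]].
have [M1 M10 hM1] := bmul_bound beps; have [M2 M20 hM2] := bmul_bound bmu; have [M3 M30 hM3] := bmul_bound bsig.
pose E := M1 + M2 + M3; have E0 : 0 <= E by rewrite !addr_ge0.
have hE : {ae leb3, forall x, [/\ eps x <= E, mu x <= E & sigma x <= E]}.
  apply: aeS (aeI hM1 (aeI hM2 hM3)) => x [h1 [h2 h3]].
  have := le_trans (ler_norm _) h1; have := le_trans (ler_norm _) h2; have := le_trans (ler_norm _) h3.
  by rewrite /E => k3 k2 k1; split; [apply: le_trans k1 _|apply: le_trans k2 _|apply: le_trans k3 _]; lra.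
have DB x : D x -> eta <= rad p x.
  move=> Dx; rewrite leNgt; apply/negP => xr.
  suff : set0 x by [].
  rewrite -cBD; split; apply: subset_closure => //.
  by apply/(eballP p eta x).
have dd (a : 'rV[R]_3) : enorm a = 1 -> dot a a = 1.
  by move=> h; rewrite -[LHS]sqr_sqrtr ?dot_ge0// -/(enorm a) h expr1n.
have n1 := dd _ na1; have n2 := dd _ na2; have n12 := free_dot_lt1 fr n1 n2.
have [C1 C10 hI1] := indicator_bounds eps00 mu00 sigma00 eta0 T0 cf beps bmu bsig e10 heps hmu hsig ind1.
have [C2 C20 hI2] := indicator_bounds eps00 mu00 sigma00 eta0 T0 cf beps bmu bsig e10 heps hmu hsig ind2.
have [Cf Cf0 hCf] := laplace_bound T0 cf.
have [Cq Cq0 hCq] := Q_abs T f eps00 mu00 sigma00 eta0 beps bmu bsig e10 E0 hco hE hD D0 DB bD.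
have d0 := dist_ge0 p eta0 D0.
have hft : forall e : R, 0 < e -> ev (fun tau => expR (- (tau * e)) <= `|laplace T f tau|).
  exact: (powR_subexp (fun tau => normr_ge0 _) (einf_lower hgam)).
set t1 := tau1 eps0 mu0 eta in hCq.
have tl := tau1_le eps00 mu00 sigma00 eta0.
have up : upper_rate I L T.
  exists (2 * (Cq * (Cf ^+ 2 / eps0)) + (C1 + C2)).
    by nneg.
  exists t1 => t ht; have [t11 t0 _] := tl _ ht.
  have [b1 b2] := hI1 t t11; have [b3 b4] := hI2 t t11.
  have [q1 q2] := hCq a1 t n1 ht; have [q3 q4] := hCq a2 t n2 ht.
  have ru := ler_wpM2l Cq0 (rate_upper eps00 mu00 sigma00 d0 t0 (hCf t (ltW t0))).
  have w (x : R) : `|x| <= Cq * (laplace T f t ^+ 2 * expR (- (kap eps0 mu0 sigma0 t * set_dist D (eball p eta))) ^+ 2 / (t * eps0 + sigma0)) ->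
    `|x| <= Cq * (Cf ^+ 2 / eps0 * expR (- (t * L)) / t) by move=> h; exact: le_trans h ru.
  have ts := two_sided b1 b2 b3 b4 (w _ q1) (w _ q2) (w _ q3) (w _ q4).
  apply: (le_trans ts).
  rewrite -subr_ge0 (_ : _ - _ = (2 * (Cq * (Cf ^+ 2 / eps0)) * expR (- (t * T)) + (C1 + C2) * expR (- (t * L))) / t); last by ring.
  by nneg.
(* The exceptional null set comes from the coefficients alone, so one set serves all [tau]. *)
have coefs : {ae leb3, forall x, forall tau, 1 <= tau ->
    let al := tau * eps x + sigma x in let be := tau * mu x in
    let al0 := tau * eps0 + sigma0 in let be0 := tau * mu0 in
    (~ D x -> forall a, QL eps0 mu0 sigma0 eps mu sigma p eta T f a tau x = 0 /\
       QU eps0 mu0 sigma0 eps mu sigma p eta T f a tau x = 0) /\ (D x ->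
    [/\ forall a, dot a a = 1 -> QL eps0 mu0 sigma0 eps mu sigma p eta T f a tau x =
          dn eps0 mu0 sigma0 p eta T f tau x * ((1 - al / al0) * ue (gr eps0 mu0 sigma0 p tau x) (trans p a x)
            + (1 - be0 / be) * um (gr eps0 mu0 sigma0 p tau x) (trans p a x)) /\
        QU eps0 mu0 sigma0 eps mu sigma p eta T f a tau x =
          dn eps0 mu0 sigma0 p eta T f tau x * ((al0 / al - 1) * ue (gr eps0 mu0 sigma0 p tau x) (trans p a x)
            + (be / be0 - 1) * um (gr eps0 mu0 sigma0 p tau x) (trans p a x)),
      `|1 - al / al0| <= coefM eps0 mu0 sigma0 e1 E /\ `|1 - be0 / be| <= coefM eps0 mu0 sigma0 e1 E,
      `|al0 / al - 1| <= coefM eps0 mu0 sigma0 e1 E /\ `|be / be0 - 1| <= coefM eps0 mu0 sigma0 e1 E,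
      (1 - eps x / eps0) + (1 - 1 / (mu x / mu0)) - coefh eps0 sigma0 e1 E / tau <= (1 - al / al0) + (1 - be0 / be) &
      (1 - 1 / (eps x / eps0)) + (1 - mu x / mu0) - coefh eps0 sigma0 e1 E / tau <= - (al0 / al - 1) - (be / be0 - 1)])}.
  apply: aeS (aeI (aeI hco hE) hD) => x [[[h1 h2 h3] [h4 h5 h6]] h7] tau tau1'.
  have tau0 : 0 < tau by exact: lt_le_trans tau1'.
  move=> al be al0 be0; split=> [nD a|Dx]; first exact: (Q_off p eta T f eps00 mu00 sigma00 a tau0 (h7 nD)).
  have [k1 k2 k3 k4] := coef_bounds eps00 mu00 sigma00 e10 E0 tau1' h1 h2 h3 h4 h5 h6.
  by split => // a a1'; exact: (Q_rep T f eps00 mu00 sigma00 eta0 DB a1' tau0 Dx h1 h2 h3).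
have iQ a tau (tau0 : 0 < tau) := Q_intg p T f eps00 mu00 sigma00 eta0 beps bmu bsig e10 hco a tau0.
have low := @Q_low_gen R eps0 mu0 sigma0 D p eta T f eps00 mu00 sigma00 eta0 e1 E e10 E0 D0 DB oD.
have lowII : jump_AII eps0 mu0 eps mu D -> lower_rate I L T.
  move=> [C C0 hC]; apply: (@rate_lower _ eps0 mu0 sigma0 T _ (laplace T f) eps00 mu00 sigma00 d0 hft I (C1 + C2)) => //.
    exact: addr_ge0.
  move=> e e0.
  have [||c' c'0 [t2 ht2 hq]] := low (QL eps0 mu0 sigma0 eps mu sigma p eta T f)
     (fun tau x => 1 - (tau * eps x + sigma x) / (tau * eps0 + sigma0)) (fun tau x => 1 - (tau * mu0) / (tau * mu x))
     (fun x => (1 - eps x / eps0) + (1 - 1 / (mu x / mu0))) C a1 a2 e _ _ C0 hC n1 n2 n12 e0.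
  - by move=> a tau tau0; case: (iQ a tau tau0).
  - apply: aeS coefs => x hx tau tau1'; have [k1 k2] := hx tau tau1'; split=> [nD a|Dx].
      by case: (k1 nD a).
    by have [r0 [r1 r2] _ r3 _] := k2 Dx; split => // a a1'; case: (r0 a a1').
  exists c' => //; exists t2 => t ht.
  have [t11 t0 _] := tl _ (le_trans ht2 ht).
  have [b1 _] := hI1 t t11; have [b3 _] := hI2 t t11.
  rewrite !mulrDl opprD; apply: le_trans (lerD b1 b3).
  by rewrite [leRHS]addrACA lerD2r; exact: hq.
(* The integrals of [QU] bound [I1] and [I2] from above, so a lower bound for [- QU] gives one for
   [- I]. *)
have lowI : jump_AI eps0 mu0 eps mu D -> lower_rate (fun t => - I t) L T.
  move=> [C C0 hC]; apply: (@rate_lower _ eps0 mu0 sigma0 T _ (laplace T f) eps00 mu00 sigma00 d0 hft (fun t => - I t) (C1 + C2)) => //.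
    exact: addr_ge0.
  move=> e e0.
  have [||c' c'0 [t2 ht2 hq]] := low (fun a tau x => - QU eps0 mu0 sigma0 eps mu sigma p eta T f a tau x)
     (fun tau x => - ((tau * eps0 + sigma0) / (tau * eps x + sigma x) - 1)) (fun tau x => - ((tau * mu x) / (tau * mu0) - 1))
     (fun x => (1 - 1 / (eps x / eps0)) + (1 - mu x / mu0)) C a1 a2 e _ _ C0 hC n1 n2 n12 e0.
  - by move=> a tau tau0; apply: intgN; case: (iQ a tau tau0).
  - apply: aeS coefs => x hx tau tau1'; have [k1 k2] := hx tau tau1'; split=> [nD a|Dx].
      by case: (k1 nD a) => _ ->; rewrite oppr0.
    have [r0 _ [r1 r2] _ r3] := k2 Dx; split => //; rewrite ?normrN// => a a1'; case: (r0 a a1') => _ ->.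
    by rewrite !mulNr -opprD mulrN.
  exists c' => //; exists t2 => t ht.
  have [t11 t0 _] := tl _ (le_trans ht2 ht).
  have [_ b2] := hI1 t t11; have [_ b4] := hI2 t t11.
  have := hq t ht; rewrite (IntN (iQ a1 t t0).2) (IntN (iQ a2 t t0).2).
  rewrite !mulrDl => q12; exact: two_upper b2 b4 q12.
have pos tau e : expR (- (tau * (L + e))) <= I tau -> expR (- (tau * (L + e))) <= `|I tau|.
  by move=> h; exact: le_trans h (ler_norm _).
have neg tau e : expR (- (tau * (L + e))) <= - I tau -> expR (- (tau * (L + e))) <= `|I tau|.
  by move=> h; apply: le_trans h _; rewrite -normrN ler_norm.
split.
- exact: limit_zero.
- by move=> LT hj; exact: limit_ninfty (lowI hj) LT.
- by move=> LT hj; exact: limit_pinfty (lowII hj) LT.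
move=> hj LT; apply: limit_log up LT _ => e e0 LeT.
case: hj => hj; first by apply: evS (lowI hj e e0 LeT) => t; exact: neg.
by apply: evS (lowII hj e e0 LeT) => t; exact: pos.
Qed.
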